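(* Let $T>0$ and $\sigma\in L^\infty([0,T]\times\mathbb{T}^d)$. Suppose $u_1,u_2$ are vector fields on $[0,T]\times\mathbb{T}^d$ with $u_i(t,\cdot)=\nabla\phi_i(t,\cdot)$ for scalar $\phi_i$, $\int_{\mathbb{T}^d}u_i(t,x)dx=0$, $u_i,\operatorname{div}u_i\in L^\infty([0,T]\times\mathbb{T}^d)$, $\nabla u_i\in L^\infty(0,T;BMO(\mathbb{T}^d))$, and such that \[ \operatorname{div}u_i(t,x_i(t,y))=\sigma(t,y)\quad\text{for a.e. }(t,y), \] where $x_i$ is the regular Lagrangian flow of $u_i$ ($\dot x_i=u_i(t,x_i)$, $x_i(0,y)=y$). Then $u_1=u_2$ a.e. on $[0,T]\times\mathbb{T}^d$.
   Context: $BMO(\mathbb{T}^d)$: $f\in L^1$ with $\|f\|_{BMO}=\sup_Q\frac1{|Q|}\int_Q|f-\{f\}_Q|\,dx<\infty$ over cubes $Q$. Regular Lagrangian flow of $b$: a measurable $X:[0,T]\times\mathbb{T}^d\to\mathbb{T}^d$ with $t\mapsto X(t,y)$ absolutely continuous for a.e. $y$, $X(0,y)=y$, $\partial_tX=b(t,X)$ a.e., and $|\{y:X(t,y)\in A\}|\le L|A|$ for some $L$, all Borel $A$, all $t$; it exists and is unique for fields of the stated regularity. *)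

(* Defs.v *)
From HB Require Import structures.
From mathcomp Require Import all_boot all_order all_algebra.
From mathcomp Require Import all_classical all_reals all_analysis.
Import Order.TTheory GRing.Theory Num.Theory.
Import numFieldNormedType.Exports.
Set Implicit Arguments. Unset Strict Implicit. Unset Printing Implicit Defensive.
Local Open Scope classical_set_scope.
Local Open Scope ring_scope.

Definition ae_on d (T : measurableType d) (R : realType)
  (m : set T -> \bar R) (D : set T) (P : T -> Prop) : Prop :=
  exists N, [/\ measurable N, m N = 0%E & D `&` [set x | ~ P x] `<=` N].

Definition abs_cont_on (R : realType) (a b : R) (f : R -> R) : Prop :=
  forall e : R, 0 < e -> exists2 del : R, 0 < del &
    forall (n : nat) (s t : 'I_n -> R),
      (forall k, a <= s k /\ s k <= t k /\ t k <= b) ->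
      (forall k l, k != l -> t k <= s l \/ t l <= s k) ->
      \sum_(k < n) (t k - s k) < del ->
      \sum_(k < n) `|f (t k) - f (s k)| < e.

Section torus.
Context {R : realType} {d : nat}.
(* points of R^d are d-tuples of reals (with the product Borel sigma-algebra);
   the torus T^d is represented by the fundamental cube [0,1)^d *)
Local Notation P := (d.-tuple R).

Definition box (a b : P) : set P :=
  [set x | forall i, tnth a i <= tnth x i < tnth b i].

Definition cube (a : P) (r : R) : set P :=
  [set x | forall i, tnth a i <= tnth x i < tnth a i + r].

Definition unit_cube : set P := [set x | forall i, 0 <= tnth x i < 1].

(* mu is Lebesgue measure on R^d: it gives boxes their volume
   (this determines mu uniquely on the Borel sets) *)
Definition is_lebesgue_Rd (mu : {measure set P -> \bar R}) : Prop :=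
  forall a b : P, (forall i, tnth a i <= tnth b i) ->
    mu (box a b) = (\prod_(i < d) (tnth b i - tnth a i))%:E.

Definition fracP (x : P) : P :=
  [tuple tnth x i - (Num.floor (tnth x i))%:~R | i < d].

Definition shift (x : P) (j : 'I_d) (s : R) : P :=
  [tuple tnth x i + (if i == j then s else 0) | i < d].

Definition partial (j : 'I_d) (f : P -> R) : P -> R :=
  fun x => derive1 (fun s : R => f (shift x j s)) 0.

Definition iter_partial (js : seq 'I_d) (f : P -> R) : P -> R :=
  foldr partial f js.

Definition continuousP (f : P -> R) : Prop :=
  forall (x : P) (e : R), 0 < e -> exists2 del : R, 0 < del &
    forall y : P, (forall i, `|tnth y i - tnth x i| < del) -> `|f y - f x| < e.

Definition periodicP (f : P -> R) : Prop :=
  forall x j, f (shift x j 1) = f x.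

Definition test_fun (psi : P -> R) : Prop :=
  periodicP psi /\
  forall js : seq 'I_d, continuousP (iter_partial js psi) /\
    forall x j, derivable (fun s : R => iter_partial js psi (shift x j s)) 0 1.

Definition weak_partial (mu : {measure set P -> \bar R}) (j : 'I_d)
  (f g : P -> R) : Prop :=
  [/\ mu.-integrable unit_cube (EFin \o f),
      mu.-integrable unit_cube (EFin \o g) &
      forall psi, test_fun psi ->
        (\int[mu]_(x in unit_cube) (f x * partial j psi x)%:E =
         - \int[mu]_(x in unit_cube) (g x * psi x)%:E)%E].

Definition weak_div (mu : {measure set P -> \bar R}) (v : 'I_d -> P -> R)
  (g : P -> R) : Prop :=
  [/\ forall j, mu.-integrable unit_cube (EFin \o v j),
      mu.-integrable unit_cube (EFin \o g) &
      forall psi, test_fun psi ->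
        (\int[mu]_(x in unit_cube) (\sum_(j < d) v j x * partial j psi x)%:E =
         - \int[mu]_(x in unit_cube) (g x * psi x)%:E)%E].

Definition bmo_le (mu : {measure set P -> \bar R}) (f : P -> R) (C : R) : Prop :=
  forall (a : P) (r : R), 0 < r ->
    let F := f \o fracP in
    let avg := fine (\int[mu]_(x in cube a r) (F x)%:E) / r ^+ d in
    (\int[mu]_(x in cube a r) (`|F x - avg|)%:E <= (C * r ^+ d)%:E)%E.

Definition st_measure (mu : {measure set P -> \bar R}) :=
  (@lebesgue_measure R \x mu)%E.

Definition space_time (T : R) : set (R * P) := `[0, T] `*` unit_cube.

Definition Linf_st (mu : {measure set P -> \bar R}) (T : R) (f : R -> P -> R) : Prop :=
  measurable_fun setT (fun p : R * P => f p.1 p.2) /\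
  exists M : R, ae_on (st_measure mu) (space_time T) (fun p => `|f p.1 p.2| <= M).

(* regular Lagrangian flow (lifted to R^d) of the field u on [0,T] x T^d *)
Definition regular_lagrangian_flow (mu : {measure set P -> \bar R}) (T : R)
  (u : 'I_d -> R -> P -> R) (X : R -> P -> P) : Prop :=
  [/\ measurable_fun setT (fun p : R * P => X p.1 p.2),
      ae_on mu unit_cube (fun y => forall i, abs_cont_on 0 T (fun t => tnth (X t y) i)),
      (forall y, unit_cube y -> X 0 y = y),
      ae_on (st_measure mu) (space_time T) (fun p =>
        forall i, derivable (fun t => tnth (X t p.2) i) p.1 1 /\
          derive1 (fun t => tnth (X t p.2) i) p.1 = u i p.1 (fracP (X p.1 p.2))) &
      exists L : R, forall t, 0 <= t <= T -> forall A : set P,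
        measurable A -> A `<=` unit_cube ->
        (mu (unit_cube `&` [set y | A (fracP (X t y))]) <= L%:E * mu A)%E].

Definition field_hyp (mu : {measure set P -> \bar R}) (T : R)
  (u : 'I_d -> R -> P -> R) (phi : R -> P -> R) (g : R -> P -> R)
  (w : 'I_d -> 'I_d -> R -> P -> R) : Prop :=
  [/\ ae_on (@lebesgue_measure R) `[0, T] (fun t =>
        forall j, weak_partial mu j (phi t) (u j t)),
      ae_on (@lebesgue_measure R) `[0, T] (fun t =>
        forall j, (\int[mu]_(x in unit_cube) (u j t x)%:E = 0)%E),
      (forall j, Linf_st mu T (u j)),
      Linf_st mu T g /\ ae_on (@lebesgue_measure R) `[0, T] (fun t =>
        weak_div mu (fun j => u j t) (g t)) &
      [/\ forall j k, measurable_fun setT (fun p : R * P => w j k p.1 p.2),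
          ae_on (@lebesgue_measure R) `[0, T] (fun t =>
            forall j k, weak_partial mu k (u j t) (w j k t)) &
          exists C : R, ae_on (@lebesgue_measure R) `[0, T] (fun t =>
            forall j k, bmo_le mu (w j k t) C)]].

End torus.

(* Main.v *)
(* Since div u_i is transported to the same function sigma along both flows, the
   Jacobian formula gives (X_i)_# (J dy) = dx with the same density
   J = exp (\int_0^t sigma).  Let phi be the difference of the potentials.  Testing
   u1 - u2 = grad phi against itself,
     \int |u1 - u2|^2 = - \int phi div (u1 - u2) = \int sigma J (phi (X2) - phi (X1)) dy,
   and grad phi has a log-Lipschitz modulus of continuity because its gradient is in
   BMO; hence \int |u1 - u2|^2 <= C D log (1/D) with D = \int |X1 - X2|^2.  The same
   modulus for u1 yields D' <= C D log (1/D), D (0) = 0, and Osgood's lemma gives D = 0.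

   The modulus s log (1/s) is always used in the linearised dyadic form
   (l + 2) (s + 2^-l), for every natural number l.  Approximations are averages over
   dyadic cubes; they commute with weak derivatives, and |avg k (grad u)| <= C k.

   The Jacobian formula is obtained without renormalisation theory: over a time step h
   the flow is close to x + \int V_k, which is nearly a composition of coordinate shears;
   the accumulated error is of order exp (C k t) (h + k 2^-k), and it vanishes on
   short time intervals when first h -> 0 and then k -> oo. *)
Require Import Defs.
From HB Require Import structures.
From mathcomp Require Import all_boot all_order all_algebra.
From mathcomp Require Import all_classical all_reals all_analysis.
From mathcomp Require Import measurable_realfun lra ring.
Import Order.TTheory GRing.Theory Num.Theory.
Import numFieldNormedType.Exports.
Set Implicit Arguments. Unset Strict Implicit. Unset Printing Implicit Defensive.
Local Open Scope classical_set_scope.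
Local Open Scope ring_scope.

(** * Integrals of bounded measurable functions *)

(** The increment [phi (X2) - phi (X1)] is expanded around [X1]. Its first-order part
    [|grad phi (X1)| |X1 - X2|] contains the quantity being estimated: Young's inequality gives the
    gradient the weight [1 / (2 (L + 1))], so that after compression by the flow at most half of the
    energy reappears and is absorbed; only the correction feels the logarithm.

    The dyadic form of the modulus is affine in [s], so it is integrated over the torus without any
    concavity argument, and [l] is chosen at the very end. In Osgood's lemma the scales appear
    squared: over a short time Gronwall's factor is at most [2^(l + 2)], against an error of order
    [(l + 2) 4^-l].

    The obstacle in the Jacobian formula is that the divergence is merely bounded, so its smooth
    approximations have no Lipschitz bound uniform in the level. Two levels are therefore kept
    apart, [k] for the displacement and [m] for the density: first [k] tends to infinity with [m]
    fixed, then [m] does. *)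

Section bounded_measurable.
Context d (Z : measurableType d) (R : realType).
Implicit Types f g : Z -> R.

(** Defined, bounded and measurable everywhere: such functions form an algebra and are integrable
    for every finite measure, so integrals are manipulated without side conditions. *)
Definition bdm f := measurable_fun setT f /\ exists M : R, forall z, `|f z| <= M.

Lemma bdm_cst c : bdm (fun=> c).
Proof. by split; [exact: measurable_cst|exists `|c|]. Qed.

Lemma bdmD f g : bdm f -> bdm g -> bdm (fun z => f z + g z).
Proof.
move=> [mf [M fM]] [mg [N gN]]; split; first exact: measurable_funD.
by exists (M + N) => z; rewrite (le_trans (ler_normD _ _))// lerD.
Qed.

Lemma bdmN f : bdm f -> bdm (fun z => - f z).
Proof.
move=> [mf [M fM]]; split; first exact: measurableT_comp.
by exists M => z; rewrite normrN.
Qed.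

Lemma bdmB f g : bdm f -> bdm g -> bdm (fun z => f z - g z).
Proof. by move=> bf bg; apply: bdmD => //; exact: bdmN. Qed.

Lemma bdmM f g : bdm f -> bdm g -> bdm (fun z => f z * g z).
Proof.
move=> [mf [M fM]] [mg [N gN]]; split; first exact: measurable_funM.
by exists (M * N) => z; rewrite normrM ler_pM.
Qed.

Lemma bdmZ c f : bdm f -> bdm (fun z => c * f z).
Proof. by apply: bdmM; exact: bdm_cst. Qed.

Lemma bdm_norm f : bdm f -> bdm (fun z => `|f z|).
Proof.
move=> [mf [M fM]]; split; first exact: measurableT_comp.
by exists M => z; rewrite normr_id.
Qed.

Lemma bdm_sum (I : Type) (s : seq I) (P : pred I) (F : I -> Z -> R) :
  (forall i, bdm (F i)) -> bdm (fun z => \sum_(i <- s | P i) F i z).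
Proof.
move=> bF; elim: s => [|i s IH].
  by under eq_fun do rewrite big_nil; exact: bdm_cst.
under eq_fun do rewrite big_cons; case: (P i) => //.
exact: bdmD.
Qed.

Lemma bdm_indic (A : set Z) : measurable A -> bdm (\1_A : Z -> R).
Proof.
move=> mA; split; first exact: measurable_indic.
by exists 1 => z; rewrite indicE; case: (_ \in _); rewrite ?normr1 ?normr0.
Qed.

End bounded_measurable.

Lemma bdm_comp d d' (Z : measurableType d) (Y : measurableType d') (R : realType)
    (T : Y -> Z) (f : Z -> R) :
  measurable_fun setT T -> bdm f -> bdm (fun y => f (T y)).
Proof.
move=> mT [mf [M fM]]; split; first exact: measurableT_comp mf mT.
by exists M => y.
Qed.

(** * Bounded functions against a finite measure *)

Section integral.
Context d (Z : measurableType d) (R : realType).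
Variable m : {finite_measure set Z -> \bar R}.
Implicit Types f g : Z -> R.

Lemma bdm_integrable f : bdm f -> m.-integrable setT (EFin \o f).
Proof.
move=> [mf [M fM]]; apply: measurable_bounded_integrable => //.
- by rewrite -ge0_fin_numE//; exact: fin_num_measure.
- exists M; split; first exact: num_real.
  by move=> x /ltW Mx z _ /=; exact: le_trans (fM z) Mx.
Qed.
Local Hint Resolve bdm_integrable : core.

Lemma intD f g : bdm f -> bdm g ->
  \int[m]_x (f x + g x) = \int[m]_x f x + \int[m]_x g x.
Proof. by move=> bf bg; apply: RintegralD => //; exact: bdm_integrable. Qed.

Lemma intB f g : bdm f -> bdm g ->
  \int[m]_x (f x - g x) = \int[m]_x f x - \int[m]_x g x.
Proof. by move=> bf bg; apply: RintegralB => //; exact: bdm_integrable. Qed.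

Lemma intZ c f : bdm f -> \int[m]_x (c * f x) = c * \int[m]_x f x.
Proof. by move=> bf; apply: RintegralZl => //; exact: bdm_integrable. Qed.

Lemma intN f : bdm f -> \int[m]_x (- f x) = - \int[m]_x f x.
Proof.
move=> bf; rewrite -mulN1r -intZ//; apply: eq_Rintegral => x _.
by rewrite mulN1r.
Qed.

Lemma int_cst c : \int[m]_x c = c * fine (m setT).
Proof. exact: Rintegral_cst. Qed.

Lemma int_sum (I : Type) (s : seq I) (P : pred I) (F : I -> Z -> R) :
  (forall i, bdm (F i)) ->
  \int[m]_x (\sum_(i <- s | P i) F i x) = \sum_(i <- s | P i) \int[m]_x F i x.
Proof.
move=> bF; elim: s => [|i s IH].
  rewrite big_nil -[RHS](mul0r (fine (m setT))) -int_cst.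
  by apply: eq_Rintegral => x _; rewrite big_nil.
rewrite big_cons -IH; case: ifPn => Pi.
  rewrite -intD//; last exact: bdm_sum.
  by apply: eq_Rintegral => x _; rewrite big_cons Pi.
by apply: eq_Rintegral => x _; rewrite big_cons (negbTE Pi).
Qed.

Lemma int_le f g : bdm f -> bdm g -> (forall x, f x <= g x) ->
  \int[m]_x f x <= \int[m]_x g x.
Proof. by move=> bf bg fg; apply: le_Rintegral => //; exact: bdm_integrable. Qed.

Lemma int_ge0 f : (forall x, 0 <= f x) -> 0 <= \int[m]_x f x.
Proof. by move=> f0; apply: Rintegral_ge0 => x _. Qed.

Lemma int_norm f : bdm f -> `|\int[m]_x f x| <= \int[m]_x `|f x|.
Proof. by move=> bf; apply: le_normr_Rintegral => //; exact: bdm_integrable. Qed.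

Lemma int_normM f M : bdm f -> (forall x, `|f x| <= M) ->
  `|\int[m]_x f x| <= M * fine (m setT).
Proof.
move=> bf fM; rewrite (le_trans (int_norm bf))// -int_cst.
by apply: int_le => //; [exact: bdm_norm|exact: bdm_cst].
Qed.

Lemma int_ae_eq f g : bdm f -> bdm g -> {ae m, forall x, f x = g x} ->
  \int[m]_x f x = \int[m]_x g x.
Proof.
move=> [mf _] [mg _] fg; congr fine; apply: ae_eq_integral => //.
- exact/measurable_EFinP.
- exact/measurable_EFinP.
- by apply: filterS fg => x ->.
Qed.

Lemma int_ae_le f g : bdm f -> bdm g -> {ae m, forall x, f x <= g x} ->
  \int[m]_x f x <= \int[m]_x g x.
Proof.
move=> bf bg fg.
(* The maximum dominates [f] everywhere and equals [g] almost everywhere, which reduces the claim to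
   the pointwise comparison. *)
have bfg : bdm (fun x => Num.max (f x) (g x)).
  case: bf bg => mf [M fM] [mg [N gN]]; split; first exact: measurable_maxr.
  exists (M + N) => x.
  have M0 := le_trans (normr_ge0 _) (fM x).
  have N0 := le_trans (normr_ge0 _) (gN x).
  rewrite /Num.max; case: ifPn => _.
    by rewrite (le_trans (gN x))// lerDr.
  by rewrite (le_trans (fM x))// lerDl.
rewrite [leRHS](_ : _ = \int[m]_x Num.max (f x) (g x)).
  by apply: int_le => // x; rewrite le_max lexx.
apply: int_ae_eq => //; apply: filterS fg => x fgx.
by rewrite max_r.
Qed.

Lemma int_eq0_ae f : bdm f -> (forall x, 0 <= f x) -> \int[m]_x f x <= 0 ->
  {ae m, forall x, f x = 0}.
Proof.
move=> bf f0 If0.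
have If : \int[m]_x f x = 0 by apply/eqP; rewrite eq_le If0 int_ge0.
have : ae_eq m setT (EFin \o f) (cst 0%E).
  apply/ae_eq_integral_abs => //; first by apply/measurable_EFinP; case: bf.
  rewrite [LHS](_ : _ = \int[m]_x (f x)%:E)%E; last first.
    by apply: eq_integral => x _; rewrite /= ger0_norm.
  by rewrite -[LHS]fineK -/(Rintegral _ _ _) ?If//; apply: integrable_fin_num => //; exact: bdm_integrable.
by apply: filterS => x /(_ I) [].
Qed.

Lemma int_cvg (f_ : nat -> Z -> R) f M : (forall n, measurable_fun setT (f_ n)) ->
  (forall n x, `|f_ n x| <= M) -> bdm f ->
  {ae m, forall x, f_ ^~ x @ \oo --> f x} ->
  (fun n => \int[m]_x f_ n x) @ \oo --> \int[m]_x f x.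
Proof.
move=> mf_ f_M bf f_f.
have H : (fun n => \int[m]_x (f_ n x)%:E)%E @ \oo --> (\int[m]_x (f x)%:E)%E.
  have c1 n : measurable_fun setT (EFin \o f_ n) by exact/measurable_EFinP.
  have c2 : measurable_fun setT (EFin \o f) by apply/measurable_EFinP; case: bf.
  have c3 : {ae m, forall x, setT x -> (EFin \o f_ n) x @[n --> \oo] --> (EFin \o f) x}.
    by apply: filterS f_f => x f_f _; apply: cvg_EFin f_f; apply: nearW.
  have c4 : m.-integrable setT (EFin \o cst M) by exact: (bdm_integrable (bdm_cst _ M)).
  have c5 : {ae m, forall x n, setT x -> (`|(EFin \o f_ n) x| <= (EFin \o cst M) x)%E}.
    by apply: aeW => x n _; rewrite lee_fin.
  by have [] := dominated_convergence measurableT c1 c2 c3 c4 c5.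
apply: fine_cvg; rewrite fineK; last first.
  by apply: integrable_fin_num => //; exact: bdm_integrable.
exact: H.
Qed.

End integral.

(** * Push-forward of measures *)

Section change_of_variable.
Context d d' (Z : measurableType d) (Y : measurableType d') (R : realType).
Variable m : {finite_measure set Z -> \bar R}.

(** The hypothesis compares the push-forward of [m] with [L] times [m'] as measures, and the
    integral of a nonnegative function is monotone in the measure. This is how the compression bound
    of a flow acts on integrals. *)
Lemma int_comp_le (m' : {finite_measure set Y -> \bar R})
    (T : Z -> Y) (L : R) : measurable_fun setT T -> 0 <= L ->
  (forall A, measurable A -> (m (T @^-1` A) <= L%:E * m' A)%E) ->
  forall f, bdm f -> (forall y, 0 <= f y) ->
  \int[m]_x f (T x) <= L * \int[m']_y f y.
Proof.
move=> mT L0 mL f bf f0.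
have bfT := bdm_comp mT bf.
rewrite -lee_fin EFinM /Rintegral fineK; last first.
  by apply: integrable_fin_num => //; exact: bdm_integrable.
rewrite fineK; last first.
  apply: integrable_fin_num => //; apply: measurable_bounded_integrable => //.
  - by rewrite -ge0_fin_numE//; exact: fin_num_measure.
  - by case: bf.
  - case: bf => _ [M fM]; exists M; split; first exact: num_real.
    by move=> x /ltW Mx z _ /=; exact: le_trans (fM z) Mx.
have mf : measurable_fun setT (EFin \o f) by apply/measurable_EFinP; case: bf.
rewrite -(@ge0_integral_pushforward _ _ _ _ _ T mT m setT (EFin \o f))//=.
have -> : L = (NngNum L0)%:num by [].
rewrite -ge0_integral_mscale//.
- by apply: ge0_le_measure_integral => // A mA; exact: mL.
- by move=> y _; rewrite lee_fin.
- by move=> y _; rewrite lee_fin.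
Qed.

Lemma int_comp_eq (m' : {measure set Y -> \bar R})
    (T : Z -> Y) : measurable_fun setT T ->
  (forall A, measurable A -> m (T @^-1` A) = m' A) ->
  forall f, bdm f -> \int[m]_x f (T x) = \int[m']_y f y.
Proof.
move=> mT mL f bf; congr fine.
have mf : measurable_fun setT (EFin \o f) by apply/measurable_EFinP; case: bf.
have := @integral_pushforward _ _ _ _ _ T mT m setT (EFin \o f) mf.
move=> <-//; last exact: (bdm_integrable m (bdm_comp mT bf)).
by apply: eq_measure_integral => A mA _; exact: mL.
Qed.

End change_of_variable.

(** * Integrals depending on a parameter, and Fubini *)

Section parametric.
Context d1 d2 (Y : measurableType d1) (Z : measurableType d2) (R : realType).

Lemma measurable_int_param (m : {sigma_finite_measure set Z -> \bar R}) (f : Y * Z -> R) :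
  measurable_fun setT f -> measurable_fun setT (fun y => \int[m]_z f (y, z)).
Proof.
move=> mf; have mF : measurable_fun setT (EFin \o f) by exact/measurable_EFinP.
apply: measurableT_comp => //=.
under eq_fun do rewrite integralE.
apply: emeasurable_funB.
- rewrite [X in measurable_fun _ X](_ : _ = fubini_F m (EFin \o f)^\+%E); last first.
    by apply/funext => y; rewrite /fubini_F; apply: eq_integral => z _; exact: (congr1 (fun h => h z) (funepos_comp (EFin \o f) (fun z => (y, z)))).
  apply: measurable_fun_fubini_tonelli_F => //.
  exact: measurable_funepos.
- rewrite [X in measurable_fun _ X](_ : _ = fubini_F m (EFin \o f)^\-%E); last first.
    by apply/funext => y; rewrite /fubini_F; apply: eq_integral => z _; exact: (congr1 (fun h => h z) (funeneg_comp (EFin \o f) (fun z => (y, z)))).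
  apply: measurable_fun_fubini_tonelli_F => //.
  exact: measurable_funeneg.
Qed.

Lemma bdm_int (m : {finite_measure set Z -> \bar R}) (f : Y * Z -> R) :
  bdm f -> bdm (fun y => \int[m]_z f (y, z)).
Proof.
move=> [mf [M fM]]; split; first exact: measurable_int_param.
exists (M * fine (m setT)) => y; apply: int_normM => //.
by apply: bdm_comp; [exact: measurable_pair1|split => //; exists M].
Qed.

Lemma int_fubini (m1 : {finite_measure set Y -> \bar R})
    (m2 : {finite_measure set Z -> \bar R}) (f : Y * Z -> R) : bdm f ->
  \int[m1]_y \int[m2]_z f (y, z) = \int[m2]_z \int[m1]_y f (y, z).
Proof.
move=> bf.
have i12 : (m1 \x m2)%E.-integrable setT (EFin \o f).
  case: bf => mf [M fM]; apply: measurable_bounded_integrable => //.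
  - rewrite -setXTT [ltLHS]product_measure1E//.
    by rewrite -ge0_fin_numE ?mule_ge0// fin_numM//; exact: fin_num_measure.
  - exists M; split; first exact: num_real.
    by move=> x /ltW Mx z _ /=; exact: le_trans (fM z) Mx.
have bfp y : bdm (fun z => f (y, z)) by apply: bdm_comp bf; exact: measurable_pair1.
have bfq z : bdm (fun y => f (y, z)) by apply: bdm_comp bf; exact: measurable_pair2.
congr fine.
have := Fubini i12; rewrite /= => F.
transitivity (\int[m1]_y \int[m2]_z (f (y, z))%:E)%E.
  apply: eq_integral => y _; rewrite fineK//.
  by apply: integrable_fin_num => //; exact: (bdm_integrable m2 (bfp y)).
rewrite F; apply: eq_integral => z _; rewrite fineK//.
by apply: integrable_fin_num => //; exact: (bdm_integrable m1 (bfq z)).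
Qed.

End parametric.

(** * The torus *)

Section tuple_maps.
Context {R : realType} {d : nat}.
Local Notation P := (d.-tuple R).
Implicit Types (x y z a b : P) (j : 'I_d) (s t : R).

Definition padd x z : P := [tuple tnth x i + tnth z i | i < d].

Lemma tnth_shift x j s i :
  tnth (Defs.shift x j s) i = tnth x i + (if i == j then s else 0).
Proof. by rewrite tnth_mktuple. Qed.

Lemma tnth_padd x z i : tnth (padd x z) i = tnth x i + tnth z i.
Proof. by rewrite tnth_mktuple. Qed.

Lemma tnth_fracP x i :
  tnth (fracP x) i = tnth x i - (Num.floor (tnth x i))%:~R.
Proof. by rewrite tnth_mktuple. Qed.

Lemma pshift0 x j : Defs.shift x j 0 = x.
Proof.
by apply: eq_from_tnth => i; rewrite tnth_shift; case: ifP; rewrite addr0.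
Qed.

Lemma pshiftD x j s t : Defs.shift (Defs.shift x j s) j t = Defs.shift x j (s + t).
Proof.
apply: eq_from_tnth => i; rewrite !tnth_shift; case: ifP => _.
  by rewrite addrA.
by rewrite !addr0.
Qed.

Lemma shift_padd x z j s :
  Defs.shift (padd x z) j s = padd (Defs.shift x j s) z.
Proof. by apply: eq_from_tnth => i; rewrite !(tnth_shift, tnth_padd) addrAC. Qed.

Lemma paddAC x y z : padd (padd x y) z = padd (padd x z) y.
Proof. by apply: eq_from_tnth => i; rewrite !tnth_padd addrAC. Qed.

Lemma frac_intD (s : R) (n : int) :
  (s + n%:~R) - (Num.floor (s + n%:~R))%:~R = s - (Num.floor s)%:~R.
Proof.
rewrite floorDrz ?intr_int// intrKfloor rmorphD/= opprD addrACA subrr addr0//.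
Qed.

Lemma frac_fracD s t :
  let r := s - (Num.floor s)%:~R + t in
  r - (Num.floor r)%:~R = s + t - (Num.floor (s + t))%:~R.
Proof.
rewrite /= (_ : s - (Num.floor s)%:~R + t = s + t + (- Num.floor s)%:~R).
  exact: frac_intD.
by rewrite mulrNz addrAC.
Qed.

Lemma frac_itv s : 0 <= s - (Num.floor s)%:~R < 1.
Proof.
have /andP[h1 h2] := floor_itv s.
by rewrite subr_ge0 h1/= ltrBlDl -[X in _ + X]/(1%:~R) -intrD.
Qed.

Lemma floor0_itv s : 0 <= s < 1 -> Num.floor s = 0.
Proof. by move=> h; apply: floor_def; rewrite add0r. Qed.

Lemma fracP_unit x : unit_cube (fracP x).
Proof. by move=> i; rewrite tnth_fracP; exact: frac_itv. Qed.

Lemma fracP_id x : unit_cube x -> fracP x = x.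
Proof.
by move=> Ux; apply: eq_from_tnth => i; rewrite tnth_fracP floor0_itv// subr0.
Qed.

Lemma fracP_shift_frac x j s :
  fracP (Defs.shift (fracP x) j s) = fracP (Defs.shift x j s).
Proof.
apply: eq_from_tnth => i; rewrite !(tnth_shift, tnth_fracP).
exact: frac_fracD.
Qed.

Lemma fracP_padd_frac x z : fracP (padd (fracP x) z) = fracP (padd x z).
Proof.
apply: eq_from_tnth => i; rewrite !(tnth_padd, tnth_fracP).
exact: frac_fracD.
Qed.

Lemma fracP_shift_int x j (n : int) :
  fracP (Defs.shift x j n%:~R) = fracP x.
Proof.
apply: eq_from_tnth => i; rewrite !(tnth_shift, tnth_fracP).
by case: ifP => _; rewrite ?addr0// frac_intD.
Qed.

Lemma fracP_shift1 x j : fracP (Defs.shift x j 1) = fracP x.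
Proof. exact: (fracP_shift_int x j 1). Qed.

(** Periodicity through [fracP] rather than through unit shifts: a single rewriting moves any point
    into the fundamental cube. *)
Definition per (T : Type) (f : P -> T) := forall x, f (fracP x) = f x.

Lemma per_shift1 T (f : P -> T) x j : per f -> f (Defs.shift x j 1) = f x.
Proof. by move=> pf; rewrite -pf fracP_shift1 pf. Qed.

Lemma per_fracP T (f : P -> T) : per (f \o fracP).
Proof. by move=> x /=; rewrite fracP_id//; exact: fracP_unit. Qed.

Lemma measurable_floor : measurable_fun setT (fun s : R => (Num.floor s)%:~R : R).
Proof.
apply: (measurability (@RGenCInfty.G R)); first exact: RGenCInfty.measurableE.
move=> _ [_ [c ->] <-]; rewrite setTI.
rewrite (_ : _ @^-1` _ = `[(Num.ceil c)%:~R, +oo[%classic)//.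
apply/seteqP; split => s /=; rewrite !in_itv/= !andbT.
  by rewrite -ceil_le_int -floor_ge_int.
by rewrite -ceil_le_int -floor_ge_int.
Qed.

Lemma measurable_fracP : measurable_fun setT (fracP : P -> P).
Proof.
apply/measurable_fun_tnthP => i.
rewrite (_ : _ \o _ = (fun x : P => tnth x i - (Num.floor (tnth x i))%:~R)).
  apply: measurable_funB; first exact: measurable_tnth.
  by apply: (measurableT_comp measurable_floor); exact: measurable_tnth.
by apply/funext => x /=; rewrite tnth_fracP.
Qed.

Lemma measurable_shift2 j :
  measurable_fun setT (fun p : P * R => Defs.shift p.1 j p.2).
Proof.
apply/measurable_fun_tnthP => i.
rewrite (_ : _ \o _ = (fun p : P * R => tnth p.1 i + (if i == j then p.2 else 0))).
  apply: measurable_funD; last by case: (i == j) => //; exact: measurable_snd.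
  by apply: (measurableT_comp (measurable_tnth i)).
by apply/funext => x /=; rewrite tnth_shift.
Qed.

Lemma measurable_shift j s : measurable_fun setT (fun x => Defs.shift x j s).
Proof.
exact: (measurableT_comp (measurable_shift2 j) (measurable_pair2 s)).
Qed.

Lemma measurable_padd2 : measurable_fun setT (fun p : P * P => padd p.1 p.2).
Proof.
apply/measurable_fun_tnthP => i.
rewrite (_ : _ \o _ = (fun p : P * P => tnth p.1 i + tnth p.2 i)).
  by apply: measurable_funD; apply: (measurableT_comp (measurable_tnth i)).
by apply/funext => x /=; rewrite tnth_padd.
Qed.

Lemma measurable_padd z : measurable_fun setT (fun x => padd x z).
Proof.
exact: (measurableT_comp measurable_padd2 (measurable_pair2 z)).
Qed.

Lemma measurable_paddf dY (Y : measurableType dY) (f g : Y -> P) :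
  measurable_fun setT f -> measurable_fun setT g ->
  measurable_fun setT (fun w => padd (f w) (g w)).
Proof.
move=> mf mg; apply: (measurableT_comp measurable_padd2 (g := fun w => (f w, g w))).
exact/measurable_fun_pairP.
Qed.

Lemma measurable_shiftf dY (Y : measurableType dY) j (f : Y -> P) (g : Y -> R) :
  measurable_fun setT f -> measurable_fun setT g ->
  measurable_fun setT (fun w => Defs.shift (f w) j (g w)).
Proof.
move=> mf mg; apply: (measurableT_comp (measurable_shift2 j) (g := fun w => (f w, g w))).
exact/measurable_fun_pairP.
Qed.

Lemma measurable_box a b : measurable (box a b).
Proof.
rewrite (_ : box a b = \bigcap_(i in [set: 'I_d])
  ((fun x => tnth x i) @^-1` `[tnth a i, tnth b i[%classic)).
  apply: fin_bigcap_measurable => // i _.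
  rewrite -[_ @^-1` _]setTI; apply: measurable_tnth => //.
apply/seteqP; split => x /= H i; first by move=> _ /=; rewrite in_itv/= H.
by have := H i I; rewrite /= in_itv.
Qed.

Lemma boxI a b a' b' : box a b `&` box a' b' =
  box [tuple Num.max (tnth a i) (tnth a' i) | i < d]
      [tuple Num.min (tnth b i) (tnth b' i) | i < d].
Proof.
apply/seteqP; split => x /=.
  move=> [H H'] i; rewrite !tnth_mktuple ge_max lt_min.
  by have /andP[-> ->] := H i; have /andP[-> ->] := H' i.
move=> H; split => i; have := H i; rewrite !tnth_mktuple ge_max lt_min;
  by move=> /andP[/andP[? ?] /andP[? ?]]; apply/andP.
Qed.

Definition boxes : set (set P) := [set A | exists a b, A = box a b].

(** A coordinate half-space is a countable union of growing boxes, so the coordinates are measurable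
    for the sigma-algebra that boxes generate. As boxes are stable under intersection, this opens
    the way to uniqueness of measures and to Dynkin classes. *)
Lemma measurable_boxes : @measurable _ P = <<s boxes>>.
Proof.
apply/seteqP; split; last first.
  apply: smallest_sub; first exact: sigma_algebra_measurable.
  by move=> _ [a [b ->]]; exact: measurable_box.
have mid : measurable_fun setT (id : g_sigma_algebraType boxes -> P).
  apply/measurable_fun_tnthP => i.
  apply: (measurability (@RGenInftyO.G R)); first exact: RGenInftyO.measurableE.
  move=> _ [_ [c ->] <-]; rewrite setTI.
  pose a (n : nat) : P := [tuple - n%:R | _ < d].
  pose b (n : nat) : P := [tuple (if k == i then c else n%:R) | k < d].
  rewrite (_ : _ @^-1` _ = \bigcup_n box (a n) (b n)).
    apply: bigcup_measurable => n _; apply: sub_sigma_algebra.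
    by exists (a n), (b n).
  apply/seteqP; split => x /=; rewrite ?in_itv/=.
    move=> xc; pose n := \max_(k < d) (Num.bound (tnth x k)).
    have nx k : `|tnth x k| < n%:R.
      rewrite (lt_le_trans (unstable.ltr_norm_bound _))// ler_nat.
      exact: (leq_bigmax_cond (F := fun k => Num.bound (tnth x k))).
    exists n => // k; rewrite !tnth_mktuple; have := nx k.
    rewrite ltr_norml => /andP[/ltW -> xn]/=.
    by case: ifP => // /eqP ->.
  move=> [n _ /(_ i)]; by rewrite !tnth_mktuple eqxx => /andP[_ ->].
move=> A mA; have := mid measurableT A mA.
by rewrite setTI.
Qed.

Lemma measure_eq_boxes (m1 m2 : {measure set P -> \bar R}) :
  (forall a b, m1 (box a b) = m2 (box a b)) ->
  (forall a b, (m1 (box a b) < +oo)%E) ->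
  forall A, measurable A -> m1 A = m2 A.
Proof.
move=> m12 m1oo.
apply: (measure_unique boxes
  (fun n : nat => box [tuple - n%:R | _ < d] [tuple n%:R | _ < d])) => //.
- exact: measurable_boxes.
- by move=> _ _ [a [b ->]] [a' [b' ->]]; rewrite boxI; do 2 eexists.
- by move=> n; do 2 eexists.
- apply/seteqP; split => // x _.
  pose n := \max_(k < d) (Num.bound (tnth x k)).
  exists n => // k; rewrite !tnth_mktuple.
  have : `|tnth x k| < n%:R.
    rewrite (lt_le_trans (unstable.ltr_norm_bound _))// ler_nat.
    exact: (leq_bigmax_cond (F := fun k => Num.bound (tnth x k))).
  by rewrite ltr_norml => /andP[/ltW -> xn].
- by move=> _ [a [b ->]].
Qed.

Definition pcst (c : R) : P := [tuple c | _ < d].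

Lemma unit_cubeE : unit_cube = box (pcst 0) (pcst 1).
Proof.
by apply/seteqP; split => x H i; have := H i; rewrite !tnth_mktuple.
Qed.

Lemma cubeE a (r : R) : cube a r = box a (padd a (pcst r)).
Proof.
by apply/seteqP; split => x H i; have := H i; rewrite tnth_padd tnth_mktuple.
Qed.

Lemma measurable_unit_cube : measurable (unit_cube : set P).
Proof. by rewrite unit_cubeE; exact: measurable_box. Qed.

Lemma measurable_cube a (r : R) : measurable (cube a r).
Proof. by rewrite cubeE; exact: measurable_box. Qed.

End tuple_maps.

(** Moves the domain of integration into the measure, so that integrals over [D] fall under the
    calculus of finite measures on the whole space. *)
Lemma int_mfrestr d (T : measurableType d) (R : realType)
    (mu : {measure set T -> \bar R}) (D : set T) (mD : measurable D)
    (Doo : (mu D < +oo)%E) (f : T -> R) : measurable_fun setT f ->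
  \int[mfrestr mD Doo]_x f x = \int[mu]_(x in D) f x.
Proof.
move=> mf; have mF : measurable_fun setT (EFin \o f) by exact/measurable_EFinP.
have mDC : measurable (~` D) by exact: measurableC.
have D0 : mfrestr mD Doo (~` D) = 0%E.
  by rewrite /mfrestr /mrestr setICl measure0.
congr fine.
transitivity (\int[mfrestr mD Doo]_(x in D) (f x)%:E)%E.
  rewrite integralE [in RHS]integralE; congr (_ - _)%E.
    rewrite (@ge0_negligible_integral _ _ _ _ setT (~` D))// ?setTD ?setCK//.
    exact: measurable_funepos.
  rewrite (@ge0_negligible_integral _ _ _ _ setT (~` D))// ?setTD ?setCK//.
  exact: measurable_funeneg.
apply: eq_measure_integral => A mA AD.
by rewrite /= /mfrestr /mrestr setIidl.
Qed.

(** * Lebesgue measure and translations of the torus *)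

Section lebesgue_tuple.
Context {R : realType} {d : nat}.
Local Notation P := (d.-tuple R).
Variable mu : {measure set P -> \bar R}.
Hypothesis Hmu : is_lebesgue_Rd mu.
Implicit Types (x y z a b : P) (j : 'I_d) (s t : R).

Lemma mu_box a b :
  mu (box a b) = (\prod_(i < d) Num.max 0 (tnth b i - tnth a i))%:E.
Proof.
have [ab|/existsNP[i abi]] := pselect (forall i, tnth a i <= tnth b i).
  rewrite Hmu//; congr EFin; apply: eq_bigr => i _.
  by rewrite max_r// subr_ge0.
have {}abi : tnth b i < tnth a i by rewrite ltNge; exact/negP.
rewrite (_ : box a b = set0) ?measure0; last first.
  by apply/seteqP; split => // x /(_ i) /andP[h1 h2];
    have := lt_trans (le_lt_trans h1 h2) abi; rewrite ltxx.
rewrite (bigD1 i)//= max_l ?mul0r// subr_le0; exact: ltW.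
Qed.

Lemma mu_box_fin a b : (mu (box a b) < +oo)%E.
Proof. by rewrite mu_box ltry. Qed.

Lemma mu_cube a (r : R) : 0 <= r -> mu (cube a r) = (r ^+ d)%:E.
Proof.
move=> r0; rewrite cubeE Hmu; last first.
  by move=> i; rewrite tnth_padd tnth_mktuple lerDl.
congr EFin; rewrite -[in RHS](card_ord d) -prodr_const.
by apply: eq_bigr => i _; rewrite tnth_padd tnth_mktuple addrC addKr.
Qed.

Lemma mu_cube_fin a (r : R) : (mu (cube a r) < +oo)%E.
Proof. by rewrite cubeE mu_box_fin. Qed.

Lemma mu_unit : mu unit_cube = 1%E.
Proof.
rewrite unit_cubeE Hmu; last by move=> i; rewrite !tnth_mktuple.
by rewrite big1// => i _; rewrite !tnth_mktuple subr0.
Qed.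

Lemma mu_unit_fin : (mu unit_cube < +oo)%E.
Proof. by rewrite mu_unit ltry. Qed.

Lemma mu_padd z A : measurable A -> mu ((fun x => padd x z) @^-1` A) = mu A.
Proof.
move=> mA; apply: (measure_eq_boxes
  (m1 := pushforward mu (fun x => padd x z))) => //.
- exact: measurable_padd.
- move=> ? a b; rewrite /= /pushforward.
  rewrite (_ : _ @^-1` _ = box (padd a (map_tuple -%R z)) (padd b (map_tuple -%R z))).
    rewrite !mu_box; congr EFin; apply: eq_bigr => i _.
    by rewrite !tnth_padd opprD addrACA subrr addr0.
  apply/seteqP; split => x H i; have := H i;
    by rewrite !tnth_padd tnth_map lerBlDr ltrBrDr.
move=> ? a b; rewrite /= /pushforward.
rewrite (_ : _ @^-1` _ = box (padd a (map_tuple -%R z)) (padd b (map_tuple -%R z))).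
  exact: mu_box_fin.
apply/seteqP; split => x H i; have := H i;
  by rewrite !tnth_padd tnth_map lerBlDr ltrBrDr.
Qed.

Definition pdelta j s : P := [tuple (if i == j then s else 0) | i < d].

Lemma pshiftE x j s : Defs.shift x j s = padd x (pdelta j s).
Proof. by apply: eq_from_tnth => i; rewrite tnth_shift tnth_padd tnth_mktuple. Qed.

Lemma mu_shift j s A : measurable A ->
  mu ((fun x => Defs.shift x j s) @^-1` A) = mu A.
Proof. by under eq_fun do rewrite pshiftE; exact: mu_padd. Qed.

(** The probability measure of the torus, carried by the fundamental cube but living on the whole of
    [P], where periodic functions are defined. *)
Definition torm : {finite_measure set P -> \bar R} :=
  mfrestr measurable_unit_cube mu_unit_fin.

Lemma tormE A : torm A = mu (A `&` unit_cube).
Proof. by []. Qed.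

Lemma torm1 : fine (torm setT) = 1.
Proof. by rewrite tormE setTI mu_unit. Qed.

Lemma torm_unit : {ae torm, forall x, unit_cube x}.
Proof.
exists (~` (unit_cube : set P)); split => //.
  exact: measurableC (@measurable_unit_cube R d).
by rewrite tormE setICl measure0.
Qed.

Lemma int_tormE (f : P -> R) : measurable_fun setT f ->
  \int[torm]_x f x = \int[mu]_(x in unit_cube) f x.
Proof. exact: int_mfrestr. Qed.

(** Translation modulo 1 is a cut and paste: the part of the target at height at least [s] comes
    from points moved by [s], the part below from points moved by [s - 1], and each piece is an
    honest translate. *)
Lemma fracP_shift_preimage j s A : measurable A -> 0 <= s < 1 ->
  mu ((fun x => fracP (Defs.shift x j s)) @^-1` A `&` unit_cube) =
  mu (A `&` unit_cube).
Proof.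
move=> mA /andP[s0 s1].
pose B1 := A `&` unit_cube `&` [set x | s <= tnth x j].
pose B2 := A `&` unit_cube `&` [set x | tnth x j < s].
have m1E : (-1)%:~R = -1 :> R by [].
have mU : measurable (unit_cube : set P) by exact: measurable_unit_cube.
have mge : measurable [set x : P | s <= tnth x j].
  rewrite (_ : [set _ | _] = (fun x => tnth x j) @^-1` `[s, +oo[%classic).
    by rewrite -[_ @^-1` _]setTI; exact: measurable_tnth.
  by apply/seteqP; split => x /=; rewrite in_itv/= andbT.
have mlt : measurable [set x : P | tnth x j < s].
  rewrite (_ : [set _ | _] = (fun x => tnth x j) @^-1` `]-oo, s[%classic).
    by rewrite -[_ @^-1` _]setTI; exact: measurable_tnth.
  by apply/seteqP; split => x /=; rewrite in_itv/=.
have mB1 : measurable B1 by apply: measurableI => //; exact: measurableI.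
have mB2 : measurable B2 by apply: measurableI => //; exact: measurableI.
have E : (fun x => fracP (Defs.shift x j s)) @^-1` A `&` unit_cube =
    (fun x => Defs.shift x j s) @^-1` B1 `|` (fun x => Defs.shift x j (s - 1)) @^-1` B2.
  apply/seteqP; split => x /=.
    move=> [Ax Ux]; have /andP[xj0 xj1] := Ux j.
    have [xs|xs] := ltP (tnth x j + s) 1; [left|right].
      have Us : unit_cube (Defs.shift x j s).
        move=> i; rewrite tnth_shift; case: eqP => [->|_]; last by rewrite addr0.
        by rewrite xs addr_ge0.
      split; last by rewrite /= tnth_shift eqxx lerDr.
      by split => //; move: Ax; rewrite fracP_id.
    have Us : unit_cube (Defs.shift x j (s - 1)).
      move=> i; rewrite tnth_shift; case: eqP => [->|_]; last by rewrite addr0.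
      by apply/andP; split; lra.
    split; last by rewrite /= tnth_shift eqxx; lra.
    split => //; move: Ax; rewrite -(fracP_shift_int _ j (-1)) m1E pshiftD fracP_id//.
  move=> [[[Ax Ux] /= xs]|[[Ax Ux] /= xs]].
    split; first by rewrite fracP_id.
    move=> i; have := Ux i; rewrite tnth_shift; case: eqP => [->|_]; last by rewrite addr0.
    by move: xs; rewrite tnth_shift eqxx => h1 /andP[h2 h3]; apply/andP; split; lra.
  split.
    by rewrite -(fracP_shift_int _ j (-1)) m1E pshiftD fracP_id//.
  move=> i; have := Ux i; rewrite tnth_shift; case: eqP => [->|_]; last by rewrite addr0.
  by move: xs; rewrite tnth_shift eqxx => h1 /andP[h2 h3]; apply/andP; split; lra.
rewrite E measureU; last 3 first.
- by rewrite -[_ @^-1` _]setTI; exact: measurable_shift.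
- by rewrite -[_ @^-1` _]setTI; exact: measurable_shift.
- apply/seteqP; split => // x [[[_ U1] _] [[_ U2] _]].
  have := U1 j; have := U2 j; rewrite !tnth_shift eqxx => /andP[h1 h2] /andP[h3 h4].
  exfalso; move: h1 h2 h3 h4; lra.
rewrite [LHS](congr2 adde (mu_shift j s mB1) (mu_shift j (s - 1) mB2)).
have D12 : B1 `&` B2 = set0.
  apply/seteqP; split => // x [[_ /= h1] [_ /= h2]].
  by have := le_lt_trans h1 h2; rewrite ltxx.
rewrite -[LHS](measureU mu mB1 mB2 D12).
congr (mu _); rewrite /B1 /B2 -setIUr.
rewrite (_ : _ `|` _ = setT) ?setIT//.
by apply/seteqP; split => // x _ /=; case: (leP s (tnth x j)); [left|right].
Qed.

Lemma torm_shift j s A : measurable A ->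
  torm ((fun x => fracP (Defs.shift x j s)) @^-1` A) = torm A.
Proof.
move=> mA; rewrite !tormE -(fracP_shift_preimage j mA (frac_itv s)).
congr (mu (_ `&` _)); apply/seteqP; split => x /=.
  by rewrite -(fracP_shift_int _ j (- Num.floor s)) pshiftD mulrNz.
by rewrite -[in X in X -> _](fracP_shift_int _ j (Num.floor s)) pshiftD subrK.
Qed.

Lemma int_torm_shift (f : P -> R) j s : bdm f -> per f ->
  \int[torm]_x f (Defs.shift x j s) = \int[torm]_x f x.
Proof.
move=> bf pf; rewrite -[RHS](@int_comp_eq _ _ _ _ _ torm torm
  (fun x => fracP (Defs.shift x j s)))//.
- by apply: eq_Rintegral => x _; rewrite pf.
- exact: measurableT_comp measurable_fracP (measurable_shift j s).
- exact: torm_shift.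
Qed.

(** Truncating the translation vector lets a general translation be built from coordinate shifts by
    induction on [k]. *)
Definition pcut (k : nat) z : P := [tuple (if (i < k)%N then tnth z i else 0) | i < d].

Lemma pcut0 z : pcut 0 z = pcst 0.
Proof. by apply: eq_from_tnth => i; rewrite !tnth_mktuple ltn0. Qed.

Lemma padd0 x : padd x (pcst 0) = x.
Proof. by apply: eq_from_tnth => i; rewrite tnth_padd tnth_mktuple addr0. Qed.

Lemma pcut_full z : pcut d z = z.
Proof. by apply: eq_from_tnth => i; rewrite !tnth_mktuple ltn_ord. Qed.

Lemma padd_pcutS x z (k : nat) (kd : (k < d)%N) :
  padd x (pcut k.+1 z) =
  Defs.shift (padd x (pcut k z)) (Ordinal kd) (tnth z (Ordinal kd)).
Proof.
apply: eq_from_tnth => i; rewrite tnth_shift !tnth_padd !tnth_mktuple ltnS.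
case: eqP => [->|/eqP ik] /=; first by rewrite leqnn ltnn addr0.
by rewrite addr0 leq_eqVlt -(inj_eq val_inj) in ik *; rewrite (negbTE ik).
Qed.

Lemma torm_padd z A : measurable A ->
  torm ((fun x => fracP (padd x z)) @^-1` A) = torm A.
Proof.
suff H (k : nat) : (k <= d)%N -> forall A, measurable A ->
    torm ((fun x => fracP (padd x (pcut k z))) @^-1` A) = torm A.
  by move=> mA; rewrite -[in LHS](pcut_full z) H.
elim: k => [_ B mB|k IH kd B mB].
  rewrite !tormE; congr (mu _); apply/seteqP; split => x /= [Bx Ux];
    by move: Bx; rewrite pcut0 padd0 fracP_id.
rewrite -(IH (ltnW kd) B mB).
rewrite -[RHS](torm_shift (Ordinal kd) (tnth z (Ordinal kd))); last first.
  rewrite -[_ @^-1` _]setTI.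
  exact: (measurableT_comp measurable_fracP (measurable_padd _)).
congr (torm _); apply/seteqP; split => x /=;
  by rewrite padd_pcutS fracP_padd_frac shift_padd.
Qed.

Lemma int_torm_padd (f : P -> R) z : bdm f -> per f ->
  \int[torm]_x f (padd x z) = \int[torm]_x f x.
Proof.
move=> bf pf; rewrite -[RHS](@int_comp_eq _ _ _ _ _ torm torm
  (fun x => fracP (padd x z)))//.
- by apply: eq_Rintegral => x _; rewrite pf.
- exact: measurableT_comp measurable_fracP (measurable_padd z).
- exact: torm_padd.
Qed.

End lebesgue_tuple.

(** * Dyadic averages *)

Lemma cvg0P (R : realType) (u : nat -> R) :
  u @ \oo --> 0 <->
  forall e, 0 < e -> exists K, forall k, (K <= k)%N -> `|u k| <= e.
Proof.
split=> [/cvgrPdist_le H e e0|H].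
  have [K _ HK] := H e e0; exists K => k Kk.
  by have := HK k Kk; rewrite /= sub0r normrN.
apply/cvgrPdist_le => e e0; have [K HK] := H e e0.
by exists K => // k /= Kk; rewrite sub0r normrN HK.
Qed.

Section leb_interval.
Context {R : realType}.

Lemma leb_itv_fin (a b : R) : (@lebesgue_measure R `[a, b] < +oo)%E.
Proof. by rewrite lebesgue_measure_itv; case: ifP => //; rewrite -EFinB ltry. Qed.

Definition lebI (a b : R) : {finite_measure set (measurableTypeR R) -> \bar R} :=
  @mfrestr _ (measurableTypeR R) R _ lebesgue_measure
    (measurable_itv `[a, b]) (leb_itv_fin a b).

Lemma lebI1 (a b : R) : a <= b -> fine (lebI a b setT) = b - a.
Proof.
move=> ab; rewrite /= /mfrestr /mrestr setTI lebesgue_measure_itv/= lte_fin.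
by move: ab; rewrite le_eqVlt => /predU1P[->|->//]; rewrite ltxx subrr.
Qed.

Lemma int_lebI (a b : R) (f : R -> R) : measurable_fun setT f ->
  \int[lebI a b]_x f x = \int[lebesgue_measure]_(x in `[a, b]) f x.
Proof.
exact: (@int_mfrestr _ (measurableTypeR R) R lebesgue_measure _
  (measurable_itv `[a, b]) (leb_itv_fin a b) f).
Qed.

Lemma lebI_in (a b : R) : {ae lebI a b, forall x, a <= x <= b}.
Proof.
exists (~` `[a, b]%classic); split.
- exact: measurableC.
- by rewrite /= /mfrestr /mrestr setICl measure0.
- by move=> x /=; apply: contra_not; rewrite in_itv.
Qed.

End leb_interval.

Section radius.
Context {R : realType}.
Definition rk (k : nat) : R := (2 ^+ k)^-1.

Lemma rk_gt0 k : 0 < rk k. Proof. by rewrite invr_gt0 exprn_gt0. Qed.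
Lemma rk_ge0 k : 0 <= rk k. Proof. exact/ltW/rk_gt0. Qed.
Lemma rk0 : rk 0 = 1. Proof. by rewrite /rk expr0 invr1. Qed.
Lemma rkS k : rk k.+1 = rk k / 2.
Proof. by rewrite /rk exprS invfM mulrC. Qed.
Lemma rk_le1 k : rk k <= 1.
Proof. by rewrite invf_le1 ?exprn_gt0// exprn_ege1// ler1n. Qed.
Lemma rkK k : 2 ^+ k * rk k = 1 :> R.
Proof. by rewrite mulfV// expf_neq0. Qed.

Lemma rk_small (e : R) : 0 < e -> exists K, forall k, (K <= k)%N -> rk k < e.
Proof.
move=> e0; exists (Num.bound e^-1) => k Kk.
by rewrite /rk invf_plt ?posrE ?exprn_gt0//; exact: upper_nthrootP.
Qed.
End radius.

(** * Moving averages over cubes and integrated partial derivatives *)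

Section averages.
Context {R : realType} {d : nat}.
Local Notation P := (d.-tuple R).
Variable mu : {measure set P -> \bar R}.
Hypothesis Hmu : is_lebesgue_Rd mu.
Implicit Types (x y z a b : P) (j : 'I_d) (s t : R) (k : nat) (f g : P -> R).
Local Notation torm := (torm Hmu).

Definition nuk k : {finite_measure set P -> \bar R} :=
  mfrestr (measurable_cube (pcst 0) (rk k)) (mu_cube_fin Hmu (pcst 0) (rk k)).

(** The cube with lower corner [x] moves with [x]: this is convolution with a normalised indicator,
    not a conditional expectation on a grid, hence it commutes with translations, with derivatives
    and with averaging at other scales. *)
Definition avg k f x : R := (2 ^+ k) ^+ d * \int[nuk k]_z f (padd x z).

Lemma nuk1 k : (2 ^+ k) ^+ d * fine (nuk k setT) = 1.
Proof.
rewrite /= /mfrestr /mrestr setTI mu_cube ?rk_ge0//=.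
by rewrite -exprMn rkK expr1n.
Qed.

Lemma avg_fac_ge0 k : 0 <= (2 ^+ k) ^+ d :> R.
Proof. by rewrite !exprn_ge0. Qed.

Lemma nuk_in k : {ae nuk k, forall z, cube (pcst 0) (rk k) z}.
Proof.
exists (~` (cube (pcst 0) (rk k) : set P)); split => //.
  exact: measurableC (measurable_cube _ _).
by rewrite /= /mfrestr /mrestr setICl measure0.
Qed.

Lemma bdm_padd f x : bdm f -> bdm (fun z => f (padd x z)).
Proof.
apply: bdm_comp.
exact: (measurableT_comp measurable_padd2 (measurable_pair1 x)).
Qed.

Lemma avg_cst k c x : avg k (fun=> c) x = c.
Proof. by rewrite /avg int_cst mulrCA nuk1 mulr1. Qed.

Lemma avgD k f g x : bdm f -> bdm g ->
  avg k (fun x => f x + g x) x = avg k f x + avg k g x.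
Proof.
by move=> bf bg; rewrite /avg intD ?mulrDr//; exact: bdm_padd.
Qed.

Lemma avgB k f g x : bdm f -> bdm g ->
  avg k (fun x => f x - g x) x = avg k f x - avg k g x.
Proof.
by move=> bf bg; rewrite /avg intB ?mulrBr//; exact: bdm_padd.
Qed.

Lemma avg_sum (I : Type) (r : seq I) (F : I -> P -> R) k x :
  (forall i, bdm (F i)) ->
  avg k (fun x => \sum_(i <- r) F i x) x = \sum_(i <- r) avg k (F i) x.
Proof.
move=> bF; rewrite /avg int_sum ?mulr_sumr// => i; exact: bdm_padd.
Qed.

Lemma avg_ae_le k f g x y : bdm f -> bdm g ->
  (forall z, cube (pcst 0) (rk k) z -> f (padd x z) <= g (padd y z)) ->
  avg k f x <= avg k g y.
Proof.
move=> bf bg fg; rewrite ler_wpM2l ?avg_fac_ge0//.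
apply: int_ae_le; [exact: bdm_padd..|].
by apply: filterS (nuk_in k) => z /fg.
Qed.

Lemma avg_le k f g x : bdm f -> bdm g -> (forall y, f y <= g y) ->
  avg k f x <= avg k g x.
Proof. by move=> bf bg fg; apply: avg_ae_le. Qed.

Lemma avg_norm k f x : bdm f -> `|avg k f x| <= avg k (fun y => `|f y|) x.
Proof.
move=> bf; rewrite /avg normrM ger0_norm ?avg_fac_ge0//.
by rewrite ler_wpM2l ?avg_fac_ge0// int_norm//; exact: bdm_padd.
Qed.

Lemma avg_normM k f x M : bdm f -> (forall y, `|f y| <= M) -> `|avg k f x| <= M.
Proof.
move=> bf fM; rewrite (le_trans (avg_norm _ _ bf))// -[leRHS](avg_cst k M x).
by apply: avg_le => //; [exact: bdm_norm|exact: bdm_cst].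
Qed.

Lemma avg_ext k f g x : (forall y, f y = g y) -> avg k f x = avg k g x.
Proof. by move=> /funext ->. Qed.

Lemma avg_osc k f x y c : bdm f ->
  (forall z, cube (pcst 0) (rk k) z -> `|f (padd x z) - f (padd y z)| <= c) ->
  `|avg k f x - avg k f y| <= c.
Proof.
move=> bf fc.
rewrite /avg -mulrBr -intB; [|exact: bdm_padd..].
rewrite normrM ger0_norm ?avg_fac_ge0// -[leRHS]mul1r -[X in _ <= X * _](nuk1 k) -mulrA.
rewrite ler_wpM2l ?avg_fac_ge0//.
have bb : bdm (fun z => f (padd x z) - f (padd y z)).
  by apply: bdmB; exact: bdm_padd.
rewrite (le_trans (int_norm _ bb))// mulrC -int_cst.
apply: int_ae_le; [exact: bdm_norm|exact: bdm_cst|].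
by apply: filterS (nuk_in k) => z /fc.
Qed.

Lemma avg_close k f x c : bdm f ->
  (forall z, cube (pcst 0) (rk k) z -> `|f (padd x z) - f x| <= c) ->
  `|avg k f x - f x| <= c.
Proof.
move=> bf fc; rewrite -{1}(avg_cst k (f x) x).
rewrite -avgB//; last exact: bdm_cst.
rewrite (le_trans (avg_norm _ _ _))//; first by apply: bdmB => //; exact: bdm_cst.
rewrite -[leRHS](avg_cst k c x); apply: avg_ae_le => //.
- by apply: bdm_norm; apply: bdmB => //; exact: bdm_cst.
- exact: bdm_cst.
Qed.

Lemma avg_per k f : per f -> per (avg k f).
Proof.
move=> pf x; rewrite /avg; congr (_ * _); apply: eq_Rintegral => z _.
by rewrite -pf fracP_padd_frac pf.
Qed.

Lemma measurable_avg2 dY (Y : measurableType dY) k (F : Y * P -> R) :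
  measurable_fun setT F ->
  measurable_fun setT (fun p : Y * P => avg k (fun x => F (p.1, x)) p.2).
Proof.
move=> mF; apply: measurable_funM; first exact: measurable_cst.
apply: (measurable_int_param (nuk k)
  (f := fun q : (Y * P) * P => F (q.1.1, padd q.1.2 q.2))).
apply: (measurableT_comp mF); apply/measurable_fun_pairP; split.
  exact: (measurableT_comp measurable_fst measurable_fst).
apply: measurable_paddf => //.
exact: (measurableT_comp measurable_snd measurable_fst).
Qed.

Lemma measurable_avg k f : measurable_fun setT f -> measurable_fun setT (avg k f).
Proof.
move=> mf; apply: measurable_funM; first exact: measurable_cst.
apply: (measurable_int_param (nuk k) (f := fun q : P * P => f (padd q.1 q.2))).
exact: (measurableT_comp mf measurable_padd2).
Qed.

Lemma bdm_avg k f : bdm f -> bdm (avg k f).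
Proof.
move=> bf; split; first by apply: measurable_avg; case: bf.
by case: (bf) => _ [M fM]; exists M => x; exact: avg_normM.
Qed.

Lemma bdm_padd2 f : bdm f -> bdm (fun q : P * P => f (padd q.1 q.2)).
Proof. by apply: bdm_comp; exact: measurable_padd2. Qed.

Lemma int_avg k f : bdm f -> per f -> \int[torm]_x avg k f x = \int[torm]_x f x.
Proof.
move=> bf pf; rewrite /avg intZ; last first.
  exact: (bdm_int (nuk k) (bdm_padd2 bf)).
rewrite (int_fubini torm (nuk k) (bdm_padd2 bf))/=.
under eq_Rintegral do rewrite int_torm_padd//.
by rewrite int_cst mulrCA nuk1 mulr1.
Qed.

Lemma int_norm_avg k f : bdm f -> per f ->
  \int[torm]_x `|avg k f x| <= \int[torm]_x `|f x|.
Proof.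
move=> bf pf; rewrite -[leRHS](int_avg k); last 2 first.
- exact: bdm_norm.
- by move=> x; rewrite pf.
apply: int_le => //; first by apply: bdm_norm; exact: bdm_avg.
  by apply: bdm_avg; exact: bdm_norm.
by move=> x; exact: avg_norm.
Qed.

Lemma avg_comm k m f x : bdm f -> avg k (avg m f) x = avg m (avg k f) x.
Proof.
move=> bf; rewrite /avg.
pose F (q : P * P) := f (padd (padd x q.1) q.2).
have bF : bdm F.
  by apply: bdm_comp bf; do 2 apply: measurable_paddf => //.
rewrite intZ; last exact: (bdm_int (nuk m) bF).
rewrite intZ; last first.
  apply: (bdm_int (nuk k) (f := fun q : P * P => f (padd (padd x q.1) q.2))).
  exact: bF.
rewrite mulrCA; congr (_ * (_ * _)).
rewrite (int_fubini (nuk k) (nuk m) bF)/= /F.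
by apply: eq_Rintegral => z _; apply: eq_Rintegral => y _; rewrite paddAC.
Qed.

(* [f'] is the [j]-th derivative of [f] in integrated form along coordinate lines;
   averages of a weak derivative are derivatives in this strong sense. *)
Definition ipart j f f' := forall x h, 0 <= h ->
  f (Defs.shift x j h) - f x = \int[lebI 0 h]_s f' (Defs.shift x j s).

Lemma measurable_shift_line x j : measurable_fun setT (fun s : R => Defs.shift x j s).
Proof. exact: (measurableT_comp (measurable_shift2 j) (measurable_pair1 x)). Qed.

Lemma bdm_line f x j : bdm f -> bdm (fun s : R => f (Defs.shift x j s)).
Proof. by apply: bdm_comp; exact: measurable_shift_line. Qed.

Lemma avg_ipart k j f f' : bdm f -> bdm f' -> ipart j f f' ->
  ipart j (avg k f) (avg k f').
Proof.
move=> bf bf' ff' x h h0; rewrite /avg -mulrBr -intB; last 2 first.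
- exact: bdm_padd.
- exact: bdm_padd.
have bF : bdm (fun q : P * R => f' (Defs.shift (padd x q.1) j q.2)).
  apply: bdm_comp bf'; apply: measurable_shiftf => //.
  exact: measurable_paddf.
rewrite intZ; last first.
  have := bdm_int (nuk k) (f := fun q : R * P => f' (padd (Defs.shift x j q.1) q.2)).
  apply; apply: bdm_comp bf'; apply: measurable_paddf => //.
  exact: measurable_shiftf.
congr (_ * _).
transitivity (\int[nuk k]_z \int[lebI 0 h]_s f' (Defs.shift (padd x z) j s)).
  by apply: eq_Rintegral => z _; rewrite -shift_padd ff'.
rewrite (int_fubini (nuk k) (lebI 0 h) bF)/=.
apply: eq_Rintegral => s _; apply: eq_Rintegral => z _.
by rewrite shift_padd.
Qed.

Lemma ipart_lip j f f' (K : R) : bdm f' -> ipart j f f' -> (forall x, `|f' x| <= K) ->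
  forall x s, `|f (Defs.shift x j s) - f x| <= K * `|s|.
Proof.
move=> bf' ff' f'K.
have H x s : 0 <= s -> `|f (Defs.shift x j s) - f x| <= K * s.
  move=> s0; rewrite ff'//.
  have := @int_normM _ _ _ (lebI 0 s) (fun t => f' (Defs.shift x j t)) K
    (bdm_line x j bf') (fun t => f'K _).
  by rewrite lebI1// subr0.
move=> x s; have [s0|s0] := leP 0 s; first by rewrite [`|s|]ger0_norm// H.
rewrite [`|s|]ltr0_norm// -[X in _ - f X](pshift0 x j) -(subrr s) -pshiftD distrC.
by apply: H; rewrite oppr_ge0 ltW.
Qed.

(** The l^1 distance is the length of a coordinate path, so bounds on partial derivatives turn into
    Lipschitz bounds with the same constant. *)
Definition dist1 x y : R := \sum_(i < d) `|tnth x i - tnth y i|.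

(** Vertices of a path from [x] to [y] along the axes; increments over it involve one partial
    derivative at a time. *)
Definition hyb x y (n : nat) : P :=
  [tuple if (i < n)%N then tnth y i else tnth x i | i < d].

Lemma hyb0 x y : hyb x y 0 = x.
Proof. by apply: eq_from_tnth => i; rewrite tnth_mktuple ltn0. Qed.

Lemma hyb_full x y : hyb x y d = y.
Proof. by apply: eq_from_tnth => i; rewrite tnth_mktuple ltn_ord. Qed.

Lemma hybS x y j : hyb x y j.+1 = Defs.shift (hyb x y j) j (tnth y j - tnth x j).
Proof.
apply: eq_from_tnth => i; rewrite tnth_shift !tnth_mktuple ltnS.
case: eqP => [->|/eqP ij]; first by rewrite leqnn ltnn addrC subrK.
by rewrite addr0 leq_eqVlt -(inj_eq val_inj) in ij *; rewrite (negbTE ij).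
Qed.

Lemma hyb_telescope f x y :
  f y - f x = \sum_(j < d) (f (Defs.shift (hyb x y j) j (tnth y j - tnth x j)) - f (hyb x y j)).
Proof.
under eq_bigr do rewrite -hybS.
rewrite -(big_mkord xpredT (fun n : nat => f (hyb x y n.+1) - f (hyb x y n))) telescope_sumr//.
by rewrite hyb_full hyb0.
Qed.

Lemma lip_dist1 f K : (forall j x s, `|f (Defs.shift x j s) - f x| <= K * `|s|) ->
  forall x y, `|f x - f y| <= K * dist1 x y.
Proof.
move=> fK x y; rewrite (hyb_telescope f y x).
rewrite (le_trans (ler_norm_sum _ _ _))// /dist1 mulr_sumr.
by apply: ler_sum => j _; exact: fK.
Qed.

Lemma dist1_ge0 x y : 0 <= dist1 x y.
Proof. by apply: sumr_ge0 => i _. Qed.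

Lemma dist1xx x : dist1 x x = 0.
Proof. by rewrite /dist1 big1// => i _; rewrite subrr normr0. Qed.

Lemma dist1_padd x y z : dist1 (padd x z) (padd y z) = dist1 x y.
Proof.
by apply: eq_bigr => i _; rewrite !tnth_padd opprD addrACA subrr addr0.
Qed.

Lemma dist1_cube x z (r : R) : cube (pcst 0) r z -> dist1 (padd x z) x <= d%:R * r.
Proof.
move=> zr; rewrite /dist1 -[d in d%:R](card_ord d) -sumr_const mulr_suml.
apply: ler_sum => i _; rewrite mul1r tnth_padd addrAC subrr add0r.
have := zr i; rewrite tnth_mktuple add0r => /andP[z0 z1].
by rewrite ger0_norm// ltW.
Qed.

Lemma dist1_shift x j s : dist1 (Defs.shift x j s) x = `|s|.
Proof.
rewrite /dist1 (bigD1 j)//= tnth_shift eqxx addrAC subrr add0r big1 ?addr0//.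
by move=> i /negbTE ij; rewrite tnth_shift ij addr0 subrr normr0.
Qed.

Lemma dist1_tri x y z : dist1 x z <= dist1 x y + dist1 y z.
Proof.
rewrite /dist1 -big_split/=; apply: ler_sum => i _.
by rewrite -{1}(subrKA (tnth y i)); exact: ler_normD.
Qed.

Lemma avg_lip_close k f K : bdm f -> 0 <= K ->
  (forall x y, `|f x - f y| <= K * dist1 x y) ->
  forall x, `|avg k f x - f x| <= K * (d%:R * rk k).
Proof.
move=> bf K0 fK x; apply: avg_close => // z zk.
by rewrite (le_trans (fK _ _))// ler_wpM2l// dist1_cube.
Qed.

Lemma avg_mod k f (w : R -> R) : bdm f ->
  (forall x y, `|f x - f y| <= w (dist1 x y)) ->
  forall x y, `|avg k f x - avg k f y| <= w (dist1 x y).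
Proof.
move=> bf fw x y; apply: avg_osc => // z _.
by rewrite (le_trans (fw _ _))// dist1_padd.
Qed.

End averages.

Lemma int_mfrestr_sub d (T : measurableType d) (R : realType)
    (mu : {measure set T -> \bar R}) (D C : set T) (mD : measurable D)
    (mC : measurable C) (Doo : (mu D < +oo)%E) (Coo : (mu C < +oo)%E) (f : T -> R) :
  D `<=` C -> measurable_fun setT f ->
  \int[mfrestr mD Doo]_x f x = \int[mfrestr mC Coo]_x (f x * \1_D x).
Proof.
move=> DC mf.
rewrite int_mfrestr// int_mfrestr; last first.
  by apply: measurable_funM => //; exact: measurable_indic.
rewrite [LHS]Rintegral_mkcond [RHS]Rintegral_mkcond; apply: eq_Rintegral => x _.
rewrite !patchE indicE; case: ifPn => xD; case: ifPn => xC; rewrite ?mulr1 ?mulr0//.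
by move: xC; rewrite notin_setE => xC; move: xD; rewrite inE => /DC.
Qed.

(** * Lipschitz bound for averages of bounded functions *)

Section averages_lipschitz.
Context {R : realType} {d : nat}.
Local Notation P := (d.-tuple R).
Variable mu : {measure set P -> \bar R}.
Hypothesis Hmu : is_lebesgue_Rd mu.
Implicit Types (x y z a b : P) (j : 'I_d) (s t : R) (k : nat) (f g : P -> R).
Local Notation torm := (torm Hmu).
Local Notation avg := (avg Hmu).

Let slab j (lo hi : R) (r : R) : set P :=
  box [tuple (if i == j then lo else 0) | i < d]
      [tuple (if i == j then hi else r) | i < d].

Let mu_slab j lo hi r : lo <= hi -> 0 <= r ->
  mu (slab j lo hi r) = ((hi - lo) * r ^+ d.-1)%:E.
Proof.
move=> lohi r0; rewrite mu_box// (bigD1 j)//= !tnth_mktuple eqxx.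
rewrite max_r ?subr_ge0//; congr (_ * _)%:E.
rewrite (eq_bigr (fun=> r)); last first.
  by move=> i /negbTE ij; rewrite !tnth_mktuple ij subr0 max_r.
rewrite prodr_const; congr (_ ^+ _).
by rewrite cardC1 card_ord.
Qed.

(** Two cubes of side [r] translated by [s] along axis [j] differ inside two slabs of volume
    [s r^(d-1)] each; after division by [r^d] this is [2 M s / r]. *)
Lemma avg_bdm_lip k f j (M : R) : bdm f -> (forall y, `|f y| <= M) ->
  forall x s, `|avg k f (Defs.shift x j s) - avg k f x| <= 2 * M * 2 ^+ k * `|s|.
Proof.
move=> bf fM.
have M0 : 0 <= M.
  exact: le_trans (normr_ge0 _) (fM (pcst 0)).
suff H x s : 0 <= s ->
    `|avg k f (Defs.shift x j s) - avg k f x| <= 2 * M * 2 ^+ k * s.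
  move=> x s; have [s0|s0] := leP 0 s; first by rewrite [`|s|]ger0_norm// H.
  rewrite [`|s|]ltr0_norm// -[X in _ - avg _ _ X](pshift0 x j) -(subrr s) -pshiftD distrC.
  by apply: H; rewrite oppr_ge0 ltW.
move=> s0; pose r : R := rk k; have r0 : 0 <= r := rk_ge0 k.
pose g z := f (padd x z); have bg : bdm g by exact: bdm_padd.
have mg : measurable_fun setT g by case: bg.
pose Q : set P := cube (pcst 0) r.
pose Qs : set P := cube (pdelta j s) r.
(* A box containing both cubes: on it the two integrals become integrals against one measure and can
   be subtracted. *)
pose C : set P := slab j 0 (r + s) r.
have mQ : measurable Q := measurable_cube _ _.
have mQs : measurable Qs := measurable_cube _ _.
have mC : measurable C := measurable_box _ _.
have Coo : (mu C < +oo)%E := mu_box_fin Hmu _ _.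
have Qoo : (mu Q < +oo)%E := mu_cube_fin Hmu _ _.
have Qsoo : (mu Qs < +oo)%E := mu_cube_fin Hmu _ _.
have QC : Q `<=` C.
  move=> z Qz i; have := Qz i; rewrite !tnth_mktuple add0r => /andP[h1 h2].
  by case: ifP => _; rewrite h1 ?h2//= (lt_le_trans h2)// lerDl.
have QsC : Qs `<=` C.
  move=> z Qz i; have := Qz i; rewrite !tnth_mktuple.
  case: ifP => _ /andP[h1 h2].
    by rewrite (le_trans s0 h1)/= addrC.
  by rewrite h1/= -[r]add0r.
have E1 : \int[nuk Hmu k]_z f (padd (Defs.shift x j s) z) = \int[mfrestr mQs Qsoo]_z g z.
  rewrite -(@int_comp_eq _ _ _ _ _ (nuk Hmu k) (mfrestr mQs Qsoo)
     (fun z => Defs.shift z j s))//.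
  - apply: eq_Rintegral => z _; rewrite /g; congr f.
    by apply: eq_from_tnth => i; rewrite !(tnth_padd, tnth_shift) addrAC addrA.
  - exact: measurable_shift.
  - move=> A mA; rewrite /= /mfrestr /mrestr.
    rewrite -[RHS](mu_shift Hmu j s (measurableI _ _ mA mQs)).
    congr (mu _); apply/seteqP; split => z /= [Az Qz]; split => // i;
      have := Qz i; rewrite !tnth_shift !tnth_mktuple; case: ifP => _.
    + by rewrite !add0r => /andP[h1 h2]; rewrite lerDr h1/= addrC ltrD2l.
    + by rewrite !add0r addr0.
    + by rewrite lerDr [s + _]addrC ltrD2r add0r.
    + by rewrite !add0r addr0.
have E2 : \int[nuk Hmu k]_z f (padd x z) = \int[mfrestr mQ Qoo]_z g z by [].
rewrite /avg -mulrBr E1 E2 (int_mfrestr_sub mQs mC Qsoo Coo)//.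
rewrite (int_mfrestr_sub mQ mC Qoo Coo)//.
have b1 : bdm (fun z => g z * \1_Qs z) by apply: bdmM => //; exact: bdm_indic.
have b2 : bdm (fun z => g z * \1_Q z) by apply: bdmM => //; exact: bdm_indic.
rewrite -intB// normrM ger0_norm ?avg_fac_ge0//.
(* [E] contains the points of [Q] left behind by the shift, [E'] the newly covered ones. *)
pose E := slab j 0 s r; pose E' := slab j r (r + s) r.
have mE : measurable E := measurable_box _ _.
have mE' : measurable E' := measurable_box _ _.
have bE : bdm (\1_E : P -> R) := bdm_indic R mE.
have bE' : bdm (\1_E' : P -> R) := bdm_indic R mE'.
have I_ind (A : set P) : measurable A -> A `<=` C ->
    \int[mfrestr mC Coo]_z (\1_A z : R) = fine (mu A).
  move=> mA AC; congr fine.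
  rewrite (integral_indic _ measurableT)//= /mfrestr /mrestr setIT.
  by rewrite setIidl.
have leE z : C z -> `|g z * \1_Qs z - g z * \1_Q z| <= M * (\1_E z + \1_E' z).
  move=> Cz; rewrite -mulrBr normrM; apply: ler_pM => //; first exact: fM.
  rewrite !indicE.
  have [zQ|zQ] := boolP (z \in Q); have [zQs|zQs] := boolP (z \in Qs).
  - by rewrite subrr normr0 addr_ge0.
  - rewrite sub0r normrN normr1 (_ : z \in E) ?lerDl//.
    move: zQ zQs; rewrite notin_setE !inE => Qz nQs i.
    have := Qz i; rewrite !tnth_mktuple add0r.
    case: eqP => [->|_] // /andP[h1 h2]; rewrite h1/= ltNge; apply/negP => sz.
    apply: nQs => i'; have := Qz i'; rewrite !tnth_mktuple add0r => /andP[h3 h4].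
    case: eqP => [->|_]; last by rewrite h3 add0r h4.
    by rewrite sz/= (lt_le_trans h2)// lerDr.
  - rewrite subr0 normr1 (_ : z \in E') ?lerDr//.
    move: zQ zQs; rewrite notin_setE !inE => nQ Qsz i.
    have := Qsz i; rewrite !tnth_mktuple.
    case: eqP => [->|_]; last by rewrite add0r.
    move=> /andP[h1 h2]; rewrite [r + s]addrC h2 andbT leNgt; apply/negP => sz.
    apply: nQ => i'; have := Qsz i'; rewrite !tnth_mktuple add0r.
    case: eqP => [->|_]; last by rewrite add0r.
    by move=> /andP[h3 h4]; rewrite sz (le_trans s0 h3).
  - by rewrite subrr normr0 addr_ge0.
have : `|\int[mfrestr mC Coo]_z (g z * \1_Qs z - g z * \1_Q z)| <=
    M * (s * r ^+ d.-1 + s * r ^+ d.-1).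
  rewrite (le_trans (int_norm _ (bdmB b1 b2)))//.
  apply: (@le_trans _ _ (\int[mfrestr mC Coo]_z (M * (\1_E z + \1_E' z)))).
    apply: int_ae_le.
    - exact/bdm_norm/bdmB.
    - exact/bdmZ/bdmD.
    - exists (~` C); split => //; first exact: measurableC.
        by rewrite /= /mfrestr /mrestr setICl measure0.
      by move=> z /=; apply: contra_not; exact: leE.
  rewrite intZ; last exact: bdmD.
  rewrite intD// ler_wpM2l// !I_ind//.
  - rewrite !mu_slab ?lerDl//= subr0 [r + s - r]addrAC subrr add0r//.
  - move=> z Ez i; have := Ez i; rewrite !tnth_mktuple; case: ifP => // _.
    by move=> /andP[h1 ->]; rewrite (le_trans r0 h1).
  - move=> z Ez i; have := Ez i; rewrite !tnth_mktuple; case: ifP => // _.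
    by move=> /andP[-> h1]; rewrite (lt_le_trans h1)// lerDr.
move=> H; rewrite (le_trans (ler_wpM2l (avg_fac_ge0 _) H))//.
have dE : d = d.-1.+1 by rewrite prednK// (leq_ltn_trans (leq0n j)).

have -> : (2 ^+ k) ^+ d = 2 ^+ k * (2 ^+ k) ^+ d.-1 :> R by rewrite -exprS -dE.
rewrite [leLHS](_ : _ = 2 * M * 2 ^+ k * s * ((2 ^+ k) ^+ d.-1 * r ^+ d.-1)); last by ring.
by rewrite -exprMn rkK expr1n mulr1.
Qed.

End averages_lipschitz.

(** * Convergence of averages in L^1 *)

Section averages_converge.
Context {R : realType} {d : nat}.
Local Notation P := (d.-tuple R).
Variable mu : {measure set P -> \bar R}.
Hypothesis Hmu : is_lebesgue_Rd mu.
Implicit Types (x y z a b : P) (j : 'I_d) (s t : R) (k : nat) (f g : P -> R).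
Local Notation torm := (torm Hmu).
Local Notation avg := (avg Hmu).

Definition avg_cvg f := (fun k => \int[torm]_x `|avg k f x - f x|) @ \oo --> 0.

Let bdm_err k f : bdm f -> bdm (fun x => `|avg k f x - f x|).
Proof. by move=> bf; apply/bdm_norm/bdmB => //; exact: bdm_avg. Qed.

(** Averaging is a contraction of L^1: an approximation error [e/3] is paid twice, and the
    convergence for [g] takes the remaining third. *)
Lemma avg_cvg_dense f : bdm f -> per f ->
  (forall e, 0 < e -> exists g, [/\ bdm g, per g, avg_cvg g &
     \int[torm]_x `|f x - g x| <= e]) -> avg_cvg f.
Proof.
move=> bf pf H; apply/cvg0P => e e0.
have e3 : 0 < e / 3 by rewrite divr_gt0.
have [g [bg pg /cvg0P /(_ _ e3) [K HK] fg]] := H _ e3.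
exists K => k Kk; rewrite ger0_norm ?int_ge0//.
have := HK k Kk; rewrite ger0_norm ?int_ge0// => {}HK.
have bfg : bdm (fun x => f x - g x) by exact: bdmB.
have pfg : per (fun x => f x - g x) by move=> x; rewrite pf pg.
apply: (@le_trans _ _ (\int[torm]_x (`|avg k (fun x => f x - g x) x| +
    (`|avg k g x - g x| + `|f x - g x|)))).
  apply: int_le; first exact: bdm_err.
    apply: bdmD; first exact/bdm_norm/bdm_avg.
    by apply: bdmD; [exact: bdm_err|exact: bdm_norm].
  move=> x; rewrite avgB//.
  rewrite [X in `|X| <= _](_ : _ = (avg k f x - avg k g x) + ((avg k g x - g x) - (f x - g x))); last by ring.
  rewrite (le_trans (ler_normD _ _))// lerD2l.
  exact: ler_normB.
rewrite intD; last 2 first.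
- exact/bdm_norm/bdm_avg.
- by apply: bdmD; [exact: bdm_err|exact: bdm_norm].
rewrite intD; [|exact: bdm_err|exact: bdm_norm].
have := int_norm_avg Hmu k bfg pfg; lra.
Qed.

Lemma avg_cvgD f g : bdm f -> bdm g -> avg_cvg f -> avg_cvg g ->
  avg_cvg (fun x => f x + g x).
Proof.
move=> bf bg /cvg0P Hf /cvg0P Hg; apply/cvg0P => e e0.
have e2 : 0 < e / 2 by rewrite divr_gt0.
have [K1 HK1] := Hf _ e2; have [K2 HK2] := Hg _ e2.
exists (maxn K1 K2) => k; rewrite geq_max => /andP[/HK1 k1 /HK2 k2].
move: k1 k2; rewrite !ger0_norm ?int_ge0// => k1 k2.
apply: (@le_trans _ _ (\int[torm]_x (`|avg k f x - f x| + `|avg k g x - g x|))).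
  apply: int_le; [exact/bdm_err/bdmD|apply: bdmD; exact: bdm_err|].
  move=> x; rewrite avgD// (le_trans _ (ler_normD _ _))//.
  by rewrite le_eqVlt; apply/orP; left; apply/eqP; congr (`|_|); ring.
rewrite intD; [lra|exact: bdm_err..].
Qed.

Lemma avg_cvgZ c f : bdm f -> avg_cvg f -> avg_cvg (fun x => c * f x).
Proof.
move=> bf Hf; rewrite /avg_cvg.
rewrite (_ : (fun _ => _) = (fun k => `|c| * \int[torm]_x `|avg k f x - f x|)).
  by rewrite -(mulr0 `|c|); apply: cvgM => //; exact: cvg_cst.
apply/funext => k; rewrite -intZ; last exact: bdm_err.
apply: eq_Rintegral => x _; rewrite /avg intZ; last exact: bdm_padd.
by rewrite mulrCA -mulrBr normrM.
Qed.

Lemma avg_cvg_cst c : avg_cvg (fun=> c).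
Proof.
rewrite /avg_cvg (_ : (fun _ => _) = (fun=> 0)); first exact: cvg_cst.
apply/funext => k; rewrite -[RHS](mul0r (fine (torm setT))) -int_cst.
by apply: eq_Rintegral => x _; rewrite avg_cst subrr normr0.
Qed.

Lemma avg_cvg_sum (I : Type) (r : seq I) (F : I -> P -> R) :
  (forall i, bdm (F i)) -> (forall i, avg_cvg (F i)) ->
  avg_cvg (fun x => \sum_(i <- r) F i x).
Proof.
move=> bF cF; elim: r => [|i r IH].
  by under eq_fun do rewrite big_nil; exact: avg_cvg_cst.
under eq_fun do rewrite big_cons.
by apply: avg_cvgD => //; exact: bdm_sum.
Qed.

Let ind (A : set P) : P -> R := fun x => \1_A (fracP x).

Let bdm_ind A : measurable A -> bdm (ind A).
Proof.
by move=> mA; apply: (bdm_comp measurable_fracP); exact: bdm_indic.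
Qed.

Let per_ind A : per (ind A).
Proof. exact: per_fracP. Qed.

(** Half-open boxes and cubes with lower corner [x] match: at every point of the fundamental cube
    the indicator is constant on the cube of side [2^-k] for large [k], so the averages converge
    pointwise there and dominated convergence applies. *)
Let avg_cvg_box a b : avg_cvg (ind (box a b)).
Proof.
have mB : measurable (box a b) := measurable_box a b.
have bB := bdm_ind mB.
have HU x : unit_cube x -> exists K, forall k, (K <= k)%N -> avg k (ind (box a b)) x = ind (box a b) x.
  move=> Ux.
  suff /choice[K HK] : forall i, exists Ki, forall k, (Ki <= k)%N ->
      forall s, 0 <= s < rk k -> tnth x i + s < 1 /\
      (tnth a i <= tnth x i + s < tnth b i) = (tnth a i <= tnth x i < tnth b i).
    exists (\max_i K i) => k Kk.
    apply/eqP; rewrite -subr_eq0 -normr_le0; apply/avg_close => // z zk.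
    rewrite (_ : ind _ (padd x z) = ind (box a b) x) ?subrr ?normr0//.
    have H i : tnth x i + tnth z i < 1 /\
        (tnth a i <= tnth x i + tnth z i < tnth b i) = (tnth a i <= tnth x i < tnth b i).
      apply: (HK i k); first by rewrite (leq_trans _ Kk)// leq_bigmax.
      by have := zk i; rewrite tnth_mktuple add0r.
    rewrite /ind fracP_id; last first.
      move=> i; rewrite tnth_padd (proj1 (H i)) andbT addr_ge0//.
        by have /andP[] := Ux i.
      by have := zk i; rewrite tnth_mktuple add0r => /andP[].
    rewrite fracP_id// !indicE; congr ((_ : bool)%:R); apply/idP/idP; rewrite !inE => Hb i;
      by have := Hb i; rewrite ?tnth_padd (proj2 (H i)).
  move=> i; have /andP[x0 x1] := Ux i.
  have [K1 HK1] := @rk_small R (1 - tnth x i) ltac:(lra).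
  have [K2 HK2] : exists K2, forall k, (K2 <= k)%N -> forall s, 0 <= s < rk k ->
      (tnth a i <= tnth x i + s) = (tnth a i <= tnth x i).
    have [ax|ax] := leP (tnth a i) (tnth x i).
      by exists 0%N => k _ s /andP[s0 _]; rewrite (le_trans ax)// lerDl.
    have [K2 HK2] := @rk_small R (tnth a i - tnth x i) ltac:(lra).
    exists K2 => k /HK2 Hk s /andP[s0 s1].
    by apply/negbTE; rewrite -ltNge; lra.
  have [K3 HK3] : exists K3, forall k, (K3 <= k)%N -> forall s, 0 <= s < rk k ->
      (tnth x i + s < tnth b i) = (tnth x i < tnth b i).
    have [xb|xb] := ltP (tnth x i) (tnth b i).
      have [K3 HK3] := @rk_small R (tnth b i - tnth x i) ltac:(lra).
      by exists K3 => k /HK3 Hk s /andP[s0 s1]; lra.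
    exists 0%N => k _ s /andP[s0 _].
    by apply/negbTE; rewrite -leNgt (le_trans xb)// lerDl.
  exists (maxn K1 (maxn K2 K3)) => k; rewrite !geq_max => /and3P[k1 k2 k3] s sk.
  rewrite (HK2 _ k2)// (HK3 _ k3)//; split => //.
  by have := HK1 _ k1; case/andP: sk; lra.
rewrite /avg_cvg.
rewrite -[0](mul0r (fine (torm setT))) -int_cst.
have bd1 x : `|ind (box a b) x| <= 1.
  by rewrite /ind indicE; case: (_ \in _); rewrite ?normr1 ?normr0.
apply: (@int_cvg _ _ _ _ _ _ 2).
- by move=> k; case: (bdm_err k bB).
- move=> k x; rewrite normr_id (le_trans (ler_normB _ _))//.
  have := avg_normM Hmu k x bB bd1; have := bd1 x; lra.
- exact: bdm_cst.
- apply: filterS (torm_unit Hmu) => x /HU[K HK].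
  apply: cvg_near_cst; exists K => // k /= Kk.
  by rewrite HK// subrr normr0.
Qed.

Let avg_cvg_ind A : measurable A -> avg_cvg (ind A).
Proof.
rewrite (@measurable_boxes R d).
apply: (@dynkin_induction _ _ boxes (fun A => avg_cvg (ind A))).
- exact: measurable_boxes.
- by move=> _ _ [a [b ->]] [a' [b' ->]]; rewrite boxI; do 2 eexists.
- rewrite (_ : ind setT = fun=> 1); first exact: avg_cvg_cst.
  by apply/funext => x; rewrite /ind indicT.
- by move=> _ [a [b ->]]; exact: avg_cvg_box.
- move=> S mS HS.
  rewrite (_ : ind (~` S) = (fun x => 1 + (-1) * ind S x)).
    apply: avg_cvgD => //.
    - exact: bdm_cst.
    - exact/bdmZ/bdm_ind.
    - exact: avg_cvg_cst.
    - by apply: avg_cvgZ => //; exact: bdm_ind.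
  apply/funext => x; rewrite /ind !indicE in_setC.
  by case: (_ \in _) => /=; rewrite ?mulr1 ?mulr0 ?subrr ?addr0.
- move=> F mF tF HF.
  have mU : measurable (\bigcup_k F k) by exact: bigcup_measurable.
  (* Countable disjoint unions: the finite partial unions converge in L^1 to the whole union by
     dominated convergence. *)
  apply: avg_cvg_dense; [exact: bdm_ind|exact: per_ind|move=> e e0].
  pose g n x := \sum_(i < n) ind (F i) x.
  have bg n : bdm (g n) by apply: bdm_sum => i; exact: bdm_ind.
  have gE x : exists K, forall n, (K <= n)%N -> g n x = ind (\bigcup_k F k) x.
    have [[i0 _ Fi0]|nF] := pselect ((\bigcup_k F k) (fracP x)).
      exists i0.+1 => n i0n; rewrite /ind indicE mem_set; last by exists i0.
      rewrite /g (bigD1 (Ordinal i0n))//= big1 ?addr0.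
        by rewrite /ind indicE mem_set.
      move=> i ii0; rewrite /ind indicE memNset// => Fi.
      move/trivIsetP : tF => /(_ i i0 I I) H.
      have : (F i `&` F i0) (fracP x) by split.
      by rewrite H//; apply: contra ii0 => /eqP ii0; apply/eqP/val_inj.
    exists 0%N => n _; rewrite /ind indicE memNset// /g big1// => i _.
    by rewrite /ind indicE memNset// => Fi; apply: nF; exists i.
  have g1 n x : 0 <= g n x <= 1.
    rewrite /g sumr_ge0/=; last by move=> i _; rewrite /ind indicE.
    have [K HK] := gE x.
    have := HK (maxn n K) (leq_maxr _ _).
    rewrite /g -(big_mkord xpredT (fun i => ind (F i) x)).
    rewrite (big_cat_nat (leq0n n) (leq_maxl n K))/= big_mkord => E.
    apply: (@le_trans _ _ (ind (\bigcup_k F k) x)).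
      by rewrite -E lerDl sumr_ge0// => i _; rewrite /ind indicE.
    by rewrite /ind indicE; case: (_ \in _).
  have i1 x : 0 <= ind (\bigcup_k F k) x <= 1.
    by rewrite /ind indicE; case: (_ \in _); rewrite ?lexx ?ler01.
  have : (fun n => \int[torm]_x `|ind (\bigcup_k F k) x - g n x|) @ \oo --> 0.
    rewrite -[0](mul0r (fine (torm setT))) -int_cst.
    apply: (@int_cvg _ _ _ _ _ _ 1).
    - by move=> n; case: (bdm_norm (bdmB (bdm_ind mU) (bg n))).
    - move=> n x; rewrite normr_id ler_norml.
      by have := g1 n x; have := i1 x => /andP[? ?] /andP[? ?]; apply/andP; split; lra.
    - exact: bdm_cst.
    - apply: aeW => x; have [K HK] := gE x.
      apply: cvg_near_cst; exists K => // n /= Kn.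
      by rewrite HK// subrr normr0.
  move=> /cvg0P /(_ _ e0) [K /(_ _ (leqnn K)) HK].
  exists (g K); split => //.
  - by move=> x; apply: eq_bigr => i _; rewrite per_ind.
  - by apply: avg_cvg_sum => i //; exact: bdm_ind.
  - by move: HK; rewrite ger0_norm ?int_ge0.
Qed.

(** Takes the place of Lebesgue's differentiation theorem. Rounding [f] down to the grid of mesh
    [1/n] based at [-M] gives a finite combination of indicators that is uniformly within [1/n] of
    [f]. *)
Lemma bdm_avg_cvg f : bdm f -> per f -> avg_cvg f.
Proof.
move=> bf pf; have [mf [M fM]] := bf.
have M0 : 0 <= M by exact: le_trans (normr_ge0 _) (fM (pcst 0)).
apply: avg_cvg_dense => // e e0.
pose n := (Num.bound e^-1).+1.
have n0 : 0 < n%:R :> R by rewrite ltr0n.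
have ne : n%:R^-1 <= e.
  rewrite invf_ple ?posrE// ltW// (lt_le_trans (unstable.ltr_bound _))// ler_nat.
  by rewrite /n.
pose h x := n%:R * (f x + M).
have h0 x : 0 <= h x.
  by rewrite mulr_ge0// -lerBlDr sub0r; have := fM x; rewrite ler_norml => /andP[].
have mh : measurable_fun setT h.
  apply: measurable_funM; first exact: measurable_cst.
  by apply: measurable_funD => //; exact: measurable_cst.
pose A m := [set x : P | m%:R <= h x < m.+1%:R].
have mA m : measurable (A m).
  rewrite (_ : A m = h @^-1` `[m%:R, m.+1%:R[%classic).
    by rewrite -[_ @^-1` _]setTI; exact: mh.
  by apply/seteqP; split => x /=; rewrite in_itv.
pose N := Num.bound (n%:R * (M + M)).
pose g x := \sum_(m < N) (m%:R / n%:R) * ind (A m) x + - M.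
have bg : bdm g.
  apply: bdmD; last exact: bdm_cst.
  by apply: bdm_sum => m; apply: bdmZ; exact: bdm_ind.
have gE x : g x = (Num.truncn (h x))%:R / n%:R - M.
  rewrite /g; congr (_ - _).
  have /andP[t1 t2] := truncn_itv (h0 x).
  have tN : (Num.truncn (h x) < N)%N.
    rewrite -(ltr_nat R) (le_lt_trans t1)// (le_lt_trans _ (unstable.ltr_bound _))//.
    by rewrite ler_wpM2l ?ler0n// lerD2r; have := fM x; rewrite ler_norml => /andP[].
  have hfrac : h (fracP x) = h x by rewrite /h pf.
  rewrite (bigD1 (Ordinal tN))//= big1 ?addr0.
    rewrite /ind indicE mem_set ?mulr1//=.
    by rewrite /A /= hfrac t1 t2.
  move=> m mt; rewrite /ind indicE memNset ?mulr0// => -[].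
  rewrite /A /= hfrac => /truncn_def hm; move/eqP : mt; apply; apply/val_inj => /=.
  by rewrite hm.
exists g; split => //.
- by move=> x; rewrite !gE /h pf.
- apply: avg_cvgD.
  + by apply: bdm_sum => m; apply: bdmZ; exact: bdm_ind.
  + exact: bdm_cst.
  + apply: avg_cvg_sum => m; first by apply: bdmZ; exact: bdm_ind.
    by apply: avg_cvgZ; [exact: bdm_ind|exact: avg_cvg_ind].
  + exact: avg_cvg_cst.
- rewrite -[e]mulr1 -(torm1 Hmu) -int_cst.
  apply: int_le; [exact/bdm_norm/bdmB|exact: bdm_cst|move=> x].
  rewrite gE (le_trans _ ne)//.
  have /andP[t1 t2] := truncn_itv (h0 x).
  have -> : f x - ((Num.truncn (h x))%:R / n%:R - M) = (h x - (Num.truncn (h x))%:R) / n%:R.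
    by rewrite /h; field; rewrite lt0r_neq0.
  rewrite normrM [`|n%:R^-1|]ger0_norm ?invr_ge0 ?ler0n// ler_piMl ?invr_ge0 ?ler0n//.
  by rewrite -natr1 in t2; rewrite ger0_norm ?subr_ge0//; lra.
Qed.

End averages_converge.

(** * Smooth periodic functions and weak derivatives *)

Section one_dim_calculus.
Context {R : realType}.
Implicit Types (f g G p : R -> R) (a b c x s t : R).

Lemma is_derive_continuous f x (l : R) : is_derive x 1 f l -> {for x, continuous f}.
Proof.
move=> [df _]; apply: differentiable_continuous.
exact/derivable1_diffP.
Qed.

Lemma is_derive_cast f x (l l' : R) : is_derive x 1 f l -> l = l' -> is_derive x 1 f l'.
Proof. by move=> H <-. Qed.

Lemma is_derive_cstD c f x (l : R) : is_derive x 1 f l ->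
  is_derive x 1 (fun y => c + f y) l.
Proof.
move=> df; apply: (is_derive_cast (is_deriveD (is_derive_cst c x 1) df)).
by rewrite add0r.
Qed.

Lemma is_derive_cstB c x : is_derive x 1 (fun y => c - y) (-1 : R).
Proof. by apply: is_derive_cstD; exact: is_deriveN. Qed.

Lemma is_derive_subr c x : is_derive x 1 (fun y => y - c) (1 : R).
Proof.
rewrite (_ : (fun _ => _) = (fun y => - c + y)); last first.
  by apply/funext => y; rewrite addrC.
by apply: is_derive_cstD; exact: is_derive_id.
Qed.

Lemma bdm_lebesgue_integrable f a b : bdm f ->
  lebesgue_measure.-integrable `[a, b] (EFin \o f).
Proof.
move=> [mf [M fM]]; apply: measurable_bounded_integrable => //.
- exact: leb_itv_fin.
- exact: measurable_funS mf.
- exists M; split; first exact: num_real.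
  by move=> x /ltW Mx z _ /=; exact: le_trans (fM z) Mx.
Qed.

Lemma lebI_cat f a b c : bdm f -> a <= b -> b <= c ->
  \int[lebI a c]_s f s = \int[lebI a b]_s f s + \int[lebI b c]_s f s.
Proof.
move=> bf ab bc; rewrite !int_lebI; [|by case: bf..].
have i1 := bdm_lebesgue_integrable a c bf.
apply/eqP; rewrite addrC -subr_eq; apply/eqP.
rewrite Rintegral_itvB//.
apply: Rintegral_itv_obnd_cbnd.
by apply: integrableS (bdm_lebesgue_integrable b c bf) => //; apply: subset_itv; rewrite bnd_simp.
Qed.

Lemma lebI_pt f a : bdm f -> \int[lebI a a]_s f s = 0.
Proof.
move=> bf; apply/eqP; rewrite -normr_le0.
have [_ [M fM]] := bf.
by have := int_normM (lebI a a) bf fM; rewrite lebI1// subrr mulr0.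
Qed.

Lemma FTC2l g G a b : a <= b -> continuous g ->
  (forall x, is_derive x 1 G (g x)) -> \int[lebI a b]_s g s = G b - G a.
Proof.
move=> ab cg dG; have mg := continuous_measurable_fun cg.
rewrite int_lebI//; move: ab; rewrite le_eqVlt => /predU1P[->|ab].
  by rewrite subrr set_itv1 Rintegral_set1.
rewrite /Rintegral (@continuous_FTC2 _ g G)//.
- exact: continuous_subspaceT.
- split.
  + by move=> x _; case: (dG x).
  + apply: cvg_at_right_filter; exact: is_derive_continuous (dG a).
  + apply: cvg_at_left_filter; exact: is_derive_continuous (dG b).
- by move=> x _; rewrite derive1E; apply: derive_val.
Qed.

Lemma primitive_ex g : bdm g -> continuous g ->
  exists G, forall x, is_derive x 1 G (g x).
Proof.
move=> bg cg.
(* An interval with reversed endpoints is empty, so at most one of the two integrals survives and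
   [G] is the signed integral from 0. *)
pose G x := \int[lebI 0 x]_s g s - \int[lebI x 0]_s g s.
have lebI_gt f a b : bdm f -> b < a -> \int[lebI a b]_s f s = 0.
  move=> bf ba; rewrite int_lebI; last by case: bf.
  by rewrite set_itv_ge ?Rintegral_set0// bnd_simp -ltNge.
have GE a y : a <= y -> a <= 0 -> G y = \int[lebI a y]_s g s - \int[lebI a 0]_s g s.
  move=> ay a0; rewrite /G; have [y0|y0] := leP 0 y.
    rewrite (lebI_cat bg a0 y0) addrAC subrr add0r.
    move: y0; rewrite le_eqVlt => /predU1P[<-|y0]; first by rewrite lebI_pt// subr0.
    by rewrite (lebI_gt _ y 0)// subr0.
  rewrite (lebI_gt g 0 y bg y0) (lebI_cat bg ay (ltW y0)).
  by move: (\int[lebI a y]_s g s) (\int[lebI y 0]_s g s) => v w; ring.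
(* A base point strictly below both 0 and [x]: near [x], [G] is the integral from [a] up to a
   constant. *)
exists G => x; pose a := Num.min x 0 - 1.
have ax : a < x.
  have : Num.min x 0 <= x by rewrite ge_min lexx.
  by move=> ?; rewrite /a; lra.
have a0 : a < 0.
  have : Num.min x 0 <= 0 by rewrite ge_min lexx orbT.
  by move=> ?; rewrite /a; lra.
pose c := \int[lebI a 0]_s g s.
apply: (@near_eq_is_derive _ _ _ (fun y => \int[lebesgue_measure]_(s in `[a, y]) g s - c)).
  have : \forall y \near x, a < y by apply: lt_nbhsr.
  apply: filterS => y ay; rewrite (GE a)// ?ltW//; rewrite /c.
  by rewrite (int_lebI _ y)//; case: bg.
have [] := @continuous_FTC1_closed R g a x (x + 1) _ _ ax (cg x).
- by rewrite ltrDl.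
- exact: bdm_lebesgue_integrable.
move=> dF F'.
have dF' : is_derive x 1 (fun y => \int[lebesgue_measure]_(s in `[a, y]) g s) (g x).
  exact: (DeriveDef dF (etrans (esym (derive1E _ _)) F')).
have := @is_deriveB _ _ _ _ (cst c) x 1 (g x) 0 dF' (is_derive_cst _ _ _).
by rewrite subr0.
Qed.

(** Smoothness as a greatest fixed point: [f] lies in some class of derivable 1-periodic functions
    closed under differentiation. Exhibiting such a class avoids iterated derivatives. *)
Definition smooth_per f := exists K : (R -> R) -> Prop, K f /\
  forall g, K g -> [/\ forall x, g (x + 1) = g x, forall x, derivable g x 1 &
    K (derive1 g)].

Lemma smooth_per_derive1 f : smooth_per f -> smooth_per (derive1 f).
Proof. by move=> [K [Kf HK]]; exists K; split => //; have [] := HK _ Kf. Qed.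

Lemma smooth_per_derivable f x : smooth_per f -> derivable f x 1.
Proof. by move=> [K [Kf HK]]; have [] := HK _ Kf. Qed.

Lemma smooth_per_period f x : smooth_per f -> f (x + 1) = f x.
Proof. by move=> [K [Kf HK]]; have [] := HK _ Kf. Qed.

Lemma smooth_per_continuous f : smooth_per f -> continuous f.
Proof.
move=> sf x; apply: differentiable_continuous; apply/derivable1_diffP.
exact: smooth_per_derivable.
Qed.

Definition arc_cos c s : R := cos (2 * pi * (s - c)).
Definition arc_sin c s : R := sin (2 * pi * (s - c)).
(** Smooth, periodic, and for large [N] close to the indicator of the arc around [c] on which the
    cosine exceeds [k]. *)
Definition arc_bump (N : R) (c k : R) s : R :=
  (1 + expR (- (N * (arc_cos c s - k))))^-1.

Lemma is_derive_arc c s : is_derive s 1 (fun s => 2 * pi * (s - c)) (2 * pi).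
Proof. by apply: is_derive_eq; rewrite subr0 /GRing.scale/= mulr1. Qed.

Lemma is_derive_arc_cos c s : is_derive s 1 (arc_cos c) (- (2 * pi) * arc_sin c s).
Proof.
have := @is_derive1_comp _ cos (fun s => 2 * pi * (s - c)) s _ _
  (is_derive_cos _) (is_derive_arc c s).
by move=> H; apply: (is_derive_cast H); rewrite /arc_sin; ring.
Qed.

Lemma is_derive_arc_sin c s : is_derive s 1 (arc_sin c) (2 * pi * arc_cos c s).
Proof.
have := @is_derive1_comp _ sin (fun s => 2 * pi * (s - c)) s _ _
  (is_derive_sin _) (is_derive_arc c s).
by move=> H; apply: (is_derive_cast H); rewrite /arc_cos; ring.
Qed.

Lemma arc_bump_den N c k s : 0 < 1 + expR (- (N * (arc_cos c s - k))).
Proof. by rewrite addr_gt0// expR_gt0. Qed.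

Lemma is_derive_arc_bump N c k s : is_derive s 1 (arc_bump N c k)
  (arc_bump N c k s * (1 + - 1 * arc_bump N c k s) * (N * (- (2 * pi) * arc_sin c s))).
Proof.
pose E s := expR (- (N * (arc_cos c s - k))).
have dI : is_derive s 1 (fun s => - (N * (arc_cos c s - k))) (- (N * (- (2 * pi) * arc_sin c s))).
  have dc := is_derive_arc_cos c s.
  by apply: is_derive_eq; rewrite subr0.
have dE : is_derive s 1 E (E s * - (N * (- (2 * pi) * arc_sin c s))).
  exact: is_derive1_comp (is_derive_expR _) dI.
have dD : is_derive s 1 (fun s => 1 + E s) (E s * - (N * (- (2 * pi) * arc_sin c s))).
  exact: is_derive_cstD.
have D0 : 1 + E s != 0 by rewrite lt0r_neq0// arc_bump_den.
have dV : is_derive s 1 (arc_bump N c k)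
    (- (1 + E s) ^- 2 * (E s * - (N * (- (2 * pi) * arc_sin c s)))) :=
  @is_deriveV R (fun y => 1 + E y) s _ 1 D0 dD.
apply: (is_derive_cast dV); rewrite /arc_bump -/(E s) /GRing.scale/=.
by field.
Qed.

(** The logistic function satisfies [y' = y (1 - y)], so together with sine, cosine and constants it
    generates an algebra closed under differentiation: the class that [smooth_per] asks for. *)
Inductive bump_alg N c k : (R -> R) -> Prop :=
| bump_alg_cst r : bump_alg N c k (fun=> r)
| bump_alg_cos : bump_alg N c k (arc_cos c)
| bump_alg_sin : bump_alg N c k (arc_sin c)
| bump_alg_bump : bump_alg N c k (arc_bump N c k)
| bump_alg_add f g : bump_alg N c k f -> bump_alg N c k g ->
    bump_alg N c k (fun s => f s + g s)
| bump_alg_mul f g : bump_alg N c k f -> bump_alg N c k g ->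
    bump_alg N c k (fun s => f s * g s).

Lemma bump_alg_derive N c k f : bump_alg N c k f ->
  exists2 f', bump_alg N c k f' & forall s, is_derive s 1 f (f' s).
Proof.
elim => {f} [r||||f g Kf [f' Kf' df] Kg [g' Kg' dg]|f g Kf [f' Kf' df] Kg [g' Kg' dg]].
- by exists (fun=> 0) => [|s]; [exact: bump_alg_cst|exact: is_derive_cst].
- exists (fun s => - (2 * pi) * arc_sin c s); last exact: is_derive_arc_cos.
  by apply: bump_alg_mul; [exact: bump_alg_cst|exact: bump_alg_sin].
- exists (fun s => 2 * pi * arc_cos c s); last exact: is_derive_arc_sin.
  by apply: bump_alg_mul; [exact: bump_alg_cst|exact: bump_alg_cos].
- exists (fun s => arc_bump N c k s * (1 + - 1 * arc_bump N c k s) *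
    (N * (- (2 * pi) * arc_sin c s))); last exact: is_derive_arc_bump.
  by repeat (apply: bump_alg_mul || apply: bump_alg_add || apply: bump_alg_cst ||
     apply: bump_alg_bump || apply: bump_alg_sin).
- by exists (fun s => f' s + g' s) => [|s]; [exact: bump_alg_add|exact: is_deriveD].
- exists (fun s => f s * g' s + g s * f' s) => [|s].
    by apply: bump_alg_add; exact: bump_alg_mul.
  by have := df s; have := dg s => *; exact: is_deriveM.
Qed.

Lemma bump_alg_per N c k f : bump_alg N c k f -> forall s, f (s + 1) = f s.
Proof.
have cper s : arc_cos c (s + 1) = arc_cos c s.
  rewrite /arc_cos -[RHS]cosD2pi; congr cos.
  by rewrite -mulr_natl; ring.
elim => {f} // [s|s|f g _ IHf _ IHg s|f g _ IHf _ IHg s].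
- rewrite /arc_sin -[RHS]sinD2pi; congr sin.
  by rewrite -mulr_natl; ring.
- by rewrite /arc_bump cper.
- by rewrite IHf IHg.
- by rewrite IHf IHg.
Qed.

Lemma arc_bump_smooth N c k : smooth_per (arc_bump N c k).
Proof.
exists (bump_alg N c k); split; first exact: bump_alg_bump.
move=> g Kg; have [g' Kg' dg] := bump_alg_derive Kg; split.
- exact: bump_alg_per Kg.
- by move=> x; case: (dg x).
- rewrite (_ : derive1 g = g')//; apply/funext => x.
  by rewrite derive1E; apply: derive_val.
Qed.

Lemma arc_bump_bound N c k s : `|arc_bump N c k s| <= 1.
Proof.
rewrite ger0_norm; last by rewrite invr_ge0; exact/ltW/arc_bump_den.
by rewrite /arc_bump invf_le1 ?arc_bump_den// lerDl expR_ge0.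
Qed.

Lemma bdm_smooth_per f : smooth_per f -> (exists M, forall s, `|f s| <= M) -> bdm f.
Proof.
move=> sf fM; split => //.
exact: continuous_measurable_fun (smooth_per_continuous sf).
Qed.

Lemma bdm_arc_bump N c k : bdm (arc_bump N c k).
Proof.
apply: bdm_smooth_per; first exact: arc_bump_smooth.
by exists 1 => s; exact: arc_bump_bound.
Qed.

Lemma smooth_per_shift p h : smooth_per p -> smooth_per (fun s => p (s - h)).
Proof.
move=> [K [Kp HK]].
exists (fun g => exists2 g0, K g0 & g = (fun s => g0 (s - h))); split; first by exists p.
move=> _ [g Kg ->]; have [pg dg Kg'] := HK g Kg.
have D x : is_derive x 1 (fun s => g (s - h)) (derive1 g (x - h)).
  have dg' : is_derive (x - h) 1 g (derive1 g (x - h)).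
    by apply: DeriveDef => //; rewrite -derive1E.
  have := is_derive1_comp (g := fun s => s - h) dg' (is_derive_subr h x).
  by rewrite mulr1.
split.
- by move=> x; rewrite addrAC pg.
- by move=> x; case: (D x).
- exists (derive1 g) => //; apply/funext => x.
  by rewrite derive1E; apply: derive_val.
Qed.

Lemma smooth_perB f g : smooth_per f -> smooth_per g -> smooth_per (fun s => f s - g s).
Proof.
move=> [K [Kf HK]] [L [Lg HL]].
exists (fun h => exists f0 g0, [/\ K f0, L g0 & h = (fun s => f0 s - g0 s)]).
split; first by exists f, g.
move=> _ [f0 [g0 [Kf0 Lg0 ->]]].
have [pf df Kf'] := HK _ Kf0; have [pg dg Lg'] := HL _ Lg0.
have D x : is_derive x 1 (fun s => f0 s - g0 s) (derive1 f0 x - derive1 g0 x).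
  by apply: is_deriveB; (apply: DeriveDef; [|by rewrite derive1E]).
split.
- by move=> x; rewrite pf pg.
- by move=> x; case: (D x).
- exists (derive1 f0), (derive1 g0); split => //; apply/funext => x.
  by rewrite derive1E; apply: derive_val.
Qed.

(** A moving window integral is again a smooth periodic function, and its derivative is a difference
    of translates. Fed into a weak derivative, it produces the increments demanded by [ipart]. *)
Lemma arc_window p h : smooth_per p -> bdm p -> 0 <= h ->
  smooth_per (fun s => \int[lebI 0 h]_t p (s - t)) /\
  derive1 (fun s => \int[lebI 0 h]_t p (s - t)) = (fun s => p s - p (s - h)).
Proof.
move=> sp bp h0.
have cp := smooth_per_continuous sp.
have [G dG] := primitive_ex bp cp.
have qE s : \int[lebI 0 h]_t p (s - t) = G s - G (s - h).
  have -> : G s - G (s - h) = - G (s - h) - - G (s - 0).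
    by rewrite subr0 opprK addrC.
  apply: (@FTC2l _ (fun t => - G (s - t))) => //.
    move=> t; apply: (@continuous_comp _ _ _ (fun t => s - t) p); last exact: cp.
    by apply: cvgB; [exact: cvg_cst|exact: cvg_id].
  move=> t.
  have := is_derive1_comp (g := fun t => s - t) (dG (s - t)) (_ : is_derive t 1 (fun t => s - t) (-1)).
  move=> /(_ (is_derive_cstB s t)) H.
  by apply: (is_derive_cast (is_deriveN H)); rewrite mulrN1 opprK.
have D s : is_derive s 1 (fun s => \int[lebI 0 h]_t p (s - t)) (p s - p (s - h)).
  rewrite (_ : (fun s => _) = (fun s => G s - G (s - h))); last by apply/funext.
  apply: is_deriveB.
  have := is_derive1_comp (g := fun s => s - h) (dG (s - h)) (is_derive_subr h s).
  by rewrite mulr1.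
have Dq : derive1 (fun s => \int[lebI 0 h]_t p (s - t)) = (fun s => p s - p (s - h)).
  by apply/funext => s; rewrite derive1E; apply: derive_val.
split => //.
have sq : smooth_per (fun s => p s - p (s - h)).
  by apply: smooth_perB => //; exact: smooth_per_shift.
have [K [Kq HK]] := sq.
exists (fun g => K g \/ g = (fun s => \int[lebI 0 h]_t p (s - t))); split; first by right.
move=> g [Kg|->]; first by have [? ? ?] := HK _ Kg; split => //; left.
split.
- move=> x; apply: eq_Rintegral => t _.
  by rewrite addrAC smooth_per_period.
- by move=> x; case: (D x).
- by left; rewrite Dq.
Qed.

(** At the endpoints of the arc every bump has the value of the logistic function at 0, hence [1/2]
    in the limit. *)
Definition arc_lim (c k : R) s : R :=
  if arc_cos c s > k then 1 else if arc_cos c s == k then 2^-1 else 0.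

Lemma arc_bump_cvg c k s : (fun n : nat => arc_bump n%:R c k s) @ \oo --> arc_lim c k s.
Proof.
(* By [1 + x <= exp x] the distance to the limit is at most [1 / (1 + n e0)], where [e0] is the gap
   between the cosine and the threshold. *)
have H (e0 : R) : 0 < e0 -> forall u : nat -> R,
    (forall n, `|u n| <= (1 + n%:R * e0)^-1) -> u @ \oo --> 0.
  move=> e00 u Hu; apply/cvg0P => e e_gt0.
  exists (Num.bound (e * e0)^-1) => n Kn; rewrite (le_trans (Hu n))//.
  have ne : (e * e0)^-1 <= n%:R.
    by rewrite ltW// (lt_le_trans (unstable.ltr_bound _))// ler_nat.
  have n0 : 0 < 1 + n%:R * e0 by rewrite ltr_pwDl// mulr_ge0// ltW.
  rewrite invf_ple ?posrE//.
  move: ne; rewrite invfM -ler_pdivlMr ?invr_gt0// invrK => ne.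
  by rewrite (le_trans ne)// lerDr.
rewrite /arc_lim; case: (ltgtP k (arc_cos c s)) => [ck|ck|ck].
- have e0 : 0 < arc_cos c s - k by rewrite subr_gt0.
  have : (fun n : nat => arc_bump n%:R c k s - 1) @ \oo --> 0.
    apply: (H _ e0) => n; rewrite /arc_bump; set E := expR _.
    have E0 : 0 < E := expR_gt0 _.
    have -> : (1 + E)^-1 - 1 = - (E / (1 + E)) by field; lra.
    have E1 : 0 < 1 + E by lra.
    rewrite normrN ger0_norm; last by apply: divr_ge0; lra.
    apply: (@le_trans _ _ E).
      by rewrite ler_pdivrMr//; nra.
    have n0 : 0 <= n%:R * (arc_cos c s - k) by rewrite mulr_ge0// ltW.
    by rewrite /E expRN lef_pV2 ?posrE ?expR_gt0 ?ltr_pwDl// expR_ge1Dx.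
  by move/subr_cvg0.
- have e0 : 0 < k - arc_cos c s by rewrite subr_gt0.
  apply: (H _ e0) => n; rewrite /arc_bump -mulrN opprB.
  have n0 : 0 <= n%:R * (k - arc_cos c s) by rewrite mulr_ge0// ltW.
  set E := expR _; have E0 : 0 < E := expR_gt0 _.
  rewrite ger0_norm; last by rewrite invr_ge0; lra.
  rewrite lef_pV2 ?posrE; [|lra|lra].
  by rewrite (le_trans (expR_ge1Dx _))// lerDr.
- rewrite (_ : (fun n : nat => _) = fun=> 2^-1); first exact: cvg_cst.
  by apply/funext => n; rewrite /arc_bump ck subrr mulr0 oppr0 expR0.
Qed.

(** With centre [a + r/2] the cosine exceeds [cos (pi r)] exactly at circle distance below [r/2],
    that is on the arc from [a] to [a + r]; the endpoints are excluded. *)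
Lemma arc_lim_in a (r : R) s : 0 < r <= 1 ->
  let u := (s - a) - (Num.floor (s - a))%:~R in
  (u != 0) -> (u != r) ->
  arc_lim (a + r / 2) (cos (pi * r)) s = (u < r)%R%:R.
Proof.
move=> /andP[r0 r1] u u0 ur.
have /andP[ug0 u1] : 0 <= u < 1 := frac_itv (s - a).
have {u0} {}ug0 : 0 < u by rewrite lt_neqAle eq_sym u0.
have pi0 : 0 < pi :> R := pi_gt0 R.
have cE : arc_cos (a + r / 2) s = cos (2 * pi * u - pi * r).
  have cosDn (y : R) (n : nat) : cos (y + (2 * pi) * n%:R) = cos y.
    elim: n y => [|n IH] y; first by rewrite mulr0 addr0.
    rewrite -[n.+1%:R]natr1 mulrDr mulr1 addrA -[RHS]IH -[RHS]cosD2pi.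
    by rewrite -[pi *+ 2]mulr_natl.
  have cosDz (y : R) (n : int) : cos (y + (2 * pi) * n%:~R) = cos y.
    case: n => n; first exact: cosDn.
    rewrite NegzE mulrNz -[LHS](cosDn _ n.+1); congr cos.
    by rewrite -addrA -mulrDr addNr mulr0 addr0.
  rewrite /arc_cos /u -[RHS](cosDz _ (Num.floor (s - a))).
  by congr cos; field.
rewrite /arc_lim cE.
have prI : pi * r \in `[0, pi] by rewrite in_itv/=; apply/andP; split; nra.
have pir0 : 0 < pi * r by rewrite mulr_gt0.
have piu : 0 < pi * u by rewrite mulr_gt0.
have piu1 : pi * u < pi by rewrite -[ltRHS]mulr1 ltr_pM2l.
(* The angle [2 pi u - pi r] lies between [- pi r] and [2 pi - pi r]; evenness and periodicity bring
   it into [[0, pi]], where the cosine decreases. *)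
case: (ltgtP u r) ur => // ur _.
  have pur : pi * u < pi * r by rewrite ltr_pM2l.
  suff -> : cos (pi * r) < cos (2 * pi * u - pi * r) by [].
  have prI2 : 0 <= pi * r <= pi by move: prI; rewrite in_itv.
  have [h|h] := leP 0 (2 * pi * u - pi * r).
    by rewrite ltr_cos// ?in_itv/=; lra.
  by rewrite -[ltRHS]cosN ltr_cos// ?in_itv/=; lra.
have pur : pi * r < pi * u by rewrite ltr_pM2l.
suff H : cos (2 * pi * u - pi * r) < cos (pi * r).
  by rewrite ltNge (ltW H)/= lt_eqF.
have [h|h] := leP (2 * pi * u - pi * r) pi.
  by rewrite ltr_cos// ?in_itv/=; lra.
rewrite -[cos (_ - _)]cosN -cosD2pi -mulr_natl ltr_cos// ?in_itv/=; lra.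
Qed.

End one_dim_calculus.

(** * Integrable, possibly unbounded functions *)

Section integrable_tools.
Context d1 d2 (Y : measurableType d1) (Z : measurableType d2) (R : realType).
Variables (m1 : {finite_measure set Y -> \bar R}) (m2 : {finite_measure set Z -> \bar R}).

(** Weak gradients in BMO need not be bounded; they stay in this larger class until they are
    averaged. *)
Definition intgr d (T : measurableType d) (m : {measure set T -> \bar R}) (f : T -> R) :=
  m.-integrable setT (EFin \o f).

Lemma intgr_measurable d (T : measurableType d) (m : {measure set T -> \bar R}) (f : T -> R) :
  intgr m f -> measurable_fun setT f.
Proof. by move=> /integrableP[/measurable_EFinP]. Qed.

Lemma intgr_le d (T : measurableType d) (m : {measure set T -> \bar R}) (f g : T -> R) :
  measurable_fun setT f -> intgr m g -> (forall x, `|f x| <= `|g x|) -> intgr m f.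
Proof.
move=> mf ig fg; apply: le_integrable ig => //; first exact/measurable_EFinP.
by move=> x _ /=; rewrite lee_fin.
Qed.

Lemma intgrM_bdm d (T : measurableType d) (m : {measure set T -> \bar R}) (f g : T -> R) :
  intgr m f -> bdm g -> intgr m (fun x => f x * g x).
Proof.
move=> intf [mg [M gM]].
have iM : intgr m (fun x => f x * M).
  rewrite /intgr (_ : _ \o _ = (fun x => (EFin \o f) x * M%:E)%E)//.
  exact: integrableZr.
apply: intgr_le iM _; first exact: measurable_funM (intgr_measurable intf) mg.
move=> x; rewrite !normrM ler_wpM2l// (le_trans (gM x))//.
exact: ler_norm.
Qed.

Lemma int_cvg_dom (F : Z -> R) (p_ : nat -> Z -> R) p (M : R) :
  intgr m2 F -> (forall n, measurable_fun setT (p_ n)) ->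
  (forall n x, `|p_ n x| <= M) -> bdm p -> (forall x, p_ ^~ x @ \oo --> p x) ->
  (fun n => \int[m2]_x (F x * p_ n x)) @ \oo --> \int[m2]_x (F x * p x).
Proof.
move=> iF mp pM bp cp; have mF := intgr_measurable iF.
have M0 : 0 <= M by exact: le_trans (normr_ge0 _) (pM 0%N point).
have iFp : intgr m2 (fun x => F x * p x) by exact: intgrM_bdm.
have H : (fun n => \int[m2]_x (F x * p_ n x)%:E)%E @ \oo --> (\int[m2]_x (F x * p x)%:E)%E.
  have c1 n : measurable_fun setT (EFin \o (fun x => F x * p_ n x)).
    by apply/measurable_EFinP; exact: measurable_funM.
  have c2 : measurable_fun setT (EFin \o (fun x => F x * p x)).
    by apply/measurable_EFinP; apply: measurable_funM => //; case: bp.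
  have c3 : {ae m2, forall x, setT x ->
      (EFin \o (fun x => F x * p_ n x)) x @[n --> \oo] --> (EFin \o (fun x => F x * p x)) x}.
    apply: aeW => x _; apply: cvg_EFin; first exact: nearW.
    by apply: cvgM => //; exact: cvg_cst.
  have c4 : m2.-integrable setT (EFin \o (fun x => `|F x * M|)).
    by apply: integrable_norm; apply: (intgrM_bdm iF (g := fun=> M)); exact: bdm_cst.
  have c5 : {ae m2, forall x n, setT x ->
      (`|(F x * p_ n x)%R%:E| <= (`|F x * M|%R)%:E)%E}.
    apply: aeW => x n _; rewrite lee_fin !normrM ler_wpM2l//.
    by rewrite [leRHS]ger0_norm.
  by have [] := dominated_convergence measurableT c1 c2 c3 c4 c5.
by apply: fine_cvg; rewrite fineK//; apply: integrable_fin_num.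
Qed.

Lemma intgr_snd (F : Z -> R) : intgr m2 F -> intgr (m1 \x m2)%E (fun q => F q.2).
Proof.
move=> iF; have mF := intgr_measurable iF.
apply/integrable12ltyP; first by apply/measurable_EFinP; exact: measurableT_comp.
rewrite /= integral_cst//.
move/integrableP : (iF) => [_ /=]; set J := (\int[m2]_x _)%E => Joo.
have J0 : (0 <= J)%E by apply: integral_ge0.
rewrite -ge0_fin_numE ?mule_ge0//.
by rewrite fin_numM// ?ge0_fin_numE//; rewrite -ge0_fin_numE//; exact: fin_num_measure.
Qed.

Lemma int_fubini_intgr (f : Y * Z -> R) : intgr (m1 \x m2)%E f ->
  (forall y, intgr m2 (fun z => f (y, z))) -> (forall z, intgr m1 (fun y => f (y, z))) ->
  \int[m1]_y \int[m2]_z f (y, z) = \int[m2]_z \int[m1]_y f (y, z).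
Proof.
move=> i12 i2 i1; congr fine.
transitivity (\int[m1]_y \int[m2]_z (f (y, z))%:E)%E.
  by apply: eq_integral => y _; rewrite fineK//; apply: integrable_fin_num => //; exact: i2.
rewrite (Fubini i12); apply: eq_integral => z _; rewrite fineK//.
by apply: integrable_fin_num => //; exact: i1.
Qed.

Lemma int_comp_intgr (T : Y -> Z) : measurable_fun setT T ->
  (forall A, measurable A -> m1 (T @^-1` A) = m2 A) ->
  forall f : Z -> R, intgr m2 f ->
  intgr m1 (fun y => f (T y)) /\ \int[m1]_x f (T x) = \int[m2]_y f y.
Proof.
move=> mT mm f intf; have mf := intgr_measurable intf.
have mF : measurable_fun setT (EFin \o f) by exact/measurable_EFinP.
have iT : intgr m1 (fun y => f (T y)).
  apply/integrableP; split.
    by apply/measurable_EFinP; exact: (measurableT_comp mf mT).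
  have := @ge0_integral_pushforward _ _ _ _ _ T mT m1 setT (fun y => `|(f y)%:E|)%E.
  move=> /= <-//; last first.
    by apply/measurable_EFinP; exact: measurableT_comp.
  rewrite (eq_measure_integral m2); first by case/integrableP : intf.
  by move=> A mA _; exact: mm.
split => //; congr fine.
have := @integral_pushforward _ _ _ _ _ T mT m1 setT (EFin \o f) mF.
move=> <-//.
by apply: eq_measure_integral => A mA _; exact: mm.
Qed.

End integrable_tools.

(** * Products of one-variable functions as test functions *)

Section product_test_functions.
Context {R : realType} {d : nat}.
Local Notation P := (d.-tuple R).
Implicit Types (x y z a b : P) (j : 'I_d) (s t : R) (F : 'I_d -> R -> R).

Definition pr F x : R := \prod_(i < d) F i (tnth x i).

Lemma pr_shift F x j s : pr F (Defs.shift x j s) =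
  F j (tnth x j + s) * \prod_(i < d | i != j) F i (tnth x i).
Proof.
rewrite /pr (bigD1 j)//= tnth_shift eqxx; congr (_ * _).
by apply: eq_bigr => i /negbTE ij; rewrite tnth_shift ij addr0.
Qed.

Definition pr_der F j : 'I_d -> R -> R := fun i => if i == j then derive1 (F i) else F i.

Lemma is_derive_pr F x j t : (forall i s, derivable (F i) s 1) ->
  is_derive t 1 (fun s => pr F (Defs.shift x j s)) (pr (pr_der F j) (Defs.shift x j t)).
Proof.
move=> dF; rewrite (_ : (fun _ => _) =
    (fun s => (\prod_(i < d | i != j) F i (tnth x i)) * F j (tnth x j + s))); last first.
  by apply/funext => s; rewrite pr_shift mulrC.
have dFj : is_derive (tnth x j + t) 1 (F j) (derive1 (F j) (tnth x j + t)).
  by apply: DeriveDef; [exact: dF|rewrite derive1E].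
have dj := is_derive1_comp (g := fun s => tnth x j + s) dFj
  (is_derive_cstD (tnth x j) (is_derive_id t 1)).
apply: (is_derive_cast (is_deriveZ (\prod_(i < d | i != j) F i (tnth x i)) dj)).
rewrite pr_shift /pr_der eqxx mulr1 mulrC; congr (_ * _).
by apply: eq_bigr => i /negbTE ->.
Qed.

Lemma partial_pr F j : (forall i s, derivable (F i) s 1) ->
  Defs.partial j (pr F) = pr (pr_der F j).
Proof.
move=> dF; apply/funext => x; rewrite /Defs.partial derive1E.
have D := is_derive_pr x j 0 dF.
by case: D => _ ->; rewrite pshift0.
Qed.

Lemma continuousP_coord (f : R -> R) j : continuous f ->
  Defs.continuousP (fun x : P => f (tnth x j)).
Proof.
move=> cf x e e0.
have /cvgrPdist_lt /(_ e e0) [del /= del0 H] := cf (tnth x j).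
exists del => // y xy; rewrite distrC; apply: H.
by rewrite /ball_/= distrC.
Qed.

Lemma continuousPM (f g : P -> R) : Defs.continuousP f -> Defs.continuousP g ->
  Defs.continuousP (fun x => f x * g x).
Proof.
move=> cf cg x e e0.
pose M := `|f x| + `|g x| + 1.
have M1 : 1 <= M by rewrite /M lerDr addr_ge0.
have M0 : 0 < M by rewrite (lt_le_trans ltr01).
pose e' := Num.min 1 (e / (2 * M)).
have e'0 : 0 < e' by rewrite lt_min ltr01/= divr_gt0// mulr_gt0.
have e'1 : e' <= 1 by rewrite ge_min lexx.
have e'e : e' * (2 * M) <= e.
  by rewrite -ler_pdivlMr ?mulr_gt0// ge_min lexx orbT.
have [d1 d10 H1] := cf x e' e'0; have [d2 d20 H2] := cg x e' e'0.
exists (Num.min d1 d2); first by rewrite lt_min d10.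
move=> y xy.
have {}H1 : `|f y - f x| < e'.
  by apply: H1 => i; rewrite (lt_le_trans (xy i))// ge_min lexx.
have {}H2 : `|g y - g x| < e'.
  by apply: H2 => i; rewrite (lt_le_trans (xy i))// ge_min lexx orbT.
rewrite (_ : _ - _ = (f y - f x) * (g y - g x) + f x * (g y - g x) + (f y - f x) * g x); last by ring.
apply: (@le_lt_trans _ _ (`|f y - f x| * `|g y - g x| + `|f x| * `|g y - g x| + `|f y - f x| * `|g x|)).
  by rewrite (le_trans (ler_normD _ _))// ?normrM lerD2r (le_trans (ler_normD _ _))// !normrM.
have f0 := normr_ge0 (f x); have g0 := normr_ge0 (g x).
have a0 := normr_ge0 (f y - f x); have b0 := normr_ge0 (g y - g x).
rewrite (lt_le_trans _ e'e)//.
have h1 : `|f y - f x| * `|g y - g x| <= 1 * e' by rewrite ler_pM// ltW// (lt_le_trans H1).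
have h2 : `|f x| * `|g y - g x| <= `|f x| * e' by rewrite ler_wpM2l// ltW.
have h3 : `|f y - f x| * `|g x| <= e' * `|g x| by rewrite ler_wpM2r// ltW.
have : 0 < e' * M by rewrite mulr_gt0.
rewrite /M; nra.
Qed.

Lemma continuousP_pr F : (forall i, continuous (F i)) -> Defs.continuousP (pr F).
Proof.
move=> cF; rewrite /pr.
elim: (index_enum _) => [|i r IH].
  move=> x e e0; exists 1 => // y _.
  by rewrite !big_nil subrr normr0.
rewrite (_ : (fun _ => _) = fun x => F i (tnth x i) * \prod_(k <- r) F k (tnth x k)).
  by apply: continuousPM => //; exact: continuousP_coord.
by apply/funext => x; rewrite big_cons.
Qed.

(** Products of smooth periodic factors are stable under partial derivatives, so the infinitely many
    conditions of [test_fun] reduce to the continuity and derivability of one product. *)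
Lemma iter_partial_pr F js : (forall i, smooth_per (F i)) ->
  exists2 G, (forall i, smooth_per (G i)) & Defs.iter_partial js (pr F) = pr G.
Proof.
move=> sF; elim: js => [|j js [G sG IH]]; first by exists F.
exists (pr_der G j).
  by move=> i; rewrite /pr_der; case: ifP => // _; exact: smooth_per_derive1.
rewrite /= IH partial_pr// => i s; exact: smooth_per_derivable.
Qed.

Lemma test_fun_pr F : (forall i, smooth_per (F i)) -> test_fun (pr F).
Proof.
move=> sF; split.
  move=> x j; apply: eq_bigr => i _; rewrite tnth_shift.
  by case: ifP => _; rewrite ?addr0// smooth_per_period.
move=> js; have [G sG ->] := iter_partial_pr js sF; split.
  by apply: continuousP_pr => i; exact: smooth_per_continuous.
move=> x j; have := is_derive_pr x j 0 (fun i s => @smooth_per_derivable R (G i) s (sG i)).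
by case.
Qed.

Lemma pr_bound F x M : 0 <= M -> (forall i s, `|F i s| <= M) -> `|pr F x| <= M ^+ d.
Proof.
move=> M0 FM; rewrite /pr normr_prod -[d in _ ^+ d](card_ord d) -prodr_const.
by apply: ler_prod => i _; rewrite normr_ge0 FM.
Qed.

Lemma measurable_pr F : (forall i, measurable_fun setT (F i)) -> measurable_fun setT (pr F).
Proof.
move=> mF; apply: measurable_prod => i _.
by apply: (measurableT_comp (mF i)); exact: measurable_tnth.
Qed.

End product_test_functions.

Lemma smooth_per_bounded {R : realType} (f : R -> R) : smooth_per f ->
  exists M : R, forall s, `|f s| <= M.
Proof.
move=> sf; have cf := smooth_per_continuous sf.
have pn (n : nat) x : f (x + n%:R) = f x.
  by elim: n x => [|n IH] x; rewrite ?addr0// -[in LHS]natr1 addrA smooth_per_period.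
have pz (z : int) x : f (x + z%:~R) = f x.
  case: z => n; first exact: pn.
  by rewrite NegzE mulrNz -[in RHS](subrK n.+1%:R x) pn.
have cn : {within `[0, 1], continuous (fun s => `|f s|)}.
  apply: continuous_subspaceT => x.
  by apply: (continuous_comp (g := fun y : R => `|y|)); [exact: cf|exact: norm_continuous].
have [c _ Hc] := EVT_max ler01 cn.
exists `|f c| => s; rewrite -(subrK (Num.floor s)%:~R s) pz; apply: Hc.
by rewrite in_itv/=; have /andP[-> /ltW ->] := frac_itv s.
Qed.

Lemma intgr_sum {R : realType} d (T : measurableType d) (m : {measure set T -> \bar R})
  (I : finType) (f : I -> T -> R) : (forall i, intgr m (f i)) ->
  \int[m]_x (\sum_i f i x) = \sum_i \int[m]_x f i x.
Proof.
move=> fi; suff [] : intgr m (fun x => \sum_i f i x) /\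
  \int[m]_x (\sum_i f i x) = \sum_i \int[m]_x f i x by [].
elim: (index_enum I) => [|i s [IH1 IH2]].
  split; first by rewrite /intgr; under eq_fun do rewrite /= big_nil; exact: integrable0.
  by under eq_Rintegral do rewrite big_nil; rewrite big_nil /Rintegral integral0.
split.
  rewrite /intgr (_ : EFin \o _ =
      ((EFin \o f i) \+ (EFin \o (fun x => (\sum_(i <- s) f i x)%R)))%E); last first.
    by apply/funext => x /=; rewrite big_cons.
  by apply: integrableD => //; exact: fi.
under eq_Rintegral do rewrite big_cons.
by rewrite big_cons RintegralD// ?IH2//; exact: fi.
Qed.

(** * From weak derivatives to derivatives of averages *)

Section weak_derivatives.
Context {R : realType} {d : nat}.
Local Notation P := (d.-tuple R).
Variable mu : {measure set P -> \bar R}.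
Hypothesis Hmu : is_lebesgue_Rd mu.
Implicit Types (x y z a b : P) (j : 'I_d) (s t : R) (k : nat) (F W : P -> R).
Local Notation torm := (torm Hmu).
Local Notation avg := (avg Hmu).

(* [chi a r] is the indicator of the torus cube with corner [a] and side [r].
   Up to its boundary it is the limit of the smooth periodic products [chib n a r],
   whose factors are logistic functions of [n * (cos (2 pi (s - c)) - cos (pi r))];
   this replaces mollifiers as a source of test functions. *)
Definition chi a (r : R) x : R :=
  \prod_(i < d) (tnth (fracP (padd x (map_tuple -%R a))) i < r)%R%:R.

Definition chil a (r : R) x : R :=
  pr (fun i => arc_lim (tnth a i + r / 2) (cos (pi * r))) x.

Definition chib n a (r : R) x : R :=
  pr (fun i => arc_bump n%:R (tnth a i + r / 2) (cos (pi * r))) x.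

Lemma arc_limB (c k s : R) : arc_lim c k s = arc_lim 0 k (s - c).
Proof. by rewrite /arc_lim /arc_cos subr0. Qed.

Lemma arc_lim_bound (c k s : R) : `|arc_lim c k s| <= 1.
Proof.
rewrite /arc_lim; case: ifP => _; first by rewrite normr1.
case: ifP => _; last by rewrite normr0.
by rewrite ger0_norm ?invr_ge0// invf_le1 ?ler1n.
Qed.

Lemma measurable_arc_lim (c k : R) : measurable_fun setT (arc_lim c k).
Proof.
apply: (measurable_fun_cvg (h := fun n : nat => arc_bump n%:R c k)).
  by move=> n; case: (bdm_arc_bump n%:R c k).
by move=> s _; exact: arc_bump_cvg.
Qed.

Lemma chil_bound a r x : `|chil a r x| <= 1.
Proof. by rewrite -[leRHS](expr1n _ d); apply: pr_bound => // i s; exact: arc_lim_bound. Qed.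

Lemma bdm_chil a r : bdm (chil a r).
Proof.
split; last by exists 1; exact: chil_bound.
by apply: measurable_pr => i; exact: measurable_arc_lim.
Qed.

Lemma chib_bound n a r x : `|chib n a r x| <= 1.
Proof. by rewrite -[leRHS](expr1n _ d); apply: pr_bound => // i s; exact: arc_bump_bound. Qed.

Lemma bdm_chib n a r : bdm (chib n a r).
Proof.
split; last by exists 1; exact: chib_bound.
by apply: measurable_pr => i; case: (bdm_arc_bump n%:R (tnth a i + r / 2) (cos (pi * r))).
Qed.

Lemma cvg_prod_fin (I : Type) (r : seq I) (u_ : I -> nat -> R) (u : I -> R) :
  (forall i, u_ i @ \oo --> u i) ->
  (fun n => \prod_(i <- r) u_ i n) @ \oo --> \prod_(i <- r) u i.
Proof.
move=> H; elim: r => [|i r IH].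
  by rewrite big_nil; under eq_fun do rewrite big_nil; exact: cvg_cst.
by rewrite big_cons; under eq_fun do rewrite big_cons; exact: cvgM.
Qed.

Lemma cvg_sum_fin (I : Type) (r : seq I) (u_ : I -> nat -> R) (u : I -> R) :
  (forall i, u_ i @ \oo --> u i) ->
  (fun n => \sum_(i <- r) u_ i n) @ \oo --> \sum_(i <- r) u i.
Proof.
move=> H; elim: r => [|i r IH].
  by rewrite big_nil; under eq_fun do rewrite big_nil; exact: cvg_cst.
by rewrite big_cons; under eq_fun do rewrite big_cons; exact: cvgD.
Qed.

Lemma chib_cvg a r x : (fun n => chib n a r x) @ \oo --> chil a r x.
Proof. by apply: cvg_prod_fin => i; exact: arc_bump_cvg. Qed.

Lemma mu_hyperplane j (c : R) : mu (unit_cube `&` [set x | tnth x j = c]) = 0%E.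
Proof.
have mc : measurable [set x : P | tnth x j = c].
  rewrite (_ : [set _ | _] = (fun x => tnth x j) @^-1` [set c])//.
  by rewrite -[_ @^-1` _]setTI; exact: measurable_tnth.
have mU := @measurable_unit_cube R d.
apply/eqP; rewrite eq_le measure_ge0 andbT.
apply/lee_addgt0Pr => e e0; rewrite add0e.
pose lo : P := [tuple if i == j then c else 0 | i < d].
pose hi : P := [tuple if i == j then c + e else 1 | i < d].
apply: (@le_trans _ _ (mu (box lo hi))).
  apply: le_measure; rewrite ?inE.
  - exact: measurableI.
  - exact: measurable_box.
  - move=> x [Ux /= xc] i; rewrite !tnth_mktuple; case: eqP => [->|_]; last exact: Ux.
    by rewrite xc lexx ltrDl.
rewrite mu_box// (bigD1 j)//= !tnth_mktuple eqxx [c + e - c]addrAC subrr add0r.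
rewrite (max_r (ltW e0)) big1 ?mulr1// => i /negbTE ij.
by rewrite !tnth_mktuple ij subr0 max_r.
Qed.

Lemma floor_eq_pts (a c : R) : forall s, 0 <= s < 1 ->
  (s - a) - (Num.floor (s - a))%:~R = c -> s = (a + c) - (Num.floor (a + c))%:~R.
Proof.
move=> s s01 H.
have sE : s = a + c + (Num.floor (s - a))%:~R by rewrite -H; ring.
have := frac_intD (a + c) (Num.floor (s - a)).
by rewrite -sE => <-; rewrite floor0_itv// subr0.
Qed.

(** The two differ only where some coordinate meets an endpoint of its arc, that is on finitely many
    hyperplanes. *)
Lemma chil_chi a r : 0 < r <= 1 -> {ae torm, forall x, chil a r x = chi a r x}.
Proof.
move=> r01.
have H i c : {ae torm, forall x, tnth x i <> c}.
  exists [set x : P | tnth x i = c]; split.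
  - rewrite (_ : [set _ | _] = (fun x => tnth x i) @^-1` [set c])//.
    by rewrite -[_ @^-1` _]setTI; exact: measurable_tnth.
  - by rewrite tormE setIC mu_hyperplane.
  - by move=> x /= /contrapT.
have H0 := @filter_forall _ _ _ _ _ (fun i => H i ((tnth a i + 0) - (Num.floor (tnth a i + 0))%:~R)).
have Hr := @filter_forall _ _ _ _ _ (fun i => H i ((tnth a i + r) - (Num.floor (tnth a i + r))%:~R)).
apply: filterS3 (torm_unit Hmu) (H0 _) (Hr _) => x Ux {}H0 {}Hr.
apply: eq_bigr => i _; rewrite tnth_fracP tnth_padd tnth_map.
apply: arc_lim_in => //; apply/eqP => E.
  by apply: (H0 i); apply: floor_eq_pts E.
by apply: (Hr i); apply: floor_eq_pts E.
Qed.

Lemma chi01 a r x : chi a r x = \1_[set y | forall i, tnth (fracP (padd y (map_tuple -%R a))) i < r] x.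
Proof.
rewrite /chi indicE; have [H|H] := boolP (x \in _).
  by rewrite big1// => i _; move: H; rewrite inE => ->.
have {H} /existsNP[i /negP H] : ~ forall i, tnth (fracP (padd x (map_tuple -%R a))) i < r.
  by move=> H'; move/negP : H; apply; rewrite inE.
by rewrite (bigD1 i)//= (negbTE H) mul0r.
Qed.

Lemma bdm_chi a r : bdm (chi a r).
Proof.
rewrite (_ : chi a r = \1_[set y | forall i, tnth (fracP (padd y (map_tuple -%R a))) i < r]); last first.
  by apply/funext => x; exact: chi01.
apply: bdm_indic.
rewrite (_ : [set _ | _] = \bigcap_(i in [set: 'I_d])
    ((fun y => tnth (fracP (padd y (map_tuple -%R a))) i) @^-1` `]-oo, r[%classic)).
  apply: fin_bigcap_measurable => // i _; rewrite -[_ @^-1` _]setTI.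
  apply: (measurableT_comp (measurable_tnth i)) => //.
  exact: (measurableT_comp measurable_fracP (measurable_padd _)).
apply/seteqP; split => x /= H i; first by move=> _ /=; rewrite in_itv/=.
by have := H i I; rewrite /= in_itv.
Qed.

Lemma cube_unit_sub k : cube (pcst 0) (rk k) `<=` (unit_cube : set P).
Proof.
move=> z zk i; have := zk i; rewrite tnth_mktuple add0r => /andP[-> h] /=.
exact: lt_le_trans h (rk_le1 k).
Qed.

(** The cube based at [a] may wrap around the torus; translation invariance turns the average over
    it into an integral over one period against [chi a], a form that test functions can
    approximate. *)
Lemma avg_chi k F a : intgr torm F -> per F ->
  avg k F a = (2 ^+ k) ^+ d * \int[torm]_x (F x * chi a (rk k) x).
Proof.
move=> iF pF; rewrite /avg; congr (_ * _).
have mF := intgr_measurable iF.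
have iFc : intgr torm (fun x => F x * chi a (rk k) x).
  by apply: intgrM_bdm => //; exact: bdm_chi.
have [_ <-] := int_comp_intgr (m1 := torm)
  (measurableT_comp measurable_fracP (measurable_padd a))
  (torm_padd Hmu a) iFc.
rewrite (@int_mfrestr_sub _ _ _ mu _ _ (measurable_cube (pcst 0) (rk k))
  (@measurable_unit_cube R d) (mu_cube_fin Hmu _ _) (mu_unit_fin Hmu)); last 2 first.
- exact: cube_unit_sub.
- apply: (measurableT_comp mF).
  exact: (measurableT_comp measurable_padd2 (measurable_pair1 a)).
congr fine; apply: ae_eq_integral => //.
- apply/measurable_EFinP/measurable_funM.
    apply: (measurableT_comp mF).
    exact: (measurableT_comp measurable_padd2 (measurable_pair1 a)).
  by apply: measurable_indic; exact: measurable_cube.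
- apply/measurable_EFinP; apply: (measurableT_comp (intgr_measurable iFc)).
  exact: (measurableT_comp measurable_fracP (measurable_padd a)).
apply: filterS (torm_unit Hmu) => x Ux _ /=; congr EFin.
have paddC y z : padd y z = padd z y.
  by apply: eq_from_tnth => i; rewrite !tnth_padd addrC.
rewrite paddC pF; congr (_ * _); rewrite chi01 !indicE; congr ((_ : bool)%:R).
have E : fracP (padd (fracP (padd x a)) (map_tuple -%R a)) = x.
  rewrite fracP_padd_frac (_ : padd _ _ = x) ?fracP_id//.
  by apply: eq_from_tnth => i; rewrite !tnth_padd tnth_map addrK.
apply/idP/idP; rewrite !inE /= E => H i.
  by have := H i; rewrite tnth_mktuple add0r => /andP[].
by rewrite tnth_mktuple add0r H andbT; have /andP[] := Ux i.
Qed.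

Lemma avg_chil k F a : intgr torm F -> per F ->
  avg k F a = (2 ^+ k) ^+ d * \int[torm]_x (F x * chil a (rk k) x).
Proof.
move=> iF pF; rewrite avg_chi//; congr (_ * _); congr fine.
apply: ae_eq_integral => //.
- apply/measurable_EFinP/measurable_funM; first exact: intgr_measurable iF.
  by case: (bdm_chi a (rk k)).
- apply/measurable_EFinP/measurable_funM; first exact: intgr_measurable iF.
  by case: (bdm_chil a (rk k)).
have r01 : 0 < (rk k : R) <= 1 by rewrite rk_gt0 rk_le1.
by apply: filterS (chil_chi a r01) => x H _; rewrite /= H.
Qed.

Lemma bdm_avg_intgr k F : intgr torm F -> per F -> bdm (avg k F).
Proof.
move=> iF pF; split; first exact: measurable_avg (intgr_measurable iF).
exists ((2 ^+ k) ^+ d * \int[torm]_x `|F x|) => a.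
rewrite avg_chil// normrM ger0_norm ?avg_fac_ge0// ler_wpM2l ?avg_fac_ge0//.
have iFc : intgr torm (fun x => F x * chil a (rk k) x).
  by apply: intgrM_bdm => //; exact: bdm_chil.
rewrite (le_trans (le_normr_Rintegral _ iFc))//.
apply: le_Rintegral => //; [exact: integrable_norm|exact: integrable_norm|].
by move=> x _; rewrite normrM ler_piMr// chil_bound.
Qed.

Lemma arc_bump_shift (N c h k s : R) : arc_bump N (c + h) k s = arc_bump N c k (s - h).
Proof. by rewrite /arc_bump /arc_cos [c + h]addrC opprD addrA. Qed.

Definition wpart j F W := [/\ per F /\ per W, intgr torm F, intgr torm W &
  forall psi, test_fun psi -> \int[torm]_x (F x * Defs.partial j psi x) =
    - \int[torm]_x (W x * psi x)].

(** The test function is the product of bumps approximating the cube at [a], with the [j]-th bump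
    replaced by its window integral over [[0, h]]. Its [j]-th derivative is the difference of the
    bumps at [a] and at [a] shifted by [h], while the function itself is the integral of all
    intermediate bumps; as [n] tends to infinity these give the two sides. *)
Lemma wpart_ipart k j F W : wpart j F W -> ipart j (avg k F) (avg k W).
Proof.
move=> [[pF pW] iF iW HFW] a h h0.
pose r : R := rk k; pose ka := cos (pi * r).
pose Pn n i := arc_bump n%:R (tnth a i + r / 2) ka.
pose Qn n s := \int[lebI 0 h]_t Pn n j (s - t).
pose Fn n i := if i == j then Qn n else Pn n i.
have sP n i : smooth_per (Pn n i) := arc_bump_smooth _ _ _.
have bP n i : bdm (Pn n i) := bdm_arc_bump _ _ _.
have [sQ dQ] : (forall n, smooth_per (Qn n)) /\
    (forall n, derive1 (Qn n) = (fun s => Pn n j s - Pn n j (s - h))).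
  by split => n; have [] := arc_window (sP n j) (bP n j) h0.
have sF n i : smooth_per (Fn n i) by rewrite /Fn; case: ifP.
pose psi n := pr (Fn n).
have tpsi n : test_fun (psi n) by exact: test_fun_pr.
have chibE n t x : chib n (Defs.shift a j t) r x =
    Pn n j (tnth x j - t) * \prod_(i < d | i != j) Fn n i (tnth x i).
  rewrite /chib /pr (bigD1 j)//= tnth_shift eqxx; congr (_ * _).
    by rewrite /Pn -arc_bump_shift addrAC.
  by apply: eq_bigr => i /negbTE ij; rewrite tnth_shift /Fn ij addr0.
have psiE n x : psi n x = \int[lebI 0 h]_t chib n (Defs.shift a j t) r x.
  rewrite /psi /pr (bigD1 j)//= {1}/Fn eqxx /Qn mulrC.
  rewrite -intZ; last first.
    apply: (bdm_comp (T := fun t => tnth x j - t)) (bP n j).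
    by apply: measurable_funB; [exact: measurable_cst|exact: measurable_id].
  by apply: eq_Rintegral => t _; rewrite chibE mulrC.
have dpsi n x : Defs.partial j (psi n) x =
    chib n a r x - chib n (Defs.shift a j h) r x.
  rewrite /psi partial_pr; last by move=> i s; exact: smooth_per_derivable.
  rewrite -[a in chib n a](pshift0 a j) !chibE /pr (bigD1 j)//= /pr_der eqxx {1}/Fn eqxx.
  rewrite dQ subr0 -mulrBl; congr (_ * _).
  by apply: eq_bigr => i /negbTE ->.
have bshift x : bdm (fun t : R => chil (Defs.shift a j t) r x).
  split; last by exists 1 => t; exact: chil_bound.
  apply: measurable_prod => i _.
  rewrite (_ : (fun t => _) = (fun t => arc_lim 0 (cos (pi * r))
     (tnth x i - (tnth (Defs.shift a j t) i + r / 2)))); last first.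
    by apply/funext => t; rewrite arc_limB.
  apply: (measurableT_comp (measurable_arc_lim 0 _)).
  apply: measurable_funB; first exact: measurable_cst.
  apply: measurable_funD; last exact: measurable_cst.
  by apply: (measurableT_comp (measurable_tnth i)); exact: measurable_shift_line.
have bshift2 : bdm (fun q : R * P => chil (Defs.shift a j q.1) r q.2).
  split; last by exists 1 => q; exact: chil_bound.
  apply: measurable_prod => i _.
  rewrite (_ : (fun _ => _) = (fun q : R * P => arc_lim 0 (cos (pi * r))
     (tnth q.2 i - (tnth (Defs.shift a j q.1) i + r / 2)))); last first.
    by apply/funext => q; rewrite arc_limB.
  apply: (measurableT_comp (measurable_arc_lim 0 _)).
  apply: measurable_funB.
    by apply: (measurableT_comp (measurable_tnth i)).
  apply: measurable_funD; last exact: measurable_cst.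
  by apply: (measurableT_comp (measurable_tnth i)); exact: measurable_shiftf.
pose psil x := \int[lebI 0 h]_t chil (Defs.shift a j t) r x.
have bpsil : bdm psil.
  have bsw : bdm (fun q : P * R => chil (Defs.shift a j q.2) r q.1).
    case: bshift2 => mb _; split; last by exists 1 => q; exact: chil_bound.
    rewrite (_ : (fun q => _) = (fun q : R * P => chil (Defs.shift a j q.1) r q.2) \o
      (fun q : P * R => (q.2, q.1)))//.
    apply: measurableT_comp => //.
    by apply/measurable_fun_pairP; split => /=; [exact: measurable_snd|exact: measurable_fst].
  exact: (bdm_int (lebI 0 h) bsw).
have bchib n x : bdm (fun t : R => chib n (Defs.shift a j t) r x).
  split; last by exists 1 => t; exact: chib_bound.
  apply: measurable_prod => i _.
  have [mb _] := bdm_arc_bump n%:R 0 (cos (pi * r)).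
  rewrite (_ : (fun t => _) = (fun t => arc_bump n%:R 0 (cos (pi * r))
     (tnth x i - (tnth (Defs.shift a j t) i + r / 2)))); last first.
    by apply/funext => t; rewrite -arc_bump_shift add0r.
  apply: (measurableT_comp mb).
  apply: measurable_funB; first exact: measurable_cst.
  apply: measurable_funD; last exact: measurable_cst.
  by apply: (measurableT_comp (measurable_tnth i)); exact: measurable_shift_line.
have psil_cvg x : (fun n => psi n x) @ \oo --> psil x.
  under eq_fun do rewrite psiE.
  apply: (@int_cvg _ _ _ _ _ _ 1).
  - by move=> n; case: (bchib n x).
  - by move=> n t; exact: chib_bound.
  - exact: bshift.
  - by apply: aeW => t; exact: chib_cvg.
have L : (fun n => \int[torm]_x (F x * Defs.partial j (psi n) x)) @ \oo -->
    \int[torm]_x (F x * (chil a r x - chil (Defs.shift a j h) r x)).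
  apply: (int_cvg_dom (M := 2)) => //.
  - move=> n; rewrite (_ : Defs.partial j (psi n) = fun x => chib n a r x - chib n (Defs.shift a j h) r x).
      by apply: measurable_funB; [case: (bdm_chib n a r)|case: (bdm_chib n (Defs.shift a j h) r)].
    by apply/funext.
  - move=> n x; rewrite dpsi (le_trans (ler_normB _ _))//.
    by have := chib_bound n a r x; have := chib_bound n (Defs.shift a j h) r x; lra.
  - by apply: bdmB; exact: bdm_chil.
  - move=> x; under eq_fun do rewrite dpsi.
    by apply: cvgB; exact: chib_cvg.
have Rr : (fun n => \int[torm]_x (W x * psi n x)) @ \oo --> \int[torm]_x (W x * psil x).
  apply: (int_cvg_dom (M := h)) => //.
  - move=> n; apply: measurable_pr => i; rewrite /Fn; case: ifP => _; last by case: (bP n i).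
    exact: continuous_measurable_fun (smooth_per_continuous (sQ n)).
  - move=> n x; rewrite psiE.
    have := int_normM (lebI 0 h) (bchib n x) (fun t => chib_bound n _ r x).
    by rewrite lebI1// subr0 mul1r.
have E : \int[torm]_x (F x * (chil a r x - chil (Defs.shift a j h) r x)) =
    - \int[torm]_x (W x * psil x).
  have := cvgN Rr; rewrite (_ : - _ = (fun n => \int[torm]_x (F x * Defs.partial j (psi n) x))).
    by move=> H; rewrite -(cvg_lim (@Rhausdorff R) L); apply: (cvg_lim (@Rhausdorff R)); exact: H.
  by apply/funext => n; rewrite /= HFW.
have iFc b : intgr torm (fun x => F x * chil b r x).
  by apply: intgrM_bdm => //; exact: bdm_chil.
have iWc b : intgr torm (fun x => W x * chil b r x).
  by apply: intgrM_bdm => //; exact: bdm_chil.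
rewrite !avg_chil// -mulrBr.
(* The sign of integration by parts cancels against the order of the difference, which is the bump
   at [a] minus the shifted one. *)
have -> : \int[torm]_x (F x * chil (Defs.shift a j h) (rk k) x) -
    \int[torm]_x (F x * chil a (rk k) x) = \int[torm]_x (W x * psil x).
  apply: oppr_inj; rewrite -E opprB -RintegralB//; [|exact: iFc|exact: iFc].
  by apply: eq_Rintegral => x _; rewrite mulrBr.
have -> : \int[torm]_x (W x * psil x) =
    \int[lebI 0 h]_t \int[torm]_x (W x * chil (Defs.shift a j t) r x).
  rewrite (@int_fubini_intgr _ _ _ _ _ (lebI 0 h) torm
    (fun q => W q.2 * chil (Defs.shift a j q.1) r q.2))/=.
  - by apply: eq_Rintegral => x _; rewrite intZ; [by []|exact: bshift].
  - by apply: intgrM_bdm => //; exact: intgr_snd.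
  - by move=> t; exact: iWc.
  - by move=> x; apply: bdm_integrable; exact: (bdmZ _ (bshift x)).
rewrite -intZ.
  by apply: eq_Rintegral => t _; rewrite avg_chil.
rewrite (_ : (fun t => _) = (fun t => ((2 ^+ k) ^+ d)^-1 * avg k W (Defs.shift a j t))).
  by apply: bdmZ; apply: bdm_line; exact: bdm_avg_intgr.
apply/funext => t; rewrite avg_chil// mulrA mulVf ?mul1r//.
Qed.

(** Testing the weak divergence and the diagonal weak derivatives with the same bumps identifies the
    averages of the trace of the gradient with those of the divergence. *)
Lemma wdiv_avg k (V W : 'I_d -> P -> R) (G : P -> R) :
  (forall j, wpart j (V j) (W j)) -> intgr torm G -> per G ->
  (forall psi, test_fun psi ->
     \int[torm]_x (\sum_(j < d) V j x * Defs.partial j psi x) =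
     - \int[torm]_x (G x * psi x)) ->
  forall a, \sum_(j < d) avg k (W j) a = avg k G a.
Proof.
move=> HVW iG pG HG a.
have iW j : intgr torm (W j) by case: (HVW j).
have pW j : per (W j) by case: (HVW j) => -[].
have iV j : intgr torm (V j) by case: (HVW j).
pose r : R := rk k.
pose Fn n i := arc_bump n%:R (tnth a i + r / 2) (cos (pi * r)).
have sF n i : smooth_per (Fn n i) := arc_bump_smooth _ _ _.
have tpsi n : test_fun (chib n a r) by exact: (test_fun_pr (sF n)).
have C (H : P -> R) : intgr torm H ->
    (fun n => \int[torm]_x (H x * chib n a r x)) @ \oo --> \int[torm]_x (H x * chil a r x).
  move=> iH; apply: (int_cvg_dom (M := 1)) => //.
  - by move=> n; case: (bdm_chib n a r).
  - by move=> n x; exact: chib_bound.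
  - exact: bdm_chil.
  - by move=> x; exact: chib_cvg.
have bpart n j : bdm (Defs.partial j (chib n a r)).
  rewrite (_ : Defs.partial j _ = pr (pr_der (Fn n) j)); last first.
    apply: (@partial_pr _ _ (Fn n)) => i s; exact: smooth_per_derivable (sF n i).
  have sD i : smooth_per (pr_der (Fn n) j i).
    by rewrite /pr_der; case: ifP => _ //; exact: smooth_per_derive1.
  have bD i : bdm (pr_der (Fn n) j i) := bdm_smooth_per (sD i) (smooth_per_bounded (sD i)).
  split; first by apply: measurable_pr => i; case: (bD i).
  have /choice[B HB] i : exists B : R, forall s, `|pr_der (Fn n) j i s| <= B.
    by case: (bD i).
  exists (\prod_i B i) => x; rewrite /pr normr_prod.
  by apply: ler_prod => i _; rewrite normr_ge0 HB.
have E n : \sum_j \int[torm]_x (W j x * chib n a r x) = \int[torm]_x (G x * chib n a r x).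
  apply: oppr_inj; rewrite -HG// -sumrN.
  rewrite (@intgr_sum _ _ _ torm _ (fun j x => V j x * Defs.partial j (chib n a r) x)); last first.
    by move=> j; apply: intgrM_bdm.
  by apply: eq_bigr => j _; have [_ _ _ ->] := HVW j.
have L : (fun n => \sum_j \int[torm]_x (W j x * chib n a r x)) @ \oo -->
    \sum_j \int[torm]_x (W j x * chil a r x).
  by apply: cvg_sum_fin => j; exact: C.
under eq_bigr do rewrite avg_chil//.
rewrite avg_chil// -mulr_sumr; congr (_ * _).
rewrite -(cvg_lim (@Rhausdorff R) L); apply: (cvg_lim (@Rhausdorff R)).
by under eq_fun do rewrite E; exact: C.
Qed.

End weak_derivatives.

(** * Logarithmic moduli of continuity *)

Lemma ge0_int_mfrestr d (T : measurableType d) (R : realType)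
    (mu : {measure set T -> \bar R}) (D : set T) (mD : measurable D)
    (Doo : (mu D < +oo)%E) (f : T -> \bar R) : measurable_fun setT f ->
  (forall x, 0 <= f x)%E ->
  (\int[mfrestr mD Doo]_x f x = \int[mu]_(x in D) f x)%E.
Proof.
move=> mf f0.
have mDC : measurable (~` D) by exact: measurableC.
have D0 : mfrestr mD Doo (~` D) = 0%E.
  by rewrite /mfrestr /mrestr setICl measure0.
rewrite (@ge0_negligible_integral _ _ _ _ setT (~` D))// ?setTD ?setCK//.
apply: eq_measure_integral => A mA AD.
by rewrite /= /mfrestr /mrestr setIidl.
Qed.

Lemma intgr_mfrestrP d (T : measurableType d) (R : realType)
    (mu : {measure set T -> \bar R}) (D : set T) (mD : measurable D)
    (Doo : (mu D < +oo)%E) (f : T -> R) :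
  intgr (mfrestr mD Doo) f <->
  measurable_fun setT f /\ (\int[mu]_(x in D) `|(f x)%:E| < +oo)%E.
Proof.
split=> [H|[mf fo]].
  have mf := intgr_measurable H; split => //.
  case/integrableP : H => _; rewrite ge0_int_mfrestr//.
  by apply: measurableT_comp => //; exact/measurable_EFinP.
apply/integrableP; split; first exact/measurable_EFinP.
rewrite ge0_int_mfrestr//.
by apply: measurableT_comp => //; exact/measurable_EFinP.
Qed.

Lemma intgr_push {R : realType} d d' (Y : measurableType d) (Z : measurableType d')
    (m1 : {measure set Y -> \bar R}) (m2 : {measure set Z -> \bar R}) (T : Y -> Z) :
  measurable_fun setT T -> (forall A, measurable A -> m1 (T @^-1` A) = m2 A) ->
  forall f : Z -> R, measurable_fun setT f -> intgr m1 (fun y => f (T y)) -> intgr m2 f.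
Proof.
move=> mT mm f mf /integrableP[_ H]; apply/integrableP; split; first exact/measurable_EFinP.
have := @ge0_integral_pushforward _ _ _ _ _ T mT m1 setT (fun y => `|(f y)%:E|)%E.
move=> /= E; rewrite -E// in H; last first.
  by apply/measurable_EFinP; exact: measurableT_comp.
rewrite (eq_measure_integral m2) in H => //.
by move=> A mA _; exact: mm.
Qed.

(** * Averages of functions of bounded mean oscillation *)

Section bounded_mean_oscillation.
Context {R : realType} {d : nat}.
Local Notation P := (d.-tuple R).
Variable mu : {measure set P -> \bar R}.
Hypothesis Hmu : is_lebesgue_Rd mu.
Implicit Types (x y z a b : P) (j : 'I_d) (s t : R) (k : nat) (F W : P -> R).
Local Notation torm := (torm Hmu).
Local Notation avg := (avg Hmu).
Local Notation nuk := (nuk Hmu).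

Definition cubem a k : {finite_measure set P -> \bar R} :=
  mfrestr (measurable_cube a (rk k)) (mu_cube_fin Hmu a (rk k)).

Lemma paddC x y : padd x y = padd y x.
Proof. by apply: eq_from_tnth => i; rewrite !tnth_padd addrC. Qed.

Lemma measurable_paddl a : measurable_fun setT (fun z : P => padd a z).
Proof. exact: (measurableT_comp measurable_padd2 (measurable_pair1 a)). Qed.

Lemma nuk_push a k A : measurable A -> nuk k ((fun z => padd a z) @^-1` A) = cubem a k A.
Proof.
move=> mA; rewrite /nuk /cubem /= /mfrestr /mrestr.
have mAc : measurable (A `&` cube a (rk k)).
  by apply: measurableI => //; exact: measurable_cube.
rewrite -(mu_padd Hmu a mAc); congr (mu _); apply/seteqP; split => z /= [Az cz].
  rewrite paddC; split => // i; have := cz i.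
  by rewrite tnth_padd tnth_mktuple add0r lerDl ltrD2l.
rewrite paddC in Az cz; split => // i; have := cz i.
by rewrite tnth_padd tnth_mktuple add0r lerDl ltrD2l.
Qed.

Lemma nuk_intgr a k F : intgr torm F -> per F -> intgr (nuk k) (fun z => F (padd a z)).
Proof.
move=> iF pF; have mF := intgr_measurable iF.
have [+ _] := int_comp_intgr (m1 := torm)
  (measurableT_comp measurable_fracP (measurable_padd a)) (torm_padd Hmu a) iF.
rewrite (_ : (fun _ => _) = (fun z => F (padd a z))); last first.
  by apply/funext => z; rewrite pF paddC.
move/intgr_mfrestrP => [mFa Foo]; apply/intgr_mfrestrP; split => //.
apply: le_lt_trans Foo; apply: ge0_subset_integral => //.
- exact: measurable_cube.
- exact: measurable_unit_cube.
- apply: measurableT_comp => //; apply/measurable_EFinP.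
  by apply: measurable_funTS.
- exact: cube_unit_sub.
Qed.

Lemma cubem_intgr a k F : intgr torm F -> per F -> intgr (cubem a k) F.
Proof.
move=> iF pF.
exact: (intgr_push (measurable_paddl a) (@nuk_push a k) (intgr_measurable iF) (nuk_intgr a k iF pF)).
Qed.

Lemma bmo_avg k W C a : intgr torm W -> per W -> bmo_le mu W C ->
  (2 ^+ k) ^+ d * \int[nuk k]_z `|W (padd a z) - avg k W a| <= C.
Proof.
move=> iW pW; rewrite /bmo_le (_ : W \o fracP = W); last exact/funext.
move=> /(_ a (rk k) (rk_gt0 k)) /=.
have mW := intgr_measurable iW.
have iWc := cubem_intgr a k iW pW.
have r0 : 0 < (rk k : R) ^+ d by rewrite exprn_gt0// rk_gt0.
have rkV : (2 ^+ k) ^+ d = ((rk k : R) ^+ d)^-1 by rewrite /rk exprVn invrK.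
have aE : avg k W a = fine (\int[mu]_(x in cube a (rk k)) (W x)%:E) / rk k ^+ d.
  rewrite /avg rkV mulrC; congr (_ / _).
  have [_ ->] := int_comp_intgr (m1 := nuk k) (m2 := cubem a k)
    (measurable_paddl a) (nuk_push a k) iWc.
  exact: (int_mfrestr (measurable_cube a (rk k)) (mu_cube_fin Hmu a (rk k)) mW).
rewrite -aE.
set c := avg k W a.
have iWcc : intgr (cubem a k) (fun x => `|W x - c|).
  apply: integrable_norm; rewrite -/(intgr _ _) /intgr.
  rewrite (_ : EFin \o _ = ((EFin \o W) \- (EFin \o (fun=> c)))%E)//.
  by apply: integrableB => //; apply: bdm_integrable; exact: bdm_cst.
have [_ ->] := int_comp_intgr (m1 := nuk k) (m2 := cubem a k)
    (measurable_paddl a) (nuk_push a k) iWcc.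
have mWc : measurable_fun setT (fun x => `|W x - c|) := intgr_measurable iWcc.
rewrite (int_mfrestr (measurable_cube a (rk k)) (mu_cube_fin Hmu a (rk k)) mWc).
move=> H; rewrite rkV mulrC ler_pdivrMr// /Rintegral.
have fin : (\int[mu]_(x in cube a (rk k)) (`|W x - c|)%:E)%E \is a fin_num.
  rewrite ge0_fin_numE; last by apply: integral_ge0.
  exact: le_lt_trans H (ltry _).
by rewrite -lee_fin fineK.
Qed.

(** The cube of half side occupies the fraction [2^-d] of the larger one, so the mean deviation over
    it from the larger average is at most [2^d] times the mean oscillation. *)
Lemma bmo_avgS k W C a : intgr torm W -> per W -> bmo_le mu W C ->
  `|avg k.+1 W a - avg k W a| <= 2 ^+ d * C.
Proof.
move=> iW pW bW; set c := avg k W a.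
have iN m : intgr (nuk m) (fun z => W (padd a z)) := nuk_intgr a m iW pW.
have ic m : intgr (nuk m) (fun=> c) by apply: bdm_integrable; exact: bdm_cst.
have iD m : intgr (nuk m) (fun z => W (padd a z) - c).
  rewrite /intgr (_ : EFin \o _ = ((EFin \o (fun z => W (padd a z))) \- (EFin \o fun=> c))%E)//.
  by apply: integrableB => //; [exact: iN|exact: ic].
have iDn m : intgr (nuk m) (fun z => `|W (padd a z) - c|) := integrable_norm (iD m).
have -> : avg k.+1 W a - c = (2 ^+ k.+1) ^+ d * \int[nuk k.+1]_z (W (padd a z) - c).
  rewrite RintegralB//; [|exact: iN|exact: ic].
  by rewrite mulrBr int_cst [c * _]mulrC mulrA nuk1 mul1r.
rewrite normrM ger0_norm ?avg_fac_ge0//.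
rewrite (le_trans (ler_wpM2l (avg_fac_ge0 k.+1) (le_normr_Rintegral _ (iD _))))//.
have sub : cube (pcst 0) (rk k.+1) `<=` (cube (pcst 0) (rk k) : set P).
  move=> z zc i; have /andP[-> /= h] := zc i; apply: (lt_le_trans h).
  rewrite lerD2l rkS ler_pdivrMr// ler_peMr ?rk_ge0//; lra.
have H : \int[nuk k.+1]_z `|W (padd a z) - c| <= \int[nuk k]_z `|W (padd a z) - c|.
  rewrite /nuk (@int_mfrestr_sub _ _ _ mu _ _ (measurable_cube (pcst 0) (rk k.+1))
    (measurable_cube (pcst 0) (rk k)) (mu_cube_fin Hmu _ _) (mu_cube_fin Hmu _ _) _ sub); last first.
    exact: intgr_measurable (iDn k).
  apply: le_Rintegral => //; last 2 first.
  - exact: (iDn k).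
  - by move=> z _; rewrite ler_piMr// indicE; case: (_ \in _).
  by apply: intgrM_bdm; [exact: (iDn k)|apply: bdm_indic; exact: measurable_cube].
rewrite (le_trans (ler_wpM2l (avg_fac_ge0 k.+1) H))//.
rewrite exprS exprMn -mulrA ler_wpM2l ?exprn_ge0//.
exact: bmo_avg.
Qed.

Lemma test_fun1 : test_fun (pr (fun (i : 'I_d) (s : R) => 1)).
Proof.
apply: test_fun_pr => _; exists (fun g => exists c, g = (fun=> c)); split; first by exists 1.
by move=> g [c ->]; split => //; exists 0; apply/funext => s; rewrite derive1_cst.
Qed.

(** Test with the constant 1. Since [avg 0] is the mean over the whole torus, this starts the
    induction in [bmo_avg_bound]. *)
Lemma wpart_mean0 j F W : wpart Hmu j F W -> \int[torm]_x W x = 0.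
Proof.
move=> [_ iF iW /(_ _ test_fun1)].
have -> : Defs.partial j (pr (fun (i : 'I_d) (s : R) => 1)) = (fun=> 0).
  apply/funext => x; rewrite /Defs.partial (_ : (fun _ => _) = cst 1) ?derive1_cst//.
  by apply/funext => s; rewrite /pr big1.
under eq_Rintegral do rewrite mulr0.
rewrite int_cst mul0r => /eqP; rewrite eq_sym oppr_eq0 => /eqP <-.
by apply: eq_Rintegral => x _; rewrite /pr big1// mulr1.
Qed.

(* BMO enters the argument only through this bound, which grows linearly in [k],
   i.e. logarithmically in the scale; John-Nirenberg is not needed. *)
Lemma bmo_avg_bound k W C a : intgr torm W -> per W -> \int[torm]_x W x = 0 ->
  bmo_le mu W C -> `|avg k W a| <= 2 ^+ d * C * k%:R.
Proof.
move=> iW pW W0 bW; elim: k => [|k IH].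
  rewrite avg_chi// expr0 expr1n mul1r mulr0.
  under eq_Rintegral => x _.
    rewrite /chi big1; last first.
      by move=> i _; rewrite rk0; have /andP[_ ->] := @fracP_unit R d (padd x (map_tuple -%R a)) i.
    rewrite mulr1; over.
  by rewrite W0 normr0.
rewrite -(subrK (avg k W a) (avg k.+1 W a)) (le_trans (ler_normD _ _))//.
by rewrite -[k.+1%:R]natr1 mulrDr mulr1 addrC lerD// bmo_avgS.
Qed.

End bounded_mean_oscillation.

Lemma dist4 (R : realDomainType) (a b c e f p q r s : R) : `|a - b| <= p -> `|c - b| <= q ->
  `|c - e| <= r -> `|f - e| <= s -> `|a - f| <= p + q + r + s.
Proof.
rewrite !ler_norml => /andP[? ?] /andP[? ?] /andP[? ?] /andP[? ?].
by apply/andP; split; lra.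
Qed.

Lemma dist3 (R : realDomainType) (a b c e p q r : R) : `|a - b| <= p -> `|c - e| <= q ->
  `|b - e| <= r -> `|a - c| <= p + q + r.
Proof.
rewrite !ler_norml => /andP[? ?] /andP[? ?] /andP[? ?].
by apply/andP; split; lra.
Qed.

Lemma cvg0_le (R : realType) (u v : nat -> R) : (forall n, 0 <= u n <= v n) ->
  v @ \oo --> 0 -> u @ \oo --> 0.
Proof.
move=> uv /cvg0P H; apply/cvg0P => e e0; have [K HK] := H e e0.
exists K => k /HK; have /andP[u0 h] := uv k.
by rewrite !ger0_norm//; [exact: le_trans|exact: le_trans h].
Qed.

(** * Log-Lipschitz functions through double averages *)

Section two_scale.
Context {R : realType} {d : nat}.
Local Notation P := (d.-tuple R).
Variable mu : {measure set P -> \bar R}.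
Hypothesis Hmu : is_lebesgue_Rd mu.
Implicit Types (x y z a b : P) (j : 'I_d) (s t : R) (k m l : nat).
Local Notation torm := (torm Hmu).
Local Notation avg := (avg Hmu).

(** The linear factor is absorbed by [(11/10)^k], and [11/10 * 4/5 < 1]. The threshold [4/5] is the
    product [8/5 * 1/2] met in [defect_short]. *)
Lemma cvg_natr_geo (q : R) : 0 <= q <= 4/5 -> (fun k => (k%:R + 2) * q ^+ k) @ \oo --> 0.
Proof.
move=> /andP[q0 q1].
have B k : (k%:R + 2) <= 20 * (11/10) ^+ k :> R.
  elim: k => [|k IH]; first by rewrite expr0; lra.
  rewrite -[k.+1%:R]natr1 exprS.
  suff : 1 <= (11/10) ^+ k :> R by lra.
  by apply: exprn_ege1; lra.
have H : (fun k => 20 * (11/10 * q) ^+ k) @ \oo --> (0 : R).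
  rewrite -[X in _ --> X](mulr0 20); apply: cvgM; first exact: cvg_cst.
  by apply: cvg_expr; rewrite ger0_norm; lra.
apply: cvg0_le H => k; apply/andP; split; first by rewrite mulr_ge0 ?exprn_ge0// addr_ge0.
by rewrite exprMn mulrA ler_wpM2r ?exprn_ge0.
Qed.

(* Averaging twice makes the approximation of a field, and also its divergence,
   Lipschitz. *)
Definition avg2 k (f : P -> R) := avg k (avg k f).

(** Its decrement from [k] to [k + 1] is [4 K d (k + 1) 2^-k], an upper bound for the change of the
    double average between these levels; errors thus telescope. *)
Definition log_err (K : R) k : R := 8 * K * d%:R * ((k%:R + 2) * rk k).

Lemma log_err_ge0 (K : R) k : 0 <= K -> 0 <= log_err K k.
Proof. by move=> K0; rewrite /log_err !mulr_ge0 ?addr_ge0 ?rk_ge0. Qed.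

Lemma log_err_cvg (K : R) : log_err K @ \oo --> 0.
Proof.
rewrite -[X in _ --> X](mulr0 (8 * K * d%:R)); apply: cvgM; first exact: cvg_cst.
rewrite (_ : (fun k => _) = (fun k => (k%:R + 2) * 2^-1 ^+ k)).
  by apply: cvg_natr_geo; lra.
by apply/funext => k; rewrite /rk exprVn.
Qed.

Lemma bdm_avg2 k f : bdm f -> bdm (avg2 k f).
Proof. by move=> bf; do 2! apply: bdm_avg. Qed.

Lemma per_avg2 k f : per f -> per (avg2 k f).
Proof. by move=> pf; do 2! apply: avg_per. Qed.

Lemma avg2_normM k f x (M : R) : bdm f -> (forall y, `|f y| <= M) -> `|avg2 k f x| <= M.
Proof.
move=> bf fM; apply: avg_normM => [|y]; first exact: bdm_avg.
exact: avg_normM.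
Qed.

(** What a gradient in BMO leaves of itself after averaging: at scale [2^-k] the Lipschitz constant
    is [K k]. *)
Definition loglip (K : R) (f : P -> R) :=
  forall k j x s, `|avg k f (Defs.shift x j s) - avg k f x| <= K * k%:R * `|s|.

Variables (f : P -> R) (K : R).
Hypotheses (bf : bdm f) (pf : per f) (K0 : 0 <= K) (Hf : loglip K f).

Local Notation V k := (avg2 k f).

Lemma avg2_lip k x y : `|V k x - V k y| <= K * k%:R * dist1 x y.
Proof.
apply: (@avg_mod _ _ _ Hmu k _ (fun r => K * k%:R * r)); first exact: bdm_avg.
exact/lip_dist1/Hf.
Qed.

(** Both double averages are compared with single ones, and these with the mixed average of levels
    [k] and [k + 1], whose order is immaterial. Each of the four comparisons averages a function
    already known to be Lipschitz. *)
Lemma avg2_step k x : `|V k.+1 x - V k x| <= log_err K k - log_err K k.+1.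
Proof.
have L m : forall a b, `|avg m f a - avg m f b| <= K * m%:R * dist1 a b.
  exact/lip_dist1/Hf.
have Km m : 0 <= K * m%:R by rewrite mulr_ge0.
have bm m : bdm (avg m f) := bdm_avg Hmu m bf.
have h1 := avg_lip_close Hmu k.+1 (bm k.+1) (Km k.+1) (L k.+1) x.
have h2 := avg_lip_close Hmu k (bm k.+1) (Km k.+1) (L k.+1) x.
have h3 := avg_lip_close Hmu k.+1 (bm k) (Km k) (L k) x.
have h4 := avg_lip_close Hmu k (bm k) (Km k) (L k) x.
have E : avg k (avg k.+1 f) x = avg k.+1 (avg k f) x by exact: avg_comm.
have D : 0 <= d%:R :> R by [].
have -> : log_err K k - log_err K k.+1 = 4 * (K * d%:R * ((k%:R + 1) * rk k)).
  by rewrite /log_err rkS -[k.+1%:R]natr1; field.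
rewrite rkS -[k.+1%:R]natr1 in h1 h2 h3.
set p := K * (d%:R * rk k); set q := K * k%:R * (d%:R * rk k).
have p0 : 0 <= p by rewrite !mulr_ge0// rk_ge0.
have q0 : 0 <= q by rewrite !mulr_ge0// rk_ge0.
have -> : 4 * (K * d%:R * ((k%:R + 1) * rk k)) = 4 * q + 4 * p by rewrite /p /q; ring.
have e1 : K * (k%:R + 1) * (d%:R * (rk k / 2)) = (q + p) / 2 by rewrite /p /q; field.
have e2 : K * (k%:R + 1) * (d%:R * rk k) = q + p by rewrite /p /q; ring.
have e3 : K * k%:R * (d%:R * (rk k / 2)) = q / 2 by rewrite /q; field.
rewrite e1 in h1; rewrite e2 in h2; rewrite e3 in h3; rewrite -/q in h4.
rewrite E in h2.
apply: le_trans (dist4 h1 h2 h3 h4) _.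
by clear h1 h2 h3 h4 E e1 e2 e3 D Km bm L; lra.
Qed.

Lemma avg2_cauchy k m x : (k <= m)%N -> `|V m x - V k x| <= log_err K k - log_err K m.
Proof.
move=> /subnK <-; elim: (m - k)%N => [|n IH]; first by rewrite add0n !subrr normr0.
rewrite addSn; have := avg2_step (n + k) x.
have := ler_normD (V (n + k).+1 x - V (n + k) x) (V (n + k) x - V k x).
by rewrite addrA subrK; lra.
Qed.

(** Uniform in [k]: above level [l], pass to level [l] at the price of [log_err K l] at each point;
    below it, use the Lipschitz constant [K k <= K l]. Two errors with factor [8 d] make the
    constant [16 d]. *)
Lemma avg2_modulus k l x y :
  `|V k x - V k y| <= K * (16 * d%:R + 1) * (l%:R + 2) * (dist1 x y + rk l).
Proof.
have D0 := dist1_ge0 x y; have r0 := @rk_ge0 R l.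
have l0 : 0 <= l%:R :> R by [].
have d0 : 0 <= d%:R :> R by [].
set D := dist1 x y in D0 *; set r := rk l in r0 *.
have a1 : 0 <= K * l%:R * D by rewrite !mulr_ge0.
have a2 : 0 <= K * D by rewrite !mulr_ge0.
have a3 : 0 <= K * d%:R * l%:R * D by rewrite !mulr_ge0.
have a4 : 0 <= K * d%:R * D by rewrite !mulr_ge0.
have a5 : 0 <= K * l%:R * r by rewrite !mulr_ge0.
have a6 : 0 <= K * r by rewrite !mulr_ge0.
have a7 : 0 <= K * d%:R * l%:R * r by rewrite !mulr_ge0.
have a8 : 0 <= K * d%:R * r by rewrite !mulr_ge0.
have -> : K * (16 * d%:R + 1) * (l%:R + 2) * (D + r) =
    16 * (K * d%:R * l%:R * D) + 32 * (K * d%:R * D) + K * l%:R * D + 2 * (K * D) +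
    (16 * (K * d%:R * l%:R * r) + 32 * (K * d%:R * r) + K * l%:R * r + 2 * (K * r)) by ring.
have [lk|kl] := leqP l k.
  have h1 := avg2_cauchy x lk; have h2 := avg2_cauchy y lk.
  have h3 := avg2_lip l x y; have ek := log_err_ge0 k K0.
  have el : log_err K l = 8 * (K * d%:R * l%:R * r) + 16 * (K * d%:R * r) by rewrite /log_err -/r; ring.
  rewrite el -/D in h1 h2 h3.
  apply: le_trans (dist3 h1 h2 h3) _.
  by clear h1 h2 h3 el; lra.
have h3 := avg2_lip k x y; apply: (le_trans h3); rewrite -/D.
have : K * k%:R * D <= K * l%:R * D by rewrite ler_wpM2r// ler_wpM2l// ler_nat ltnW.
by move=> ?; clear h3; lra.
Qed.

(* The continuous representative of [f]. *)
Definition tilde (g : P -> R) x : R := limn (fun k => avg2 k g x).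

Lemma avg2_cvg x : (fun k => V k x) @ \oo --> tilde f x.
Proof.
suff H : cvgn (fun k => V k x) by exact: H.
apply/cauchy_cvgP; apply/cauchy_exP => e e0.
have /cvg0P /(_ (e / 2)) := log_err_cvg K.
case; first by rewrite divr_gt0.
move=> k Hk; exists (V k x); exists k => // m /= km.
rewrite /ball /= distrC (le_lt_trans (avg2_cauchy x km))//.
have := Hk k (leqnn k); have em := log_err_ge0 m K0.
by rewrite ger0_norm ?log_err_ge0//; lra.
Qed.

Lemma tilde_close k x : `|tilde f x - V k x| <= log_err K k.
Proof.
have H : (fun m => `|V m x - V k x|) @ \oo --> `|tilde f x - V k x|.
  by apply: cvg_norm; apply: cvgB; [exact: avg2_cvg|exact: cvg_cst].
apply: (cvgr_to_le H) => //; near=> m.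
have km : (k <= m)%N by near: m; exact: nbhs_infty_ge.
have := avg2_cauchy x km; have := log_err_ge0 m K0; lra.
Unshelve. all: by end_near. Qed.

Lemma tilde_modulus l x y :
  `|tilde f x - tilde f y| <= K * (16 * d%:R + 1) * (l%:R + 2) * (dist1 x y + rk l).
Proof.
have H : (fun m => `|V m x - V m y|) @ \oo --> `|tilde f x - tilde f y|.
  by apply: cvg_norm; apply: cvgB; exact: avg2_cvg.
apply: (cvgr_to_le H); near=> m; exact: avg2_modulus.
Unshelve. all: by end_near. Qed.

Lemma per_tilde : per (tilde f).
Proof.
move=> x; have E : (fun k => V k (fracP x)) = (fun k => V k x).
  by apply/funext => k; exact: per_avg2.
exact: (congr1 (fun u : nat -> R => limn u) E).
Qed.

Lemma tilde_norm (M : R) x : (forall y, `|f y| <= M) -> `|tilde f x| <= M.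
Proof.
move=> fM; have H : (fun m => `|V m x|) @ \oo --> `|tilde f x|.
  by apply: cvg_norm; exact: avg2_cvg.
apply: (cvgr_to_le H); near=> m; exact: avg2_normM.
Unshelve. all: by end_near. Qed.

Lemma measurable_tilde : measurable_fun setT (tilde f).
Proof.
apply: (measurable_fun_cvg (h := fun k => V k)) => [k|x _]; last exact: avg2_cvg.
by case: (bdm_avg2 k bf).
Qed.

Lemma bdm_tilde : bdm (tilde f).
Proof.
split; first exact: measurable_tilde.
by case: (bf) => _ [M fM]; exists M => x; exact: tilde_norm.
Qed.

Lemma avg2_cvgL1 (g : P -> R) : bdm g -> per g ->
  (fun k => \int[torm]_x `|avg2 k g x - g x|) @ \oo --> 0.
Proof.
move=> bg pg; have H := bdm_avg_cvg Hmu bg pg.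
have H2 : (fun k => \int[torm]_x `|avg k g x - g x| + \int[torm]_x `|avg k g x - g x|) @ \oo --> 0.
  by rewrite -[X in _ --> X]addr0; apply: cvgD.
apply: cvg0_le H2 => k; apply/andP; split; first by apply: Rintegral_ge0.
have b1 := bdm_avg Hmu k bg; have b2 := bdm_avg2 k bg.
have bD : bdm (fun x => avg k g x - g x) by exact: bdmB.
have pD : per (fun x => avg k g x - g x) by move=> x; rewrite avg_per// pg.
have := int_norm_avg Hmu k bD pD.
have E x : avg k (fun x => avg k g x - g x) x = avg2 k g x - avg k g x by exact: avgB.
under eq_Rintegral do rewrite E.
move=> h; apply: (@le_trans _ _ (\int[torm]_x (`|avg2 k g x - avg k g x| + `|avg k g x - g x|))).
  apply: int_le; [exact/bdm_norm/bdmB| |].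
    by apply: bdmD; apply: bdm_norm; apply: bdmB.
  by move=> x; rewrite -[X in `|X| <= _](subrKA (avg k g x)) ler_normD.
by rewrite intD; [rewrite lerD2r|apply: bdm_norm; exact: bdmB|exact: bdm_norm].
Qed.

(** The double averages tend to [tilde f] uniformly and to [f] in L^1. *)
Lemma tilde_ae : {ae torm, forall x, tilde f x = f x}.
Proof.
have bD : bdm (fun x => `|tilde f x - f x|) by apply/bdm_norm/bdmB => //; exact: bdm_tilde.
suff E : \int[torm]_x `|tilde f x - f x| = 0.
  have E0 : \int[torm]_x `|tilde f x - f x| <= 0 by rewrite E.
  have := int_eq0_ae bD (fun x => normr_ge0 _) E0.
  by apply: filterS => x /eqP; rewrite normr_eq0 subr_eq0 => /eqP.
apply/eqP; rewrite eq_le Rintegral_ge0// andbT.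
have H : (fun k => log_err K k + \int[torm]_x `|V k x - f x|) @ \oo --> 0.
  by rewrite -[X in _ --> X]addr0; apply: cvgD; [exact: log_err_cvg|exact: avg2_cvgL1].
apply: (cvgr_to_ge H); near=> k.
have bV := bdm_avg2 k bf.
have -> : log_err K k = \int[torm]_x log_err K k by rewrite int_cst torm1 mulr1.
rewrite -intD; [|exact: bdm_cst|exact/bdm_norm/bdmB].
apply: int_le => //; first by apply: bdmD; [exact: bdm_cst|exact/bdm_norm/bdmB].
move=> x; rewrite -[X in `|X| <= _](subrKA (V k x)) (le_trans (ler_normD _ _))// lerD2r.
exact: tilde_close.
Unshelve. all: by end_near. Qed.

End two_scale.

(** * Absolutely continuous functions *)

Section absolute_continuity.
Context {R : realType}.
Implicit Types (a b p x y s t : R).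

Lemma lebI_ae x y (Q : R -> Prop) : (forall z, x <= z <= y -> Q z) ->
  {ae lebI x y, forall z, Q z}.
Proof.
move=> HQ; have [N [mN N0 HN]] := lebI_in x y; exists N; split => // z /= Qz.
by apply: HN => /= /HQ.
Qed.

(** Supremum argument. The local step crosses [p] from any nearby [x <= p] to any nearby [y >= p],
    so it both attains the supremum and moves beyond it. *)
Lemma real_induction (S : R -> Prop) a b : a <= b -> S a ->
  (forall p, a <= p <= b -> exists2 e, 0 < e & forall x y, a <= x <= p -> p <= y <= b ->
     p - e < x -> y < p + e -> S x -> S y) -> S b.
Proof.
move=> ab Sa H; pose E := [set x | a <= x <= b /\ S x].
have Ea : E a by split; rewrite ?lexx.
have ubE : ubound E b by move=> x [/andP[]].
have hE : has_sup E by split; [exists a|exists b].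
have Ep : a <= sup E <= b.
  by apply/andP; split; [apply: ub_le_sup => //; exists b|apply: ge_sup => //; exists a].
have [e e0 He] := H _ Ep.
have [x [/andP[ax xb] Sx] xe] := sup_adherent e0 hE.
have xE : x <= sup E by apply: ub_le_sup; [exists b|split; rewrite ?ax].
have /andP[_ Eb] := Ep.
have [bE|Eb'] := ltP b (sup E + e).
  by apply: (He x b) => //; rewrite ?ax ?lexx ?andbT.
have : E (sup E + e / 2).
  have Eb2 : sup E + e / 2 <= b by lra.
  split; first by apply/andP; split => //; lra.
  apply: (He x) => //; rewrite ?ax//; last by lra.
  by apply/andP; split => //; lra.
by move=> /(ub_le_sup (ex_intro _ b ubE)); lra.
Qed.

Lemma is_derive0_small (f : R -> R) p e : is_derive p 1 f 0 -> 0 < e ->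
  exists2 r, 0 < r & forall y, `|y - p| < r -> `|f y - f p| <= e * `|y - p|.
Proof.
move=> [df f0] e0; have : (fun h => h^-1 *: (f (h *: 1 + p) - f p)) @ 0^' --> (0 : R).
  by rewrite -[X in _ --> X]f0; exact: df.
move=> /cvgrPdist_lt /(_ _ e0) [r /= r0 H]; exists r => // y yp.
have [->|/eqP ynp] := pselect (y = p); first by rewrite !subrr normr0 mulr0.
have yp0 : y - p != 0 by rewrite subr_eq0.
have := H (y - p); rewrite /= sub0r normrN => /(_ yp yp0).
rewrite sub0r normrN /GRing.scale/= mulr1 subrK normrM normfV.
by rewrite ltr_pdivrMl ?normr_gt0// [e * _]mulrC => /ltW.
Qed.

(** The exceptional null set is covered by an open set [U] of measure below the [del] of absolute
    continuity. Moving from [a] to [b] by real induction, intervals in [U] are collected near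
    exceptional points and the slope [e] is used near the others; this replaces a covering lemma. *)
Lemma ac_const (f : R -> R) a b : a <= b -> abs_cont_on a b f ->
  {ae lebesgue_measure, forall t, a <= t <= b -> is_derive t 1 f 0} -> f b = f a.
Proof.
move=> ab acf [N [mN N0 HN]].
suff H e : 0 < e -> `|f b - f a| <= e * (b - a) + e.
  apply/eqP; rewrite -subr_eq0 -normr_le0; apply/ler_addgt0Pl => e e0; rewrite addr0.
  have ab1 : 0 < b - a + 1 by rewrite ltr_wpDl// subr_ge0.
  have := H (e / (b - a + 1)); rewrite divr_gt0// => /(_ isT) /le_trans; apply.
  by rewrite -[X in _ + X]mulr1 -mulrDr mulfVK ?gt_eqF.
move=> e0; have [del del0 Hdel] := acf e e0.
have [U [oU NU Udel]] : exists U : set R, [/\ open U, N `<=` U &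
    (lebesgue_measure (U `\` N) < del%:E)%E].
  apply: lebesgue_regularity_outer => //.
  exact: (eq_ind_r (fun z => (z < +oo)%E) (ltry 0) N0).
have mU : measurable U := open_measurable oU.
have Ule : (lebesgue_measure U < del%:E)%E.
  rewrite -(setDUK NU); apply: le_lt_trans Udel.
  apply: (le_trans (measureU2 lebesgue_measure mN (measurableD mU mN))).
  exact: (eq_ind_r (fun z => (z + _ <= _)%E) (eq_ind_r (fun z => (z <= _)%E) (lexx _) (add0e _)) N0).
pose om x := \int[lebI a x]_s (\1_U s : R).
have bU : bdm (\1_U : R -> R) by exact: bdm_indic.
have om_lt : om b < del.
  rewrite /om int_lebI; last by case: bU.
  rewrite /Rintegral -lte_fin; apply: le_lt_trans Ule.
  rewrite integral_indic// fineK; last first.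
    rewrite ge0_fin_numE//; apply: le_lt_trans (leb_itv_fin a b).
    by apply: le_measure; rewrite ?inE//; try exact: measurableI; exact: subIsetr.
  by apply: le_measure; rewrite ?inE//; try exact: measurableI; exact: subIsetl.
(* Progress up to [x]: finitely many ordered intervals, of total length at most the measure of [U]
   between [a] and [x], outside which [f] has varied by at most [e (x - a)]. *)
pose S x := exists n (s t : nat -> R), [/\
  forall k, (k < n)%N -> [/\ a <= s k, s k <= t k & t k <= x],
  forall k l, (k < l)%N -> (l < n)%N -> t k <= s l,
  \sum_(k < n) (t k - s k) <= om x &
  `|f x - f a| <= e * (x - a) + \sum_(k < n) `|f (t k) - f (s k)|].
suff [n [s [t [H1 H2 H3 H4]]]] : S b.
  apply: (le_trans H4); rewrite lerD2l ltW//.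
  apply: (Hdel n (fun k => s k) (fun k => t k)) => /=.
  - by move=> k; have [] := H1 k (ltn_ord k).
  - move=> k l; rewrite neq_ltn => /orP[kl|lk]; [left|right]; exact: H2.
  - exact: le_lt_trans om_lt.
apply: (real_induction ab).
  exists 0%N, (fun=> a), (fun=> a); split => //; rewrite ?big_ord0 ?subrr ?normr0 ?mulr0 ?addr0//.
  by rewrite /om lebI_pt.
move=> p /andP[ap pb]; have [Np|Np] := pselect (N p).
  have /nbhs_ballP[r /= r0 Hr] : nbhs p U by apply: open_nbhs_nbhs; split => //; exact: NU.
  exists r => // x y /andP[ax xp] /andP[py yb] xr yr [n [s [t [H1 H2 H3 H4]]]].
  have xy : x <= y := le_trans xp py.
  have omE : om y = om x + (y - x).
    rewrite /om (lebI_cat bU ax xy); congr (_ + _).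
    rewrite -(lebI1 xy) -[RHS]mul1r -int_cst; apply: int_ae_eq => //.
    - exact: bdm_cst.
    - apply: lebI_ae => z /andP[xz zy]; rewrite indicE mem_set//; apply: Hr.
      by rewrite /ball/= ltr_distlC; apply/andP; split; lra.
  exists n.+1, (fun k => if (k < n)%N then s k else x), (fun k => if (k < n)%N then t k else y).
  split.
  - move=> k; rewrite ltnS => kn; case: ifPn => [/H1[h1 h2 h3]|_]; split => //; exact: le_trans h3 xy.
  - move=> k l kl; rewrite ltnS => ln; rewrite (leq_trans kl ln).
    by case: ifPn => [|_]; [exact: H2|have [] := H1 k (leq_trans kl ln)].
  - rewrite big_ord_recr/= ltnn omE lerD2r; apply: le_trans H3.
    by apply: ler_sum => k _; rewrite ltn_ord.
  - rewrite big_ord_recr/= ltnn (eq_bigr (fun k : 'I_n => `|f (t k) - f (s k)|)); last first.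
      by move=> k _; rewrite ltn_ord.
    have := ler_normD (f y - f x) (f x - f a); rewrite addrA subrK.
    have : e * (x - a) <= e * (y - a) by rewrite ler_pM2l//; lra.
    by move: H4; clear; lra.
have D : is_derive p 1 f 0.
  have := contra_not (HN p) Np; rewrite /= => /contrapT; apply.
  by rewrite ap pb.
have [r r0 Hr] := is_derive0_small D e0.
exists r => // x y /andP[ax xp] /andP[py yb] xr yr [n [s [t [H1 H2 H3 H4]]]].
have xy : x <= y := le_trans xp py.
exists n, s, t; split => //.
- by move=> k kn; have [h1 h2 h3] := H1 k kn; split => //; exact: le_trans h3 xy.
- apply: (le_trans H3); rewrite /om (lebI_cat bU ax xy) lerDl.
  by apply: Rintegral_ge0 => z _; rewrite indicE.
have h1 : `|f x - f p| <= e * (p - x).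
  have := Hr x; rewrite distrC ger0_norm ?subr_ge0//; apply; lra.
have h2 : `|f y - f p| <= e * (y - p).
  have := Hr y; rewrite ger0_norm ?subr_ge0//; apply; lra.
have := ler_distD (f p) (f y) (f x); rewrite (distrC (f p) (f x)).
have := ler_normD (f y - f x) (f x - f a); rewrite addrA subrK.
move: H4 h1 h2; clear; lra.
Qed.

Lemma ac_lip (f : R -> R) a b (K : R) : 0 <= K ->
  (forall s t, a <= s -> s <= t -> t <= b -> `|f t - f s| <= K * (t - s)) -> abs_cont_on a b f.
Proof.
move=> K0 H e e0; have K1 : 0 < K + 1 by rewrite ltr_wpDl.
exists (e / (K + 1)); first by rewrite divr_gt0.
move=> n s t st _; rewrite ltr_pdivlMr// => lt; apply: le_lt_trans lt.
rewrite mulr_suml ler_sum// => k _; have [ask [skt tkb]] := st k.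
by rewrite (le_trans (H _ _ ask skt tkb))// mulrC ler_wpM2l ?subr_ge0// lerDl.
Qed.

Lemma acB (f g : R -> R) a b : abs_cont_on a b f -> abs_cont_on a b g ->
  abs_cont_on a b (fun t => f t - g t).
Proof.
move=> af ag e e0; have e2 : 0 < e / 2 by rewrite divr_gt0.
have [r r0 Hr] := af _ e2; have [q q0 Hq] := ag _ e2.
exists (Num.min r q); first by rewrite lt_min r0.
move=> n s t st dj; rewrite lt_min => /andP[lr lq].
rewrite (splitr e); apply: le_lt_trans (ltrD (Hr n s t st dj lr) (Hq n s t st dj lq)).
rewrite -big_split/= ler_sum// => k _.
rewrite (_ : _ - _ - _ = (f (t k) - f (s k)) - (g (t k) - g (s k))) ?ler_normB//; ring.
Qed.

Lemma int_lebI_lip (h : R -> R) a s t (M : R) : bdm h -> (forall r, `|h r| <= M) ->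
  a <= s -> s <= t -> `|\int[lebI a t]_r h r - \int[lebI a s]_r h r| <= M * (t - s).
Proof.
move=> bh hM as_ st; rewrite (lebI_cat bh as_ st) addrC addKr -lebI1//.
exact: int_normM.
Qed.

Lemma ac_ftc (f h : R -> R) a b : a <= b -> abs_cont_on a b f -> bdm h ->
  {ae lebesgue_measure, forall t, a <= t <= b -> is_derive t 1 f (h t)} ->
  f b - f a = \int[lebI a b]_t h t.
Proof.
move=> ab acf bh df; have [mh [M hM]] := bh.
have M0 : 0 <= M by exact: le_trans (hM 0).
pose A : set R := `[a, b + 1]%classic.
have mA : measurable A := measurable_itv _.
have iA : lebesgue_measure.-integrable A (EFin \o h) := bdm_lebesgue_integrable a (b + 1) bh.
have lA : locally_integrable [set: R] (h \_ A) by apply: integrable_locally.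
have hAM t : `|(h \_ A) t| <= M by rewrite patchE; case: ifP => _; rewrite ?normr0.
have bhA : bdm (h \_ A).
  split; last by exists M.
  by apply/(measurable_restrictT _ _).1 => //; exact: measurable_funTS.
have hA t : a <= t <= b -> (h \_ A) t = h t.
  move=> /andP[at_ tb]; rewrite patchE mem_set//.
  by rewrite /A /= in_itv/= at_/=; apply: (le_trans tb); rewrite lerDl.
have a1a : a - 1 <= a by rewrite gerBl.
(* Starting at [a - 1] places every point of [[a, b]] strictly to the right of the base point, where
   the almost everywhere form of the fundamental theorem applies. *)
pose G x := \int[lebI (a - 1) x]_t (h \_ A) t.
have acG : abs_cont_on a b G.
  by apply: (ac_lip M0) => s t as_ st _; apply: int_lebI_lip => //; exact: le_trans as_.
have -> : \int[lebI a b]_t h t = G b - G a.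
  rewrite /G (lebI_cat bhA a1a ab) addrC addKr.
  by apply: int_ae_eq => //; apply: lebI_ae => t tab; rewrite hA.
suff H : f b - G b = f a - G a.
  by apply/eqP; rewrite subr_eq -[f b](subrK (G b)) H; apply/eqP; ring.
apply: (@ac_const (fun t => f t - G t) a b ab (acB acf acG)).
pose G0 x := \int[lebesgue_measure]_(s in `[a - 1, x]) (h \_ A) s.
have D := @FTC1 R (h \_ A) (BLeft (a - 1)) (fun y => bdm_lebesgue_integrable (a - 1) y bhA) lA.
move: df D; apply: filterS2; first exact: (ae_filter_ringOfSetsType lebesgue_measure).
move=> t Hf HG tab.
have /andP[at_ tb] := tab.
have [dG Gt] : derivable G0 t 1 /\ derive1 G0 t = (h \_ A) t 
  by apply: HG; rewrite lte_fin (lt_le_trans _ at_)// gtrBl.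
rewrite (hA t tab) in Gt.
rewrite -(subrr (h t)); apply: is_deriveB; first exact: Hf.
rewrite (_ : G = G0).
  exact: DeriveDef dG (etrans (esym (derive1E _ _)) Gt).
by apply/funext => x; rewrite /G int_lebI//; case: bhA.
Qed.

End absolute_continuity.

(** * The Jacobian formula *)

Section shear.
Context {R : realType} {d : nat}.
Local Notation P := (d.-tuple R).
Variable mu : {measure set P -> \bar R}.
Hypothesis Hmu : is_lebesgue_Rd mu.
Implicit Types (x y z : P) (j : 'I_d) (s t r B K : R) (F v g : P -> R).
Local Notation torm := (torm Hmu).

Definition lipb B K F := [/\ bdm F, per F, forall x, `|F x| <= B &
  forall x y, `|F x - F y| <= K * dist1 x y].

Lemma lipb_line_continuous B K F x j : lipb B K F -> continuous (fun r => F (Defs.shift x j r)).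
Proof.
move=> [_ _ _ H] r; apply/cvgrPdist_lt => e e0.
have K1 : 0 < `|K| + 1 by rewrite ltr_wpDl.
near=> s; apply: (le_lt_trans (H _ _)).
have -> : dist1 (Defs.shift x j r) (Defs.shift x j s) = `|r - s|.
  rewrite (_ : Defs.shift x j r = Defs.shift (Defs.shift x j s) j (r - s)) ?dist1_shift//.
  by rewrite pshiftD subrKC.
apply: (@le_lt_trans _ _ ((`|K| + 1) * `|r - s|)).
  by rewrite ler_wpM2r// (le_trans (ler_norm K))// lerDl.
rewrite mulrC -ltr_pdivlMr//; near: s.
by apply: cvgr_dist_lt; [exact: cvg_id|rewrite divr_gt0].
Unshelve. all: by end_near. Qed.

(** Continuity of [g] along lines upgrades the integrated derivative to a classical one. *)
Lemma ipart_line v g x j B K : lipb B K g -> ipart j v g ->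
  forall r, is_derive r 1 (fun r => v (Defs.shift x j r)) (g (Defs.shift x j r)).
Proof.
move=> lg vg; have cg : continuous (fun r => g (Defs.shift x j r)) := lipb_line_continuous lg.
have [bg _ _ _] := lg.
have [Ga HG] := primitive_ex (bdm_line x j bg) cg.
have E r r' : r <= r' -> v (Defs.shift x j r') - Ga r' = v (Defs.shift x j r) - Ga r.
  move=> rr'; have h0 : 0 <= r' - r by rewrite subr_ge0.
  have := vg (Defs.shift x j r) _ h0; rewrite pshiftD subrKC.
  under eq_Rintegral do rewrite pshiftD.
  have cgr : continuous (fun s => g (Defs.shift x j (r + s))).
    move=> s; apply: (continuous_comp (f := fun s => r + s) (g := fun s => g (Defs.shift x j s))).
      by apply: cvgD; [exact: cvg_cst|exact: cvg_id].
    exact: cg.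
  have dgr s : is_derive s 1 (fun s => Ga (r + s)) (g (Defs.shift x j (r + s))).
    have := is_derive1_comp (g := fun s => r + s) (HG (r + s)) (is_derive_cstD r (is_derive_id s 1)).
    by rewrite mulr1.
  have -> := FTC2l h0 cgr dgr.
  by rewrite addr0 subrKC => /eqP; rewrite subr_eq => /eqP ->; ring.
have E2 r : v (Defs.shift x j r) = Ga r + (v (Defs.shift x j 0) - Ga 0).
  have [h|/ltW h] := leP 0 r; have := E _ _ h; move=> /eqP; rewrite subr_eq => /eqP.
    by move=> ->; ring.
  by move=> ->; ring.
move=> r; rewrite (_ : (fun r => _) = (fun r => (v (Defs.shift x j 0) - Ga 0) + Ga r)).
  exact: is_derive_cstD.
by apply/funext => s; rewrite E2 addrC.
Qed.

(** On each line in direction [j] the integrand is the derivative of [Q (r + nu r)], with [Q] a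
    primitive of [F] along the line. As [nu] has period 1, the integral over a period is
    [Q (1 + nu 0) - Q (nu 0)], which is the integral of the periodic [F] over a full period; no
    inverse of the shear enters. *)
Lemma shear_int F v g j B K B' K' B2 K2 : lipb B K F -> lipb B' K' g -> lipb B2 K2 v -> ipart j v g ->
  \int[torm]_x (F (Defs.shift x j (v x)) * (1 + g x)) = \int[torm]_x F x.
Proof.
move=> lF lg lv vg; have [bF pF _ _] := lF; have [bg pg _ _] := lg; have [bv pv _ _] := lv.
pose H x := F (Defs.shift x j (v x)) * (1 + g x).
have bFv : bdm (fun x => F (Defs.shift x j (v x))).
  apply: (bdm_comp (T := fun x => Defs.shift x j (v x)) _ bF).
  by apply: measurable_shiftf => //; case: bv.
have bH : bdm H by apply: bdmM => //; apply: bdmD => //; exact: bdm_cst.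
have pH : per H.
  move=> x; rewrite /H pv pg; congr (_ * _).
  by rewrite -pF fracP_shift_frac pF.
have avgl (f : P -> R) : bdm f -> per f ->
    \int[torm]_x f x = \int[torm]_x \int[lebI 0 1]_r f (Defs.shift x j r).
  move=> bf pf.
  have b2 : bdm (fun q : R * P => f (Defs.shift q.2 j q.1)).
    apply: (bdm_comp (T := fun q : R * P => Defs.shift q.2 j q.1) _ bf).
    by apply: measurable_shiftf.
  have := int_fubini (lebI 0 1) torm b2; rewrite /= => <-.
  transitivity (\int[lebI 0 1]_r \int[torm]_x f x).
    by rewrite int_cst lebI1// subr0 mulr1.
  by apply: eq_Rintegral => r _; rewrite int_torm_shift.
rewrite (avgl _ bH pH) (avgl _ bF pF); apply: eq_Rintegral => x _.
pose p r := F (Defs.shift x j r).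
have cp : continuous p := lipb_line_continuous lF.
have bp : bdm p := bdm_line x j bF.
have [Q HQ] := primitive_ex bp cp.
pose nu r := v (Defs.shift x j r).
have dnu r : is_derive r 1 nu (g (Defs.shift x j r)) := ipart_line x lg vg r.
have dr r : is_derive r 1 (fun r => r + nu r) (1 + g (Defs.shift x j r)).
  by apply: is_deriveD => //; exact: dnu.
have cH : continuous (fun r => H (Defs.shift x j r)).
  have cr : continuous (fun r => r + nu r).
    by move=> r; exact: is_derive_continuous (dr r).
  have -> : (fun r => H (Defs.shift x j r)) =
      (fun r => p (r + nu r) * (1 + g (Defs.shift x j r))).
    by apply/funext => r; rewrite /H pshiftD.
  move=> r; apply: cvgM.
    by apply: (continuous_comp (f := fun r => r + nu r)); [exact: cr|exact: cp].
  apply: cvgD; first exact: cvg_cst.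
  exact: (lipb_line_continuous lg).
have dH r : is_derive r 1 (fun r => Q (r + nu r)) (H (Defs.shift x j r)).
  have h := is_derive1_comp (g := fun r => r + nu r) (HQ (r + nu r)) (dr r).
  by apply: (is_derive_cast h); rewrite /H pshiftD.
have -> := FTC2l ler01 cH dH; have -> := FTC2l ler01 cp HQ.
have nu1 : nu 1 = nu 0 by rewrite /nu pshift0 per_shift1.
rewrite nu1 add0r.
(* [Q (1 + r) - Q r] is constant because [F] is periodic along the line, so the base point [nu 0]
   may be moved to 0. *)
have D r : is_derive r 1 (fun r => Q (1 + r) - Q r) 0.
  have h := is_derive1_comp (g := fun s => 1 + s) (HQ (1 + r)) (is_derive_cstD 1 (is_derive_id r 1)).
  apply: (is_derive_cast (is_deriveB h (HQ r))).
  by rewrite mulr1 /p [1 + r]addrC -pshiftD per_shift1// subrr.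
by have := @is_derive_0_is_cst _ _ (nu 0) 0 D; rewrite addr0.
Qed.

End shear.

(** * Composition of coordinate shears *)

Section composite_shear.
Context {R : realType} {d : nat}.
Local Notation P := (d.-tuple R).
Variable mu : {measure set P -> \bar R}.
Hypothesis Hmu : is_lebesgue_Rd mu.
Implicit Types (x y z : P) (i j : 'I_d) (B K : R) (F : P -> R) (l : seq 'I_d).
Local Notation torm := (torm Hmu).

Variables (v g : 'I_d -> P -> R) (a b e : R).
Hypotheses (lv : forall i, lipb a b (v i)) (lg : forall i, lipb b e (g i))
  (vg : forall i, ipart i (v i) (g i)) (a0 : 0 <= a) (b0 : 0 <= b) (b1 : b <= 1) (e0 : 0 <= e).

(* The map [x |-> x + v x] is replaced by a composition of [d] coordinate shears:
   each satisfies an exact one-dimensional change of variables ([shear_int]), and the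
   composition differs from the map by terms quadratic in the displacement. *)
Fixpoint shears l F : P -> R :=
  if l is i :: l' then fun x => shears l' F (Defs.shift x i (v i x)) * (1 + g i x) else F.

(** All displacements are taken at the same [x], whereas [shears] takes each at the point already
    displaced by the earlier ones. *)
Fixpoint moved l y x : P :=
  if l is i :: l' then Defs.shift (moved l' y x) i (v i x) else y.

Lemma shiftAC x i j (s t : R) :
  Defs.shift (Defs.shift x i s) j t = Defs.shift (Defs.shift x j t) i s.
Proof. by apply: eq_from_tnth => m; rewrite !tnth_shift addrAC. Qed.

Lemma dist1_shift2 x y i (s t : R) :
  dist1 (Defs.shift x i s) (Defs.shift y i t) <= dist1 x y + `|s - t|.
Proof.
apply: (le_trans (dist1_tri _ (Defs.shift x i t) _)); rewrite addrC lerD//.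
  by rewrite !pshiftE dist1_padd.
rewrite (_ : Defs.shift x i s = Defs.shift (Defs.shift x i t) i (s - t)) ?dist1_shift//.
by rewrite pshiftD subrKC.
Qed.

Lemma moved_shift l y x i (s : R) :
  moved l (Defs.shift y i s) x = Defs.shift (moved l y x) i s.
Proof. by elim: l => //= j l ->; rewrite shiftAC. Qed.

Lemma moved_dist l y x x' :
  dist1 (moved l y x) (moved l y x') <= (size l)%:R * (b * dist1 x x').
Proof.
elim: l => [|i l IH] /=; first by rewrite dist1xx mul0r.
apply: (le_trans (dist1_shift2 _ _ _ _ _)).
rewrite -[(size l).+1%:R]natr1 mulrDl mul1r lerD//.
by have [_ _ _ ->] := lv i.
Qed.

Lemma lipb_comp_shear F i B K : 0 <= B -> 0 <= K -> lipb B K F ->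
  lipb (B * (1 + b)) (K * (1 + b) * (1 + b) + B * e)
    (fun x => F (Defs.shift x i (v i x)) * (1 + g i x)).
Proof.
move=> B0 K0 [bF pF FB FK].
have [bv pv _ vK] := lv i; have [bg pg gB gK] := lg i.
have b10 : 0 <= 1 + b by rewrite addr_ge0.
have g1 x : `|1 + g i x| <= 1 + b.
  by rewrite (le_trans (ler_normD _ _))// normr1 lerD2l.
split.
- apply: bdmM; last by apply: bdmD => //; exact: bdm_cst.
  apply: (bdm_comp (T := fun x => Defs.shift x i (v i x)) _ bF).
  by apply: measurable_shiftf => //; case: bv.
- by move=> x; rewrite pv pg; congr (_ * _); rewrite -pF fracP_shift_frac pF.
- by move=> x; rewrite normrM ler_pM.
move=> x y; set p := F _; set q := F (Defs.shift y _ _).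
have -> : p * (1 + g i x) - q * (1 + g i y) = (p - q) * (1 + g i x) + q * (g i x - g i y) by ring.
rewrite (le_trans (ler_normD _ _))// !normrM [leRHS]mulrDl lerD//.
  rewrite (_ : K * _ * _ * _ = K * ((1 + b) * dist1 x y) * (1 + b)); last by ring.
  rewrite ler_pM//.
  rewrite (le_trans (FK _ _))// ler_wpM2l// (le_trans (dist1_shift2 _ _ _ _ _))//.
  by rewrite mulrDl mul1r lerD2l.
by rewrite -mulrA ler_pM//; exact: FB.
Qed.

Lemma shears_lipb l F B K : 0 <= B -> 0 <= K -> lipb B K F ->
  exists B' K', [/\ 0 <= B', 0 <= K' & lipb B' K' (shears l F)].
Proof.
move=> B0 K0 lF; elim: l => [|i l [B' [K' [B'0 K'0 H]]]]; first by exists B, K.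
exists (B' * (1 + b)), (K' * (1 + b) * (1 + b) + B' * e); split => /=.
- by rewrite mulr_ge0// addr_ge0.
- by rewrite addr_ge0// !mulr_ge0// addr_ge0.
exact: (lipb_comp_shear i B'0 K'0 H).
Qed.

Lemma int_shears l F B K : 0 <= B -> 0 <= K -> lipb B K F ->
  \int[torm]_x shears l F x = \int[torm]_x F x.
Proof.
move=> B0 K0 lF; elim: l => [//|i l IH] /=.
have [B' [K' [_ _ H]]] := shears_lipb l B0 K0 lF.
by rewrite (shear_int Hmu H (lg i) (lv i) (vg i)).
Qed.

(** Each shear multiplies the previous error by [|1 + g| <= 2] and adds one more copy of the
    bracket, hence the factor [2^n - 1]. The part with [K] accounts for displacements evaluated at
    moved points, the part with [B] for the same shift in [g] and for products of two
    derivatives. *)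
Lemma shears_approx l F B K x : 0 <= B -> 0 <= K -> lipb B K F -> (size l <= d)%N ->
  `|shears l F x - F (moved l x x) * (1 + \sum_(i <- l) g i x)| <=
  (2 ^+ size l - 1) * (K * (2 * d%:R * (1 + d%:R) * (b * a)) + B * (d%:R * (e * a + b * b))).
Proof.
move=> B0 K0 lF; have [_ _ FB FK] := lF.
set Q := (X in _ <= _ * X).
have d0 : 0 <= d%:R :> R by [].
elim: l x => [|i l IH] x ld.
  by rewrite /= big_nil addr0 mulr1 subrr normr0 expr0 subrr mul0r.
have {}IH := IH (Defs.shift x i (v i x)) (ltnW ld).
rewrite big_cons [shears _ _ _]/= [moved _ _ _]/= [size _]/= exprS.
set x' := Defs.shift x i (v i x) in IH *.
set n := size l in ld IH *.
have nd : n%:R <= d%:R :> R by rewrite ler_nat ltnW.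
have n0 : 0 <= n%:R :> R by [].
have xx' : dist1 x' x <= a by rewrite dist1_shift; have [_ _ ->] := lv i.
have gb j y : `|g j y| <= b by have [_ _ ->] := lg j.
set t := shears l F x' in IH *; set S' := \sum_(j <- l) g j x' in IH *.
set S := \sum_(j <- l) g j x; set c := g i x.
set p := F (moved l x' x') in IH *; set q := F _.
have cb : `|c| <= b := gb i x.
have pq : `|p - q| <= K * (d%:R * (b * a)).
  rewrite /p /q -moved_shift (le_trans (FK _ _))// ler_wpM2l// (le_trans (moved_dist _ _ _ _))//.
  by rewrite ler_pM ?mulr_ge0 ?dist1_ge0// ler_wpM2l.
have sumle (f : 'I_d -> R) w : (forall j, `|f j| <= w) -> 0 <= w ->
    `|\sum_(j <- l) f j| <= d%:R * w.
  move=> fw w0; rewrite (le_trans (ler_norm_sum _ _ _))//.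
  apply: (@le_trans _ _ (\sum_(j <- l) w)); first by apply: ler_sum => j _.
  by rewrite big_const_seq count_predT iter_addr_0 -[w *+ _]mulr_natl ler_wpM2r.
have S'b : `|S'| <= d%:R * b by apply: sumle.
have SS : `|S' - S| <= d%:R * (e * a).
  rewrite /S' /S -sumrB; apply: sumle; last exact: mulr_ge0.
  move=> j; have [_ _ _ gK] := lg j.
  by rewrite (le_trans (gK _ _))// ler_wpM2l.
have -> : t * (1 + c) - q * (1 + (c + S)) =
    (t - p * (1 + S')) * (1 + c) + ((p - q) * ((1 + S') * (1 + c)) + q * ((S' - S) + S' * c)).
  by ring.
have c2 : `|1 + c| <= 2.
  by rewrite (le_trans (ler_normD _ _))// normr1; have := le_trans cb b1; lra.
have S2 : `|(1 + S') * (1 + c)| <= 2 * (1 + d%:R).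
  rewrite normrM mulrC ler_pM// (le_trans (ler_normD _ _))// normr1 lerD2l.
  by rewrite (le_trans S'b)// ler_piMr.
have -> : (2 * 2 ^+ n - 1) * Q = ((2 ^+ n - 1) * Q) * 2 + Q by ring.
rewrite (le_trans (ler_normD _ _))// lerD//; first by rewrite normrM ler_pM.
rewrite (le_trans (ler_normD _ _))// lerD//.
  rewrite normrM (_ : K * _ = K * (d%:R * (b * a)) * (2 * (1 + d%:R))); last by ring.
  by rewrite ler_pM.
rewrite normrM; apply: ler_pM => //; first exact: FB.
rewrite (le_trans (ler_normD _ _))// mulrDr lerD//.
by rewrite normrM mulrA ler_pM.
Qed.

Definition vecf (w : 'I_d -> P -> R) x : P := [tuple w i x | i < d].

Lemma moved_enum y x : moved (index_enum 'I_d) y x = padd y (vecf v x).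
Proof.
apply: eq_from_tnth => i; rewrite tnth_padd tnth_mktuple.
have E l : tnth (moved l y x) i = tnth y i + (count_mem i l)%:R * v i x.
  elim: l => [|j l IH] /=; first by rewrite mul0r addr0.
  rewrite tnth_shift IH -addrA; congr (_ + _); rewrite [i == j]eq_sym natrD mulrDl addrC.
  by congr (_ + _); case: eqP => [->|_]; rewrite ?mul1r ?mul0r.
by rewrite E count_uniq_mem ?index_enum_uniq// mem_index_enum mul1r.
Qed.

Lemma composite_shear F B K : 0 <= B -> 0 <= K -> lipb B K F ->
  `|\int[torm]_x (F (padd x (vecf v x)) * (1 + \sum_i g i x)) - \int[torm]_x F x| <=
  2 ^+ d * (K * (2 * d%:R * (1 + d%:R) * (b * a)) + B * (d%:R * (e * a + b * b))).
Proof.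
move=> B0 K0 lF; have [bF pF FB FK] := lF.
set Q := (X in 2 ^+ d * X).
have Q0 : 0 <= Q by rewrite addr_ge0// !mulr_ge0// ?addr_ge0// mulr_ge0.
have [B' [K' [_ _ [bS _ _ _]]]] := shears_lipb (index_enum 'I_d) B0 K0 lF.
have bP : bdm (fun x => F (padd x (vecf v x)) * (1 + \sum_i g i x)).
  apply: bdmM; last first.
    by apply: bdmD; [exact: bdm_cst|apply: bdm_sum => i; have [] := lg i].
  apply: (bdm_comp (T := fun x => padd x (vecf v x)) _ bF).
  apply: measurable_paddf => //; apply/measurable_fun_tnthP => i.
  rewrite (_ : _ \o _ = v i); last by apply/funext => x; rewrite /= tnth_mktuple.
  by have [[]] := lv i.
rewrite -(int_shears (index_enum 'I_d) B0 K0 lF) -intB//.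
have -> : 2 ^+ d * Q = 2 ^+ d * Q * fine (torm setT) by rewrite torm1 mulr1.
apply: int_normM; first exact: bdmB.
move=> x; have sd : size (index_enum 'I_d) = d.
  by rewrite [index_enum _]unlock -enumT size_enum_ord.
have := shears_approx (l := index_enum 'I_d) x B0 K0 lF.
rewrite sd leqnn => /(_ isT); rewrite moved_enum distrC => /le_trans; apply.
by rewrite ler_wpM2r// gerBl.
Qed.

End composite_shear.

(** * Time integrals of bounded fields *)

Section time_integrals.
Context {R : realType} {d : nat}.
Local Notation P := (d.-tuple R).
Implicit Types (x y z : P) (i j : 'I_d) (s t h B K M : R).

Definition jbdm (f : R -> P -> R) := bdm (fun q : R * P => f q.1 q.2).

Lemma jbdm_line f x : jbdm f -> bdm (fun s => f s x).
Proof.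
move=> bf; apply: (bdm_comp (T := fun s : R => (s, x)) _ bf).
exact: measurable_pair2.
Qed.

Lemma jbdm_slice f s : jbdm f -> bdm (f s).
Proof.
move=> bf; apply: (bdm_comp (T := fun x : P => (s, x)) _ bf).
exact: measurable_pair1.
Qed.

Lemma dist1_le x y K : (forall i, `|tnth x i - tnth y i| <= K) -> dist1 x y <= d%:R * K.
Proof.
move=> H; rewrite /dist1 -[d in d%:R]card_ord -sumr_const mulr_suml ler_sum// => i _.
by rewrite mul1r.
Qed.

Definition tint (f : R -> P -> R) t h x := \int[lebI t (t + h)]_s f s x.

Lemma bdm_tint f t h : jbdm f -> bdm (tint f t h).
Proof.
move=> bf; apply: (bdm_int (lebI t (t + h)) (f := fun q : P * R => f q.2 q.1)).
apply: (bdm_comp (T := fun q : P * R => (q.2, q.1)) _ bf).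
by apply/measurable_fun_pairP; split => /=; [exact: measurable_snd|exact: measurable_fst].
Qed.

Lemma lebI_normM (f : R -> R) t h M : 0 <= h -> bdm f -> (forall s, t <= s <= t + h -> `|f s| <= M) ->
  `|\int[lebI t (t + h)]_s f s| <= M * h.
Proof.
move=> h0 bf fM; have th : t <= t + h by rewrite lerDl.
have /le_trans := int_norm (lebI t (t + h)) bf; apply.
have -> : M * h = \int[lebI t (t + h)]_s M by rewrite int_cst lebI1// addrAC subrr add0r.
by apply: int_ae_le; [exact: bdm_norm|exact: bdm_cst|exact: lebI_ae].
Qed.

Lemma lipb_tint f t h B K : 0 <= h -> jbdm f -> (forall s, lipb B K (f s)) ->
  lipb (B * h) (K * h) (tint f t h).
Proof.
move=> h0 bf lf; split.
- exact: bdm_tint.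
- by move=> x; apply: eq_Rintegral => s _; have [_ ->] := lf s.
- move=> x; apply: lebI_normM => //; first exact: jbdm_line.
  by move=> s _; have [_ _ ->] := lf s.
move=> x y; rewrite /tint -intB; [|exact: jbdm_line..].
rewrite mulrAC; apply: lebI_normM => //; first by apply: bdmB; exact: jbdm_line.
by move=> s _; have [_ _ _ ->] := lf s.
Qed.

Lemma ipart_tint f f' j t h : jbdm f -> jbdm f' -> (forall s, ipart j (f s) (f' s)) ->
  ipart j (tint f t h) (tint f' t h).
Proof.
move=> bf bf' ff' x r r0; rewrite /tint -intB; [|exact: jbdm_line..].
have b2 : bdm (fun q : R * R => f' q.1 (Defs.shift x j q.2)).
  apply: (bdm_comp (T := fun q : R * R => (q.1, Defs.shift x j q.2)) _ bf').
  apply/measurable_fun_pairP; split => /=; first exact: measurable_fst.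
  by apply: (measurableT_comp (measurable_shift_line x j)); exact: measurable_snd.
rewrite -(int_fubini (lebI t (t + h)) (lebI 0 r) b2) /=.
by apply: eq_Rintegral => s _; rewrite ff'.
Qed.

Lemma jbdm_sum (I : Type) (r : seq I) (f : I -> R -> P -> R) : (forall i : I, jbdm (f i)) ->
  jbdm (fun s x => \sum_(i <- r) f i s x).
Proof.
move=> bf; elim: r => [|i r IH]; rewrite /jbdm.
  by under eq_fun do rewrite big_nil; exact: bdm_cst.
by under eq_fun do rewrite big_cons; exact: (bdmD (bf i) IH).
Qed.

Lemma tint_sum (f : 'I_d -> R -> P -> R) t h x : (forall i, jbdm (f i)) ->
  \sum_i tint (f i) t h x = tint (fun s x => \sum_i f i s x) t h x.
Proof. by move=> bf; rewrite /tint int_sum// => i; exact: jbdm_line. Qed.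

Lemma expR_quad (a : R) : `|a| <= 2^-1 -> `|expR a - 1 - a| <= 2 * a ^+ 2.
Proof.
move=> /[dup]; rewrite {1}ler_norml => /andP[a1 a2] _.
have h1 := expR_ge1Dx a; rewrite ger0_norm; last by lra.
have h2 := expR_ge1Dx (- a).
have a3 : 0 < 1 - a by lra.
have h3 : expR a <= (1 - a)^-1.
  by rewrite -[expR a]invrK lef_pV2 ?posrE ?invr_gt0 ?expR_gt0// -expRN.
suff : (1 - a)^-1 <= 1 + a + 2 * a ^+ 2 by lra.
rewrite -[leLHS]mul1r ler_pdivrMr//.
have : 0 <= a ^+ 2 * (1 - 2 * a) by rewrite mulr_ge0 ?sqr_ge0//; lra.
rewrite !expr2; nra.
Qed.

Lemma norm_prod_le (a b q w e1 e2 Pa J B x y : R) : `|a| <= Pa -> `|b| <= J -> `|q| <= B ->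
  `|w| <= J -> `|e1| <= x -> `|e2| <= y -> `|a * b + q * (w * (e1 + e2))| <= Pa * J + B * (J * (x + y)).
Proof.
move=> h1 h2 h3 h4 h5 h6; rewrite (le_trans (ler_normD _ _))// lerD ?normrM ?ler_pM//.
by rewrite (le_trans (ler_normD _ _))// lerD.
Qed.

End time_integrals.

(** Coefficient of [h^2] in the error of one time step: the term with [q] comes from the composition
    of shears, the term with [J] from freezing the position in the flow and linearising the
    exponential. *)
Definition step_const (R : realType) (q D ck M A A2 J : R) :=
  q * (2 * D * (1 + D) * (ck * M) + D * (A * M + ck * ck)) +
  J * (D * (ck * (D * M)) + (2 * M ^+ 2 + D * A2 * (D * M))).

Lemma step_const_ge0 (R : realType) (q D ck M A A2 J : R) : 0 <= q -> 0 <= D -> 0 <= ck ->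
  0 <= M -> 0 <= A -> 0 <= A2 -> 0 <= J -> 0 <= step_const q D ck M A A2 J.
Proof. by move=> *; rewrite /step_const !(addr_ge0, mulr_ge0, exprn_ge0). Qed.

Lemma wsum_le (R : realType) (K B a b : R) : 0 <= K -> 0 <= B -> 0 <= a -> 0 <= b ->
  K * a + B * b <= (K + B) * (a + b).
Proof. by move=> *; rewrite mulrDl !mulrDr lerD// ?lerDl ?lerDr mulr_ge0. Qed.

Lemma step_arith (R : realType) (q D ck M A A2 J h e K B ge se : R) :
  0 <= q -> 0 <= D -> 0 <= ck -> 0 <= M -> 0 <= A -> 0 <= A2 -> 0 <= J -> 0 <= h -> 0 <= e ->
  0 <= K -> 0 <= B ->
  q * (K * (2 * D * (1 + D) * (ck * h * (M * h))) + B * (D * (A * h * (M * h) + ck * h * (ck * h)))) +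
    B * ge + (J * (K * (D * ((e + ck * (D * (M * h))) * h)) +
    B * (2 * (M * h) ^+ 2 + D * A2 * (D * (M * h)) * h)) + B * J * se) <=
  (K + B) * (step_const q D ck M A A2 J * h + J * D * e) * h + B * (ge + J * se).
Proof.
move=> q0 D0 ck0 M0 A0 A20 J0 h0 e0 K0 B0; rewrite /step_const.
set a1 := 2 * D * (1 + D) * (ck * M); set b1 := D * (A * M + ck * ck).
set a2 := D * (ck * (D * M)); set b2 := 2 * M ^+ 2 + D * A2 * (D * M).
have a1p : 0 <= a1 by rewrite /a1 !(mulr_ge0, addr_ge0).
have b1p : 0 <= b1 by rewrite /b1 !(mulr_ge0, addr_ge0).
have a2p : 0 <= a2 by rewrite /a2 !(mulr_ge0, addr_ge0).
have b2p : 0 <= b2 by rewrite /b2 !(mulr_ge0, addr_ge0, exprn_ge0).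
have h1 : q * (K * a1 + B * b1) * (h * h) <= q * ((K + B) * (a1 + b1)) * (h * h).
  by rewrite ler_wpM2r ?mulr_ge0// ler_wpM2l// wsum_le.
have h2 : J * (K * a2 + B * b2) * (h * h) <= J * ((K + B) * (a2 + b2)) * (h * h).
  by rewrite ler_wpM2r ?mulr_ge0// ler_wpM2l// wsum_le.
have h3 : 0 <= B * (J * D * e * h) by rewrite !mulr_ge0.
have -> : (K + B) * ((q * (a1 + b1) + J * (a2 + b2)) * h + J * D * e) * h + B * (ge + J * se) =
  q * ((K + B) * (a1 + b1)) * (h * h) + J * ((K + B) * (a2 + b2)) * (h * h) +
  K * (J * D * e * h) + B * (J * D * e * h) + B * (ge + J * se) by ring.
apply: (@le_trans _ _ (q * (K * a1 + B * b1) * (h * h) + J * (K * a2 + B * b2) * (h * h) +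
  K * (J * D * e * h) + B * (ge + J * se))).
  by rewrite le_eqVlt; apply/orP; left; apply/eqP; rewrite /a1 /b1 /a2 /b2; ring.
by rewrite lerD2r; apply: ler_wpDr => //; rewrite lerD2r lerD.
Qed.

(** [B] feeds into [K] at rate [D A]; the weight [D A + 1] on [B] makes the combined quantity grow
    at a rate independent of [A]. *)
Lemma growth_arith (R : realType) (D ck M A h K B : R) : 0 <= D -> 0 <= ck -> 0 <= M -> 0 <= A ->
  0 <= h -> h <= 1 -> 0 <= K -> 0 <= B ->
  K * (1 + D * (ck * h)) * (1 + M * h) + B * (D * A * h) + (D * A + 1) * (B * (1 + M * h)) <=
  (K + (D * A + 1) * B) * (1 + (D * ck * (1 + M) + M + 1) * h).
Proof.
move=> D0 ck0 M0 A0 h0 h1 K0 B0; have h2 : 0 <= 1 - h by rewrite subr_ge0.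
rewrite -subr_ge0; set X := (X in 0 <= X).
have -> : X = K * h * (D * ck * M * (1 - h) + 1) + B * h * ((D * A + 1) * (D * ck * (1 + M)) + 1).
  by rewrite /X; ring.
by clear X; move: (1 - h) h2 => z h2; rewrite !(addr_ge0, mulr_ge0).
Qed.

Lemma iter_arith (R : realType) (n : nat) (h Q B E1 E2 x y N N' KB D2 : R) :
  0 <= h -> 0 <= Q -> 0 <= B -> 0 <= E2 -> 1 <= x -> 1 <= y -> N' <= N * x -> KB <= N -> 0 <= KB ->
  D2 <= n%:R * x ^+ n * N' * Q * h + y ^+ n * (B * y) * E1 ->
  D2 + KB * Q * h + B * E2 <= n.+1%:R * x ^+ n.+1 * N * Q * h + y ^+ n.+1 * B * (E1 + E2).
Proof.
move=> h0 Q0 B0 E20 x1 y1 NN KN KB0 HD.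
have x0 : 0 <= x by rewrite (le_trans ler01).
have xn : 0 <= n%:R * x ^+ n by rewrite mulr_ge0// exprn_ge0.
have i1 : n%:R * x ^+ n * N' * Q * h <= n%:R * x ^+ n * (N * x) * Q * h.
  by rewrite !ler_wpM2r// ler_wpM2l.
have i2 : KB * Q * h <= x ^+ n.+1 * N * Q * h.
  rewrite !ler_wpM2r// (le_trans KN)// ler_peMl ?exprn_ege1//.
  exact: le_trans KN.
have i3 : B * E2 <= y ^+ n.+1 * (B * E2) by rewrite ler_peMl ?mulr_ge0// exprn_ege1.
have -> : n.+1%:R * x ^+ n.+1 * N * Q * h + y ^+ n.+1 * B * (E1 + E2) =
  n%:R * x ^+ n * (N * x) * Q * h + y ^+ n * (B * y) * E1 + x ^+ n.+1 * N * Q * h + y ^+ n.+1 * (B * E2).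
  by rewrite -[n.+1%:R]natr1 !exprS; ring.
by rewrite lerD// lerD//; apply: (le_trans HD); rewrite lerD2r.
Qed.

Lemma dist_chain (R : realType) (i1 i2 i3 i4 a b : R) : `|i1 - i2| <= a -> `|i3 - i4| <= b ->
  `|i1 - i4| <= `|i2 - i3| + (b + a).
Proof.
move=> h1 h2; have -> : i1 - i4 = (i2 - i3) + ((i3 - i4) + (i1 - i2)) by ring.
by rewrite (le_trans (ler_normD _ _))// lerD2l (le_trans (ler_normD _ _))// lerD.
Qed.

Lemma int_dist_ae (R : realType) d (Z : measurableType d) (m : {finite_measure set Z -> \bar R})
    (f g w : Z -> R) (a b : R) : fine (m setT) = 1 -> bdm f -> bdm g -> bdm w ->
  {ae m, forall z, `|f z - g z| <= a + b * w z} ->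
  `|\int[m]_z f z - \int[m]_z g z| <= a + b * \int[m]_z w z.
Proof.
move=> m1 bf bg bw H; have bZ := bdmZ b bw.
rewrite -intB// (le_trans (int_norm _ (bdmB bf bg)))//.
rewrite -intZ// -[a]mulr1 -m1 -int_cst -intD//; last exact: bdm_cst.
by apply: int_ae_le H; [exact/bdm_norm/bdmB|apply: bdmD => //; exact: bdm_cst].
Qed.

(** * One-step error of the Jacobian formula and its iteration *)

Section jacobian_scheme.
Context {R : realType} {d : nat}.
Local Notation P := (d.-tuple R).
Variable mu : {measure set P -> \bar R}.
Hypothesis Hmu : is_lebesgue_Rd mu.
Implicit Types (x y z : P) (i j : 'I_d) (s t h B K : R) (k m n : nat) (F : P -> R).
Local Notation torm := (torm Hmu).

Variables (T M c L : R) (A eta : nat -> R) (V G : nat -> 'I_d -> R -> P -> R)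
  (U : 'I_d -> R -> P -> R) (g sigma : R -> P -> R) (X : R -> P -> P).

Hypotheses (M0 : 0 <= M) (c0 : 0 <= c) (L0 : 0 <= L) (A0 : forall k, 0 <= A k)
  (eta0 : forall k, 0 <= eta k).

(* [V k] approximates the field [U] with error [eta k], [G k i] is the [i]-th
   derivative of the [i]-th component of [V k], and [c * k] is the logarithmic growth
   coming from BMO; [A k] may grow arbitrarily, as it multiplies only terms that are
   quadratic in the time step. *)
Definition smooth_field := [/\
  forall k i, jbdm (V k i) /\ forall s, lipb M (c * k%:R) (V k i s),
  forall k i, jbdm (G k i) /\ forall s, lipb (c * k%:R) (A k) (G k i s),
  forall k i s, ipart i (V k i s) (G k i s),
  forall k s x, `|\sum_i G k i s x| <= M &
  (forall i, jbdm (U i)) /\ forall k i s x, `|U i s x - V k i s x| <= eta k /\ `|U i s x| <= M].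

Definition flow_of := [/\ measurable_fun setT (fun q : R * P => X q.1 q.2),
  {ae torm, forall y, X 0 y = y},
  {ae torm, forall y, forall i s h, 0 <= s -> 0 <= h -> s + h <= T ->
     tnth (X (s + h) y) i - tnth (X s y) i = \int[lebI s (s + h)]_r U i r (X r y)} &
  forall t, 0 <= t <= T -> forall f : P -> R, bdm f -> per f -> (forall x, 0 <= f x) ->
     \int[torm]_y f (X t y) <= L * \int[torm]_x f x].

Hypotheses (HV : smooth_field) (HX : flow_of).
Hypotheses (bsig : jbdm sigma) (sigM : forall s y, `|sigma s y| <= M).

Definition gapp k s x := \sum_i G k i s x.
Definition jac t y := expR (\int[lebI 0 t]_s sigma s y).
Definition jmax := expR (M * T).
(** Failure of the Jacobian formula for the observable [F]; it is followed backwards in time by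
    transporting the observable. *)
Definition defect t F := \int[torm]_y (F (X t y) * jac t y) - \int[torm]_x F x.

Lemma jbdm_gapp k : jbdm (gapp k).
Proof. by apply: jbdm_sum => i; case: HV => _ /(_ k i)[]. Qed.

Lemma lipb_gapp k s : lipb M (d%:R * A k) (gapp k s).
Proof.
have [_ HG _ GM _] := HV; split.
- exact: jbdm_slice (jbdm_gapp k).
- by move=> x; apply: eq_bigr => i _; have [_ /(_ s)[_ -> _]] := HG k i.
- by move=> x; exact: GM.
move=> x y; rewrite /gapp -sumrB (le_trans (ler_norm_sum _ _ _))//.
apply: (@le_trans _ _ (\sum_(i < d) A k * dist1 x y)).
  by apply: ler_sum => i _; have [_ /(_ s)[_ _ _ ->]] := HG k i.
by rewrite sumr_const card_ord -[_ *+ d]mulr_natl mulrA.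
Qed.

Lemma jbdm_flow f : jbdm f -> jbdm (fun s y => f s (X s y)).
Proof.
have [mX _ _ _] := HX; move=> bf.
apply: (bdm_comp (T := fun q : R * P => (q.1, X q.1 q.2)) _ bf).
by apply/measurable_fun_pairP; split => //=; exact: measurable_fst.
Qed.

Lemma bdm_flow F t : bdm F -> bdm (fun y => F (X t y)).
Proof.
have [mX _ _ _] := HX; move=> bF; apply: (bdm_comp (T := X t) _ bF).
exact: (measurableT_comp mX (measurable_pair1 t)).
Qed.

Lemma jac_gt0 t y : 0 < jac t y.
Proof. exact: expR_gt0. Qed.

Lemma jac_le t y : 0 <= t <= T -> jac t y <= jmax.
Proof.
move=> /andP[t0 tT]; rewrite /jac /jmax ler_expR.
have := lebI_normM (t := 0) t0 (jbdm_line y bsig) (fun s _ => sigM s y).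
rewrite add0r => /(le_trans (ler_norm _)) /le_trans; apply.
by rewrite ler_wpM2l.
Qed.

Lemma bdm_jac t : 0 <= t <= T -> bdm (jac t).
Proof.
move=> tT; split; last first.
  by exists jmax => y; rewrite ger0_norm ?jac_le// ltW ?jac_gt0.
apply: measurableT_comp; first exact: measurable_expR.
by have [] := bdm_tint 0 t bsig; rewrite /tint add0r.
Qed.

Lemma jacD t h y : 0 <= t -> 0 <= h -> jac (t + h) y = jac t y * expR (tint sigma t h y).
Proof.
move=> t0 h0; rewrite /jac -expRD; congr expR; apply: lebI_cat => //.
  exact: jbdm_line.
by rewrite lerDl.
Qed.

Definition good y := forall i s h, 0 <= s -> 0 <= h -> s + h <= T ->
     tnth (X (s + h) y) i - tnth (X s y) i = \int[lebI s (s + h)]_r U i r (X r y).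

Lemma flow_lip y t h : good y -> 0 <= t -> 0 <= h -> t + h <= T ->
  dist1 (X (t + h) y) (X t y) <= d%:R * (M * h).
Proof.
move=> gy t0 h0 thT; apply: dist1_le => i; rewrite gy//.
have [_ _ _ _ [bU UVM]] := HV.
have bUX : bdm (fun s => U i s (X s y)) by exact: (jbdm_line y (jbdm_flow (bU i))).
apply: lebI_normM => //.
by move=> s _; have [_ ->] := UVM 0%N i s (X s y).
Qed.

(** One time step with the position frozen in the field: close to the flow and, by
    [composite_shear], nearly a change of variables with density [1 + tint (gapp k)]. *)
Definition coarse k t h x := padd x (vecf (fun i => tint (V k i) t h) x).

Lemma flow_coarse k y t h : good y -> 0 <= t -> 0 <= h -> t + h <= T ->
  dist1 (X (t + h) y) (coarse k t h (X t y)) <= d%:R * ((eta k + c * k%:R * (d%:R * (M * h))) * h).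
Proof.
move=> gy t0 h0 thT; apply: dist1_le => i; rewrite tnth_padd tnth_mktuple opprD addrA gy//.
have [HVk _ _ _ [bU UVM]] := HV; have [bV lV] := HVk k i.
have bUX : bdm (fun s => U i s (X s y)) by exact: (jbdm_line y (jbdm_flow (bU i))).
have bVX : bdm (fun s => V k i s (X t y)) by exact: jbdm_line.
rewrite /tint -intB//; apply: lebI_normM => //; first exact: bdmB.
move=> s /andP[ts sth]; have [h1 _] := UVM k i s (X s y).
have [_ _ _ h2] := lV s.
rewrite -(subrKA (V k i s (X s y))) (le_trans (ler_normD _ _))// lerD// (le_trans (h2 _ _))//.
rewrite ler_wpM2l ?mulr_ge0//.
have st0 : 0 <= s - t by rewrite subr_ge0.
have := @flow_lip y t (s - t) gy t0 st0; rewrite subrKC => /(_ (le_trans sth thT)) /le_trans; apply.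
by rewrite !ler_wpM2l// lerBlDl.
Qed.

(** The cost of using the divergence of level [m] in place of that of level [k]. *)
Definition gerr k m t h :=
  \int[lebI t (t + h)]_s \int[torm]_x `|gapp k s x - gapp m s x|.

(** The cost of using the divergence of level [m] along the flow in place of [sigma]. *)
Definition serr m t h :=
  \int[lebI t (t + h)]_s \int[torm]_y `|sigma s y - gapp m s (X s y)|.

(** The displacement uses level [k] but the density uses level [m]: otherwise the uncontrolled [A k]
    would enter the Lipschitz constant of the observable at first order in [h]. With [m] fixed only
    the constant [A m] does. *)
Definition pull k m t h F x := F (coarse k t h x) * (1 + tint (gapp m) t h x).

Lemma jbdm_gerr k m : jbdm (fun s x => `|gapp k s x - gapp m s x|).
Proof. by apply: bdm_norm; apply: bdmB; exact: jbdm_gapp. Qed.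

Lemma jbdm_serr m : jbdm (fun s y => `|sigma s y - gapp m s (X s y)|).
Proof. by apply: bdm_norm; apply: bdmB => //; apply: jbdm_flow; exact: jbdm_gapp. Qed.

Lemma int_tint f t h : jbdm f ->
  \int[lebI t (t + h)]_s \int[torm]_x f s x = \int[torm]_x tint f t h x.
Proof. by move=> bf; exact: (int_fubini (lebI t (t + h)) torm bf). Qed.

Lemma lipb_tV k i t h : 0 <= h -> lipb (M * h) (c * k%:R * h) (tint (V k i) t h).
Proof. by move=> h0; have [/(_ k i)[bV lV] _ _ _ _] := HV; exact: lipb_tint. Qed.

Lemma lipb_tG k i t h : 0 <= h -> lipb (c * k%:R * h) (A k * h) (tint (G k i) t h).
Proof. by move=> h0; have [_ /(_ k i)[bG lG] _ _ _] := HV; exact: lipb_tint. Qed.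

Lemma lipb_tgapp m t h : 0 <= h -> lipb (M * h) (d%:R * A m * h) (tint (gapp m) t h).
Proof. by move=> h0; apply: lipb_tint => //; [exact: jbdm_gapp|exact: lipb_gapp]. Qed.

Lemma coarse_dist k t h x y : 0 <= h ->
  dist1 (coarse k t h x) (coarse k t h y) <= (1 + d%:R * (c * k%:R * h)) * dist1 x y.
Proof.
move=> h0; apply: (@le_trans _ _ (dist1 x y + d%:R * (c * k%:R * h * dist1 x y))); last first.
  by rewrite mulrDl mul1r mulrA.
apply: (le_trans (dist1_tri _ (padd y (vecf (fun i => tint (V k i) t h) x)) _)).
rewrite dist1_padd lerD// [padd y _]paddC [coarse k t h y]paddC dist1_padd.
apply: dist1_le => i; rewrite !tnth_mktuple.
by have [_ _ _ ->] := lipb_tV k i t h0.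
Qed.

Lemma coarse_per k t h x : fracP (coarse k t h (fracP x)) = fracP (coarse k t h x).
Proof.
have E : vecf (fun i => tint (V k i) t h) (fracP x) = vecf (fun i => tint (V k i) t h) x.
  apply: eq_from_tnth => i; rewrite !tnth_mktuple; apply: eq_Rintegral => s _.
  by have [/(_ k i)[_ /(_ s)[_ -> _ _]]] := HV.
by rewrite /coarse E fracP_padd_frac.
Qed.

Lemma bdm_coarse k t h F : bdm F -> bdm (fun x => F (coarse k t h x)).
Proof.
move=> bF; apply: (bdm_comp (T := coarse k t h) _ bF).
apply: measurable_paddf => //; apply/measurable_fun_tnthP => i.
rewrite (_ : _ \o _ = tint (V k i) t h); last by apply/funext => x; rewrite /= tnth_mktuple.
have [/(_ k i)[bV _] _ _ _ _] := HV.
by have [] := bdm_tint t h bV.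
Qed.

Lemma lipb_pull k m t h F B K : 0 <= h -> 0 <= B -> 0 <= K -> lipb B K F ->
  lipb (B * (1 + M * h))
    (K * (1 + d%:R * (c * k%:R * h)) * (1 + M * h) + B * (d%:R * A m * h)) (pull k m t h F).
Proof.
move=> h0 B0 K0 [bF pF FB FK].
have [bH pH HB HK] := lipb_tgapp m t h0.
have M1 : 0 <= 1 + M * h by rewrite addr_ge0// mulr_ge0.
have H1 x : `|1 + tint (gapp m) t h x| <= 1 + M * h.
  by rewrite (le_trans (ler_normD _ _))// normr1 lerD2l.
split.
- by apply: bdmM; [exact: bdm_coarse|apply: bdmD => //; exact: bdm_cst].
- by move=> x; rewrite /pull pH; congr (_ * _); rewrite -pF coarse_per pF.
- by move=> x; rewrite normrM ler_pM.
move=> x y; rewrite /pull; set p := F _; set q := F (coarse k t h y).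
set a := tint _ _ _ x; set b := tint _ _ _ y.
have -> : p * (1 + a) - q * (1 + b) = (p - q) * (1 + a) + q * (a - b) by ring.
rewrite (le_trans (ler_normD _ _))// !normrM [leRHS]mulrDl lerD//.
  rewrite (_ : K * _ * _ * _ = K * ((1 + d%:R * (c * k%:R * h)) * dist1 x y) * (1 + M * h)); last by ring.
  apply: ler_pM; [by []|by []| |exact: H1]; apply: (le_trans (FK _ _)).
  by rewrite ler_wpM2l// coarse_dist.
by rewrite -mulrA; apply: ler_pM => //; [exact: FB|exact: HK].
Qed.

(** [composite_shear] applies with the density of level [k]; exchanging it for level [m] costs
    [gerr]. *)
Lemma pull_int k m t h F B K : 0 <= h -> c * k%:R * h <= 1 -> 0 <= B -> 0 <= K -> lipb B K F ->
  `|\int[torm]_x pull k m t h F x - \int[torm]_x F x| <=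
  2 ^+ d * (K * (2 * d%:R * (1 + d%:R) * (c * k%:R * h * (M * h))) +
    B * (d%:R * (A k * h * (M * h) + c * k%:R * h * (c * k%:R * h)))) + B * gerr k m t h.
Proof.
move=> h0 ckh B0 K0 lF; have [bF pF FB FK] := lF.
have [_ HG VG _ _] := HV.
have bG i : jbdm (G k i) by case: (HG k i).
have ck0 : 0 <= c * k%:R * h by rewrite !mulr_ge0.
have VGt i : ipart i (tint (V k i) t h) (tint (G k i) t h).
  by apply: ipart_tint => //; case: HV => /(_ k i)[].
have := composite_shear Hmu (fun i => lipb_tV k i t h0) (fun i => lipb_tG k i t h0) VGt
  (mulr_ge0 M0 h0) ck0 ckh (mulr_ge0 (A0 k) h0) B0 K0 lF.
set I1 := Rintegral _ _ _ => H.
have [bp _ _ _] := lipb_pull k m t h0 B0 K0 lF.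
have bk := bdm_tint t h (jbdm_gapp k); have bm := bdm_tint t h (jbdm_gapp m).
have I1E : I1 = \int[torm]_x (F (coarse k t h x) * (1 + tint (gapp k) t h x)).
  by apply: eq_Rintegral => x _; rewrite tint_sum.
have bI1 : bdm (fun x => F (coarse k t h x) * (1 + tint (gapp k) t h x)).
  by apply: bdmM; [exact: bdm_coarse|apply: bdmD => //; exact: bdm_cst].
rewrite -(subrKA I1) addrC (le_trans (ler_normD _ _))// lerD//.
rewrite I1E -intB// (le_trans (int_norm _ (bdmB bp bI1)))//.
rewrite /gerr (int_tint t h (jbdm_gerr k m)) -intZ; last exact: bdm_tint (jbdm_gerr k m).
apply: int_le; [exact/bdm_norm/bdmB|apply: bdmZ; exact: bdm_tint (jbdm_gerr k m)|].
move=> x; rewrite /pull -mulrBr normrM; apply: ler_pM => //.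
rewrite opprD addrACA subrr add0r distrC /tint -intB; [|exact: jbdm_line (jbdm_gapp _)..].
by apply: int_norm; apply: bdmB; exact: jbdm_line (jbdm_gapp _).
Qed.

Lemma jac_pull m k t h y F B K : 0 <= t -> 0 <= h -> t + h <= T -> M * h <= 2^-1 ->
  0 <= B -> 0 <= K -> lipb B K F -> good y ->
  `|F (X (t + h) y) * jac (t + h) y - pull k m t h F (X t y) * jac t y| <=
  jmax * (K * (d%:R * ((eta k + c * k%:R * (d%:R * (M * h))) * h)) +
    B * (2 * (M * h) ^+ 2 + d%:R * A m * (d%:R * (M * h)) * h)) +
  B * jmax * tint (fun s y => `|sigma s y - gapp m s (X s y)|) t h y.
Proof.
move=> t0 h0 thT Mh B0 K0 [bF pF FB FK] gy.
have tT : t <= T by rewrite (le_trans _ thT)// lerDl.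
rewrite /pull; set p := F (X _ _); set q := F (coarse _ _ _ _); set H := tint _ _ _ (X t y).
set S := tint _ _ _ y.
have j1 : `|jac (t + h) y| <= jmax.
  by rewrite ger0_norm ?jac_le// ?addr_ge0// ltW ?jac_gt0.
have j2 : `|jac t y| <= jmax by rewrite ger0_norm ?jac_le ?t0// ltW ?jac_gt0.
have pq : `|p - q| <= K * (d%:R * ((eta k + c * k%:R * (d%:R * (M * h))) * h)).
  by rewrite (le_trans (FK _ _))// ler_wpM2l// flow_coarse.
set Sg := tint sigma t h y; set E := expR Sg.
have -> : p * jac (t + h) y - q * (1 + H) * jac t y =
    (p - q) * jac (t + h) y + q * (jac t y * ((E - 1 - Sg) + (Sg - H))).
  by rewrite jacD// -/Sg -/E; ring.
have Sg1 : `|Sg| <= M * h.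
  by apply: lebI_normM => //; exact: jbdm_line.
have h1 : `|E - 1 - Sg| <= 2 * (M * h) ^+ 2.
  rewrite (le_trans (expR_quad (le_trans Sg1 Mh)))// ler_wpM2l// -[Sg ^+ 2]real_normK ?num_real//.
  by rewrite lerXn2r ?nnegrE// mulr_ge0.
have bs : bdm (fun s => sigma s y) by exact: jbdm_line.
have bgX : bdm (fun s => gapp m s (X s y)) := jbdm_line y (jbdm_flow (jbdm_gapp m)).
have bgt : bdm (fun s => gapp m s (X t y)) := jbdm_line (X t y) (jbdm_gapp m).
have h2 : `|Sg - H| <= S + d%:R * A m * (d%:R * (M * h)) * h.
  have -> : Sg - H = \int[lebI t (t + h)]_s (sigma s y - gapp m s (X s y)) +
      \int[lebI t (t + h)]_s (gapp m s (X s y) - gapp m s (X t y)).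
    by rewrite !intB//; rewrite subrKA.
  rewrite (le_trans (ler_normD _ _))// lerD//; first by apply: int_norm; exact: bdmB.
  apply: lebI_normM => //; first exact: bdmB.
  move=> s /andP[ts sth]; have [_ _ _ h2] := lipb_gapp m s.
  rewrite (le_trans (h2 _ _))// ler_wpM2l ?mulr_ge0//.
  have st0 : 0 <= s - t by rewrite subr_ge0.
  have := @flow_lip y t (s - t) gy t0 st0; rewrite subrKC => /(_ (le_trans sth thT)) /le_trans; apply.
  by rewrite !ler_wpM2l// lerBlDl.
have J0 : 0 <= jmax by exact: expR_ge0.
have -> : jmax * (K * (d%:R * ((eta k + c * k%:R * (d%:R * (M * h))) * h)) +
    B * (2 * (M * h) ^+ 2 + d%:R * A m * (d%:R * (M * h)) * h)) + B * jmax * S =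
  K * (d%:R * ((eta k + c * k%:R * (d%:R * (M * h))) * h)) * jmax +
  B * (jmax * (2 * (M * h) ^+ 2 + (S + d%:R * A m * (d%:R * (M * h)) * h))) by ring.
exact: (norm_prod_le pq j1 (FB _) j2 h1 h2).
Qed.

Definition Wc k m := step_const (2 ^+ d) d%:R (c * k%:R) M (A k) (A m) jmax.

Hypothesis good_ae : {ae torm, forall y, good y}.

Lemma jmax_ge0 : 0 <= jmax. Proof. exact: expR_ge0. Qed.

Lemma Wc_ge0 k m : 0 <= Wc k m.
Proof. by apply: step_const_ge0; rewrite ?exprn_ge0 ?mulr_ge0 ?jmax_ge0. Qed.

Lemma defect_step k m t h F B K : 0 <= t -> 0 <= h -> t + h <= T -> M * h <= 2^-1 ->
  c * k%:R * h <= 1 -> 0 <= B -> 0 <= K -> lipb B K F ->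
  `|defect (t + h) F| <= `|defect t (pull k m t h F)| +
    (K + B) * (Wc k m * h + jmax * d%:R * eta k) * h + B * (gerr k m t h + jmax * serr m t h).
Proof.
move=> t0 h0 thT Mh ckh B0 K0 lF; have [bF _ _ _] := lF.
have J0 := jmax_ge0.
have tT : 0 <= t <= T by rewrite t0 (le_trans _ thT)// lerDl.
have thT2 : 0 <= t + h <= T by rewrite thT addr_ge0.
have [bp _ _ _] := lipb_pull k m t h0 B0 K0 lF.
have H1 := pull_int m t h0 ckh B0 K0 lF.
have b1 : bdm (fun y => F (X (t + h) y) * jac (t + h) y).
  by apply: bdmM; [exact: bdm_flow|exact: bdm_jac].
have b2 : bdm (fun y => pull k m t h F (X t y) * jac t y).
  by apply: bdmM; [exact: bdm_flow|exact: bdm_jac].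
set cst := jmax * (K * (d%:R * ((eta k + c * k%:R * (d%:R * (M * h))) * h)) +
    B * (2 * (M * h) ^+ 2 + d%:R * A m * (d%:R * (M * h)) * h)).
have H2 : `|\int[torm]_y (F (X (t + h) y) * jac (t + h) y) -
    \int[torm]_y (pull k m t h F (X t y) * jac t y)| <= cst + B * jmax * serr m t h.
  have pw : {ae torm, forall y, `|F (X (t + h) y) * jac (t + h) y -
      pull k m t h F (X t y) * jac t y| <=
      cst + B * jmax * tint (fun s y => `|sigma s y - gapp m s (X s y)|) t h y}.
    by apply: filterS good_ae => y gy; exact: jac_pull gy.
  rewrite /serr (int_tint t h (jbdm_serr m)).
  exact: (int_dist_ae (torm1 Hmu) b1 b2 (bdm_tint t h (jbdm_serr m)) pw).
have H3 := @step_arith _ (2 ^+ d) d%:R (c * k%:R) M (A k) (A m) jmax h (eta k) K B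
  (gerr k m t h) (serr m t h).
rewrite -addrA; apply: (le_trans (dist_chain H2 H1)); rewrite lerD2l.
by apply: H3; rewrite ?exprn_ge0 ?mulr_ge0.
Qed.

Lemma gerr_ge0 k m t h : 0 <= gerr k m t h.
Proof. by apply: int_ge0 => s; apply: int_ge0 => x. Qed.

Lemma serr_ge0 m t h : 0 <= serr m t h.
Proof. by apply: int_ge0 => s; apply: int_ge0 => x. Qed.

Lemma gerrD k m t a b : 0 <= a -> 0 <= b ->
  gerr k m t (a + b) = gerr k m t a + gerr k m (t + a) b.
Proof.
move=> a0 b0; rewrite /gerr addrA; apply: lebI_cat; rewrite ?lerDl//.
exact: (bdm_int torm (jbdm_gerr k m)).
Qed.

Lemma serrD m t a b : 0 <= a -> 0 <= b ->
  serr m t (a + b) = serr m t a + serr m (t + a) b.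
Proof.
move=> a0 b0; rewrite /serr addrA; apply: lebI_cat; rewrite ?lerDl//.
exact: (bdm_int torm (jbdm_serr m)).
Qed.

(** Errors quadratic in [h] are multiplied by the number of steps, while [gerr] and [serr] are
    additive in time and add up to their value over the whole interval. *)
Lemma defect_iter k m t h n F B K : 0 <= t -> 0 <= h -> h <= 1 -> M * h <= 2^-1 ->
  c * k%:R * h <= 1 ->
  (forall F B K, 0 <= B -> 0 <= K -> lipb B K F -> defect t F = 0) ->
  t + n%:R * h <= T -> 0 <= B -> 0 <= K -> lipb B K F ->
  `|defect (t + n%:R * h) F| <=
    n%:R * (1 + (d%:R * (c * k%:R) * (1 + M) + M + 1) * h) ^+ n * (K + (d%:R * A m + 1) * B) *
      (Wc k m * h + jmax * d%:R * eta k) * h +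
    (1 + M * h) ^+ n * B * (gerr k m t (n%:R * h) + jmax * serr m t (n%:R * h)).
Proof.
move=> t0 h0 h1 Mh ckh D0.
set al := d%:R * (c * k%:R) * (1 + M) + M + 1; set A' := d%:R * A m + 1.
set Q := Wc k m * h + jmax * d%:R * eta k.
have J0 := jmax_ge0.
have Q0 : 0 <= Q by rewrite addr_ge0 ?mulr_ge0// Wc_ge0.
have al0 : 0 <= al by rewrite /al !(addr_ge0, mulr_ge0).
have A'1 : 1 <= A' by rewrite /A' lerDr mulr_ge0.
elim: n F B K => [|n IH] F B K tT B0 K0 lF.
  rewrite !mul0r addr0 (D0 F B K)// normr0 add0r expr0 mul1r mulr_ge0// addr_ge0 ?mulr_ge0//.
    exact: gerr_ge0.
  exact: serr_ge0.
have nh0 : 0 <= n%:R * h by rewrite mulr_ge0.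
have nS : n.+1%:R * h = n%:R * h + h by rewrite -natr1 mulrDl mul1r.
rewrite nS in tT *.
have tn0 : 0 <= t + n%:R * h by rewrite addr_ge0.
have tT' : t + n%:R * h + h <= T by rewrite -addrA.
have tnT : t + n%:R * h <= T by rewrite (le_trans _ tT')// lerDl.
have B'0 : 0 <= B * (1 + M * h) by rewrite mulr_ge0// addr_ge0// mulr_ge0.
have K'0 : 0 <= K * (1 + d%:R * (c * k%:R * h)) * (1 + M * h) + B * (d%:R * A m * h).
  by rewrite !(addr_ge0, mulr_ge0).
have := IH _ _ _ tnT B'0 K'0 (lipb_pull k m (t + n%:R * h) h0 B0 K0 lF).
have := defect_step m tn0 h0 tT' Mh ckh B0 K0 lF.
rewrite addrA gerrD// serrD// -/Q.
set e1 := gerr k m t _; set e2 := serr m t _; set e3 := gerr k m _ h; set e4 := serr m _ h.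
set N := K + A' * B.
set N' := K * (1 + d%:R * (c * k%:R * h)) * (1 + M * h) + B * (d%:R * A m * h) + A' * (B * (1 + M * h)).
move=> H1 H2; apply: (le_trans H1).
have NN : N' <= N * (1 + al * h) by apply: growth_arith; rewrite ?mulr_ge0.
have KN : K + B <= N by rewrite lerD2l ler_peMl.
have x1 : 1 <= 1 + al * h by rewrite lerDl mulr_ge0.
have y1 : 1 <= 1 + M * h by rewrite lerDl mulr_ge0.
have E2 : 0 <= e3 + jmax * e4.
  by rewrite addr_ge0 ?mulr_ge0//; [exact: gerr_ge0|exact: serr_ge0].
have := iter_arith (n := n) h0 Q0 B0 E2 x1 y1 NN KN (addr_ge0 K0 B0) H2.
move=> /le_trans; apply.
by rewrite [jmax * (e2 + e4)]mulrDr [e1 + e3 + _]addrACA.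
Qed.

End jacobian_scheme.

Lemma int_ae_leD (R : realType) d (Z : measurableType d) (m : {finite_measure set Z -> \bar R})
    (f g h : Z -> R) : bdm f -> bdm g -> bdm h -> {ae m, forall z, f z <= g z + h z} ->
  \int[m]_z f z <= \int[m]_z g z + \int[m]_z h z.
Proof. by move=> bf bg bh H; rewrite -intD//; apply: int_ae_le => //; exact: bdmD. Qed.

(** * Limit of the scheme *)

Section jacobian.
Context {R : realType} {d : nat}.
Local Notation P := (d.-tuple R).
Variable mu : {measure set P -> \bar R}.
Hypothesis Hmu : is_lebesgue_Rd mu.
Implicit Types (x y z : P) (i j : 'I_d) (s t h B K : R) (k m n : nat) (F : P -> R).
Local Notation torm := (torm Hmu).
Local Notation avg := (avg Hmu).

Variables (T M c L E0 : R) (A eta : nat -> R) (V G : nat -> 'I_d -> R -> P -> R)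
  (U : 'I_d -> R -> P -> R) (g sigma : R -> P -> R) (X : R -> P -> P).

Hypotheses (M0 : 0 <= M) (c0 : 0 <= c) (L0 : 0 <= L) (A0 : forall k, 0 <= A k)
  (E00 : 0 <= E0) (T0 : 0 <= T).
Hypothesis etaE : forall k, eta k = E0 * ((k%:R + 2) * rk k).
Hypotheses (HV : smooth_field M c A eta V G U) (HX : flow_of Hmu T L U X).
Hypotheses (bsig : jbdm sigma) (sigM : forall s y, `|sigma s y| <= M).
Hypotheses (bg : jbdm g) (pg : forall s, per (g s)).

Local Notation jac := (jac sigma).
Local Notation jmax := (jmax T M).
Local Notation defect := (defect Hmu sigma X).
Local Notation gapp := (gapp G).

Definition gdist k := \int[lebI 0 T]_s \int[torm]_x `|gapp k s x - g s x|.

Hypothesis gdist_cvg : gdist @ \oo --> 0.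
Hypothesis gsig : \int[lebI 0 T]_s \int[torm]_y `|g s (X s y) - sigma s y| = 0.

Lemma eta_pos k : 0 <= eta k.
Proof. by rewrite etaE !mulr_ge0 ?addr_ge0 ?rk_ge0. Qed.

Lemma lebI_sub (f : R -> R) t h : bdm f -> (forall s, 0 <= f s) -> 0 <= t -> 0 <= h -> t + h <= T ->
  \int[lebI t (t + h)]_s f s <= \int[lebI 0 T]_s f s.
Proof.
move=> bf f0 t0 h0 thT; have th : t <= t + h by rewrite lerDl.
rewrite (lebI_cat bf t0 (le_trans th thT)) (lebI_cat bf th thT) addrCA lerDl.
by rewrite addr_ge0// int_ge0.
Qed.

Lemma jbdm_gdist k : jbdm (fun s x => `|gapp k s x - g s x|).
Proof. by apply: bdm_norm; apply: bdmB => //; exact: (jbdm_gapp HV). Qed.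

Lemma gdist_ge0 k : 0 <= gdist k.
Proof. by apply: int_ge0 => s; apply: int_ge0 => x. Qed.

Lemma gerr_le k m t h : 0 <= t -> 0 <= h -> t + h <= T ->
  gerr Hmu G k m t h <= gdist k + gdist m.
Proof.
move=> t0 h0 thT.
have bI n : bdm (fun s : R => \int[torm]_x `|gapp n s x - g s x|) := bdm_int torm (jbdm_gdist n).
have bK : bdm (fun s : R => \int[torm]_x `|gapp k s x - gapp m s x|) :=
  bdm_int torm (jbdm_gerr HV k m).
apply: (le_trans (lebI_sub bK _ t0 h0 thT)); first by move=> s; exact: int_ge0.
apply: (@int_ae_leD _ _ _ (lebI 0 T) _ _ _ bK (bI k) (bI m)); apply: aeW => s.
have b1 n : bdm (fun x => `|gapp n s x - g s x|) := jbdm_slice s (jbdm_gdist n).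
apply: (int_ae_leD (jbdm_slice s (jbdm_gerr HV k m)) (b1 k) (b1 m)).
by apply: aeW => x; rewrite -(subrKA (g s x)) (le_trans (ler_normD _ _))// lerD2l distrC lexx.
Qed.

(** Along the flow [sigma] is the divergence [g], so what remains is the error of approximating [g],
    composed with the flow; the compression bound brings it back to the torus. *)
Lemma serr_le m t h : 0 <= t -> 0 <= h -> t + h <= T -> serr Hmu G sigma X m t h <= L * gdist m.
Proof.
move=> t0 h0 thT; have [_ _ _ comp] := HX.
have bs : bdm (fun s : R => \int[torm]_y `|sigma s y - gapp m s (X s y)|) :=
  bdm_int torm (jbdm_serr HV HX bsig m).
apply: (le_trans (lebI_sub bs _ t0 h0 thT)); first by move=> s; exact: int_ge0.
have bgX : jbdm (fun s y => `|g s (X s y) - sigma s y|).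
  by apply: bdm_norm; apply: bdmB => //; exact: (jbdm_flow HX).
have bI : bdm (fun s : R => \int[torm]_y `|g s (X s y) - sigma s y|) := bdm_int torm bgX.
have bd : bdm (fun s : R => L * \int[torm]_x `|gapp m s x - g s x|).
  by apply: bdmZ; exact: (bdm_int torm (jbdm_gdist m)).
have -> : L * gdist m = \int[lebI 0 T]_s (L * \int[torm]_x `|gapp m s x - g s x|).
  by rewrite intZ//; exact: (bdm_int torm (jbdm_gdist m)).
rewrite -[leRHS]add0r -[X in _ <= X + _]gsig.
apply: (@int_ae_leD _ _ _ (lebI 0 T) _ _ _ bs bI bd); apply: lebI_ae => s sT.
have b1 : bdm (fun x => `|gapp m s x - g s x|) := jbdm_slice s (jbdm_gdist m).
have p1 : per (fun x => `|gapp m s x - g s x|).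
  by move=> x; have [_ pG _ _] := lipb_gapp HV m s; rewrite pG pg.
apply: le_trans (lerD (lexx _) (comp s sT _ b1 p1 (fun x => normr_ge0 _))).
have b2 : bdm (fun y => `|gapp m s (X s y) - g s (X s y)|).
  exact: (bdm_flow HX s b1).
have b3 : bdm (fun y => `|g s (X s y) - sigma s y|) := jbdm_slice s bgX.
apply: (int_ae_leD (jbdm_slice s (jbdm_serr HV HX bsig m)) b3 b2); apply: aeW => y; rewrite distrC -(subrKA (g s (X s y))) (le_trans (ler_normD _ _))// addrC lerD//.
Qed.

Lemma exp_pow (x : R) n : 0 <= x -> (1 + x) ^+ n <= expR (n%:R * x).
Proof.
move=> x0; rewrite mulrC expRM_natr lerXn2r ?nnegrE ?expR_ge0 ?addr_ge0//.
exact: expR_ge1Dx.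
Qed.

Definition rate k := d%:R * (c * k%:R) * (1 + M) + M + 1.

(** The scheme is run with time step [tau / n.+1] and [n] tends to infinity: every term quadratic in
    the step disappears, including those with [A k]. *)
Lemma defect_bound k m t (tau : R) F B K : 0 <= t -> 0 <= tau -> t + tau <= T ->
  (forall F B K, 0 <= B -> 0 <= K -> lipb B K F -> defect t F = 0) ->
  0 <= B -> 0 <= K -> lipb B K F ->
  `|defect (t + tau) F| <=
    expR (rate k * tau) * (K + (d%:R * A m + 1) * B) * (jmax * d%:R * eta k) * tau +
    jmax * B * (gdist k + gdist m + jmax * (L * gdist m)).
Proof.
move=> t0 tau0 ttT D0 B0 K0 lF.
have [_ _ good_ae _] := HX.
set N := K + _; set E := expR _; set Z := jmax * B * _.
have J0 : 0 <= jmax := expR_ge0 _.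
pose C := E * N * (@Wc R d T M c A k m * tau) * tau.
suff H n : tau <= n.+1%:R -> M * tau <= 2^-1 * n.+1%:R -> c * k%:R * tau <= n.+1%:R ->
    `|defect (t + tau) F| <= E * N * (jmax * d%:R * eta k) * tau + Z + C * n.+1%:R^-1.
  have L1 : (fun n => E * N * (jmax * d%:R * eta k) * tau + Z + C * n.+1%:R^-1) @ \oo -->
      E * N * (jmax * d%:R * eta k) * tau + Z.
    rewrite -[X in _ --> X]addr0; apply: cvgD; first exact: cvg_cst.
    rewrite -[X in _ --> X](mulr0 C); apply: cvgM; first exact: cvg_cst.
    exact: cvg_harmonic.
  apply: (cvgr_to_ge L1).
  have near_nat (r : R) : \forall n \near \oo, r <= n.+1%:R.
    near=> n; apply: (@le_trans _ _ n%:R); last by rewrite ler_nat.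
    by near: n; exact: nbhs_infty_ger.
  near=> n; apply: H.
  - by near: n; exact: near_nat.
  - rewrite ler_pdivlMl//; near: n; exact: near_nat.
  - by near: n; exact: near_nat.
move=> n1 n2 n3; have n0 : 0 < n.+1%:R :> R by [].
pose h := tau / n.+1%:R.
have nh : n.+1%:R * h = tau by rewrite /h mulrC divfK ?gt_eqF.
have h0 : 0 <= h by rewrite divr_ge0.
have h1 : h <= 1 by rewrite ler_pdivrMr// mul1r.
have h2 : M * h <= 2^-1 by rewrite mulrA ler_pdivrMr.
have h3 : c * k%:R * h <= 1 by rewrite mulrA ler_pdivrMr// mul1r.
have := defect_iter (n := n.+1) M0 c0 A0 eta_pos HV HX bsig sigM good_ae m t0 h0 h1 h2 h3 D0 _ B0 K0 lF.
rewrite nh => /(_ ttT) /le_trans; apply.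
rewrite -/(rate k) -/N.
have al0 : 0 <= rate k by rewrite /rate !(addr_ge0, mulr_ge0).
have N0 : 0 <= N by rewrite /N !(addr_ge0, mulr_ge0).
have W0 := @Wc_ge0 R d T _ _ _ M0 c0 A0 k m; have e0 := eta_pos k.
have i1 : (1 + rate k * h) ^+ n.+1 <= E.
  by rewrite (le_trans (exp_pow _ _))// ?mulr_ge0// mulrCA nh.
have i2 : (1 + M * h) ^+ n.+1 <= jmax.
  rewrite (le_trans (exp_pow _ _))// ?mulr_ge0// mulrCA nh ler_expR ler_wpM2l//.
  by rewrite (le_trans _ ttT)// lerDr.
rewrite -addrA [Z + _]addrC addrA; apply: lerD.
  set W := @Wc R d T M c A k m in W0 *.
  have -> : n.+1%:R * (1 + rate k * h) ^+ n.+1 * N * (W * h + jmax * d%:R * eta k) * h =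
      (1 + rate k * h) ^+ n.+1 * N * tau * (W * h + jmax * d%:R * eta k) by rewrite -nh; ring.
  have -> : E * N * (jmax * d%:R * eta k) * tau + C / n.+1%:R =
      E * N * tau * (W * h + jmax * d%:R * eta k) by rewrite /C /h -/W; ring.
  rewrite ler_wpM2r ?addr_ge0 ?mulr_ge0//.
  by rewrite !ler_wpM2r.
have g1 := gerr_le k m t0 tau0 ttT; have g2 := serr_le m t0 tau0 ttT.
have g5 : 0 <= gerr Hmu G k m t tau by exact: gerr_ge0.
have g6 : 0 <= serr Hmu G sigma X m t tau by exact: serr_ge0.
have g3 := gdist_ge0 k; have g4 := gdist_ge0 m.
rewrite /Z; apply: ler_pM => //.
- by rewrite mulr_ge0// exprn_ge0// addr_ge0// mulr_ge0.
- by rewrite addr_ge0// mulr_ge0.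
- by rewrite ler_wpM2r.
- by rewrite lerD// ler_wpM2l.
Unshelve. all: by end_near. Qed.

(* Iterating small steps costs a factor [exp (C k tau)], which the error
   [eta k ~ k 2^-k] absorbs as soon as [tau] is small, uniformly in [k]. *)
Lemma defect_short t (tau : R) : 0 <= t -> 0 <= tau -> t + tau <= T ->
  expR (d%:R * c * (1 + M) * tau) <= 8 / 5 ->
  (forall F B K, 0 <= B -> 0 <= K -> lipb B K F -> defect t F = 0) ->
  forall F B K, 0 <= B -> 0 <= K -> lipb B K F -> defect (t + tau) F = 0.
Proof.
move=> t0 tau0 ttT texp D0 F B K B0 K0 lF.
have J0 : 0 <= jmax := expR_ge0 _.
have Hm m : `|defect (t + tau) F| <= jmax * B * (gdist m + jmax * (L * gdist m)).
  pose N := K + (d%:R * A m + 1) * B.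
  have N0 : 0 <= N by rewrite /N !(addr_ge0, mulr_ge0).
  pose C := expR ((M + 1) * tau) * N * (jmax * d%:R * E0) * tau.
  have C0 : 0 <= C by rewrite /C !mulr_ge0 ?expR_ge0.
  have L1 : (fun k => C * ((k%:R + 2) * (4/5) ^+ k) +
      jmax * B * (gdist k + (gdist m + jmax * (L * gdist m)))) @ \oo -->
      jmax * B * (gdist m + jmax * (L * gdist m)).
    rewrite -[X in _ --> X]add0r; apply: cvgD.
      rewrite -[X in _ --> X](mulr0 C); apply: cvgM; first exact: cvg_cst.
      by apply: cvg_natr_geo; lra.
    apply: cvgM; first exact: cvg_cst.
    rewrite -[X in _ --> X]add0r; apply: cvgD; [exact: gdist_cvg|exact: cvg_cst].
  apply: (cvgr_to_ge L1); near=> k.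
  apply: (le_trans (defect_bound k m t0 tau0 ttT D0 B0 K0 lF)).
  rewrite -[gdist k + gdist m + _]addrA lerD2r.
  (* The rate is affine in [k], so the exponential is a constant times a [k]-th power with base at
     most [8/5], to be set against [2^-k]. *)
  have -> : expR (rate k * tau) =
      expR (d%:R * c * (1 + M) * tau) ^+ k * expR ((M + 1) * tau).
    by rewrite -expRM_natr -expRD; congr expR; rewrite /rate; ring.
  rewrite etaE /C -/N.
  set e1 := expR ((M + 1) * tau).
  have e10 : 0 <= e1 := expR_ge0 _.
  have -> : expR (d%:R * c * (1 + M) * tau) ^+ k * e1 * N *
      (jmax * d%:R * (E0 * ((k%:R + 2) * rk k))) * tau =
    (e1 * N * (jmax * d%:R * E0) * tau) * ((k%:R + 2) * (expR (d%:R * c * (1 + M) * tau) ^+ k * rk k)).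
    by ring.
  rewrite ler_wpM2l//.
  rewrite ler_wpM2l ?addr_ge0//.
  have -> : 4 / 5 = 8 / 5 * 2^-1 :> R by field.
  rewrite exprMn /rk exprVn ler_wpM2r ?invr_ge0 ?exprn_ge0//.
  by rewrite lerXn2r ?nnegrE ?expR_ge0.
apply/eqP; rewrite -normr_le0.
have L2 : (fun m => jmax * B * (gdist m + jmax * (L * gdist m))) @ \oo --> (0 : R).
  rewrite -[X in _ --> X](mulr0 (jmax * B)); apply: cvgM; first exact: cvg_cst.
  rewrite -[X in _ --> X](addr0 0); apply: cvgD; first exact: gdist_cvg.
  rewrite -[X in _ --> X](mulr0 jmax); apply: cvgM; first exact: cvg_cst.
  by rewrite -[X in _ --> X](mulr0 L); apply: cvgM; [exact: cvg_cst|exact: gdist_cvg].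
by apply: (cvgr_to_ge L2); near=> m; exact: Hm.
Unshelve. all: by end_near. Qed.

Lemma defect_start F : bdm F -> defect 0 F = 0.
Proof.
move=> bF; have [_ X0 _ _] := HX.
have T00 : 0 <= (0 : R) <= T by rewrite lexx.
rewrite /defect; apply/eqP; rewrite subr_eq0; apply/eqP; apply: int_ae_eq => //.
  apply: bdmM; first exact: (bdm_flow HX).
  exact: (bdm_jac M0 bsig sigM T00).
apply: filterS X0 => y ->; rewrite /jac lebI_pt ?expR0 ?mulr1//.
exact: jbdm_line.
Qed.

Lemma defect_lipb t F B K : 0 <= t <= T -> 0 <= B -> 0 <= K -> lipb B K F -> defect t F = 0.
Proof.
move=> /andP[t0 tT].
pose b := d%:R * c * (1 + M) * t.
have b0 : 0 <= b by rewrite /b !mulr_ge0// addr_ge0.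
(* With at least [8 b / 3] steps each exponent is at most [3/8], and
   [exp (3/8) <= 1 / (1 - 3/8) = 8/5]. *)
pose n := (Num.truncn (b * (8 / 3))).+1.
have n0 : 0 < n%:R :> R by rewrite ltr0n.
have bn : b * (8 / 3) <= n%:R.
  by apply: ltW; apply: truncnS_gt; rewrite mulr_ge0//; lra.
pose tau := t / n%:R.
have tau0 : 0 <= tau by rewrite divr_ge0.
have ntau : n%:R * tau = t by rewrite /tau mulrC divfK ?gt_eqF.
have texp : expR (d%:R * c * (1 + M) * tau) <= 8 / 5.
  have x1 : d%:R * c * (1 + M) * tau <= 3 / 8.
    by rewrite /tau mulrA ler_pdivrMr// -/b; lra.
  apply: (le_trans (y := expR (3 / 8))); first by rewrite ler_expR.
  have := expR_ge1Dx (- (3 / 8) : R); rewrite expRN.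
  have e0 : 0 < expR (3 / 8 : R) by exact: expR_gt0.
  move=> h; rewrite -[leLHS]invrK -[8 / 5]invrK lef_pV2 ?posrE ?invr_gt0//; last by lra.
suff H m : (m <= n)%N -> forall F B K, 0 <= B -> 0 <= K -> lipb B K F -> defect (m%:R * tau) F = 0.
  by rewrite -ntau; exact: H.
elim: m => [_|m IH mn] F' B' K' B0 K0 lF.
  by rewrite mul0r; apply: defect_start; case: lF.
rewrite -natr1 mulrDl mul1r; apply: defect_short B0 K0 lF => //.
- by rewrite mulr_ge0.
- rewrite (le_trans _ tT)// -ntau -[X in _ + X]mul1r -mulrDl natr1 ler_wpM2r// ler_nat//.
- exact: IH (ltnW mn).
Qed.

(** From Lipschitz to bounded observables: averages of [F] are Lipschitz and converge in L^1, and
    both sides are continuous in L^1, the left one by the compression bound. *)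
Theorem jacobian_formula t F : 0 <= t <= T -> bdm F -> per F ->
  \int[torm]_y (F (X t y) * jac t y) = \int[torm]_x F x.
Proof.
move=> tT bF pF; have [_ _ _ comp] := HX.
have J0 : 0 <= jmax := expR_ge0 _.
have bJ := bdm_jac M0 bsig sigM tT.
suff H k : `|defect t F| <= (jmax * L + 1) * \int[torm]_x `|avg k F x - F x|.
  apply/eqP; rewrite -subr_eq0 -normr_le0 -/(defect t F).
  have L1 : (fun k => (jmax * L + 1) * \int[torm]_x `|avg k F x - F x|) @ \oo --> (0 : R).
    rewrite -[X in _ --> X](mulr0 (jmax * L + 1)); apply: cvgM; first exact: cvg_cst.
    exact: bdm_avg_cvg.
  by apply: (cvgr_to_ge L1); near=> k; exact: H.
have bA := bdm_avg Hmu k bF; have pA := avg_per Hmu k pF.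
have [_ [B FB]] := bF; have B0 : 0 <= B by exact: le_trans (FB (pcst 0)).
have lA : lipb B (2 * B * 2 ^+ k) (avg k F).
  split => //; first by move=> x; exact: avg_normM.
  by apply: lip_dist1 => j x s; exact: avg_bdm_lip.
have D0 := defect_lipb tT B0 _ lA.
have bFX := bdmM (bdm_flow HX t bF) bJ; have bAX := bdmM (bdm_flow HX t bA) bJ.
have bD : bdm (fun x => `|avg k F x - F x|) by apply: bdm_norm; exact: bdmB.
have bDX := bdm_flow HX t bD.
have -> : defect t F = (\int[torm]_y (F (X t y) * jac t y) - \int[torm]_y (avg k F (X t y) * jac t y)) +
    (\int[torm]_x avg k F x - \int[torm]_x F x).
  have E : \int[torm]_y (avg k F (X t y) * jac t y) = \int[torm]_x avg k F x.
    apply/eqP; rewrite -subr_eq0 -/(defect t (avg k F)) D0//.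
    by rewrite !mulr_ge0// exprn_ge0.
  by rewrite /defect E; ring.
rewrite mulrDl mul1r (le_trans (ler_normD _ _))// lerD//; last first.
  rewrite -intB//; apply: int_norm; exact: bdmB.
rewrite -intB// (le_trans (int_norm _ (bdmB bFX bAX)))//.
apply: (@le_trans _ _ (\int[torm]_y (jmax * `|avg k F (X t y) - F (X t y)|))).
  apply: int_le; [exact: (bdm_norm (bdmB bFX bAX))|exact: bdmZ bDX|].
  move=> y; rewrite -mulrBl normrM distrC mulrC ler_wpM2r//.
  by rewrite ger0_norm ?expR_ge0//; exact: (jac_le M0 bsig).
rewrite intZ// -mulrA ler_wpM2l//; apply: comp => //.
by move=> x; rewrite pA pF.
Unshelve. all: by end_near. Qed.

End jacobian.

(** * The energy estimate *)

Lemma bdm_sqr (R : realType) d (Z : measurableType d) (f : Z -> R) :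
  bdm f -> bdm (fun z => f z ^+ 2).
Proof. by move=> bf; under eq_fun do rewrite expr2; exact: bdmM. Qed.

Lemma sqr_sum_le (R : realType) (d : nat) (h : 'I_d -> R) :
  (\sum_j h j) ^+ 2 <= d%:R * \sum_j h j ^+ 2.
Proof.
rewrite expr2 mulr_suml.
apply: (@le_trans _ _ (\sum_(i < d) \sum_(j < d) (h i ^+ 2 / 2 + h j ^+ 2 / 2))).
  apply: ler_sum => i _; rewrite mulr_sumr; apply: ler_sum => j _.
  by have := sqr_ge0 (h i - h j); rewrite sqrrB -mulr_natr; lra.
rewrite (eq_bigr (fun i => d%:R * (h i ^+ 2 / 2) + \sum_(j < d) h j ^+ 2 / 2)); last first.
  by move=> i _; rewrite big_split/= sumr_const card_ord -[_ *+ d]mulr_natl.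
rewrite big_split/= sumr_const card_ord -[X in _ + X]mulr_natl -mulr_sumr -mulrDr ler_wpM2l//.
by rewrite -mulr_suml; set S := \sum_(i < d) _; lra.
Qed.

(** Young's inequality puts the weight [1 / (2 Lp)] on [v]; with [Lp = L + 1] the compression bound
    leaves at most half of the energy, as in [half_le]. The other terms involve only the separation
    and the scale [r]. *)
Lemma amgm_sum (R : realType) (d : nat) (A kap r q Lp : R) (h v : 'I_d -> R) : 0 <= A -> 0 <= kap -> 0 <= r -> 0 < Lp ->
  (forall j, 0 <= h j) -> (\sum_j h j) ^+ 2 <= d%:R * q -> q = \sum_j h j ^+ 2 ->
  A * (\sum_j h j * (`|v j| + kap * (\sum_j h j + r))) <=
  (2 * Lp)^-1 * (\sum_j v j ^+ 2) + Lp * A ^+ 2 / 2 * q + 3 / 2 * A * kap * (d%:R + 1) * (q + r ^+ 2).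
Proof.
move=> A0 k0 r0 L1 h0 hq qE; set e := \sum_j h j in hq *.
have e0 : 0 <= e by apply: sumr_ge0.
have q0 : 0 <= q by rewrite qE; apply: sumr_ge0 => j _; exact: sqr_ge0.
have d0 : 0 <= d%:R :> R by [].
have -> : A * (\sum_j h j * (`|v j| + kap * (e + r))) =
    \sum_j (A * (h j * `|v j|)) + A * kap * (e * (e + r)).
  transitivity (\sum_j (A * (h j * `|v j|) + A * kap * (e + r) * h j)).
    by rewrite mulr_sumr; apply: eq_bigr => j _; ring.
  by rewrite big_split/=; congr (_ + _); rewrite -mulr_sumr -/e; ring.
apply: lerD.
  rewrite qE !mulr_sumr -big_split/=; apply: ler_sum => j _.
  set a := h j; rewrite -[v j ^+ 2]real_normK ?num_real//; set b := `|v j|.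
  have := sqr_ge0 (b - Lp * (A * a)).
  rewrite -(pmulr_rge0 _ (_ : 0 < (2 * Lp)^-1)); last by rewrite invr_gt0 mulr_gt0.
  have -> : (2 * Lp)^-1 * (b - Lp * (A * a)) ^+ 2 =
    (2 * Lp)^-1 * b ^+ 2 - A * (a * b) + Lp * A ^+ 2 / 2 * a ^+ 2.
    by field; rewrite gt_eqF.
  by rewrite -addrA [- _ + _]addrC addrA subr_ge0.
have -> : 3 / 2 * A * kap * (d%:R + 1) * (q + r ^+ 2) =
  A * kap * (3 / 2 * (d%:R + 1) * (q + r ^+ 2)) by ring.
rewrite ler_wpM2l ?mulr_ge0//.
have h1 := sqr_ge0 (e - r); rewrite sqrrB -mulr_natr in h1.
have h2 : 0 <= d%:R * r ^+ 2 by rewrite mulr_ge0// sqr_ge0.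
have h3 : 0 <= r ^+ 2 := sqr_ge0 _.
have -> : e * (e + r) = e ^+ 2 + e * r by ring.
have -> : 3 / 2 * (d%:R + 1) * (q + r ^+ 2) =
  3 / 2 * (d%:R * q) + 3 / 2 * q + 3 / 2 * (d%:R * r ^+ 2) + 3 / 2 * r ^+ 2 by ring.
lra.
Qed.

Lemma half_le (R : realType) (L I E : R) : 0 <= L -> 0 <= E -> I <= L * E ->
  (2 * (L + 1))^-1 * I <= E / 2.
Proof.
move=> L0 E0 H; have L1 : 0 < 2 * (L + 1) by lra.
by rewrite mulrC ler_pdivrMr// [leRHS](_ : _ = L * E + E); [lra|field].
Qed.

(** * Energy of the difference of two gradient fields *)

Section energy.
Context {R : realType} {d : nat}.
Local Notation P := (d.-tuple R).
Variable mu : {measure set P -> \bar R}.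
Hypothesis Hmu : is_lebesgue_Rd mu.
Implicit Types (x y z : P) (i j : 'I_d) (s t h B K : R) (k l m n : nat) (F : P -> R).
Local Notation torm := (torm Hmu).
Local Notation avg := (avg Hmu).
Local Notation avg2 := (avg2 Hmu).

Lemma int_lines F j : bdm F -> per F ->
  \int[torm]_x F x = \int[torm]_x \int[lebI 0 1]_r F (Defs.shift x j r).
Proof.
move=> bF pF.
have b2 : bdm (fun q : R * P => F (Defs.shift q.2 j q.1)).
  apply: (bdm_comp (T := fun q : R * P => Defs.shift q.2 j q.1) _ bF).
  by apply: measurable_shiftf.
have := int_fubini (lebI 0 1) torm b2; rewrite /= => <-.
transitivity (\int[lebI 0 1]_r \int[torm]_x F x).
  by rewrite int_cst lebI1// subr0 mulr1.
by apply: eq_Rintegral => r _; rewrite int_torm_shift.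
Qed.

Lemma ibp (f f' g g' : P -> R) j B1 K1 B2 K2 B3 K3 B4 K4 : lipb B1 K1 f -> lipb B2 K2 f' ->
  lipb B3 K3 g -> lipb B4 K4 g' -> ipart j f f' -> ipart j g g' ->
  \int[torm]_x (f' x * g x) = - \int[torm]_x (f x * g' x).
Proof.
move=> lf lf' lg lg' ff' gg'.
have [bf pf _ _] := lf; have [bf' pf' _ _] := lf'.
have [bg pg _ _] := lg; have [bg' pg' _ _] := lg'.
have b1 := bdmM bf' bg; have b2 := bdmM bf bg'.
apply/eqP; rewrite -addr_eq0 -intD//; apply/eqP.
rewrite (@int_lines (fun x => f' x * g x + f x * g' x) j); last 2 first.
- exact: bdmD.
- by move=> x; rewrite pf' pg pf pg'.
rewrite -[RHS](mul0r (fine (torm setT))) -(int_cst torm 0); apply: eq_Rintegral => x _.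
have dp (r : R) : is_derive r 1 (fun r => f (Defs.shift x j r) * g (Defs.shift x j r))
    (f' (Defs.shift x j r) * g (Defs.shift x j r) + f (Defs.shift x j r) * g' (Defs.shift x j r)).
  apply: (is_derive_cast (is_deriveM (ipart_line x lf' ff' r) (ipart_line x lg' gg' r))).
  by rewrite /GRing.scale/= addrC mulrC.
have cp : continuous (fun r => f' (Defs.shift x j r) * g (Defs.shift x j r) +
    f (Defs.shift x j r) * g' (Defs.shift x j r)).
  move=> r; apply: cvgD; apply: cvgM;
    [exact: (lipb_line_continuous lf')|exact: (lipb_line_continuous lg)|
     exact: (lipb_line_continuous lf)|exact: (lipb_line_continuous lg')].
have -> := FTC2l ler01 cp dp.
by rewrite !pshift0 !per_shift1// subrr.
Qed.

Lemma ipart_seg (f f' : P -> R) x j h K : bdm f' -> ipart j f f' ->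
  (forall s, `|s| <= `|h| -> `|f' (Defs.shift x j s)| <= K) ->
  `|f (Defs.shift x j h) - f x| <= `|h| * K.
Proof.
move=> bf' ff' H; rewrite mulrC.
have [h0|/ltW h0] := leP 0 h.
  rewrite ff'// (ger0_norm h0).
  have := lebI_normM (t := 0) h0 (bdm_line x j bf') (M := K); rewrite add0r; apply.
  by move=> s /andP[s0 sh]; apply: H; rewrite !ger0_norm.
have h0' : 0 <= - h by rewrite oppr_ge0.
have := ff' (Defs.shift x j h) _ h0'; rewrite pshiftD subrr pshift0 distrC => ->.
rewrite (ler0_norm h0).
have := lebI_normM (t := 0) h0' (bdm_line (Defs.shift x j h) j bf') (M := K); rewrite add0r; apply.
move=> s /andP[s0 sh]; rewrite pshiftD; apply: H.
by rewrite !ler0_norm//; lra.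
Qed.

(** Lets the modulus of continuity at intermediate points of the coordinate path be taken at the
    distance of the endpoints. *)
Lemma hyb_seg_dist x y j s : `|s| <= `|tnth y j - tnth x j| ->
  dist1 (Defs.shift (hyb x y j) j s) x <= dist1 x y.
Proof.
move=> H; rewrite /dist1 ler_sum// => i _; rewrite tnth_shift tnth_mktuple.
have [->|_] := eqVneq i j.
  by rewrite ltnn addrAC subrr add0r distrC.
by rewrite addr0; case: ifP => _; rewrite ?subrr ?normr0// distrC.
Qed.

Variables (u : 'I_d -> P -> R) (pk : nat -> P -> R) (qk : nat -> 'I_d -> P -> R)
  (g1 g2 sg J : P -> R) (X1 X2 : P -> P)
  (M Kc L J1 : R) (eta : nat -> R).

Let gd x := g1 x - g2 x.

Hypotheses (M0 : 0 <= M) (Kc0 : 0 <= Kc) (L0 : 0 <= L) (J10 : 0 <= J1).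
Hypotheses (bu : forall j, bdm (u j)) (pu : forall j, per (u j)) (uM : forall j x, `|u j x| <= M).
Hypotheses (bpk : forall k, bdm (pk k)) (ppk : forall k, per (pk k)).
Hypothesis Hpk : forall k j, ipart j (pk k) (avg k (u j)).
Hypotheses (bqk : forall k j, bdm (qk k j)) (pqk : forall k j, per (qk k j)).
Hypothesis Hqk : forall k j, ipart j (avg k (u j)) (qk k j).
Hypothesis Hdiv : forall k x, \sum_j qk k j x = avg k gd x.
Hypothesis int_gd0 : \int[torm]_x gd x = 0.
Hypothesis umod : forall k l j x y,
  `|avg2 k (u j) x - avg2 k (u j) y| <= Kc * (l%:R + 2) * (dist1 x y + rk l).
Hypothesis uclose : forall k j x, `|u j x - avg2 k (u j) x| <= eta k.
Hypothesis eta_cvg0 : eta @ \oo --> 0.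
Hypotheses (mX1 : measurable_fun setT X1) (mX2 : measurable_fun setT X2).
Hypotheses (bg1 : bdm g1) (pg1 : per g1) (bg2 : bdm g2) (pg2 : per g2).
Hypotheses (bsg : bdm sg) (sgM : forall y, `|sg y| <= M).
Hypotheses (bJ : bdm J) (J_itv : forall y, 0 <= J y <= J1).
Hypotheses (jac1 : forall F, bdm F -> per F -> \int[torm]_y (F (X1 y) * J y) = \int[torm]_x F x)
  (jac2 : forall F, bdm F -> per F -> \int[torm]_y (F (X2 y) * J y) = \int[torm]_x F x).
Variable D0 : R.
Hypothesis XD : forall j y, `|tnth (X1 y) j - tnth (X2 y) j| <= D0.
Hypothesis comp1 : forall F, bdm F -> per F -> (forall x, 0 <= F x) ->
  \int[torm]_y F (X1 y) <= L * \int[torm]_x F x.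
Hypotheses (gs1 : {ae torm, forall y, g1 (X1 y) = sg y}) (gs2 : {ae torm, forall y, g2 (X2 y) = sg y}).

Let bgd : bdm gd. Proof. exact: bdmB. Qed.
Let pgd : per gd. Proof. by move=> x; rewrite /gd pg1 pg2. Qed.

(* [pk k] and [qk k j] play the role of [avg k phi] and [avg k (w j j)], where
   [phi] and [w] are the differences of the potentials and of the gradients. *)
Definition pot k x := avg k (pk k) x.

(* With [J dy] the common density, [\int p (g1 - g2)] equals
   [\int sg J (p (X1) - p (X2))], since both [g_i (X_i)] are equal to [sg]. *)
Lemma weighted_flow (pt gk : P -> R) (c B : R) : bdm pt -> per pt -> (forall x, `|pt x - c| <= B) ->
  bdm gk -> \int[torm]_x gk x = 0 ->
  - (\int[torm]_x (pt x * gk x)) <=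
  J1 * M * \int[torm]_y `|pt (X1 y) - pt (X2 y)| + B * \int[torm]_x `|gk x - gd x|.
Proof.
move=> bpot ppot ptB bgk gk0.
pose p x := pt x - c.
have bp : bdm p by apply: bdmB => //; exact: bdm_cst.
have ppt : per p by move=> x; rewrite /p ppot.
(* Since [gk] has mean zero, the constant [c] may be subtracted from [pt]: what is bounded is the
   oscillation of the potential, not its size. *)
have E1 : \int[torm]_x (pt x * gk x) = \int[torm]_x (p x * gk x).
  transitivity (\int[torm]_x (p x * gk x + c * gk x)).
    by apply: eq_Rintegral => x _; rewrite -mulrDl /p subrK.
  rewrite intD; [|exact: bdmM|exact: bdmZ].
  by rewrite intZ// gk0 mulr0 addr0.
have b12 := bdm_comp mX1 bp; have b22 := bdm_comp mX2 bp.
have bsJ := bdmM bsg bJ.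
have jac' (X : P -> P) (g : P -> R) : measurable_fun setT X -> bdm g -> per g ->
    (forall F, bdm F -> per F -> \int[torm]_y (F (X y) * J y) = \int[torm]_x F x) ->
    {ae torm, forall y, g (X y) = sg y} ->
    \int[torm]_x (p x * g x) = \int[torm]_y (sg y * J y * p (X y)).
  move=> mX bg pg jX gs.
  have bpg := bdmM bp bg.
  rewrite -(jX (fun x => p x * g x)) //; last by move=> x; rewrite ppt pg.
  apply: int_ae_eq.
  - by apply: bdmM => //; exact: (bdm_comp mX bpg).
  - by apply: bdmM => //; exact: (bdm_comp mX bp).
  - by apply: filterS gs => y ->; ring.
have E2 : - (\int[torm]_x (p x * gd x)) =
    \int[torm]_y (sg y * J y * (p (X2 y) - p (X1 y))).
  transitivity (\int[torm]_x (p x * g2 x) - \int[torm]_x (p x * g1 x)).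
    rewrite -intB; [|exact: bdmM|exact: bdmM].
    rewrite -intN; last exact: bdmM.
    by apply: eq_Rintegral => x _; rewrite /gd; ring.
  rewrite (jac' X1 g1)// (jac' X2 g2)// -intB; [|exact: bdmM|exact: bdmM].
  by apply: eq_Rintegral => y _; ring.
have -> : - (\int[torm]_x (pt x * gk x)) =
    \int[torm]_y (sg y * J y * (p (X2 y) - p (X1 y))) + \int[torm]_x (p x * (gd x - gk x)).
  rewrite E1 -E2 addrC -[X in _ + X]intN; last exact: bdmM.
  rewrite -intD; [|by apply: bdmM => //; exact: bdmB|by apply: bdmN; exact: bdmM].
  rewrite -intN; last exact: bdmM.
  by apply: eq_Rintegral => x _; ring.
rewrite -intZ; last by apply: bdm_norm; apply: bdmB; [exact: (bdm_comp mX1 bpot)|exact: (bdm_comp mX2 bpot)].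
rewrite -intZ; last by apply: bdm_norm; exact: bdmB.
apply: lerD.
  apply: int_le.
  - by apply: bdmM => //; exact: bdmB.
  - by apply: bdmZ; apply: bdm_norm; apply: bdmB; [exact: (bdm_comp mX1 bpot)|exact: (bdm_comp mX2 bpot)].
  move=> y; rewrite (le_trans (ler_norm _))// normrM.
  have -> : p (X2 y) - p (X1 y) = - (pt (X1 y) - pt (X2 y)) by rewrite /p; ring.
  rewrite normrN ler_wpM2r// normrM mulrC ler_pM//.
  by have /andP[h1 h2] := J_itv y; rewrite ger0_norm.
apply: int_le.
- by apply: bdmM => //; exact: bdmB.
- by apply: bdmZ; apply: bdm_norm; exact: bdmB.
move=> x; rewrite (le_trans (ler_norm _))// normrM [`|gd x - gk x|]distrC ler_wpM2r//.
exact: ptB.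
Qed.

Lemma lipb_avg k (f : P -> R) : bdm f -> per f -> exists B K, lipb B K (avg k f).
Proof.
move=> bf pf; have [_ [B fB]] := bf.
exists B, (2 * B * 2 ^+ k); split.
- exact: bdm_avg.
- exact: avg_per.
- by move=> x; exact: avg_normM.
- by apply: lip_dist1 => j x s; exact: avg_bdm_lip.
Qed.

Lemma pot_ipart k j : ipart j (pot k) (avg2 k (u j)).
Proof. by apply: avg_ipart; [exact: bpk|exact: bdm_avg|exact: Hpk]. Qed.

Lemma avg2_ipart k j : ipart j (avg2 k (u j)) (avg k (qk k j)).
Proof. by apply: avg_ipart; [exact: bdm_avg|exact: bqk|exact: Hqk]. Qed.

Lemma avg2_div k x : \sum_j avg k (qk k j) x = avg2 k gd x.
Proof. by rewrite -avg_sum//; apply: avg_ext => y; exact: Hdiv. Qed.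

(** The double average of [u] is the gradient of [pot k] and has divergence [avg2 k gd]; all these
    functions are Lipschitz, so the integration by parts is the classical one. *)
Lemma energy_identity k : \int[torm]_x (\sum_j avg2 k (u j) x ^+ 2) =
  - \int[torm]_x (pot k x * avg2 k gd x).
Proof.
have [B1 [K1 lp]] := lipb_avg k (bpk k) (ppk k).
have bV j : bdm (avg2 k (u j)) by do 2! apply: bdm_avg.
have bW j : bdm (avg k (qk k j)) by exact: bdm_avg.
have [bp _ _ _] := lp.
have bVV j : bdm (fun x => avg2 k (u j) x ^+ 2) := bdm_sqr (bV j).
have bpW j : bdm (fun x => pot k x * avg k (qk k j) x) := bdmM bp (bW j).
rewrite (int_sum _ _ _ bVV).
under [in RHS]eq_Rintegral do rewrite -avg2_div mulr_sumr.
rewrite (int_sum _ _ _ bpW).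
rewrite -sumrN; apply: eq_bigr => j _.
have [B2 [K2 lu]] := lipb_avg k (bdm_avg Hmu k (bu j)) (avg_per Hmu k (pu j)).
have [B3 [K3 lw]] := lipb_avg k (bqk k j) (pqk k j).
under eq_Rintegral do rewrite expr2.
exact: (ibp lp lu lu lw (pot_ipart k j) (avg2_ipart k j)).
Qed.

Lemma pot_lip k x y : `|pot k x - pot k y| <= M * dist1 x y.
Proof.
apply: lip_dist1 => j z s; apply: (ipart_lip _ (pot_ipart k j)).
  by do 2! apply: bdm_avg.
by move=> a; apply: avg2_normM.
Qed.

Lemma pot_bound k x : `|pot k x - pot k (pcst 0)| <= M * d%:R.
Proof.
have -> : pot k x = pot k (fracP x) by rewrite /pot avg_per.
rewrite (le_trans (pot_lip _ _ _))// ler_wpM2l// -[leRHS]mulr1; apply: dist1_le => i.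
have /andP[h1 /ltW h2] := @fracP_unit R d x i.
by rewrite [tnth (pcst 0) i]tnth_mktuple subr0 ger0_norm.
Qed.

Lemma energy_flow k : \int[torm]_x (\sum_j avg2 k (u j) x ^+ 2) <=
  J1 * M * \int[torm]_y `|pot k (X1 y) - pot k (X2 y)| +
  M * d%:R * \int[torm]_x `|avg2 k gd x - gd x|.
Proof.
rewrite energy_identity.
have bgk : bdm (avg2 k gd) by apply: bdm_avg2.
have gk0 : \int[torm]_x avg2 k gd x = 0.
  rewrite (int_avg Hmu k (bdm_avg Hmu k bgd) (avg_per Hmu k pgd)).
  by rewrite (int_avg Hmu k bgd pgd) int_gd0.
exact: (weighted_flow (bdm_avg Hmu k (bpk k)) (avg_per Hmu k (ppk k)) (pot_bound k) bgk gk0).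
Qed.

(** Along the coordinate path the gradient is compared with its value at [x]: this keeps a
    first-order term in the field at [x], and the modulus bounds only the correction. *)
Lemma pot_diff k l x y : `|pot k y - pot k x| <=
  \sum_j `|tnth y j - tnth x j| * (`|avg2 k (u j) x| + Kc * (l%:R + 2) * (dist1 x y + rk l)).
Proof.
rewrite (hyb_telescope (pot k) x y) (le_trans (ler_norm_sum _ _ _))//.
apply: ler_sum => j _; apply: (ipart_seg _ (pot_ipart k j)); first by do 2! apply: bdm_avg.
move=> s sh; set z := Defs.shift _ _ _.
have := umod k l j z x; rewrite -lerBlDl => h.
rewrite (le_trans (lerB_dist _ _))// (le_trans h)// ler_wpM2l ?mulr_ge0 ?addr_ge0//.
by rewrite lerD2r; exact: hyb_seg_dist.
Qed.

Definition sqd y := \sum_j (tnth (X1 y) j - tnth (X2 y) j) ^+ 2.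

(** The coefficients of [amgm_sum] for [A = J1 M], with the factor [l + 2] of the modulus taken
    out. *)
Definition econst := (L + 1) * (J1 * M) ^+ 2 / 2 + 3 / 2 * (J1 * M) * Kc * (d%:R + 1).

Lemma econst_ge0 : 0 <= econst.
Proof.
have A0 : 0 <= J1 * M by rewrite mulr_ge0.
rewrite /econst addr_ge0 ?divr_ge0 ?mulr_ge0 ?exprn_ge0 ?addr_ge0//; lra.
Qed.

Lemma dist1_sqr y : dist1 (X1 y) (X2 y) ^+ 2 <= d%:R * sqd y.
Proof.
rewrite (le_trans (sqr_sum_le (fun i => `|tnth (X1 y) i - tnth (X2 y) i|)))//.
rewrite ler_wpM2l// ler_sum// => i _.
by rewrite real_normK ?num_real.
Qed.

Lemma pot_flow k l y : J1 * M * `|pot k (X1 y) - pot k (X2 y)| <=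
  (2 * (L + 1))^-1 * (\sum_j avg2 k (u j) (X1 y) ^+ 2) +
  econst * (l%:R + 2) * (sqd y + rk l ^+ 2).
Proof.
have A0 : 0 <= J1 * M by rewrite mulr_ge0.
have l0 : 0 <= l%:R :> R by [].
have L1 : 0 < L + 1 by rewrite ltr_wpDl.
have q0 : 0 <= sqd y by apply: sumr_ge0 => j _; exact: sqr_ge0.
have r0 : 0 <= rk l :> R := rk_ge0 l.
have H := @amgm_sum R d (J1 * M) (Kc * (l%:R + 2)) (rk l) (sqd y) (L + 1)
  (fun j => `|tnth (X1 y) j - tnth (X2 y) j|) (fun j => avg2 k (u j) (X1 y)) A0 _ r0 L1
  (fun j => normr_ge0 _) (dist1_sqr y) _.
rewrite distrC (le_trans (ler_wpM2l A0 (pot_diff k l (X1 y) (X2 y))))//.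
under eq_bigr do rewrite distrC.
apply: (le_trans (H _ _)).
- by rewrite mulr_ge0// addr_ge0.
- by apply: eq_bigr => j _; rewrite real_normK ?num_real.
rewrite -addrA lerD2l.
have -> : econst * (l%:R + 2) * (sqd y + rk l ^+ 2) =
  (L + 1) * (J1 * M) ^+ 2 / 2 * ((l%:R + 2) * (sqd y + rk l ^+ 2)) +
  3 / 2 * (J1 * M) * (Kc * (l%:R + 2)) * (d%:R + 1) * (sqd y + rk l ^+ 2).
  by rewrite /econst; ring.
rewrite lerD2r ler_wpM2l//; first by rewrite divr_ge0// mulr_ge0 ?sqr_ge0// ltW.
apply: (@le_trans _ _ (sqd y + rk l ^+ 2)); first by rewrite lerDl sqr_ge0.
rewrite ler_peMl ?addr_ge0 ?sqr_ge0//; lra.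
Qed.

Lemma bdm_sqd : bdm sqd.
Proof.
apply: bdm_sum => j; apply: bdm_sqr; split.
  by apply: measurable_funB; apply: (measurableT_comp (measurable_tnth j)).
by exists D0 => y; exact: XD.
Qed.

(** The compression of [X1] bounds the energy evaluated along the flow by [L] times the energy; with
    the weight of [pot_flow] at most half of it returns to the right-hand side and is absorbed. *)
Lemma energy_bound_k k l : \int[torm]_x (\sum_j avg2 k (u j) x ^+ 2) <=
  2 * econst * (l%:R + 2) * (\int[torm]_y sqd y + rk l ^+ 2) +
  2 * (M * d%:R) * \int[torm]_x `|avg2 k gd x - gd x|.
Proof.
have H := energy_flow k.
set E := \int[torm]_x (\sum_j avg2 k (u j) x ^+ 2) in H *.
set e := \int[torm]_x `|avg2 k gd x - gd x| in H *.
have bV j : bdm (avg2 k (u j)) := bdm_avg2 Hmu k (bu j).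
have bS : bdm (fun x => \sum_j avg2 k (u j) x ^+ 2).
  by apply: bdm_sum => j; exact: bdm_sqr (bV j).
have pS : per (fun x => \sum_j avg2 k (u j) x ^+ 2).
  by move=> x; apply: eq_bigr => j _; rewrite (per_avg2 Hmu k (pu j) x).
have S0 x : 0 <= \sum_j avg2 k (u j) x ^+ 2 by apply: sumr_ge0 => j _; exact: sqr_ge0.
have bSX := bdm_comp mX1 bS.
have L1 : 0 < L + 1 by rewrite ltr_wpDl.
have E0 : 0 <= E by apply: int_ge0.
have K1 : J1 * M * \int[torm]_y `|pot k (X1 y) - pot k (X2 y)| <=
    E / 2 + econst * (l%:R + 2) * (\int[torm]_y sqd y + rk l ^+ 2).
  have bpot : bdm (pot k) := bdm_avg Hmu k (bpk k).
  have bpX : bdm (fun y => `|pot k (X1 y) - pot k (X2 y)|).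
    by apply: bdm_norm; apply: bdmB; [exact: (bdm_comp mX1 bpot)|exact: (bdm_comp mX2 bpot)].
  have bq : bdm (fun y => sqd y + rk l ^+ 2) by apply: bdmD; [exact: bdm_sqd|exact: bdm_cst].
  have -> : \int[torm]_y sqd y + rk l ^+ 2 = \int[torm]_y (sqd y + rk l ^+ 2).
    by rewrite intD; [rewrite int_cst torm1 mulr1|exact: bdm_sqd|exact: bdm_cst].
  have b1 := bdmZ ((2 * (L + 1))^-1) bSX.
  have b2 := bdmZ (econst * (l%:R + 2)) bq.
  rewrite -(intZ _ _ bpX) -(intZ _ _ bq).
  apply: (@le_trans _ _ (\int[torm]_y ((2 * (L + 1))^-1 * (\sum_j avg2 k (u j) (X1 y) ^+ 2)) +
     \int[torm]_y (econst * (l%:R + 2) * (sqd y + rk l ^+ 2)))).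
    apply: (int_ae_leD (bdmZ (J1 * M) bpX) b1 b2).
    by apply: aeW => y; exact: pot_flow.
  rewrite lerD2r (intZ _ _ bSX).
  exact: (half_le L0 E0 (comp1 bS pS S0)).
have -> : 2 * econst * (l%:R + 2) * (\int[torm]_y sqd y + rk l ^+ 2) + 2 * (M * d%:R) * e =
  2 * (econst * (l%:R + 2) * (\int[torm]_y sqd y + rk l ^+ 2)) + 2 * (M * d%:R * e) by ring.
move: H K1; set a := M * d%:R * e; set b := J1 * M * _; set c := econst * _ * _.
lra.
Qed.

Lemma energy_bound l : \int[torm]_x (\sum_j u j x ^+ 2) <=
  2 * econst * (l%:R + 2) * (\int[torm]_y sqd y + rk l ^+ 2).
Proof.
set Z := 2 * _ * _ * _.
have L1 : (fun k => Z + 2 * (M * d%:R) * \int[torm]_x `|avg2 k gd x - gd x| + d%:R * (2 * M * eta k))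
    @ \oo --> Z.
  rewrite -[X in _ --> X]addr0; apply: cvgD.
    rewrite -[X in _ --> X]addr0; apply: cvgD; first exact: cvg_cst.
    rewrite -[X in _ --> X](mulr0 (2 * (M * d%:R))); apply: cvgM; first exact: cvg_cst.
    exact: avg2_cvgL1.
  rewrite -[X in _ --> X](mulr0 d%:R); apply: cvgM; first exact: cvg_cst.
  by rewrite -[X in _ --> X](mulr0 (2 * M)); apply: cvgM; [exact: cvg_cst|exact: eta_cvg0].
apply: (cvgr_to_ge L1); near=> k.
have H := energy_bound_k k l; rewrite -/Z in H.
apply: (@le_trans _ _ (\int[torm]_x (\sum_j avg2 k (u j) x ^+ 2) + d%:R * (2 * M * eta k))); last first.
  by rewrite lerD2r.
have bV j : bdm (avg2 k (u j)) := bdm_avg2 Hmu k (bu j).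
have bS : bdm (fun x => \sum_j avg2 k (u j) x ^+ 2).
  by apply: bdm_sum => j; exact: bdm_sqr (bV j).
have bU : bdm (fun x => \sum_j u j x ^+ 2).
  by apply: bdm_sum => j; exact: bdm_sqr (bu j).
have -> : d%:R * (2 * M * eta k) = \int[torm]_x (d%:R * (2 * M * eta k)).
  by rewrite int_cst torm1 mulr1.
apply: (int_ae_leD bU bS (bdm_cst _ _)); apply: aeW => x.
rewrite -lerBlDl -sumrB.
apply: (@le_trans _ _ (\sum_(j < d) 2 * M * eta k)); last first.
  by rewrite sumr_const card_ord -[_ *+ d]mulr_natl.
apply: ler_sum => j _; rewrite subr_sqr (le_trans (ler_norm _))// normrM mulrC.
apply: ler_pM; [exact: normr_ge0|exact: normr_ge0| |exact: uclose].
apply: (le_trans (ler_normD _ _)).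
have h1 := uM j x; have h2 := avg2_normM Hmu k x (bu j) (uM j).
by move: h1 h2; set a := `|_|; set b := `|_|; lra.
Unshelve. all: by end_near. Qed.

End energy.

(** * Reduction to everywhere defined data *)

Lemma ae_ord (R : realType) dZ (Z : measurableType dZ) (m : {measure set Z -> \bar R}) n
    (Q : 'I_n -> Z -> Prop) :
  (forall i, {ae m, forall z, Q i z}) -> {ae m, forall z, forall i, Q i z}.
Proof.
move=> H; have /ae_foralln : forall k : nat, {ae m, forall z, forall i : 'I_n, i = k :> nat -> Q i z}.
  move=> k; have [kn|kn] := ltnP k n; last first.
    by apply: aeW => z i ik; have := ltn_ord i; rewrite ik ltnNge kn.
  apply: filterS (H (Ordinal kn)) => z Qz i0 ik.
  by have -> : i0 = Ordinal kn by exact: val_inj.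
by apply: filterS => z Hz i; exact: (Hz i i erefl).
Qed.

(** * Null sets of space-time *)

Section null_sets.
Context {R : realType} {d : nat}.
Local Notation P := (d.-tuple R).
Variable mu : {measure set P -> \bar R}.
Hypothesis Hmu : is_lebesgue_Rd mu.
Variable T : R.
Implicit Types (x y z : P) (N : set (R * P)).
Local Notation torm := (torm Hmu).

(** The value at the grid point [2^-n floor (2^n x)] is constant on each of countably many boxes,
    and tends to [f x] by continuity. *)
Lemma continuousP_measurable (f : P -> R) : Defs.continuousP f -> measurable_fun setT f.
Proof.
move=> cf.
pose z n x : d.-tuple int := [tuple Num.floor (2 ^+ n * tnth x i) | i < d].
pose q n (c : d.-tuple int) : P := [tuple (tnth c i)%:~R * rk n | i < d].
have dz n x i : `|tnth (q n (z n x)) i - tnth x i| <= rk n.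
  have -> : tnth (q n (z n x)) i - tnth x i =
      rk n * ((Num.floor (2 ^+ n * tnth x i))%:~R - 2 ^+ n * tnth x i).
    rewrite 2!tnth_mktuple mulrBr mulrC; congr (_ - _).
    by rewrite mulrA [rk n * _]mulrC rkK mul1r.
  rewrite normrM (ger0_norm (rk_ge0 n)) ler_piMr ?rk_ge0// distrC.
  by have /andP[h1 h2] := frac_itv (2 ^+ n * tnth x i); rewrite ger0_norm// ltW.
apply: (@measurable_fun_cvg _ _ R setT (fun n x => f (q n (z n x)))); last first.
  move=> x _; apply/cvgrPdist_lt => e e0.
  have [del del0 H] := cf x e e0; have [K HK] := rk_small del0.
  exists K => // n Kn; rewrite /= distrC; apply: H => i.
  exact: le_lt_trans (dz n x i) (HK n Kn).
move=> n _ B mB; rewrite setTI.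
rewrite (_ : _ @^-1` B = \bigcup_k (if @unpickle (d.-tuple int) k is Some c then
   [set x | f (q n c) \in B /\ z n x = c] else set0)); last first.
  apply/seteqP; split=> [x /= Bx|x [k _]].
    by exists (pickle (z n x)) => //; rewrite pickleK; split=> //; exact/mem_set.
  by case: unpickle => // c [/set_mem Bc zc]; rewrite /= zc.
apply: bigcupT_measurable => k; case: unpickle => [c|]; last exact: measurable0.
have [Bc|Bc] := boolP (f (q n c) \in B); last first.
  by rewrite (_ : [set _ | _] = set0)//; apply/seteqP; split=> x [].
rewrite (_ : [set _ | _] = box (q n c) (padd (q n c) (pcst (rk n)))); first exact: measurable_box.
have E x i : (Num.floor (2 ^+ n * tnth x i) == tnth c i) =
    (tnth (q n c) i <= tnth x i < tnth (padd (q n c) (pcst (rk n))) i).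
  have e0 : 0 < 2 ^+ n :> R by rewrite exprn_gt0.
  have -> : tnth (padd (q n c) (pcst (rk n))) i = ((tnth c i)%:~R + 1) / 2 ^+ n.
    by rewrite tnth_padd [tnth (q n c) i]tnth_mktuple [tnth (pcst _) i]tnth_mktuple mulrDl mul1r.
  have -> : tnth (q n c) i = (tnth c i)%:~R / 2 ^+ n by rewrite tnth_mktuple.
  rewrite ler_pdivrMr// ltr_pdivlMr// mulrC.
  apply/eqP/idP => [<-|/andP[h1 h2]].
    by have := frac_itv (tnth x i * 2 ^+ n); rewrite subr_ge0 ltrBlDl addrC.
  by apply/floor_def; rewrite h1 intrD.
apply/seteqP; split=> [x [_ zc] i|x H].
  by rewrite -E -zc tnth_mktuple.
by split=> //; apply: eq_from_tnth => i; rewrite tnth_mktuple; apply/eqP; rewrite E.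
Qed.

(** Obtained from the supremum over simple functions, so it covers integrands of unknown
    measurability, such as the [mu]-measure of sections in [st_jnull]. *)
Lemma ge0_integral_mono dZ (Z : measurableType dZ) (m : {measure set Z -> \bar R})
    (f g : Z -> \bar R) : (forall x : Z, 0 <= f x)%E -> (forall x : Z, f x <= g x)%E ->
  (\int[m]_x f x <= \int[m]_x g x)%E.
Proof.
move=> f0 fg; have g0 (x : Z) : (0 <= g x)%E by exact: le_trans (f0 x) (fg x).
rewrite !ge0_integralTE//; apply: le_ereal_sup => _ [h hf <-].
by exists h => // x; exact: le_trans (hf x) (fg x).
Qed.

Lemma ge0_integral0_ae dZ (Z : measurableType dZ) (m : {measure set Z -> \bar R})
    (f : Z -> \bar R) : measurable_fun setT f -> (forall x : Z, 0 <= f x)%E ->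
  (\int[m]_x f x = 0)%E -> {ae m, forall x : Z, f x = 0%E}.
Proof.
move=> mf f0 If.
have : ae_eq m setT f (cst 0%E).
  apply/ae_eq_integral_abs => //; rewrite -[RHS]If.
  by apply: eq_integral => x _; rewrite gee0_abs.
by apply: filterS => x /(_ I).
Qed.

Lemma lebI_aeS a b (Q Q' : R -> Prop) : (forall t, Q t -> Q' t) ->
  {ae lebI a b, forall t, Q t} -> {ae lebI a b, forall t, Q' t}.
Proof.
by move=> QQ' [A [mA A0 H]]; exists A; split=> // t nQ'; apply: H => /QQ'.
Qed.

Lemma lebI_aeI a b (Q Q' : R -> Prop) : {ae lebI a b, forall t, Q t} ->
  {ae lebI a b, forall t, Q' t} -> {ae lebI a b, forall t, Q t /\ Q' t}.
Proof.
move=> [A [mA A0 HA]] [B [mB B0 HB]]; exists (A `|` B); split.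
- exact: measurableU.
- by rewrite measureU0.
- by move=> t /= /not_andP[n|n]; [left; exact: HA|right; exact: HB].
Qed.

Lemma indic01 dZ (Z : measurableType dZ) (A : set Z) (z : Z) : 0 <= \1_A z :> R.
Proof. by rewrite indicE. Qed.

(* Null sets of space-time, expressed without assuming that [mu] carries a
   sigma-finite structure. *)
Definition jnull N := measurable N /\ \int[lebI 0 T]_t \int[torm]_x \1_N (t, x) = 0.

Lemma bdm_jindic N : measurable N -> bdm (fun q : R * P => \1_N q : R).
Proof. by move=> mN; exact: bdm_indic. Qed.

Lemma jnull_ae1 N : jnull N -> {ae lebI 0 T, forall t, {ae torm, forall x, ~ N (t, x)}}.
Proof.
move=> [mN N0].
have b1 : bdm (fun t : R => \int[torm]_x \1_N (t, x)) := bdm_int torm (bdm_jindic mN).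
have h0 t : 0 <= \int[torm]_x \1_N (t, x) :> R by apply: int_ge0 => x; exact: indic01.
have := @int_eq0_ae _ _ _ (lebI 0 T) _ b1 h0; rewrite N0 lexx => /(_ isT).
apply: lebI_aeS => t H.
have bt : bdm (fun x => \1_N (t, x) : R).
  exact: (bdm_comp (T := fun x => (t, x)) (measurable_pair1 t) (bdm_jindic mN)).
have := @int_eq0_ae _ _ _ torm _ bt (fun x => indic01 N (t, x)); rewrite H lexx => /(_ isT).
by apply: filterS => x; rewrite indicE => /eqP; rewrite pnatr_eq0 eqb0 notin_setE.
Qed.

Lemma jnull_ae2 N : jnull N -> {ae torm, forall x, {ae lebI 0 T, forall t, ~ N (t, x)}}.
Proof.
move=> [mN N0].
have bN := bdm_jindic mN.
have F := int_fubini (lebI 0 T) torm bN.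
rewrite F in N0.
have bN' : bdm (fun q : P * R => \1_N (q.2, q.1) : R).
  apply: (bdm_comp (T := fun q : P * R => (q.2, q.1)) _ bN); exact: measurable_fun_pair.
have b1 : bdm (fun x : P => \int[lebI 0 T]_t \1_N (t, x)) := bdm_int (lebI 0 T) bN'.
have h0 x : 0 <= \int[lebI 0 T]_t \1_N (t, x) :> R by apply: int_ge0 => t; exact: indic01.
have := @int_eq0_ae _ _ _ torm _ b1 h0; rewrite N0 lexx => /(_ isT).
apply: filterS => x H.
have bt : bdm (fun t => \1_N (t, x) : R).
  exact: (bdm_comp (T := fun t => (t, x)) (measurable_pair2 x) bN).
have := @int_eq0_ae _ _ _ (lebI 0 T) _ bt (fun t => indic01 N (t, x)); rewrite H lexx => /(_ isT).
by apply: lebI_aeS => t; rewrite indicE => /eqP; rewrite pnatr_eq0 eqb0 notin_setE.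
Qed.

Lemma ae_jnull N : measurable N ->
  {ae lebI 0 T, forall t, {ae torm, forall x, ~ N (t, x)}} -> jnull N.
Proof.
move=> mN H; split=> //.
have b1 : bdm (fun t : R => \int[torm]_x \1_N (t, x)) := bdm_int torm (bdm_jindic mN).
rewrite -[RHS](mul0r (fine (lebI 0 T setT))) -(int_cst (lebI 0 T) 0).
apply: int_ae_eq => //; first exact: bdm_cst.
apply: lebI_aeS H => t Ht.
rewrite -[RHS](mul0r (fine (torm setT))) -(int_cst torm 0).
apply: int_ae_eq; [|exact: bdm_cst|].
  exact: (bdm_comp (T := fun x => (t, x)) (measurable_pair1 t) (bdm_jindic mN)).
by apply: filterS Ht => x; rewrite indicE -notin_setE => /negbTE ->.
Qed.

Lemma st_jnull N : measurable N -> st_measure mu N = 0%E -> jnull N.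
Proof.
move=> mN N0; apply: ae_jnull => //.
have mt : measurable_fun setT (fun t => torm (xsection N t)).
  exact: (measurable_fun_xsection torm mN).
have : (\int[lebI 0 T]_t torm (xsection N t) = 0)%E.
  apply/eqP; rewrite eq_le; apply/andP; split; last exact: integral_ge0.
  rewrite ge0_int_mfrestr//.
  rewrite integral_mkcond -N0 /st_measure /product_measure1.
  apply: ge0_integral_mono => t; first by rewrite patchE; case: ifP.
  rewrite patchE; case: ifP => _; last exact: measure_ge0.
  rewrite tormE.
  apply: le_measure; rewrite ?inE//; [|exact: measurable_xsection].
  by apply: measurableI; [exact: measurable_xsection|exact: measurable_unit_cube].
move=> /(@ge0_integral0_ae _ _ (lebI 0 T) _ mt (fun t => measure_ge0 _ _)).
apply: lebI_aeS => t Ht; exists (xsection N t); split; [exact: measurable_xsection|exact: Ht|].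
by move=> x /contrapT Nx; rewrite /xsection/= inE.
Qed.

(** Inside [space_time T] sections have the same measure for [mu] and for [torm], and they are empty
    at times outside the interval, so the product measure is computed with finite measures. *)
Lemma jnull_st N : N `<=` space_time T -> jnull N -> st_measure mu N = 0%E.
Proof.
move=> NT jN; have [mN _] := jN; have H := jnull_ae1 jN.
rewrite /st_measure /product_measure1.
rewrite (_ : (fun _ => _) = (fun t => torm (xsection N t)) \_ `[0, T]); last first.
  apply/funext => t; rewrite patchE /=; case: ifPn => [|tT].
    move=> /set_mem /= tT; rewrite tormE; congr (mu _).
    by apply/seteqP; split=> [x Nx|x []//]; split=> //; have := NT (t, x); rewrite /xsection/= inE in Nx; case/(_ Nx).
  rewrite (_ : xsection N t = set0) ?measure0//; apply/seteqP; split=> // x.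
  rewrite /xsection/= inE => Nx; have := NT (t, x) Nx => -[/= tT' _].
  by move: tT; rewrite notin_setE.
rewrite -integral_mkcond -ge0_int_mfrestr//; last exact: (measurable_fun_xsection torm mN).
  exact: leb_itv_fin.
move=> Doo; rewrite -[RHS](integral0 (lebI 0 T) setT).
have mt : measurable_fun (setT : set (measurableTypeR R)) (fun t => torm (xsection N t)).
  exact: (measurable_fun_xsection torm mN).
apply: (@ae_eq_integral _ (measurableTypeR R) R (lebI 0 T) setT (cst 0%E) _ measurableT mt (measurable_cst _)).
suff: {ae lebI 0 T, forall t, torm (xsection N t) = 0%E}.
  by apply: lebI_aeS => t Ht _.
apply: lebI_aeS H => t [A [mA A0 HA]].
apply/eqP; rewrite -measure_le0 -A0; apply: le_measure; rewrite ?inE//.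
  exact: measurable_xsection.
by move=> x; rewrite /xsection/= inE => Nx; apply: HA; exact.
Qed.

Lemma ae_on_jnull (Q : R * P -> Prop) : ae_on (st_measure mu) (space_time T) Q ->
  exists2 N, jnull N & forall t x, 0 <= t <= T -> unit_cube x -> ~ N (t, x) -> Q (t, x).
Proof.
move=> [N [mN N0 HN]]; exists N; first exact: st_jnull.
move=> t x tT ux; apply: contra_notP => Qn; apply: HN; split=> //.
Qed.

Lemma ae_lebI_lebesgue (Q : R -> Prop) a b : {ae lebI a b, forall t, Q t} ->
  {ae lebesgue_measure, forall t, a <= t <= b -> Q t}.
Proof.
move=> [A [mA A0 HA]]; exists (A `&` `[a, b]); split=> //.
  by apply: measurableI.
by move=> t /not_implyP[ab nQ]; split; [exact: HA|rewrite /= in_itv].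
Qed.

Lemma ae_on_lebI (Q : R -> Prop) : ae_on (@lebesgue_measure R) `[0, T] Q ->
  {ae lebI 0 T, forall t, Q t}.
Proof.
move=> [N [mN N0 HN]]; exists (N `|` ~` `[0, T]); split.
- by apply: measurableU => //; exact: measurableC.
- rewrite /= /mfrestr /mrestr; apply/eqP; rewrite -measure_le0 -N0.
  apply: le_measure; rewrite ?inE//.
    by apply: measurableI => //; apply: measurableU => //; exact: measurableC.
  by move=> t [[//|nT] tT].
move=> t nQ; have [tT|nT] := pselect (`[0, T]%classic t); last by right.
by left; apply: HN.
Qed.

End null_sets.

Section clamp.
Context {R : realType}.

Definition clamp (M a : R) : R := Num.max (- M) (Num.min M a).

Lemma clamp_norm (M a : R) : 0 <= M -> `|clamp M a| <= M.
Proof.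
move=> M0; rewrite ler_norml /clamp le_max lexx/= ge_max ge_min lexx/= andbT; lra.
Qed.

Lemma clamp_id (M a : R) : `|a| <= M -> clamp M a = a.
Proof.
by rewrite ler_norml => /andP[h1 h2]; rewrite /clamp (min_idPr h2) (max_idPr h1).
Qed.

Lemma measurable_clamp d (Z : measurableType d) M (f : Z -> R) : measurable_fun setT f ->
  measurable_fun setT (fun z => clamp M (f z)).
Proof. by move=> mf; apply: measurable_maxr => //; exact: measurable_minr. Qed.

End clamp.

(** * Replacing the fields by everywhere defined ones *)

Section clean_fields.
Context {R : realType} {d : nat}.
Local Notation P := (d.-tuple R).
Variable mu : {measure set P -> \bar R}.
Hypothesis Hmu : is_lebesgue_Rd mu.
Variable T : R.
Hypothesis T0 : 0 <= T.
Implicit Types (x y z : P) (i j : 'I_d) (s t M K C : R) (k m : nat).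
Local Notation torm := (torm Hmu).
Local Notation avg := (avg Hmu).
Local Notation avg2 := (avg2 Hmu).
Local Notation wpart := (wpart Hmu).

Lemma test_fun_measurable (psi : P -> R) : test_fun psi ->
  measurable_fun setT psi /\ forall j, measurable_fun setT (Defs.partial j psi).
Proof.
move=> [_ H]; split; first exact: continuousP_measurable (H [::]).1.
by move=> j; exact: continuousP_measurable (H [:: j]).1.
Qed.

Lemma unit_measurable (f : P -> R) : mu.-integrable unit_cube (EFin \o f) ->
  measurable_fun setT (f \o fracP).
Proof.
move=> /integrableP[/measurable_EFinP mf _].
apply: (measurable_comp measurable_unit_cube _ mf); last exact: measurable_fracP.
by move=> _ [x _ <-]; exact: fracP_unit.
Qed.

Lemma unit_intgr (f : P -> R) : mu.-integrable unit_cube (EFin \o f) -> intgr torm (f \o fracP).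
Proof.
move=> If; apply/intgr_mfrestrP; split; first exact: unit_measurable.
move/integrableP : If => [_]; rewrite (@eq_integral _ _ _ mu unit_cube (fun x => `|(f x)%:E|)%E)//.
by move=> x /set_mem ux; rewrite /= fracP_id.
Qed.

Lemma int_unit (f g h : P -> R) : measurable_fun setT h -> (forall x, unit_cube x -> h x = f x * g x) ->
  \int[torm]_x h x = fine (\int[mu]_(x in unit_cube) (f x * g x)%:E).
Proof.
move=> mh hfg; rewrite int_tormE//; congr fine.
by apply: eq_integral => x /set_mem ux; rewrite hfg.
Qed.

Lemma weak_partial_wpart j (f g : P -> R) : weak_partial mu j f g ->
  wpart j (f \o fracP) (g \o fracP).
Proof.
move=> [If Ig H]; split; [by split; exact: per_fracP|exact: unit_intgr|exact: unit_intgr|].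
move=> psi tpsi; have [mp mdp] := test_fun_measurable tpsi.
have mf := unit_measurable If; have mg := unit_measurable Ig.
rewrite (@int_unit f (Defs.partial j psi)); last 2 first.
- exact: measurable_funM.
- by move=> x ux; rewrite /= fracP_id.
rewrite (@int_unit g psi); last 2 first.
- exact: measurable_funM.
- by move=> x ux; rewrite /= fracP_id.
by rewrite H// fineN.
Qed.

Definition wdiv (V : 'I_d -> P -> R) (G : P -> R) := forall psi, test_fun psi ->
  \int[torm]_x (\sum_(j < d) V j x * Defs.partial j psi x) = - \int[torm]_x (G x * psi x).

Lemma weak_div_wdiv (V : 'I_d -> P -> R) (G : P -> R) : weak_div mu V G ->
  wdiv (fun j => V j \o fracP) (G \o fracP).
Proof.
move=> [IV IG H] psi tpsi; have [mp mdp] := test_fun_measurable tpsi.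
have mV j := unit_measurable (IV j); have mG := unit_measurable IG.
rewrite (@int_unit (fun x => \sum_(j < d) V j x * Defs.partial j psi x) (fun=> 1)); last 2 first.
- by apply: measurable_sum => j; exact: measurable_funM.
- by move=> x ux; rewrite mulr1; apply: eq_bigr => j _; rewrite /= fracP_id.
rewrite (@int_unit G psi); last 2 first.
- exact: measurable_funM.
- by move=> x ux; rewrite /= fracP_id.
rewrite -fineN -H//; congr fine; apply: eq_integral => x _; by rewrite mulr1.
Qed.

Lemma int_ae_eqm (f g : P -> R) : measurable_fun setT f -> measurable_fun setT g ->
  {ae torm, forall x, f x = g x} -> \int[torm]_x f x = \int[torm]_x g x.
Proof.
move=> mf mg H; congr fine; apply: ae_eq_integral => //; [exact/measurable_EFinP|exact/measurable_EFinP|].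
by apply: filterS H => x -> _.
Qed.

Lemma wpart_aeL j (F F' W : P -> R) : wpart j F W -> bdm F' -> per F' ->
  {ae torm, forall x, F' x = F x} -> wpart j F' W.
Proof.
move=> [[pF pW] iF iW H] bF' pF' E; split=> //; first exact: bdm_integrable.
move=> psi tpsi; rewrite -H//; have [mp mdp] := test_fun_measurable tpsi.
apply: int_ae_eqm; [by apply: measurable_funM => //; case: bF'|
  by apply: measurable_funM => //; exact: intgr_measurable iF|].
by apply: filterS E => x ->.
Qed.

Lemma wpart_aeR j (F W W' : P -> R) : wpart j F W -> bdm W' -> per W' ->
  {ae torm, forall x, W' x = W x} -> wpart j F W'.
Proof.
move=> [[pF pW] iF iW H] bF' pF' E; split=> //; first exact: bdm_integrable.
move=> psi tpsi; rewrite H//; have [mp mdp] := test_fun_measurable tpsi.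
congr (- _); apply: int_ae_eqm; [by apply: measurable_funM => //; exact: intgr_measurable iW|
  by apply: measurable_funM => //; case: bF'|].
by apply: filterS E => x ->.
Qed.

Lemma wdiv_ae (V V' : 'I_d -> P -> R) (G G' : P -> R) : wdiv V G ->
  (forall j, measurable_fun setT (V j)) -> (forall j, measurable_fun setT (V' j)) ->
  measurable_fun setT G -> measurable_fun setT G' ->
  (forall j, {ae torm, forall x, V' j x = V j x}) -> {ae torm, forall x, G' x = G x} ->
  wdiv V' G'.
Proof.
move=> H mV mV' mG mG' EV EG psi tpsi; have [mp mdp] := test_fun_measurable tpsi.
transitivity (\int[torm]_x (\sum_(j < d) V j x * Defs.partial j psi x)).
  apply: int_ae_eqm.
  - by apply: measurable_sum => j; exact: measurable_funM.
  - by apply: measurable_sum => j; exact: measurable_funM.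
  have : {ae torm, forall x, forall j, V' j x = V j x} by exact: ae_ord.
  by apply: filterS => x Hx; apply: eq_bigr => j _; rewrite Hx.
rewrite H//; congr (- _); apply: int_ae_eqm; [exact: measurable_funM|exact: measurable_funM|].
by apply: filterS EG => x ->.
Qed.

(** The hypotheses on a field with the exceptional times removed and the bounds valid at every
    point; the BMO condition is kept only through the averages it controls. *)
Definition clean_field M K (u : 'I_d -> R -> P -> R) (w : 'I_d -> 'I_d -> R -> P -> R)
    (phi g : R -> P -> R) := [/\
  forall j, jbdm (u j) /\ forall s, per (u j s) /\ forall x, `|u j s x| <= M,
  jbdm g /\ forall s, per (g s) /\ forall x, `|g s x| <= M,
  forall j i, measurable_fun setT (fun q : R * P => w j i q.1 q.2) /\
    forall m s x, `|avg m (w j i s) x| <= K * m%:R,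
  forall s j, wpart j (phi s) (u j s) /\ forall i, wpart i (u j s) (w j i s) &
  forall s, wdiv (fun j => u j s) (g s)].

(** Agreement with the periodic extension of [f], as an iterated almost everywhere statement that
    avoids the product measure. *)
Definition jsame (f f' : R -> P -> R) :=
  {ae lebI 0 T, forall t, {ae torm, forall x, f' t x = f t (fracP x)}}.

Lemma wpart0 j : wpart j (fun=> 0) (fun=> 0).
Proof.
split=> //; [exact: bdm_integrable (bdm_cst _ _)|exact: bdm_integrable (bdm_cst _ _)|].
move=> psi _; under eq_Rintegral do rewrite mul0r.
by under [in RHS]eq_Rintegral do rewrite mul0r; rewrite int_cst mul0r oppr0.
Qed.

Lemma wdiv0 : wdiv (fun=> fun=> 0) (fun=> 0).
Proof.
move=> psi _.
rewrite (@eq_Rintegral _ _ _ torm setT (fun=> 0)); last by move=> x _; rewrite big1// => j _; rewrite mul0r.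
rewrite [in RHS](@eq_Rintegral _ _ _ torm setT (fun=> 0)); last by move=> x _; rewrite mul0r.
by rewrite int_cst mul0r oppr0.
Qed.

Lemma measurable_frac2 (f : R -> P -> R) : measurable_fun setT (fun q : R * P => f q.1 q.2) ->
  measurable_fun setT (fun q : R * P => f q.1 (fracP q.2)).
Proof.
move=> mf; have mp : measurable_fun setT (fun q : R * P => (q.1, fracP q.2)).
  by apply: measurable_fun_pair => //; exact: measurableT_comp measurable_fracP measurable_snd.
exact: (measurableT_comp mf mp).
Qed.

Lemma bmo_le_frac (f : P -> R) C : bmo_le mu f C -> bmo_le mu (f \o fracP) C.
Proof.
move=> H a r r0.
have -> : (f \o fracP) \o fracP = f \o fracP by apply/funext => x; exact: per_fracP.
exact: H.
Qed.

(** On the null set of bad times everything is set to zero, and the zero field satisfies all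
    conditions. At good times the data are extended periodically and the bounded ones clamped, which
    changes values on null sets only and so preserves weak derivatives. *)
Lemma field_clean u phi g w : field_hyp mu T u phi g w ->
  exists M K u' w' phi' g', [/\ 0 <= M, 0 <= K, clean_field M K u' w' phi' g',
    forall j, jsame (u j) (u' j) & jsame g g'].
Proof.
move=> [Hphi _ Hu [[mg [Mg HMg]] Hdiv] [mw Hw [C HC]]].
have /choice[Mu HMu] := fun j => (Hu j).2.
pose M := `|Mg| + \sum_j `|Mu j|.
pose K := 2 ^+ d * `|C|.
have M0 : 0 <= M by rewrite addr_ge0// sumr_ge0.
have K0 : 0 <= K by rewrite mulr_ge0// exprn_ge0.
have gMM : Mg <= M by rewrite (le_trans (ler_norm _))// lerDl sumr_ge0.
have uMM j : Mu j <= M.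
  by rewrite (le_trans (ler_norm _))// /M (bigD1 j)//= addrCA lerDl addr_ge0// sumr_ge0.
have ae_bound (f : R -> P -> R) (B : R) :
    ae_on (st_measure mu) (space_time T) (fun p => `|f p.1 p.2| <= B) ->
    {ae lebI 0 T, forall t, {ae torm, forall x, `|f t (fracP x)| <= B}}.
  move=> /(ae_on_jnull Hmu)[N jN HN].
  apply: lebI_aeS (lebI_aeI (lebI_in 0 T) (jnull_ae1 jN)) => t [tT].
  apply: filterS2 (torm_unit Hmu) => x ux; rewrite fracP_id//; exact: HN.
have aeu : {ae lebI 0 T, forall t, forall j, {ae torm, forall x, `|u j t (fracP x)| <= Mu j}}.
  apply: (@ae_ord _ _ (measurableTypeR R) (lebI 0 T)) => j.
  exact: ae_bound (HMu j).
have [B [mB B0 HB]] := lebI_aeI (lebI_aeI (ae_on_lebI Hphi) (ae_on_lebI Hdiv))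
  (lebI_aeI (lebI_aeI (ae_on_lebI Hw) (ae_on_lebI HC)) (lebI_aeI aeu (ae_bound _ _ HMg))).
pose A : set R := ~` B.
have mA : measurable (A : set (measurableTypeR R)) by exact: measurableC.
have HA t : A t -> _ := fun Bt => contrapT (fun n => Bt (HB t n)).
have aeA : {ae lebI 0 T, forall t, A t} by exists B; split=> // t; rewrite /A /= => /contrapT.
have A1 t : A t -> \1_A t = 1 :> R by move=> At; rewrite indicE mem_set.
have A0 t : ~ A t -> \1_A t = 0 :> R by move=> At; rewrite indicE memNset.
have m1 : measurable_fun setT (fun q : R * P => \1_A q.1 : R).
  by apply: (measurableT_comp (f := \1_A : R -> R)) => //; exact: (measurable_indic mA).
pose cl (f : R -> P -> R) t x := \1_A t * clamp M (f t (fracP x)).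
have cl_jbdm f : measurable_fun setT (fun q : R * P => f q.1 q.2) -> jbdm (cl f).
  move=> mf; split.
    by apply: measurable_funM => //; apply: measurable_clamp; exact: measurable_frac2.
  exists M => q; rewrite /cl; have [Aq|nAq] := pselect (A q.1).
    by rewrite A1// mul1r clamp_norm.
  by rewrite A0// mul0r normr0.
have cl_bd f s : per (cl f s) /\ forall x, `|cl f s x| <= M.
  split=> x; first by rewrite /cl (fracP_id (fracP_unit x)).
  rewrite /cl; have [Aq|nAq] := pselect (A s).
    by rewrite A1// mul1r clamp_norm.
  by rewrite A0// mul0r normr0.
have cl_ae f t (B' : R) : A t -> B' <= M -> {ae torm, forall x, `|f t (fracP x)| <= B'} ->
    {ae torm, forall x, cl f t x = f t (fracP x)}.
  move=> At BM; apply: filterS => x fx; rewrite /cl A1// mul1r clamp_id//; exact: le_trans fx BM.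
have cl0 f t : ~ A t -> cl f t = (fun=> 0) by move=> nA; apply/funext => x; rewrite /cl A0// mul0r.
exists M, K, (fun j => cl (u j)), (fun j i t x => \1_A t * w j i t (fracP x)),
  (fun t x => \1_A t * phi t (fracP x)), (cl g).
have W1 (f : R -> P -> R) t : A t -> (fun x => \1_A t * f t (fracP x)) = f t \o fracP.
  by move=> At; apply/funext => x; rewrite A1// mul1r.
have W0 (f : R -> P -> R) t : ~ A t -> (fun x => \1_A t * f t (fracP x)) = (fun=> 0).
  by move=> At; apply/funext => x; rewrite A0// mul0r.
split=> //; last 2 first.
- move=> j; apply: lebI_aeS aeA => t At.
  have [_ [_ [au _]]] := HA t At; exact: cl_ae (uMM j) (au j).
- apply: lebI_aeS aeA => t At.
  have [_ [_ [_ ag]]] := HA t At; exact: cl_ae gMM ag.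
split.
- move=> j; split; first exact: cl_jbdm (Hu j).1.
  exact: cl_bd.
- by split; [exact: cl_jbdm|exact: cl_bd].
- move=> j i; split.
    by apply: measurable_funM => //; exact: measurable_frac2.
  move=> m s x; have [As|nAs] := pselect (A s); last first.
    by rewrite W0// avg_cst normr0 mulr_ge0.
  have [_ [[Hws HCs] _]] := HA s As; rewrite W1//.
  have wp := weak_partial_wpart (Hws j i); have [[_ pw] _ iw _] := wp.
  rewrite (le_trans (bmo_avg_bound m x iw pw (wpart_mean0 wp) (bmo_le_frac (HCs j i))))//.
  by rewrite ler_wpM2r// ler_wpM2l ?exprn_ge0// ler_norm.
- move=> s j; have [As|nAs] := pselect (A s); last first.
    by rewrite W0// !cl0//; split=> [|i]; rewrite ?W0//; exact: wpart0.
  have [[Hp _] [[Hws HCs] [au _]]] := HA s As.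
  have bc : bdm (cl (u j) s) := jbdm_slice s (cl_jbdm _ (Hu j).1).
  have ac := cl_ae (u j) s _ As (uMM j) (au j).
  rewrite W1//; split=> [|i].
    exact: wpart_aeR (weak_partial_wpart (Hp j)) bc (cl_bd _ _).1 ac.
  rewrite W1//; exact: wpart_aeL (weak_partial_wpart (Hws j i)) bc (cl_bd _ _).1 ac.
- move=> s; have [As|nAs] := pselect (A s); last first.
    rewrite (_ : (fun j => cl (u j) s) = (fun=> fun=> 0)); last by apply/funext => j; rewrite cl0.
    by rewrite cl0//; exact: wdiv0.
  have [[_ Hd] [_ [au ag]]] := HA s As.
  have [IV IG _] := Hd.
  apply: (wdiv_ae (weak_div_wdiv Hd)).
  + by move=> j; exact: unit_measurable.
  + by move=> j; have [] := jbdm_slice s (cl_jbdm _ (Hu j).1).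
  + exact: unit_measurable.
  + by have [] := jbdm_slice s (cl_jbdm _ mg).
  + move=> j; exact: cl_ae (uMM j) (au j).
  + exact: cl_ae gMM ag.
Qed.

Lemma clean_loglip M K u w phi g : clean_field M K u w phi g -> forall j s, loglip Hmu K (u j s).
Proof.
move=> [_ _ Hw Hwp _] j s m i x h.
have [_ /(_ i) wp] := Hwp s j; have [[_ pw] _ iw _] := wp.
apply: (ipart_lip _ (wpart_ipart m wp)); first exact: bdm_avg_intgr.
by have [_] := Hw j i; exact.
Qed.

Lemma jbdm_avg k (f : R -> P -> R) : jbdm f -> jbdm (fun s => avg k (f s)).
Proof.
move=> [mf [M fM]]; split; first exact: (@measurable_avg2 _ _ _ Hmu _ R k (fun q => f q.1 q.2)).
by exists M => q; apply: avg_normM => [|y]; [exact: (jbdm_slice q.1 (conj mf (ex_intro _ M fM)))|exact: (fM (q.1, y))].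
Qed.

(** At each time the continuous representative agrees with the field almost everywhere, hence
    inherits its weak derivatives and its divergence. *)
Lemma clean_tilde M K u w phi g : 0 <= K -> clean_field M K u w phi g ->
  clean_field M K (fun j s => tilde Hmu (u j s)) w phi g.
Proof.
move=> K0 cf; have Hl := clean_loglip cf; have [Hu Hg Hw Hwp Hd] := cf.
have bu j s : bdm (u j s) := jbdm_slice s (Hu j).1.
have pu j s : per (u j s) := ((Hu j).2 s).1.
have uM j s x : `|u j s x| <= M := ((Hu j).2 s).2 x.
have bU j s : bdm (tilde Hmu (u j s)) by exact: (bdm_tilde (bu j s) K0 (Hl j s)).
have pU j s : per (tilde Hmu (u j s)) by exact: per_tilde.
have ae j s := tilde_ae (bu j s) (pu j s) K0 (Hl j s).
split=> //.
- move=> j; split; last by move=> s; split=> // x; exact: (tilde_norm (bu j s) K0 (Hl j s)).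
  split.
    apply: (measurable_fun_cvg (h := fun k q => avg2 k (u j q.1) q.2)) => [k|q _].
      by have [] := jbdm_avg k (jbdm_avg k (Hu j).1).
    exact: (avg2_cvg (bu j q.1) K0 (Hl j q.1)).
  by exists M => q; exact: (tilde_norm (bu j q.1) K0 (Hl j q.1)).
- move=> s j; have [h1 h2] := Hwp s j; split=> [|i].
    exact: wpart_aeR h1 (bU j s) (pU j s) (ae j s).
  exact: wpart_aeL (h2 i) (bU j s) (pU j s) (ae j s).
- move=> s; apply: (wdiv_ae (Hd s)) => [j|j|||j|].
  + by have [] := bu j s.
  + by have [] := bU j s.
  + by have [] := jbdm_slice s Hg.1.
  + by have [] := jbdm_slice s Hg.1.
  + exact: ae j s.
  + exact: aeW.
Qed.

End clean_fields.

(** * Flows of continuous representatives *)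

Section regular_fields.
Context {R : realType} {d : nat}.
Local Notation P := (d.-tuple R).
Variable mu : {measure set P -> \bar R}.
Hypothesis Hmu : is_lebesgue_Rd mu.
Variable T : R.
Hypothesis T0 : 0 <= T.
Implicit Types (x y z : P) (i j : 'I_d) (s t M K C L : R) (k m : nat).
Local Notation torm := (torm Hmu).
Local Notation avg := (avg Hmu).
Local Notation avg2 := (avg2 Hmu).
Local Notation wpart := (wpart Hmu).
Local Notation tilde := (tilde Hmu).

Lemma avg_aeE k (f g : P -> R) x : bdm f -> per f -> bdm g -> per g ->
  {ae torm, forall x, f x = g x} -> avg k f x = avg k g x.
Proof.
move=> bf pf bg pg E.
rewrite (avg_chi k x (bdm_integrable _ bf) pf) (avg_chi k x (bdm_integrable _ bg) pg).
congr (_ * _); apply: int_ae_eq.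
- by apply: bdmM => //; exact: bdm_chi.
- by apply: bdmM => //; exact: bdm_chi.
- by apply: filterS E => z ->.
Qed.

(** Averages do not see null sets. For a field equal to its own representative, the distance to the
    double averages is bounded at every point, as [smooth_field] requires. *)
Lemma tilde_tilde K (f : P -> R) : bdm f -> per f -> 0 <= K -> loglip Hmu K f ->
  tilde (tilde f) = tilde f.
Proof.
move=> bf pf K0 lf.
have bt := bdm_tilde bf K0 lf; have pt := per_tilde Hmu pf; have ae := tilde_ae bf pf K0 lf.
have E k x : avg2 k (tilde f) x = avg2 k f x.
  by apply: avg_ext => y; exact: (avg_aeE k y bt pt bf pf ae).
apply/funext => x; rewrite {1}/tilde; congr (limn _).
by apply/funext => k; exact: E.
Qed.

Lemma clean_mono M M' K K' (u : 'I_d -> R -> P -> R) w phi g : M <= M' -> K <= K' ->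
  clean_field Hmu M K u w phi g -> clean_field Hmu M' K' u w phi g.
Proof.
move=> MM KK [Hu [bg Hg] Hw Hwp Hd]; split=> //.
- move=> j; have [bu uM] := Hu j; split=> // s; have [pu h] := uM s.
  by split=> // x; exact: le_trans (h x) MM.
- by split=> // s; have [pg h] := Hg s; split=> // x; exact: le_trans (h x) MM.
- move=> j i; have [mw h] := Hw j i; split=> // m s x.
  by rewrite (le_trans (h m s x))// ler_wpM2r.
Qed.

Section one_field.
Variables (M K : R) (U : 'I_d -> R -> P -> R) (w : 'I_d -> 'I_d -> R -> P -> R) (phi g : R -> P -> R).
Hypotheses (M0 : 0 <= M) (K0 : 0 <= K) (cU : clean_field Hmu M K U w phi g).
Hypothesis tU : forall j s, tilde (U j s) = U j s.

(** The Lipschitz constant that [avg_bdm_lip] gives for the average of a function bounded by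
    [K k]. *)
Let A k : R := 2 * (K * k%:R) * 2 ^+ k.

Lemma smooth_clean : smooth_field M K A (@log_err R d K) (fun k i s => avg2 k (U i s))
  (fun k i s => avg2 k (w i i s)) U.
Proof.
have Hl := clean_loglip cU; have [Hu Hg Hw Hwp Hd] := cU.
have bU j s : bdm (U j s) := jbdm_slice s (Hu j).1.
have pU j s : per (U j s) := ((Hu j).2 s).1.
have UM j s x : `|U j s x| <= M := ((Hu j).2 s).2 x.
have baw k i j s : bdm (avg k (w i j s)).
  have [_ /(_ j) [[_ pw] _ iw _]] := Hwp s i; exact: bdm_avg_intgr.
have pw i j s : per (w i j s) by have [_ /(_ j) [[_ pw] _ iw _]] := Hwp s i.
split.
- move=> k i; split; first by do 2! apply: jbdm_avg; exact: (Hu i).1.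
  move=> s; split; [exact: bdm_avg2|exact: per_avg2| |].
    by move=> x; exact: avg2_normM.
  by move=> x y; exact: avg2_lip.
- move=> k i; have [mw wK] := Hw i i; split.
    split; last first.
      by exists (K * k%:R) => q; apply: avg_normM; [exact: baw|move=> y; exact: wK].
    pose m1 := @measurable_avg2 _ _ _ Hmu _ (measurableTypeR R) k _ mw.
    exact: (@measurable_avg2 _ _ _ Hmu _ (measurableTypeR R) k _ m1).
  move=> s; split; [exact: bdm_avg|exact: per_avg2| |].
    by move=> x; apply: avg_normM => // y; exact: wK.
  by apply: lip_dist1 => j x h; apply: avg_bdm_lip => // y; exact: wK.
- move=> k i s; apply: avg_ipart; [exact: bdm_avg|exact: baw|].
  by have [_ /(_ i) wp] := Hwp s i; exact: wpart_ipart.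
- move=> k s x; rewrite -avg_sum//.
  have [bg gM] := Hg; have bgs := jbdm_slice s bg; have [pg gsM] := gM s.
  rewrite (@avg_ext _ _ _ _ _ _ (avg k (g s))); first exact: avg2_normM.
  move=> y; apply: (wdiv_avg k _ _ pg (Hd s)) => [j|]; last exact: bdm_integrable.
  by have [_] := Hwp s j; exact.
- split=> [i|k i s x]; first exact: (Hu i).1.
  by split=> //; rewrite -{1}(tU i s); exact: tilde_close.
Qed.

Lemma gapp_clean k s x : gapp (fun k i s => avg2 k (w i i s)) k s x = avg2 k (g s) x.
Proof.
have [Hu Hg Hw Hwp Hd] := cU; rewrite /gapp -avg_sum; last first.
  by move=> i; have [_ /(_ i) [[_ pw] _ iw _]] := Hwp s i; exact: bdm_avg_intgr.
have [bg gM] := Hg; have bgs := jbdm_slice s bg; have [pg gsM] := gM s.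
apply: avg_ext => y; apply: (wdiv_avg k _ _ pg (Hd s)) => [j|]; last exact: bdm_integrable.
by have [_] := Hwp s j; exact.
Qed.

Lemma gdist_clean : gdist Hmu T (fun k i s => avg2 k (w i i s)) g @ \oo --> 0.
Proof.
have [Hu [bg gM] Hw Hwp Hd] := cU.
have b k : jbdm (fun s x => `|avg2 k (g s) x - g s x|).
  have b2 := jbdm_avg Hmu k (jbdm_avg Hmu k bg); exact: bdm_norm (bdmB b2 bg).
rewrite (_ : gdist _ _ _ _ = fun k => \int[lebI 0 T]_s \int[torm]_x `|avg2 k (g s) x - g s x|); last first.
  apply/funext => k; rewrite /gdist; apply: eq_Rintegral => s _; apply: eq_Rintegral => x _.
  by rewrite gapp_clean.
rewrite -[X in _ --> X](mul0r (fine (lebI 0 T setT))) -(int_cst (lebI 0 T) 0).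
apply: (@int_cvg _ _ _ (lebI 0 T) (fun k s => \int[torm]_x `|avg2 k (g s) x - g s x|) (fun=> 0) (2 * M)).
- by move=> k; have [] := bdm_int torm (b k).
- move=> k s; have bs := jbdm_slice s (b k); have [pg gsM] := gM s; have bgs := jbdm_slice s bg.
  apply: (@le_trans _ _ (2 * M * fine (torm setT))); last by rewrite torm1 mulr1.
  apply: int_normM => // x; rewrite normr_id (le_trans (ler_normB _ _))// mulr_natl mulr2n.
  by apply: lerD; [exact: avg2_normM|exact: gsM].
- exact: bdm_cst.
- apply: (lebI_aeS _ (lebI_in 0 T)) => s _; have [pg gsM] := gM s; have bgs := jbdm_slice s bg.
  exact: avg2_cvgL1.
Qed.

Lemma clean_jacobian L sigma X : 0 <= L -> flow_of Hmu T L U X -> jbdm sigma ->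
  (forall s y, `|sigma s y| <= M) ->
  \int[lebI 0 T]_s \int[torm]_y `|g s (X s y) - sigma s y| = 0 ->
  forall t F, 0 <= t <= T -> bdm F -> per F ->
  \int[torm]_y (F (X t y) * jac sigma t y) = \int[torm]_x F x.
Proof.
move=> L0 HX bsig sigM gsig.
have [_ [bg gM] _ _ _] := cU.
apply: (@jacobian_formula _ _ _ Hmu T M K L (8 * K * d%:R) A (@log_err R d K) _ _ U g sigma X) => //.
- by move=> k; rewrite /A !mulr_ge0// exprn_ge0.
- by rewrite !mulr_ge0.
- exact: smooth_clean.
- by move=> s; have [] := gM s.
- exact: gdist_clean.
Qed.

Variables (u : 'I_d -> R -> P -> R) (X : R -> P -> P).
Hypotheses (mu_ : forall j, measurable_fun setT (fun q : R * P => u j q.1 q.2)).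
Hypotheses (uU : forall j, jsame Hmu T (u j) (U j)).
Hypothesis HX : regular_lagrangian_flow mu T u X.

Lemma jsame_jnull (f f' : R -> P -> R) : measurable_fun setT (fun q : R * P => f q.1 q.2) ->
  measurable_fun setT (fun q : R * P => f' q.1 q.2) -> jsame Hmu T f f' ->
  jnull Hmu T [set q | f' q.1 q.2 <> f q.1 (fracP q.2)].
Proof.
move=> mf mf' H; apply: ae_jnull.
  have mD : measurable_fun setT (fun q : R * P => f' q.1 q.2 - f q.1 (fracP q.2)).
    by apply: measurable_funB => //; exact: measurable_frac2.
  have := mD measurableT _ (measurableC (measurable_set1 (0 : R))); rewrite setTI.
  rewrite (_ : _ @^-1` _ = [set q : R * P | f' q.1 q.2 <> f q.1 (fracP q.2)])//.
  apply/seteqP; split=> q /=; apply: contra_not.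
    by move=> ->; rewrite subrr.
  by move/subr0_eq.
by apply: lebI_aeS H => t; apply: filterS => x h /=; rewrite h.
Qed.

Lemma flow_compression : exists2 L, 0 <= L & forall t, 0 <= t <= T -> forall f : P -> R,
  bdm f -> per f -> (forall x, 0 <= f x) -> \int[torm]_y f (X t y) <= L * \int[torm]_x f x.
Proof.
have [mX _ _ _ [L HL]] := HX.
(* The definition of the flow prescribes no sign for its constant, hence the maximum with 0. *)
exists (Num.max L 0); first by rewrite le_max lexx orbT.
move=> t tT f bf pf f0.
have mXt : measurable_fun setT (X t) := measurableT_comp mX (measurable_pair1 t).
have mT : measurable_fun setT (fun y => fracP (X t y)) := measurableT_comp measurable_fracP mXt.
rewrite (_ : \int[torm]_y f (X t y) = \int[torm]_y f (fracP (X t y))); last first.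
  by apply: eq_Rintegral => y _; rewrite pf.
apply: int_comp_le => //; first by rewrite le_max lexx orbT.
move=> B mB; rewrite !tormE.
have := HL t tT (B `&` unit_cube) (measurableI _ _ mB measurable_unit_cube) (@subIsetr _ _ _).
rewrite (_ : unit_cube `&` _ = (fun y => fracP (X t y)) @^-1` B `&` unit_cube); last first.
  rewrite setIC; congr (_ `&` _); apply/seteqP; split=> y /= => [[]//|By]; split=> //.
  exact: fracP_unit.
move=> h; apply: (le_trans h); apply: lee_wpmul2r => //.
by rewrite lee_fin le_max lexx.
Qed.

(** Bounded compression at each time prevents a set of positive measure from being carried into a
    null set; compositions with the flow thus become insensitive to the choice of
    representatives. *)
Lemma jnull_flow N : jnull Hmu T N -> jnull Hmu T [set q | N (q.1, fracP (X q.1 q.2))].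
Proof.
move=> jN; have [mN _] := jN; have [mX _ _ _ _] := HX; have [L L0 HL] := flow_compression.
have mY : measurable_fun setT (fun q : R * P => (q.1, fracP (X q.1 q.2))).
  by apply: measurable_fun_pair => //; exact: (measurableT_comp measurable_fracP mX).
apply: ae_jnull.
  by have := mY measurableT _ mN; rewrite setTI.
apply: lebI_aeS (lebI_aeI (lebI_in 0 T) (jnull_ae1 jN)) => t [tT Ht].
have mXt : measurable_fun setT (X t) := measurableT_comp mX (measurable_pair1 t).
have bf : bdm (fun x => \1_N (t, fracP x) : R).
  apply: (bdm_comp (T := fun x => (t, fracP x)) _ (bdm_indic R mN)).
  exact: measurableT_comp (measurable_pair1 t) measurable_fracP.
have pf : per (fun x => \1_N (t, fracP x) : R) by move=> x; rewrite (fracP_id (fracP_unit x)).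
have f0 x : 0 <= \1_N (t, fracP x) :> R by exact: indic01.
have := HL t tT _ bf pf f0.
have -> : \int[torm]_x \1_N (t, fracP x) = 0 :> R.
  rewrite -[RHS](mul0r (fine (torm setT))) -(int_cst torm 0).
  apply: int_ae_eq => //; first exact: bdm_cst.
  apply: filterS2 (torm_unit Hmu) Ht => x ux Nx; rewrite fracP_id//.
  by rewrite indicE memNset.
rewrite mulr0 => h.
have bX : bdm (fun y => \1_N (t, fracP (X t y)) : R) := bdm_comp mXt bf.
have := @int_eq0_ae _ _ _ torm _ bX (fun y => f0 (X t y)) h.
apply: filterS => y /eqP; rewrite indicE pnatr_eq0 eqb0 notin_setE.
by [].
Qed.

Definition good_point y := [/\ unit_cube y, forall i, abs_cont_on 0 T (fun t => tnth (X t y) i) &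
  {ae lebesgue_measure, forall t, 0 <= t <= T -> forall i,
    is_derive t 1 (fun t => tnth (X t y) i) (U i t (X t y))}].

Lemma good_point_ae : {ae torm, forall y, good_point y}.
Proof.
have [mX [N [mN N0 HN]] X0 Hd _] := HX; have [Hu _ _ _ _] := cU.
have [N1 jN1 HN1] := ae_on_jnull Hmu Hd.
have jB i : {ae torm, forall y, {ae lebI 0 T, forall t, ~ U i t (fracP (X t y)) <> u i t (fracP (fracP (X t y)))}}.
  have [mU _] := (Hu i).1.
  exact: (jnull_ae2 (jnull_flow (jsame_jnull (mu_ i) mU (uU i)))).
have aN : {ae torm, forall y, ~ N y}.
  exists N; split=> //; last by move=> y /contrapT.
  apply/eqP; rewrite -measure_le0 -N0; apply: le_measure; rewrite ?inE//.
  by apply: measurableI => //; exact: measurable_unit_cube.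
have := ae_ord jB; apply: filterS3 (filterI (torm_unit Hmu) aN) (jnull_ae2 jN1) => y [uy Ny] h1 hB.
split=> //.
  by move=> i; have : ~ ~ (forall i, abs_cont_on 0 T (fun t => tnth (X t y) i));
     [move=> h; apply: Ny; exact: HN|move/contrapT; exact].
apply: ae_lebI_lebesgue.
have hB' := @ae_ord _ _ (measurableTypeR R) (lebI 0 T) _ _ hB.
apply: lebI_aeS (lebI_aeI (lebI_in 0 T) (lebI_aeI h1 hB')) => t [tT [n1 nB]] i.
have [dX dE] := HN1 t y tT uy n1 i.
have pU : per (U i t) by have [_ /(_ t) []] := Hu i.
apply: DeriveDef => //; rewrite -derive1E dE /= -[RHS]pU.
by have /contrapT -> := nB i; rewrite (fracP_id (fracP_unit _)).
Qed.

(** Trajectories from the null set of bad initial points are frozen; the displacement bound [M T]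
    then holds for all initial points, and the integral equation for almost all of them. *)
Lemma flow_clean : exists L X', [/\ 0 <= L, flow_of Hmu T L U X',
  {ae torm, forall y, {ae lebesgue_measure, forall t, 0 <= t <= T -> forall i,
     is_derive t 1 (fun t => tnth (X' t y) i) (U i t (X' t y))}},
  forall i t y, 0 <= t <= T -> `|tnth (X' t y) i - tnth y i| <= M * T &
  {ae torm, forall y, forall t, X' t y = X t y}].
Proof.
have [L L0 HL] := flow_compression; have [mX _ X0 _ _] := HX; have [Hu _ _ _ _] := cU.
have [B [mB B0 HB]] := good_point_ae.
pose X' t y := if y \in B then y else X t y.
have gB y : y \notin B -> good_point y.
  by rewrite notin_setE => nB; apply: contrapT => ng; apply: nB; exact: HB.
have X'E y t : y \notin B -> X' t y = X t y by rewrite /X' => /negbTE ->.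
have aB : {ae torm, forall y, y \notin B}.
  by exists B; split=> // y; rewrite /= notin_setE => /contrapT.
have bUX i y : bdm (fun r => U i r (X r y)).
  apply: (bdm_comp (T := fun r => (r, X r y)) _ (Hu i).1).
  by apply: measurable_fun_pair => //; exact: measurableT_comp mX (measurable_pair2 y).
have ftc y : good_point y -> forall i s h, 0 <= s -> 0 <= h -> s + h <= T ->
    tnth (X (s + h) y) i - tnth (X s y) i = \int[lebI s (s + h)]_r U i r (X r y).
  move=> [uy ac dX] i s h s0 h0 shT.
  apply: (@ac_ftc _ (fun t => tnth (X t y) i) (fun r => U i r (X r y))).
  - by rewrite lerDl.
  - move=> e e0; have [del del0 Hdel] := ac i e e0; exists del => // n a b Hab dab; apply: Hdel => //.
    by move=> k; have [h1 [h2 h3]] := Hab k; split; [exact: le_trans s0 h1|split=> //; exact: le_trans h3 shT].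
  - exact: bUX.
  - move: dX; apply: filterS; first exact: (ae_filter_ringOfSetsType lebesgue_measure).
    move=> t Ht /andP[st tsh]; apply: Ht; apply/andP; split; [exact: le_trans s0 st|exact: le_trans tsh shT].
exists L, X'; split=> //.
- split.
  + apply: (@measurable_fun_ifT _ _ _ _ (fun q : R * P => q.2) (fun q => X q.1 q.2) (fun q => q.2 \in B)) => //.
    apply: (measurable_fun_bool true); rewrite setTI.
    rewrite (_ : _ @^-1` _ = (fun q : R * P => q.2) @^-1` B).
      by rewrite -[X in measurable X]setTI; exact: measurable_snd.
    by apply/seteqP; split=> q; [exact: set_mem|move=> Bq; exact/mem_set].
    exact: measurable_snd.
  + by apply: filterS aB => y yB; rewrite X'E//; apply: X0; have [] := gB y yB.
  + apply: filterS aB => y yB i s h s0 h0 shT.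
    rewrite !X'E// (ftc y (gB y yB))//; apply: eq_Rintegral => r _; by rewrite X'E.
  + move=> t tT f bf pf f0; rewrite (_ : \int[torm]_y f (X' t y) = \int[torm]_y f (X t y)); first exact: HL.
    have mXt : measurable_fun setT (X t) := measurableT_comp mX (measurable_pair1 t).
    apply: int_ae_eqm.
    * apply: (measurableT_comp bf.1).
      apply: (@measurable_fun_ifT _ _ _ _ id (X t) (fun y => y \in B)) => //.
      apply: (measurable_fun_bool true); rewrite setTI.
      rewrite (_ : _ @^-1` _ = B)//.
      by apply/seteqP; split=> q; [exact: set_mem|move=> Bq; exact/mem_set].
    * exact: measurableT_comp bf.1 mXt.
    * by apply: filterS aB => y yB; rewrite X'E.
- apply: filterS aB => y yB; have [_ _] := gB y yB.
  apply: filterS; first exact: (ae_filter_ringOfSetsType lebesgue_measure).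
  move=> t Ht tT i; have := Ht tT i.
  rewrite (_ : (fun t => tnth (X' t y) i) = (fun t => tnth (X t y) i)) ?X'E//.
  by apply/funext => r; rewrite X'E.
- move=> i t y /andP[t0 tT]; have [yB|yB] := boolP (y \in B).
    by rewrite /X' yB subrr normr0 mulr_ge0.
  have gy := gB y yB; have [uy _ _] := gy; rewrite X'E//.
  have := ftc y gy i 0 t (lexx _) t0; rewrite add0r (X0 y uy) => -> //.
  apply: (@le_trans _ _ (M * t)); last by rewrite ler_wpM2l.
  have := @lebI_normM _ (fun r => U i r (X r y)) 0 t M t0 (bUX i y); rewrite add0r; apply.
  by move=> r _; exact: ((Hu i).2 r).2.
- by apply: filterS aB => y yB t; rewrite X'E.
Qed.

Lemma flow_gsig (g0 sigma0 sigma : R -> P -> R) X' :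
  measurable_fun setT (fun q : R * P => g0 q.1 q.2) -> jsame Hmu T g0 g ->
  jsame Hmu T sigma0 sigma ->
  ae_on (st_measure mu) (space_time T) (fun p => g0 p.1 (fracP (X p.1 p.2)) = sigma0 p.1 p.2) ->
  jbdm (fun s y => `|g s (X' s y) - sigma s y|) ->
  {ae torm, forall y, forall t, X' t y = X t y} ->
  \int[lebI 0 T]_s \int[torm]_y `|g s (X' s y) - sigma s y| = 0.
Proof.
move=> mg0 gg ss H bG XX; have [_ [bg gM] _ _ _] := cU.
have [N jN HN] := ae_on_jnull Hmu H.
have jB := jnull_flow (jsame_jnull mg0 bg.1 gg).
rewrite -[RHS](mul0r (fine (lebI 0 T setT))) -(int_cst (lebI 0 T) 0).
have b1 : bdm (fun s : R => \int[torm]_y `|g s (X' s y) - sigma s y|) := bdm_int torm bG.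
apply: int_ae_eq => //; first exact: bdm_cst.
apply: lebI_aeS (lebI_aeI (lebI_aeI (lebI_in 0 T) ss) (lebI_aeI (jnull_ae1 jN) (jnull_ae1 jB))) =>
  t [[tT st] [Nt Bt]].
rewrite -[RHS](mul0r (fine (torm setT))) -(int_cst torm 0).
apply: int_ae_eq; [exact: jbdm_slice t bG|exact: bdm_cst|].
apply: filterS3 (filterI (torm_unit Hmu) XX) (filterI st Nt) Bt => y [uy Xy] [sy Ny] /contrapT /= By.
have [pg _] := gM t.
apply/eqP; rewrite normr_eq0 subr_eq0; apply/eqP.
rewrite Xy -pg By (fracP_id (fracP_unit (X t y))) sy (fracP_id uy).
by have := HN t y tT uy Ny.
Qed.

End one_field.
End regular_fields.

(** * Uniqueness *)

Section osgood.
Context {R : realType}.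
Implicit Types (s t a B c lam C T : R) (n l k : nat) (D : R -> R).

(* [E] is the exponential frozen beyond [t1], to be bounded on the whole line. *)
Lemma int_expR_le lam (t0 t1 t : R) : 0 < lam -> t0 <= t -> t <= t1 ->
  exists E : R -> R, [/\ bdm E, forall s, s <= t1 -> E s = expR (lam * (s - t0)) &
    \int[lebI t0 t]_s E s <= expR (lam * (t - t0)) / lam].
Proof.
move=> lam0 t0t tt1.
pose e s := expR (lam * (s - t0)).
have ce : continuous e.
  by move=> s; apply: continuous_comp; [apply: cvgM; [exact: cvg_cst|apply: cvgB; [exact: cvg_id|exact: cvg_cst]]|exact: continuous_expR].
exists (fun s => e (Num.min s t1)); split.
- split; last first.
    exists (e t1) => s; rewrite ger0_norm ?expR_ge0// ler_expR ler_pM2l// lerD2r.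
    by rewrite ge_min lexx orbT.
  apply: (measurableT_comp (f := e)); first exact: continuous_measurable_fun.
  exact: measurable_minr.
- by move=> s st; rewrite (min_idPl st).
have me : measurable_fun setT e by exact: continuous_measurable_fun.
rewrite int_lebI; last first.
  by apply: (measurableT_comp (f := e)) => //; exact: measurable_minr.
rewrite (_ : \int[_]_(x in _) _ = \int[lebesgue_measure]_(x in `[t0, t]) e x); last first.
  apply: eq_Rintegral => s; rewrite inE/= in_itv/= => /andP[_ st]; congr e; apply/min_idPl.
  exact: le_trans st tt1.
rewrite -int_lebI//.
have dG s : is_derive s 1 (fun s => lam^-1 * expR (lam * (s - t0))) (e s).
  have dl : is_derive s 1 (fun s => lam * (s - t0)) lam.
    by apply: is_derive_eq; rewrite subr0 /GRing.scale/= mulr1.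
  have de := @is_derive1_comp _ expR (fun s => lam * (s - t0)) s _ _ (is_derive_expR _) dl.
  apply: (is_derive_cast (is_deriveZ lam^-1 de)).
  by rewrite /GRing.scale/= mulrC mulfK// gt_eqF.
have -> := FTC2l t0t ce dG.
rewrite subrr mulr0 expR0 mulr1 mulrC gerBl invr_ge0; exact: ltW.
Qed.

(** Measured with the weight [exp (2 c (t - t0))] the integral operator has norm at most [1/2], so
    each iteration, starting from the crude bound [B], halves the excess over [2 a]. *)
Lemma weighted_gronwall D a c (t0 t1 : R) : 0 <= a -> 0 < c -> bdm D ->
  (forall t, t0 <= t <= t1 -> D t <= a + c * \int[lebI t0 t]_s D s) ->
  forall t, t0 <= t <= t1 -> D t <= 2 * a * expR (2 * c * (t - t0)).
Proof.
move=> a0 c0 bD H.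
have [mD [B DB]] := bD.
have B0 : 0 <= B by exact: le_trans (DB 0).
have l0 : 0 < 2 * c by rewrite mulr_gt0.
have E1 t : t0 <= t -> 1 <= expR (2 * c * (t - t0)).
  by move=> h; rewrite -[X in X <= _]expR0 ler_expR mulr_ge0 ?subr_ge0// ltW.
have step n t : t0 <= t <= t1 -> D t <= (2 * a + B * rk n) * expR (2 * c * (t - t0)).
  elim: n t => [|n IHn] t /andP[t0t tt1].
    rewrite rk0 mulr1 (le_trans (ler_norm _))// (le_trans (DB t))//.
    have := E1 t t0t; set e := expR _ => e1.
    rewrite (@le_trans _ _ (2 * a + B))//; first by rewrite lerDr mulr_ge0.
    by rewrite ler_peMr// addr_ge0// mulr_ge0.
  have [E [bE EE IE]] := int_expR_le l0 t0t tt1.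
  rewrite (le_trans (H t _)) ?t0t//.
  have : \int[lebI t0 t]_s D s <= (2 * a + B * rk n) * (expR (2 * c * (t - t0)) / (2 * c)).
    apply: (@le_trans _ _ (\int[lebI t0 t]_s ((2 * a + B * rk n) * E s))).
      apply: int_ae_le => //; first exact: bdmZ.
      apply: lebI_ae => s /andP[t0s st]; have st1 := le_trans st tt1.
      by rewrite EE// IHn// t0s.
    by rewrite intZ// ler_wpM2l// addr_ge0 ?mulr_ge0// rk_ge0.
  have := E1 t t0t; set e := expR _ => e1; set I := \int[_]_s _.
  rewrite rkS; have := rk_ge0 (R := R) n; set r := rk n => r0 HI.
  have : c * I <= (2 * a + B * r) * e / 2.
    rewrite (_ : (2 * a + B * r) * e / 2 = c * ((2 * a + B * r) * (e / (2 * c)))); last by field; exact: lt0r_neq0.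
    by rewrite ler_pM2l.
  have : a <= a * e by rewrite ler_peMr.
  clear; move=> h1 h2.
  rewrite (_ : (2 * a + B * (r / 2)) * e = a * e + (2 * a + B * r) * e / 2); last by field.
  exact: lerD.
move=> t tt; apply/ler_addgt0Pr => e e0.
have [t0t _] := andP tt.
have x0 : 0 < expR (2 * c * (t - t0)) by exact: expR_gt0.
have [k Hk] := rk_small (divr_gt0 e0 (mulr_gt0 (ltr_wpDl B0 ltr01) x0)).
rewrite (le_trans (step k t tt))// mulrDl lerD2l -mulrA mulrC.
have := ltW (Hk k (leqnn k)); rewrite ler_pdivlMr; last by rewrite mulr_gt0// ltr_wpDl.
move=> h; rewrite (le_trans _ h)//.
move: x0; set E := expR _ => x0.
have -> : rk k * E * B = rk k * (B * E) by ring.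
by rewrite ler_wpM2l ?rk_ge0// ler_wpM2r ?lerDl// ltW.
Qed.

Lemma expR_small C : 0 < C -> expR (2 * C * (8 * (C + 1))^-1) <= 2.
Proof.
move=> C0; set a := _ * _.
have a4 : 0 <= a <= 1 / 4.
  rewrite /a divr_ge0 ?mulr_ge0//=; [|lra|lra].
  by rewrite ler_pdivrMr; lra.
have := @expR_quad _ a; rewrite ger0_norm; last by case/andP: a4.
have [a0 a1] := andP a4; have a2 : a <= 2^-1 by lra.
move=> /(_ a2); rewrite ler_norml => /andP[_ h].
have : a ^+ 2 <= a * (1 / 4) by rewrite expr2 ler_wpM2l.
lra.
Qed.

(** On an interval of length [tau] Gronwall's factor [exp (2 C (l + 2) tau)] is at most [2^(l + 2)],
    while the error carries [4^-l]; up to a constant their product is [(l + 2) 2^-l], which tends to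
    0. As [tau] depends on [C] alone, real induction covers [[0, T]]. *)
Lemma osgood D T C : 0 <= T -> 0 < C -> bdm D -> (forall t, 0 <= D t) ->
  (forall l t, 0 <= t <= T ->
     D t <= C * (l%:R + 2) * \int[lebI 0 t]_s (D s + rk l ^+ 2)) ->
  forall t, 0 <= t <= T -> D t = 0.
Proof.
move=> T0 C0 bD D0 H.
pose tau := (8 * (C + 1))^-1.
have tau0 : 0 < tau by rewrite invr_gt0; lra.
have short t0 t1 : 0 <= t0 -> t0 <= t1 -> t1 <= T -> t1 - t0 <= tau ->
    (forall t, 0 <= t <= t0 -> D t = 0) -> forall t, 0 <= t <= t1 -> D t = 0.
  move=> t00 t01 t1T dt Dz t /andP[tge tt1].
  have [tt0|/ltW t0t] := leP t t0; first by apply: Dz; rewrite tge.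
  have bound l : D t <= 8 * C * T * ((l%:R + 2) * rk l).
    have l2 : 0 < l%:R + 2 :> R by rewrite ltr_wpDl.
    have c0 : 0 < C * (l%:R + 2) by rewrite mulr_gt0.
    have Hg s : t0 <= s <= t1 -> D s <= C * (l%:R + 2) * (rk l ^+ 2 * T) +
        C * (l%:R + 2) * \int[lebI t0 s]_r D r.
      move=> /andP[t0s st1]; have sT := le_trans st1 t1T; have s0 := le_trans t00 t0s.
      rewrite (le_trans (H l s _)) ?s0//= -mulrDr ler_pM2l//.
      rewrite intD//; last exact: bdm_cst.
      rewrite int_cst lebI1// subr0 (lebI_cat bD t00 t0s).
      rewrite (_ : \int[lebI 0 t0]_r D r = 0) ?add0r; last first.
        rewrite -[RHS](mul0r (fine (lebI 0 t0 setT))) -(int_cst (lebI 0 t0) 0).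
        by apply: int_ae_eq => //; [exact: bdm_cst|exact: lebI_ae].
      by rewrite addrC lerD2r ler_wpM2l// exprn_ge0// rk_ge0.
    have a0 : 0 <= C * (l%:R + 2) * (rk l ^+ 2 * T).
      by rewrite mulr_ge0 ?(ltW c0)// mulr_ge0// exprn_ge0// rk_ge0.
    have := weighted_gronwall a0 c0 bD Hg (t := t); rewrite t0t tt1 => /(_ isT) h.
    apply: (le_trans h).
    have : expR (2 * (C * (l%:R + 2)) * (t - t0)) <= 2 ^+ (l + 2).
      apply: (@le_trans _ _ (expR ((l + 2)%:R * (2 * C * tau)))).
        rewrite ler_expR natrD [leRHS]mulrC.
        rewrite (_ : 2 * (C * (l%:R + 2)) * (t - t0) = 2 * C * (l%:R + 2) * (t - t0)); last by ring.
        rewrite mulrAC ler_wpM2r ?(ltW l2)// ler_wpM2l//; first by rewrite mulr_ge0// ltW.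
        by rewrite (le_trans _ dt)// lerD2r.
      rewrite expRM_natl; apply: lerXn2r; rewrite ?nnegrE ?expR_ge0//.
      exact: expR_small.
    move=> h2.
    apply: (@le_trans _ _ (2 * (C * (l%:R + 2) * (rk l ^+ 2 * T)) * 2 ^+ (l + 2))).
      by rewrite ler_wpM2l// mulr_ge0.
    have := rkK (R := R) l; set r := rk l => rK.
    rewrite exprD (_ : 2 * (C * (l%:R + 2) * (r ^+ 2 * T)) * (2 ^+ l * 2 ^+ 2) =
      8 * C * T * ((l%:R + 2) * r) * (2 ^+ l * r)); last by ring.
    by rewrite rK mulr1.
  apply/eqP; rewrite eq_le D0 andbT.
  have L : (fun l => 8 * C * T * ((l%:R + 2) * rk l)) @ \oo --> 0.
    rewrite -[X in _ --> X](mulr0 (8 * C * T)); apply: cvgM; first exact: cvg_cst.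
    rewrite (_ : (fun l => _) = fun l => (l%:R + 2) * 2^-1 ^+ l); first by apply: cvg_natr_geo; lra.
    by apply/funext => l; rewrite /rk exprVn.
  apply: (cvgr_to_ge L); near=> l; exact: bound.
move=> t tT.
suff: forall t, 0 <= t <= T -> D t = 0 by apply.
apply: (@real_induction _ (fun x => forall t, 0 <= t <= x -> D t = 0) 0 T T0).
  move=> s /andP[s0 s1]; apply/eqP; rewrite eq_le D0 andbT.
  have -> : s = 0 by apply/eqP; rewrite eq_le s1.
  have := H 0%N 0; rewrite lexx T0 => /(_ isT); rewrite lebI_pt ?mulr0//.
  by apply: bdmD => //; exact: bdm_cst.
(* Half of [tau] on each side of [p], so that [x] and [y] are at most [tau] apart. *)
move=> p pT; exists (tau / 2); first by rewrite divr_gt0.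
move=> x y /andP[x0 xp] /andP[py yT] px yp Hx.
by apply: (short x y) => //; lra.
Unshelve. all: by end_near. Qed.

End osgood.

(** For the derivative of the squared separation: [v1] is the increment of one field between the two
    trajectories, bounded by the modulus, and [v2] the difference of the fields at one trajectory,
    kept as an energy. *)
Lemma sum_rate_le (R : realType) (d : nat) (kap r : R) (a v1 v2 : 'I_d -> R) : 0 <= kap -> 0 <= r ->
  (forall j, `|v1 j| <= kap * (\sum_i `|a i| + r)) ->
  \sum_j 2 * a j * (v1 j + v2 j) <=
  (kap * (3 * d%:R + 1) + 1) * (\sum_j a j ^+ 2 + r ^+ 2) + \sum_j v2 j ^+ 2.
Proof.
move=> k0 r0; set e := \sum_i `|a i|; set q := \sum_j a j ^+ 2 => H.
have e0 : 0 <= e by exact: sumr_ge0.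
have q0 : 0 <= q by apply: sumr_ge0 => j _; exact: sqr_ge0.
have d0 : 0 <= d%:R :> R by [].
have eq : e ^+ 2 <= d%:R * q.
  rewrite (le_trans (sqr_sum_le (fun i => `|a i|)))// ler_wpM2l// ler_sum// => i _.
  by rewrite real_normK ?num_real.
apply: (@le_trans _ _ (\sum_j (2 * kap * (e + r) * `|a j| + (a j ^+ 2 + v2 j ^+ 2)))).
  apply: ler_sum => j _; rewrite mulrDr; apply: lerD.
    rewrite (le_trans (ler_norm _))// !normrM normr_nat.
    rewrite (_ : 2 * kap * (e + r) * `|a j| = 2 * `|a j| * (kap * (e + r))); last by ring.
    by rewrite ler_wpM2l// mulr_ge0.
  by have := sqr_ge0 (a j - v2 j); rewrite sqrrB -mulr_natr; lra.
rewrite big_split/= -mulr_sumr -/e big_split/= -/q.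
set S := \sum_(i < d) v2 i ^+ 2.
rewrite addrA lerD2r.
have h1 := sqr_ge0 (e - r); rewrite sqrrB -mulr_natr in h1.
have h2 : 0 <= d%:R * r ^+ 2 by rewrite mulr_ge0// sqr_ge0.
have h3 : 0 <= r ^+ 2 := sqr_ge0 _.
have : 2 * (e + r) * e <= (3 * d%:R + 1) * (q + r ^+ 2).
  rewrite (_ : 2 * (e + r) * e = 2 * e ^+ 2 + 2 * (e * r)); last by ring.
  rewrite (_ : (3 * d%:R + 1) * (q + r ^+ 2) =
    3 * (d%:R * q) + q + 3 * (d%:R * r ^+ 2) + r ^+ 2); last by ring.
  lra.
move=> /(ler_wpM2l k0) h.
rewrite (_ : 2 * kap * (e + r) * e = kap * (2 * (e + r) * e)); last by ring.
rewrite (_ : (kap * (3 * d%:R + 1) + 1) * (q + r ^+ 2) =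
  kap * ((3 * d%:R + 1) * (q + r ^+ 2)) + q + r ^+ 2); last by ring.
by move: h; set x := kap * _; set y := kap * _; lra.
Qed.

Lemma dist_double (R : realDomainType) (a b c e p : R) : `|a - b| <= p -> `|c - e| <= p ->
  `|a - c - (b - e)| <= 2 * p.
Proof.
move=> h1 h2; rewrite (_ : a - c - (b - e) = (a - b) - (c - e)); last by ring.
by rewrite (le_trans (ler_normB _ _))// mulr_natl mulr2n lerD.
Qed.

(** * Separation of the two flows *)

Section two_fields.
Context {R : realType} {d : nat}.
Local Notation P := (d.-tuple R).
Variable mu : {measure set P -> \bar R}.
Hypothesis Hmu : is_lebesgue_Rd mu.
Variable T : R.
Hypothesis T0 : 0 <= T.
Implicit Types (x y z : P) (i j : 'I_d) (s t h : R) (k l m : nat).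
Local Notation torm := (torm Hmu).
Local Notation avg := (avg Hmu).
Local Notation avg2 := (avg2 Hmu).

Lemma ipartB j (f f' g g' : P -> R) : bdm f' -> bdm g' -> ipart j f f' -> ipart j g g' ->
  ipart j (fun x => f x - g x) (fun x => f' x - g' x).
Proof.
move=> bf bg Hf Hg x h h0; rewrite intB; [|exact: bdm_line|exact: bdm_line].
by rewrite -Hf// -Hg//; ring.
Qed.

Lemma avg2B k (f g : P -> R) x : bdm f -> bdm g ->
  avg2 k (fun x => f x - g x) x = avg2 k f x - avg2 k g x.
Proof.
move=> bf bg; rewrite /avg2 -avgB; [|exact: bdm_avg|exact: bdm_avg].
by apply: avg_ext => y; exact: avgB.
Qed.

Lemma wdiv_int0 (V : 'I_d -> P -> R) (G : P -> R) : wdiv Hmu V G -> \int[torm]_x G x = 0.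
Proof.
move=> H; have := H _ test_fun1.
have E x : \sum_(j < d) V j x * Defs.partial j (pr (fun=> fun=> 1)) x = 0.
  rewrite big1// => j _; rewrite /Defs.partial (_ : (fun _ => _) = cst 1) ?derive1_cst ?mulr0//.
  by apply/funext => s; rewrite /pr big1.
under eq_Rintegral do rewrite E.
rewrite int_cst mul0r => /eqP; rewrite eq_sym oppr_eq0 => /eqP <-.
by apply: eq_Rintegral => x _; rewrite /pr big1// mulr1.
Qed.

Lemma flow_of_mono L L' U X : L <= L' -> flow_of Hmu T L U X -> flow_of Hmu T L' U X.
Proof.
move=> LL [h1 h2 h3 h4]; split=> // t tT f bf pf f0.
by rewrite (le_trans (h4 t tT f bf pf f0))// ler_wpM2r// int_ge0.
Qed.

Lemma ae_lebI_sub (Q : R -> Prop) t : 0 <= t <= T -> {ae lebI 0 T, forall s, Q s} ->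
  {ae lebI 0 t, forall s, Q s}.
Proof.
move=> /andP[t0 tT] [A [mA A0 HA]]; exists A; split=> //.
apply/eqP; rewrite -measure_le0 -A0 /= /mfrestr /mrestr.
apply: le_measure; rewrite ?inE//; [exact: measurableI|exact: measurableI|].
move=> s [As /=]; rewrite in_itv/= => /andP[s0 st]; split=> //=.
by rewrite in_itv/= s0 (le_trans st tT).
Qed.

Variables (M K L : R) (sigma : R -> P -> R).
Hypotheses (M0 : 0 <= M) (K0 : 0 <= K) (L0 : 0 <= L).
Hypotheses (bsig : jbdm sigma) (sigM : forall s y, `|sigma s y| <= M).

Section one.
Variables (U : 'I_d -> R -> P -> R) (w : 'I_d -> 'I_d -> R -> P -> R) (phi g : R -> P -> R)
  (X : R -> P -> P).

(** One field with its flow after all reductions; the constants [M], [K], [L] and the function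
    [sigma] are shared by both fields. *)
Definition driven := [/\ clean_field Hmu M K U w phi g, forall j s, tilde Hmu (U j s) = U j s,
  flow_of Hmu T L U X,
  {ae torm, forall y, {ae lebesgue_measure, forall t, 0 <= t <= T -> forall i,
     is_derive t 1 (fun t => tnth (X t y) i) (U i t (X t y))}} &
  (forall i t y, 0 <= t <= T -> `|tnth (X t y) i - tnth y i| <= M * T) /\
  \int[lebI 0 T]_s \int[torm]_y `|g s (X s y) - sigma s y| = 0].

Hypothesis HD : driven.

Lemma driven_bU j s : bdm (U j s).
Proof. by have [[Hu _ _ _ _] _ _ _ _] := HD; exact: jbdm_slice s (Hu j).1. Qed.

Lemma driven_pU j s : per (U j s).
Proof. by have [[Hu _ _ _ _] _ _ _ _] := HD; exact: ((Hu j).2 s).1. Qed.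

Lemma driven_UM j s x : `|U j s x| <= M.
Proof. by have [[Hu _ _ _ _] _ _ _ _] := HD; exact: ((Hu j).2 s).2. Qed.

Lemma driven_mX t : measurable_fun setT (X t).
Proof. by have [_ _ [mX _ _ _] _ _] := HD; exact: measurableT_comp mX (measurable_pair1 t). Qed.

Lemma driven_close k j s x : `|U j s x - avg2 k (U j s) x| <= @log_err R d K k.
Proof.
have [cU tU _ _ _] := HD; rewrite -{1}(tU j s).
exact: (tilde_close (driven_bU j s) K0 (clean_loglip cU j s)).
Qed.

Lemma driven_modulus l j s x y :
  `|U j s x - U j s y| <= K * (16 * d%:R + 1) * (l%:R + 2) * (dist1 x y + rk l).
Proof.
have [cU tU _ _ _] := HD; rewrite -(tU j s).
exact: (tilde_modulus (driven_bU j s) K0 (clean_loglip cU j s)).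
Qed.

Lemma driven_avg2_modulus k l j s x y : `|avg2 k (U j s) x - avg2 k (U j s) y| <=
  K * (16 * d%:R + 1) * (l%:R + 2) * (dist1 x y + rk l).
Proof.
have [cU tU _ _ _] := HD.
exact: (avg2_modulus (driven_bU j s) K0 (clean_loglip cU j s)).
Qed.

Lemma driven_g t : [/\ bdm (g t), per (g t) & \int[torm]_x g t x = 0].
Proof.
have [[_ [bg gM] _ _ Hd] _ _ _ _] := HD; split; first exact: jbdm_slice t bg.
  by have [] := gM t.
exact: wdiv_int0 (Hd t).
Qed.

(** The integrability of the potential is recorded only together with a component of the field, so
    dimension 0 is set apart. *)
Lemma driven_avg k t : [/\ bdm (avg k (phi t)), per (avg k (phi t)) &
  forall j, ipart j (avg k (phi t)) (avg k (U j t))] \/ d = 0%N.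
Proof.
case: (posnP d) => [|d0]; [by right|left].
have [[_ _ _ Hwp _] _ _ _ _] := HD.
have [[[pp _] ip _ _] _] := Hwp t (Ordinal d0).
split; [exact: bdm_avg_intgr|exact: avg_per|].
by move=> j; have [wp _] := Hwp t j; exact: wpart_ipart.
Qed.

Lemma driven_avgw k t j : [/\ bdm (avg k (w j j t)), per (avg k (w j j t)) &
  ipart j (avg k (U j t)) (avg k (w j j t))].
Proof.
have [[_ _ _ Hwp _] _ _ _ _] := HD.
have [_ /(_ j) wp] := Hwp t j; have [[_ pw] _ iw _] := wp.
by split; [exact: bdm_avg_intgr|exact: avg_per|exact: wpart_ipart].
Qed.

Lemma driven_div k t x : \sum_j avg k (w j j t) x = avg k (g t) x.
Proof.
have [[_ _ _ Hwp Hd] _ _ _ _] := HD; have [bg pg _] := driven_g t.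
apply: (wdiv_avg k _ _ pg (Hd t)) => [j|]; last exact: bdm_integrable.
by have [_] := Hwp t j; exact.
Qed.

Lemma driven_jac t F : 0 <= t <= T -> bdm F -> per F ->
  \int[torm]_y (F (X t y) * jac sigma t y) = \int[torm]_x F x.
Proof.
have [cU tU HX _ [_ gs]] := HD.
exact: (clean_jacobian T0 M0 K0 cU tU L0 HX bsig sigM gs).
Qed.

Lemma driven_gsig : {ae lebI 0 T, forall t, {ae torm, forall y, g t (X t y) = sigma t y}}.
Proof.
have [[_ [bg gM] _ _ _] tU HX _ [_ gs]] := HD.
have bG : jbdm (fun s y => `|g s (X s y) - sigma s y|).
  by apply: bdm_norm; exact: (bdmB (jbdm_flow HX bg) bsig).
have b1 : bdm (fun s : R => \int[torm]_y `|g s (X s y) - sigma s y|) := bdm_int torm bG.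
have h0 s : 0 <= \int[torm]_y `|g s (X s y) - sigma s y| by exact: int_ge0.
have := @int_eq0_ae _ _ _ (lebI 0 T) _ b1 h0; rewrite gs lexx => /(_ isT).
apply: lebI_aeS => t Ht.
have bt := jbdm_slice t bG.
have := @int_eq0_ae _ _ _ torm _ bt (fun y => normr_ge0 _); rewrite Ht lexx => /(_ isT).
by apply: filterS => y /eqP; rewrite normr_eq0 subr_eq0 => /eqP.
Qed.

End one.

Variables (U1 : 'I_d -> R -> P -> R) (w1 : 'I_d -> 'I_d -> R -> P -> R) (phi1 g1 : R -> P -> R)
  (X1 : R -> P -> P) (U2 : 'I_d -> R -> P -> R) (w2 : 'I_d -> 'I_d -> R -> P -> R)
  (phi2 g2 : R -> P -> R) (X2 : R -> P -> P).
Hypotheses (H1 : driven U1 w1 phi1 g1 X1) (H2 : driven U2 w2 phi2 g2 X2).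
Hypothesis d0 : (0 < d)%N.

Let Kt : R := K * (16 * d%:R + 1).
Let ec : R := @econst R d (2 * M) (2 * Kt) L (jmax T M).
Let gap t x := \sum_j (U1 j t x - U2 j t x) ^+ 2.

Let Kt0 : 0 <= Kt.
Proof. by rewrite mulr_ge0// addr_ge0// mulr_ge0. Qed.

Let jm0 : 0 <= jmax T M. Proof. exact: expR_ge0. Qed.

Let ec0 : 0 <= ec.
Proof. by apply: econst_ge0 => //; rewrite mulr_ge0. Qed.

Let XD t j y : 0 <= t <= T -> `|tnth (X1 t y) j - tnth (X2 t y) j| <= 2 * (M * T).
Proof.
move=> tT; have [_ _ _ _ [h1 _]] := H1; have [_ _ _ _ [h2 _]] := H2.
have := h1 j t y tT; have := h2 j t y tT.
set a := tnth (X1 t y) j; set b := tnth (X2 t y) j; set c := tnth y j => hb ha.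
rewrite mulrDl mul1r (_ : a - b = (a - c) - (b - c)); last by ring.
by rewrite (le_trans (ler_normB _ _))// lerD.
Qed.

(** [energy_bound] for the difference of the two fields: the bounds of a single field double, and
    the density [jac sigma t] is the same for both flows. *)
Lemma energy_time t : 0 <= t <= T ->
  {ae torm, forall y, g1 t (X1 t y) = sigma t y} ->
  {ae torm, forall y, g2 t (X2 t y) = sigma t y} ->
  forall l, \int[torm]_x gap t x <=
    2 * ec * (l%:R + 2) * (\int[torm]_y sqd (X1 t) (X2 t) y + rk l ^+ 2).
Proof.
move=> tT gs1 gs2 l.
have [bg1 pg1 ig1] := driven_g H1 t; have [bg2 pg2 ig2] := driven_g H2 t.
have M20 : 0 <= 2 * M by rewrite mulr_ge0.
have Kt20 : 0 <= 2 * Kt by rewrite mulr_ge0.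
have P1 k := driven_avg H1 k t; have P2 k := driven_avg H2 k t.
have nd : d <> 0%N by move=> dd; move: d0; rewrite dd.
have bU1 j := driven_bU H1 j t; have bU2 j := driven_bU H2 j t.
have [_ _ [_ _ _ comp1] _ _] := H1.
apply: (@energy_bound R d mu Hmu (fun j x => U1 j t x - U2 j t x)
  (fun k x => avg k (phi1 t) x - avg k (phi2 t) x)
  (fun k j x => avg k (w1 j j t) x - avg k (w2 j j t) x)
  (g1 t) (g2 t) (sigma t) (jac sigma t) (X1 t) (X2 t) (2 * M) (2 * Kt) L (jmax T M)
  (fun k => 2 * @log_err R d K k) M20 Kt20 L0 jm0 _ _ _ _ _ _ _ _ _ _ _ _ _ _
  (driven_mX H1 t) (driven_mX H2 t) bg1 pg1 bg2 pg2 (jbdm_slice t bsig) _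
  (bdm_jac M0 bsig sigM tT) _ _ _ (2 * (M * T)) _ _ gs1 gs2 l).
- by move=> j; exact: bdmB.
- by move=> j x; rewrite (driven_pU H1) (driven_pU H2).
- move=> j x; rewrite (le_trans (ler_normB _ _))// mulrDl mul1r lerD//; [exact: (driven_UM H1)|exact: (driven_UM H2)].
- by move=> k; case: (P1 k) => [[b1 _ _]|//]; case: (P2 k) => [[b2 _ _]|//]; exact: bdmB.
- by move=> k x; case: (P1 k) => [[_ b1 _]|//]; case: (P2 k) => [[_ b2 _]|//]; rewrite b1 b2.
- move=> k j; case: (P1 k) => [[_ _ b1]|//]; case: (P2 k) => [[_ _ b2]|//].
  have := ipartB (bdm_avg Hmu k (bU1 j)) (bdm_avg Hmu k (bU2 j)) (b1 j) (b2 j).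
  congr ipart; apply/funext => x; rewrite avgB//.
- move=> k j; have [b1 _ _] := driven_avgw H1 k t j; have [b2 _ _] := driven_avgw H2 k t j.
  exact: bdmB.
- move=> k j x; have [_ b1 _] := driven_avgw H1 k t j; have [_ b2 _] := driven_avgw H2 k t j.
  by rewrite b1 b2.
- move=> k j; have [b1 _ i1] := driven_avgw H1 k t j; have [b2 _ i2] := driven_avgw H2 k t j.
  have := ipartB b1 b2 i1 i2.
  congr ipart; apply/funext => x; rewrite avgB//.
- by move=> k x; rewrite sumrB (driven_div H1) (driven_div H2) avgB.
- by rewrite intB// ig1 ig2 subrr.
- move=> k l' j x y; rewrite !avg2B// -!(mulrA 2).
  exact: (dist_double (driven_avg2_modulus H1 k l' j t x y) (driven_avg2_modulus H2 k l' j t x y)).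
- move=> k j x; rewrite avg2B//.
  exact: (dist_double (driven_close H1 k j t x) (driven_close H2 k j t x)).
- rewrite -[X in _ --> X](mulr0 (2 : R)); apply: cvgM; [exact: cvg_cst|exact: log_err_cvg].
- by move=> y; rewrite (le_trans (sigM t y))// ler_peMl// ler1n.
- by move=> y; rewrite ltW ?jac_gt0//= (jac_le M0 bsig sigM).
- by move=> F bF pF; exact: (driven_jac H1).
- by move=> F bF pF; exact: (driven_jac H2).
- by move=> j y; exact: XD.
- by move=> F bF pF F0; exact: comp1.
Qed.

(** The rate of [sum_rate_le] for the modulus [Kt (l + 2)], plus [L] times the energy constant. *)
Let Cc : R := Kt * (3 * d%:R + 1) + 1 + L * (2 * ec).

(** The time derivative of [sqd] along the two trajectories. *)
Definition sep_rate t y := \sum_j 2 * (tnth (X1 t y) j - tnth (X2 t y) j) *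
  (U1 j t (X1 t y) - U2 j t (X2 t y)).

Let bdm_gap t : bdm (gap t).
Proof.
by apply: bdm_sum => j; apply: bdm_sqr; apply: bdmB; [exact: (driven_bU H1)|exact: (driven_bU H2)].
Qed.

Let bdm_diff t j : 0 <= t <= T -> bdm (fun y => tnth (X1 t y) j - tnth (X2 t y) j).
Proof.
move=> tT; split; last by exists (2 * (M * T)) => y; exact: XD.
by apply: measurable_funB; apply: (measurableT_comp (measurable_tnth j));
  [exact: (driven_mX H1)|exact: (driven_mX H2)].
Qed.

Let bdm_sqdt t : 0 <= t <= T -> bdm (sqd (X1 t) (X2 t)).
Proof. by move=> tT; apply: bdm_sum => j; apply: bdm_sqr; exact: bdm_diff. Qed.

Let bdm_rate t : 0 <= t <= T -> bdm (sep_rate t).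
Proof.
move=> tT; apply: bdm_sum => j; apply: bdmM; first by apply: bdmZ; exact: bdm_diff.
by apply: bdmB; [exact: (bdm_comp (driven_mX H1 t) (driven_bU H1 j t))|
  exact: (bdm_comp (driven_mX H2 t) (driven_bU H2 j t))].
Qed.

(** The velocity difference splits into the increment of [U1] between the trajectories and [U1 - U2]
    at [X2]; compression turns the latter into the energy, which is again bounded by the
    separation. *)
Lemma sep_rate_time t : 0 <= t <= T ->
  {ae torm, forall y, g1 t (X1 t y) = sigma t y} ->
  {ae torm, forall y, g2 t (X2 t y) = sigma t y} ->
  forall l, \int[torm]_y sep_rate t y <=
    Cc * (l%:R + 2) * (\int[torm]_y sqd (X1 t) (X2 t) y + rk l ^+ 2).
Proof.
move=> tT gs1 gs2 l.
have [_ _ [_ _ _ comp2] _ _] := H2.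
have l0 : 0 <= l%:R :> R by [].
have l2 : 0 <= l%:R + 2 :> R by rewrite addr_ge0.
pose B := Kt * (l%:R + 2) * (3 * d%:R + 1) + 1.
have bs := bdm_sqdt tT; have bg := bdm_gap t; have br := bdm_rate tT.
have bgX : bdm (fun y => gap t (X2 t y)) := bdm_comp (driven_mX H2 t) bg.
have bsr : bdm (fun y => sqd (X1 t) (X2 t) y + rk l ^+ 2) by apply: bdmD => //; exact: bdm_cst.
have I1 : \int[torm]_y sep_rate t y <=
    B * (\int[torm]_y sqd (X1 t) (X2 t) y + rk l ^+ 2) + \int[torm]_y gap t (X2 t y).
  have -> : \int[torm]_y sqd (X1 t) (X2 t) y + rk l ^+ 2 =
      \int[torm]_y (sqd (X1 t) (X2 t) y + rk l ^+ 2).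
    by rewrite intD; [rewrite int_cst torm1 mulr1|exact: bs|exact: bdm_cst].
  rewrite -(intZ _ _ bsr).
  apply: (int_ae_leD br (bdmZ B bsr) bgX); apply: aeW => y.
  have := @sum_rate_le R d (Kt * (l%:R + 2)) (rk l)
    (fun j => tnth (X1 t y) j - tnth (X2 t y) j)
    (fun j => U1 j t (X1 t y) - U1 j t (X2 t y))
    (fun j => U1 j t (X2 t y) - U2 j t (X2 t y)) (mulr_ge0 Kt0 l2) (rk_ge0 l)
    (fun j => driven_modulus H1 l j t (X1 t y) (X2 t y)).
  apply: le_trans; rewrite le_eqVlt; apply/orP; left; apply/eqP.
  by apply: eq_bigr => j _; congr (_ * _); rewrite subrKA.
have pg : per (gap t).
  by move=> x; apply: eq_bigr => j _; rewrite (driven_pU H1) (driven_pU H2).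
have g0 x : 0 <= gap t x by apply: sumr_ge0 => j _; exact: sqr_ge0.
have I2 := comp2 t tT (gap t) bg pg g0.
have I3 := energy_time tT gs1 gs2 l.
have D0 : 0 <= \int[torm]_y sqd (X1 t) (X2 t) y.
  by apply: int_ge0 => y; apply: sumr_ge0 => j _; exact: sqr_ge0.
have r0 : 0 <= rk l ^+ 2 :> R by exact: sqr_ge0.
move: I1 I2 (ler_wpM2l L0 I3) D0 r0.
set D := \int[torm]_y sqd _ _ y; set r := rk l ^+ 2; set a := \int[torm]_y sep_rate t y.
set b := \int[torm]_y _; set c := L * _.
rewrite /B /Cc => h1 h2 h3 D0 r0.
apply: (le_trans h1); apply: (@le_trans _ _ ((Kt * (l%:R + 2) * (3 * d%:R + 1) + 1) * (D + r) +
  L * (2 * ec * (l%:R + 2) * (D + r)))); first by rewrite lerD2l (le_trans h2).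
have : 0 <= (l%:R + 1) * (D + r) by rewrite mulr_ge0// addr_ge0.
move: (D + r) => z hz.
rewrite (_ : (Kt * (3 * d%:R + 1) + 1 + L * (2 * ec)) * (l%:R + 2) * z =
  (Kt * (l%:R + 2) * (3 * d%:R + 1) + 1) * z + L * (2 * ec * (l%:R + 2) * z) + (l%:R + 1) * z); last by ring.
by rewrite lerDl.
Qed.

(* The flows are not controlled outside [0, T]. *)
Let tI t : R := \1_(`[0, T]%classic) t.

Let tI1 t : 0 <= t <= T -> tI t = 1.
Proof. by move=> tT; rewrite /tI indicE mem_set//= in_itv. Qed.

Let tI0 t : ~~ (0 <= t <= T) -> tI t = 0.
Proof. by move=> tT; rewrite /tI indicE memNset//= in_itv/=; exact/negP. Qed.

Let jbdm_cut (f : R -> P -> R) B : measurable_fun setT (fun q : R * P => f q.1 q.2) ->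
  (forall t y, 0 <= t <= T -> `|f t y| <= B) -> jbdm (fun t y => tI t * f t y).
Proof.
move=> mf fB; split.
  apply: measurable_funM => //; apply: (measurableT_comp (f := tI)) => //.
  by apply: measurable_indic.
exists `|B| => q; have [tT|nT] := boolP (0 <= q.1 <= T).
  by rewrite tI1// mul1r (le_trans (fB _ _ tT))// ler_norm.
by rewrite tI0// mul0r normr0.
Qed.

Let mdiff j : measurable_fun setT (fun q : R * P => tnth (X1 q.1 q.2) j - tnth (X2 q.1 q.2) j).
Proof.
have [_ _ [m1 _ _ _] _ _] := H1; have [_ _ [m2 _ _ _] _ _] := H2.
by apply: measurable_funB; apply: (measurableT_comp (measurable_tnth j)).
Qed.

Let jbdm_sqd : jbdm (fun t y => tI t * sqd (X1 t) (X2 t) y).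
Proof.
apply: (@jbdm_cut _ (\sum_(j < d) (2 * (M * T)) ^+ 2)).
  by apply: measurable_sum => j; under eq_fun do rewrite expr2; apply: measurable_funM; exact: mdiff.
move=> t y tT; rewrite /sqd (le_trans (ler_norm_sum _ _ _))// ler_sum// => j _.
by rewrite normrX lerXn2r ?nnegrE// ?mulr_ge0// XD.
Qed.

Let jbdm_ratej j : jbdm (fun t y => tI t * (2 * (tnth (X1 t y) j - tnth (X2 t y) j) *
  (U1 j t (X1 t y) - U2 j t (X2 t y)))).
Proof.
have [[Hu1 _ _ _ _] _ HX1 _ _] := H1; have [[Hu2 _ _ _ _] _ HX2 _ _] := H2.
apply: (@jbdm_cut _ (2 * (2 * (M * T)) * (2 * M))).
  apply: measurable_funM; first by apply: measurable_funM => //; exact: mdiff.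
  apply: measurable_funB.
    by have [] := jbdm_flow HX1 (Hu1 j).1.
  by have [] := jbdm_flow HX2 (Hu2 j).1.
move=> t y tT; rewrite !normrM normr_nat ler_pM ?mulr_ge0//.
  by rewrite ler_wpM2l// XD.
rewrite (le_trans (ler_normB _ _))// mulr_natl mulr2n lerD//.
  exact: (driven_UM H1).
exact: (driven_UM H2).
Qed.

Let jbdm_rate : jbdm (fun t y => tI t * sep_rate t y).
Proof.
have := @bdm_sum _ _ R _ (index_enum 'I_d) xpredT _ (fun j => jbdm_ratej j).
by rewrite /jbdm /sep_rate; under eq_fun do rewrite -mulr_sumr.
Qed.

(** Trajectories are Lipschitz in time, so the squared distance is absolutely continuous and is the
    integral of its derivative from its value 0 at time 0. *)
Lemma sqd_integral t : 0 <= t <= T ->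
  {ae torm, forall y, sqd (X1 t) (X2 t) y = \int[lebI 0 t]_s (tI s * sep_rate s y)}.
Proof.
move=> /andP[t0 tT].
have [[Hu1 _ _ _ _] _ HX1 dX1 _] := H1; have [[Hu2 _ _ _ _] _ HX2 dX2 _] := H2.
have [mX1 s1 f1 _] := HX1; have [mX2 s2 f2 _] := HX2.
apply: filterS2 (filterI (filterI s1 s2) (filterI f1 f2)) (filterI dX1 dX2) => y [[e1 e2] [i1 i2]] [D1 D2].
transitivity (\sum_j \int[lebI 0 t]_s (tI s * (2 * (tnth (X1 s y) j - tnth (X2 s y) j) *
  (U1 j s (X1 s y) - U2 j s (X2 s y))))); last first.
  rewrite -int_sum; last by move=> j; exact: (jbdm_line y (jbdm_ratej j)).
  by apply: eq_Rintegral => s _; rewrite mulr_sumr.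
apply: eq_bigr => j _.
pose a s := tnth (X1 s y) j - tnth (X2 s y) j.
have a0 : a 0 = 0 by rewrite /a e1 e2 subrr.
rewrite -[LHS]subr0 -[X in _ - X](expr0n R 2) -[in X in _ - X]a0.
have bU1 : bdm (fun r => U1 j r (X1 r y)) := jbdm_line y (jbdm_flow HX1 (Hu1 j).1).
have bU2 : bdm (fun r => U2 j r (X2 r y)) := jbdm_line y (jbdm_flow HX2 (Hu2 j).1).
have lipX (X : R -> P -> P) (U : 'I_d -> R -> P -> R) s r : bdm (fun r => U j r (X r y)) ->
    (forall r x, `|U j r x| <= M) ->
    (forall i s h, 0 <= s -> 0 <= h -> s + h <= T ->
      tnth (X (s + h) y) i - tnth (X s y) i = \int[lebI s (s + h)]_r U i r (X r y)) ->
    0 <= s -> s <= r -> r <= T -> `|tnth (X r y) j - tnth (X s y) j| <= M * (r - s).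
  move=> bU UM ii s0 sr rT; have rs0 : 0 <= r - s by rewrite subr_ge0.
  have E : s + (r - s) = r by rewrite addrC subrK.
  have := ii j s (r - s) s0 rs0; rewrite E => /(_ rT) ->.
  by have := lebI_normM rs0 bU (M := M) (t := s); rewrite E; apply => p _; exact: UM.
apply: (@ac_ftc _ (fun s => a s ^+ 2) (fun s => tI s * (2 * (tnth (X1 s y) j - tnth (X2 s y) j) *
  (U1 j s (X1 s y) - U2 j s (X2 s y)))) 0 t) => //.
- apply: (@ac_lip _ _ _ _ (2 * (2 * (M * T)) * (2 * M))); first by rewrite !mulr_ge0.
  move=> s r s0 sr rt; have rT := le_trans rt tT; have sT := le_trans sr rT; have r0 := le_trans s0 sr.
  rewrite subr_sqr normrM mulrC -mulrA; apply: ler_pM => //.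
    rewrite (le_trans (ler_normD _ _))// mulr_natl mulr2n lerD//; apply: XD; exact/andP.
  have l1 := lipX X1 U1 s r bU1 (driven_UM H1 j) i1 s0 sr rT.
  have l2 := lipX X2 U2 s r bU2 (driven_UM H2 j) i2 s0 sr rT.
  by rewrite -mulrA; have := dist_double l1 l2.
- exact: (jbdm_line y (jbdm_ratej j)).
move: D1 D2; apply: filterS2; first exact: (ae_filter_ringOfSetsType lebesgue_measure).
move=> s h1 h2 /andP[s0 st]; have sT : 0 <= s <= T by rewrite s0 (le_trans st tT).
have d1 := h1 sT j; have d2 := h2 sT j; have da := is_deriveB d1 d2.
have dm := is_deriveM da da.
rewrite tI1// mul1r.
rewrite (_ : (fun s => a s ^+ 2) = (fun s => a s * a s)); last by apply/funext => r; rewrite expr2.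
apply: (is_derive_cast dm).
change (a s * (U1 j s (X1 s y) - U2 j s (X2 s y)) + a s * (U1 j s (X1 s y) - U2 j s (X2 s y)) =
  2 * a s * (U1 j s (X1 s y) - U2 j s (X2 s y))).
ring.
Qed.

Lemma separation_zero t : 0 <= t <= T -> \int[torm]_y sqd (X1 t) (X2 t) y = 0.
Proof.
move=> tT.
pose D s := \int[torm]_y (tI s * sqd (X1 s) (X2 s) y).
have DE s : 0 <= s <= T -> D s = \int[torm]_y sqd (X1 s) (X2 s) y.
  by move=> sT; apply: eq_Rintegral => y _; rewrite tI1// mul1r.
have bD : bdm D := bdm_int torm jbdm_sqd.
have tI_ge0 s : 0 <= tI s by exact: indic01.
have sq0 s y : 0 <= sqd (X1 s) (X2 s) y by apply: sumr_ge0 => j _; exact: sqr_ge0.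
rewrite -DE//.
have Cc0 : 0 < Cc.
  rewrite /Cc ltr_wpDr//; first by rewrite mulr_ge0// mulr_ge0.
  by rewrite ltr_wpDl// mulr_ge0// addr_ge0// mulr_ge0.
apply: (osgood T0 Cc0 bD) => // [s|l s sT]; first by apply: int_ge0 => y; rewrite mulr_ge0.
have [s0 sT'] := andP sT.
have bR : bdm (fun r : R => \int[torm]_y (tI r * sep_rate r y)) := bdm_int torm jbdm_rate.
have bR' : bdm (fun r : R => Cc * (l%:R + 2) * (D r + rk l ^+ 2)).
  by apply: bdmZ; apply: bdmD => //; exact: bdm_cst.
rewrite DE//.
have bi : bdm (fun y => \int[lebI 0 s]_r (tI r * sep_rate r y)).
  have b' : bdm (fun q : P * R => tI q.2 * sep_rate q.2 q.1).
    apply: (bdm_comp (T := fun q : P * R => (q.2, q.1)) _ jbdm_rate); exact: measurable_fun_pair.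
  exact: (bdm_int (lebI 0 s) b').
rewrite (int_ae_eq (bdm_sqdt sT) bi (sqd_integral sT)).
rewrite -(int_fubini (lebI 0 s) torm jbdm_rate)/=.
rewrite -intZ; last by apply: bdmD => //; exact: bdm_cst.
apply: int_ae_le => //.
apply: (ae_lebI_sub sT).
apply: lebI_aeS (lebI_aeI (lebI_in 0 T) (lebI_aeI (driven_gsig H1) (driven_gsig H2))) => r [rT [gs1 gs2]].
rewrite DE//; apply: (le_trans _ (sep_rate_time rT gs1 gs2 l)).
by apply: int_ae_le => //; [exact: jbdm_slice r jbdm_rate|exact: bdm_rate|apply: aeW => y; rewrite tI1// mul1r].
Qed.

(** With zero separation the energy is at most a constant times [(l + 2) 4^-l] for every [l]. *)
Lemma driven_unique : {ae lebI 0 T, forall t, {ae torm, forall x, forall j, U1 j t x = U2 j t x}}.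
Proof.
apply: lebI_aeS (lebI_aeI (lebI_in 0 T) (lebI_aeI (driven_gsig H1) (driven_gsig H2))) => t [tT [gs1 gs2]].
have g0 x : 0 <= gap t x by apply: sumr_ge0 => j _; exact: sqr_ge0.
have G0 : \int[torm]_x gap t x <= 0.
  have HL : (fun l => 2 * ec * ((l%:R + 2) * (2^-1 ^+ l))) @ \oo --> 0.
    rewrite -[X in _ --> X](mulr0 (2 * ec)); apply: cvgM; first exact: cvg_cst.
    by apply: cvg_natr_geo; lra.
  apply: (cvgr_to_ge HL); near=> l.
  apply: (le_trans (energy_time tT gs1 gs2 l)); rewrite separation_zero// add0r.
  rewrite -[2 * ec * _ * _]mulrA ler_wpM2l ?mulr_ge0// ler_wpM2l ?addr_ge0//.
  rewrite expr2 exprVn -/(rk l) ler_piMr ?rk_ge0//; exact: rk_le1.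
have := int_eq0_ae (bdm_gap t) g0 G0.
apply: filterS => x /eqP; rewrite psumr_eq0; last by move=> j _; exact: sqr_ge0.
move=> /allP h j; have := h j (mem_index_enum j).
by rewrite /= sqrf_eq0 subr_eq0 => /eqP.
Unshelve. all: by end_near. Qed.

End two_fields.

Lemma Linf_clean (R : realType) (d : nat) (mu : {measure set (d.-tuple R) -> \bar R})
    (Hmu : is_lebesgue_Rd mu) (T : R) (f : R -> d.-tuple R -> R) : Linf_st mu T f ->
  exists M f', [/\ 0 <= M, jbdm f', forall s y, `|f' s y| <= M & jsame Hmu T f f'].
Proof.
move=> [mf [B HB]]; have B0 : 0 <= `|B| by [].
exists `|B|, (fun t x => clamp `|B| (f t (fracP x))); split=> //.
- split; first by apply: measurable_clamp; exact: measurable_frac2.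
  by exists `|B| => q; exact: clamp_norm.
- by move=> s y; exact: clamp_norm.
have [N jN HN] := ae_on_jnull Hmu HB.
apply: lebI_aeS (lebI_aeI (lebI_in 0 T) (jnull_ae1 jN)) => t [tT].
apply: filterS2 (torm_unit Hmu) => x ux Nx; apply: clamp_id.
by rewrite fracP_id// (le_trans (HN t x tT ux Nx))// ler_norm.
Qed.

Lemma driven_of_flow (R : realType) (d : nat) (mu : {measure set (d.-tuple R) -> \bar R})
    (Hmu : is_lebesgue_Rd mu) (T M K : R) (sigma sigma' : R -> d.-tuple R -> R)
    (u u' : 'I_d -> R -> d.-tuple R -> R) w phi (g g' : R -> d.-tuple R -> R)
    (X : R -> d.-tuple R -> d.-tuple R) :
  0 <= T -> 0 <= M -> clean_field Hmu M K u' w phi g' ->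
  (forall j s, tilde Hmu (u' j s) = u' j s) ->
  (forall j, measurable_fun setT (fun q : R * d.-tuple R => u j q.1 q.2)) ->
  measurable_fun setT (fun q : R * d.-tuple R => g q.1 q.2) ->
  (forall j, jsame Hmu T (u j) (u' j)) -> jsame Hmu T g g' ->
  jbdm sigma' -> jsame Hmu T sigma sigma' ->
  regular_lagrangian_flow mu T u X ->
  ae_on (st_measure mu) (space_time T)
    (fun p => g p.1 (fracP (X p.1 p.2)) = sigma p.1 p.2) ->
  exists L X', 0 <= L /\ forall L', L <= L' -> driven Hmu T M K L' sigma' u' w phi g' X'.
Proof.
move=> T0 M0 cu tu mu_ mg uu gg bs ss HX gs.
have [L [X' [L0 fX dX bX XX]]] := flow_clean T0 M0 cu mu_ uu HX.
exists L, X'; split=> // L' LL; split=> //; first exact: flow_of_mono LL fX.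
split=> //; apply: (flow_gsig cu HX mg gg ss gs _ XX).
have [_ [bg _] _ _ _] := cu.
exact: (bdm_norm (bdmB (jbdm_flow fX bg) bs)).
Qed.

Lemma field_tilde (R : realType) (d : nat) (mu : {measure set (d.-tuple R) -> \bar R})
    (Hmu : is_lebesgue_Rd mu) (T : R) (u : 'I_d -> R -> d.-tuple R -> R) phi g w :
  field_hyp mu T u phi g w ->
  exists M K u' w' phi' g', [/\ 0 <= M, 0 <= K, clean_field Hmu M K u' w' phi' g',
    forall j s, tilde Hmu (u' j s) = u' j s &
    (forall j, jsame Hmu T (u j) (u' j)) /\ jsame Hmu T g g'].
Proof.
move=> /(field_clean Hmu)[M [K [u' [w' [phi' [g' [M0 K0 cu uu gg]]]]]]].
have [Hu _ _ _ _] := cu.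
have bu j s : bdm (u' j s) := jbdm_slice s (Hu j).1.
have pu j s : per (u' j s) := ((Hu j).2 s).1.
have lu := clean_loglip cu.
exists M, K, (fun j s => tilde Hmu (u' j s)), w', phi', g'.
split; [exact: M0|exact: K0|exact: (clean_tilde K0 cu)| |].
  by move=> j s; exact: (tilde_tilde (bu j s) (pu j s) K0 (lu j s)).
split; last exact: gg.
move=> j; apply: lebI_aeS (uu j) => t.
by apply: filterS2 (tilde_ae (bu j t) (pu j t) K0 (lu j t)) => x ->.
Qed.

Theorem mainTheorem7 (R : realType) (d : nat)
  (mu : {measure set (d.-tuple R) -> \bar R}) (T : R)
  (sigma : R -> d.-tuple R -> R)
  (u1 u2 : 'I_d -> R -> d.-tuple R -> R)
  (phi1 phi2 g1 g2 : R -> d.-tuple R -> R)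
  (w1 w2 : 'I_d -> 'I_d -> R -> d.-tuple R -> R)
  (X1 X2 : R -> d.-tuple R -> d.-tuple R) :
  is_lebesgue_Rd mu ->
  0 < T ->
  Linf_st mu T sigma ->
  field_hyp mu T u1 phi1 g1 w1 ->
  field_hyp mu T u2 phi2 g2 w2 ->
  regular_lagrangian_flow mu T u1 X1 ->
  regular_lagrangian_flow mu T u2 X2 ->
  ae_on (st_measure mu) (space_time T)
    (fun p => g1 p.1 (fracP (X1 p.1 p.2)) = sigma p.1 p.2) ->
  ae_on (st_measure mu) (space_time T)
    (fun p => g2 p.1 (fracP (X2 p.1 p.2)) = sigma p.1 p.2) ->
  forall j, ae_on (st_measure mu) (space_time T)
    (fun p => u1 j p.1 p.2 = u2 j p.1 p.2).
Proof.
move=> Hmu /ltW T0 Hs F1 F2 HX1 HX2 gs1 gs2 j.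
have [Ms [s' [Ms0 bs' s'M ss]]] := Linf_clean Hmu Hs.
have [M1 [K1 [v1 [w1' [phi1' [g1' [M10 K10 c1 t1 [uv1 gg1]]]]]]]] := field_tilde Hmu F1.
have [M2 [K2 [v2 [w2' [phi2' [g2' [M20 K20 c2 t2 [uv2 gg2]]]]]]]] := field_tilde Hmu F2.
have [_ _ Lu1 [[mg1 _] _] _] := F1; have [_ _ Lu2 [[mg2 _] _] _] := F2.
have mu1 i := (Lu1 i).1; have mu2 i := (Lu2 i).1.
(* Common constants for both fields, as [driven] requires; the compression constants are added
   likewise below. *)
pose M := Ms + M1 + M2; pose K := K1 + K2.
have M0 : 0 <= M by rewrite !addr_ge0.
have K0 : 0 <= K by rewrite addr_ge0.
have c1' : clean_field Hmu M K v1 w1' phi1' g1'.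
  by apply: clean_mono c1; rewrite /M /K; lra.
have c2' : clean_field Hmu M K v2 w2' phi2' g2'.
  by apply: clean_mono c2; rewrite /M /K; lra.
have sM s y : `|s' s y| <= M by rewrite (le_trans (s'M s y))// /M -addrA lerDl addr_ge0.
have [L1 [Y1 [L10 D1]]] := driven_of_flow T0 M0 c1' t1 mu1 mg1 uv1 gg1 bs' ss HX1 gs1.
have [L2 [Y2 [L20 D2]]] := driven_of_flow T0 M0 c2' t2 mu2 mg2 uv2 gg2 bs' ss HX2 gs2.
have L120 : 0 <= L1 + L2 by rewrite addr_ge0.
have D1' := D1 (L1 + L2) (ler_wpDr L20 (lexx L1)).
have D2' := D2 (L1 + L2) (ler_wpDl L10 (lexx L2)).
have H := driven_unique T0 M0 K0 L120 bs' sM D1' D2' (leq_ltn_trans (leq0n j) (ltn_ord j)).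
(* The conclusion asks for a measurable null set: the exceptional set is itself measurable, and null
   because almost all of its time sections are. *)
pose N : set (R * d.-tuple R) := space_time T `&` [set p | u1 j p.1 p.2 <> u2 j p.1 p.2].
have mN : measurable N.
  apply: measurableI.
    by apply: measurableX => //; exact: measurable_unit_cube.
  have mD := measurable_funB (mu1 j) (mu2 j).
  have := mD measurableT _ (measurableC (measurable_set1 (0 : R))); rewrite setTI.
  rewrite (_ : _ @^-1` _ = [set p : R * d.-tuple R | u1 j p.1 p.2 <> u2 j p.1 p.2])//.
  apply/seteqP; split=> q /=; apply: contra_not; first by move=> ->; rewrite subrr.
  by move/subr0_eq.
exists N; split=> //.
apply: (@jnull_st R d mu Hmu T N (@subIsetl _ _ _)).
apply: (@ae_jnull R d mu Hmu T N mN); apply: lebI_aeS (lebI_aeI H (lebI_aeI (uv1 j) (uv2 j))) => t [Ht [E1 E2]].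
apply: filterS3 Ht E1 E2 => x Hx e1 e2 [[/= _ ux]]; apply.
by have := Hx j; rewrite e1 e2 fracP_id.
Qed.
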